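(* Let $k$ be an algebraically closed field, let $Y$ be an irreducible scheme of finite type over $k$ of dimension $d$, and let $E$ be an object of $\operatorname{D}(Y)$, the bounded derived category of coherent sheaves on $Y$. Suppose there is a closed point $y_0\in Y$ such that $k_{y_0}$ is a direct summand of $\operatorname{H}_0(E)$ and such that, for every closed point $y\in Y$ and every integer $i$, $$\operatorname{Hom}_{\operatorname{D}(Y)}(E,k_y[i])=0\quad\text{unless } y=y_0 \text{ and } 0\le i\le d.$$ Then $Y$ is non-singular at $y_0$, and $E\cong \operatorname{H}_0(E)$ in $\operatorname{D}(Y)$.
   Context: For a closed point $y\in Y$, $k_y$ denotes the structure sheaf of the point $y$ (the skyscraper sheaf), regarded as a coherent sheaf on $Y$. $\operatorname{H}_0(E)$ is the homology sheaf of $E$ in degree $0$, and a coherent sheaf is regarded as a complex concentrated in degree $0$. $[i]$ denotes the $i$-fold shift in the derived category, so that $\operatorname{Hom}_{\operatorname{D}(Y)}(F,G[i])=\operatorname{Ext}^i(F,G)$ for coherent sheaves $F,G$. Non-singular at $y_0$ means that the local ring $\mathcal O_{Y,y_0}$ is regular. *)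

(* Defs.v *)
From HB Require Import structures.
From mathcomp Require Import all_boot all_order all_algebra.
From mathcomp Require Import boolp classical_sets topology_structure.

Set Implicit Arguments.
Unset Strict Implicit.
Unset Printing Implicit Defensive.
Import GRing.Theory.
Local Open Scope classical_set_scope.
Local Open Scope ring_scope.
Local Open Scope quotient_scope.

Section CommutativeAlgebra.
Variable R : comPzRingType.

Definition is_unit (a : R) := exists b, a * b = 1.

Definition is_ideal (I : set R) :=
  [/\ I 0, forall a b, I a -> I b -> I (a + b) & forall a b, I b -> I (a * b)].

Definition is_prime (P : set R) :=
  [/\ is_ideal P, ~ P 1 & forall a b, P (a * b) -> P a \/ P b].

Definition generated_by n (g : 'I_n -> R) : set R :=
  [set a | exists c : 'I_n -> R, a = \sum_i c i * g i].

Definition noetherian := forall I : set R, is_ideal I ->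
  exists n (g : 'I_n -> R), I = generated_by g.

Definition nonunits : set R := [set a | ~ is_unit a].

Definition local_ring := is_ideal nonunits.

Definition prime_chain n (P : 'I_n.+1 -> set R) :=
  (forall i, is_prime (P i)) /\ forall i j : 'I_n.+1, (i < j)%N -> P i `<` P j.

Definition ring_dim_eq n :=
  (exists P : 'I_n.+1 -> set R, prime_chain P) /\
  forall m (P : 'I_m.+1 -> set R), prime_chain P -> (m <= n)%N.

Definition regular_local_ring := [/\ noetherian, local_ring &
  exists n, ring_dim_eq n /\ exists g : 'I_n -> R, nonunits = generated_by g].

Definition finitely_generated_over (k : pzRingType) (phi : k -> R) :=
  exists n (g : 'I_n -> R), forall S : set R,
    (forall c, S (phi c)) -> (forall i, S (g i)) ->
    (forall a b, S a -> S b -> S (a + b)) ->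
    (forall a b, S a -> S b -> S (a * b)) -> forall a, S a.

End CommutativeAlgebra.

Definition is_localization_away (A B : comPzRingType) (phi : A -> B) (f : A) :=
  [/\ is_unit (phi f),
      forall b, exists a n, phi f ^+ n * b = phi a &
      forall a, phi a = 0 -> exists n, f ^+ n * a = 0].

Definition irreducible_set (X : topologicalType) (Z : set X) :=
  Z !=set0 /\ forall A B : set X, closed A -> closed B ->
    Z `<=` A `|` B -> Z `<=` A \/ Z `<=` B.

Definition closed_chain (X : topologicalType) n (Z : 'I_n.+1 -> set X) :=
  (forall i, closed (Z i) /\ irreducible_set (Z i)) /\
  forall i j : 'I_n.+1, (i < j)%N -> Z i `<` Z j.

Definition space_dim_eq (X : topologicalType) n :=
  (exists Z : 'I_n.+1 -> set X, closed_chain Z) /\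
  forall m (Z : 'I_m.+1 -> set X), closed_chain Z -> (m <= n)%N.

Record opens (X : topologicalType) :=
  Opens { oset :> set X; oset_open : open oset }.

Definition oT (X : topologicalType) : opens X := Opens openT.
Definition oI (X : topologicalType) (U V : opens X) : opens X :=
  Opens (openI (oset_open U) (oset_open V)).

Lemma oIl (X : topologicalType) (U V : opens X) : oI U V `<=` U.
Proof. exact: subIsetl. Qed.

Lemma oIr (X : topologicalType) (U V : opens X) : oI U V `<=` V.
Proof. exact: subIsetr. Qed.

Lemma sub_oT (X : topologicalType) (U : opens X) : U `<=` oT X.
Proof. exact: subsetT. Qed.

Record ring_sheaf (X : topologicalType) := RingSheaf {
  rsec :> opens X -> comPzRingType;
  rres : forall U V : opens X, V `<=` U -> {rmorphism rsec U -> rsec V};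
  rres_id : forall (U : opens X) (h : U `<=` U) s, rres h s = s;
  rres_comp : forall (U V W : opens X) (hVU : V `<=` U) (hWV : W `<=` V)
    (hWU : W `<=` U) s, rres hWV (rres hVU s) = rres hWU s;
  rsep : forall (U : opens X) (I : Type) (V : I -> opens X)
    (hV : forall i, V i `<=` U), U `<=` \bigcup_i V i ->
    forall s t, (forall i, rres (hV i) s = rres (hV i) t) -> s = t;
  rglue : forall (U : opens X) (I : Type) (V : I -> opens X)
    (hV : forall i, V i `<=` U), U `<=` \bigcup_i V i ->
    forall s : forall i, rsec (V i),
    (forall i j (W : opens X) (hi : W `<=` V i) (hj : W `<=` V j),
      rres hi (s i) = rres hj (s j)) ->
    exists t, forall i, rres (hV i) t = s i }.

Section Stalk.
Variables (X : topologicalType) (O : ring_sheaf X) (x : X).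

Record pregerm := Pregerm {
  gdom : opens X; gmem : oset gdom x; gval : O gdom }.

HB.instance Definition _ := gen_eqMixin pregerm.
HB.instance Definition _ := gen_choiceMixin pregerm.

Definition germ_equiv (g h : pregerm) := exists (W : opens X)
  (hg : W `<=` gdom g) (hh : W `<=` gdom h),
  oset W x /\ rres O hg (gval g) = rres O hh (gval h).

Definition germ_equivb (g h : pregerm) : bool := `[< germ_equiv g h >].

Lemma germ_equivb_refl : reflexive germ_equivb.
Proof.
move=> g; apply/asboolP; exists (gdom g), (@subset_refl _ _), (@subset_refl _ _).
by split=> //; exact: gmem.
Qed.

Lemma germ_equivb_sym : symmetric germ_equivb.
Proof.
by move=> g h; apply/asboolP/asboolP => -[W [a [b [Wx e]]]]; exists W, b, a.
Qed.

Lemma germ_equivb_trans : transitive germ_equivb.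
Proof.
move=> h g l /asboolP[W [a [b [Wx e]]]] /asboolP[W' [a' [b' [W'x e']]]].
apply/asboolP; exists (oI W W').
have iW : oI W W' `<=` W by move=> ? [].
have iW' : oI W W' `<=` W' by move=> ? [].
exists (subset_trans iW a), (subset_trans iW' b'); split=> //.
rewrite -(rres_comp a iW) e -(rres_comp b' iW') -e'.
have hh := subset_trans iW b.
by rewrite (rres_comp b iW hh) (rres_comp a' iW' hh).
Qed.

Canonical germ_equiv_rel :=
  EquivRel germ_equivb germ_equivb_refl germ_equivb_sym germ_equivb_trans.

Definition stalk := {eq_quot germ_equiv_rel}.
HB.instance Definition _ := Choice.on stalk.

Definition germ (U : opens X) (Ux : oset U x) (s : O U) : stalk :=
  \pi_stalk (Pregerm Ux s).

Lemma germP (U V : opens X) (Ux : oset U x) (Vx : oset V x) s t :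
  germ Ux s = germ Vx t <-> exists (W : opens X) (hU : W `<=` U)
  (hV : W `<=` V), oset W x /\ rres O hU s = rres O hV t.
Proof.
split=> [/eqmodP/asboolP[W [a [b e]]]|[W [a [b e]]]]; first by exists W, a, b.
by apply/eqmodP/asboolP; exists W, a, b.
Qed.

Lemma germ_res (U V : opens X) (Ux : oset U x) (Vx : oset V x) (h : V `<=` U) s :
  germ Vx (rres O h s) = germ Ux s.
Proof.
apply/germP; exists V, (@subset_refl _ _), h; split=> //.
exact: (rres_comp h _ h).
Qed.

Lemma germ_surj (p : stalk) : exists U (Ux : oset U x) s, p = germ Ux s.
Proof.
exists (gdom (repr p)), (gmem (repr p)), (gval (repr p)).
by rewrite /germ; case: (repr p) (reprK p) => /= U Ux s <-.
Qed.

Definition stalk_op (op : forall U, O U -> O U -> O U) (p q : stalk) : stalk :=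
  @germ (oI (gdom (repr p)) (gdom (repr q)))
    (conj (gmem (repr p)) (gmem (repr q)))
    (op _ (rres O (@oIl _ _ _) (gval (repr p)))
          (rres O (@oIr _ _ _) (gval (repr q)))).

Lemma stalk_opE (op : forall U, O U -> O U -> O U)
    (opM : forall (U V : opens X) (h : V `<=` U) s t,
      rres O h (op U s t) = op V (rres O h s) (rres O h t))
    (U : opens X) (Ux : oset U x) s t :
  stalk_op op (germ Ux s) (germ Ux t) = germ Ux (op U s t).
Proof.
rewrite /stalk_op.
have e1 := reprK (germ Ux s); have e2 := reprK (germ Ux t).
case: (repr (germ Ux s)) e1 => /= A Ax a /germP[W [hA [hU [Wx e1]]]].
case: (repr (germ Ux t)) e2 => /= B Bx b /germP[W' [hB [hU' [W'x e2]]]].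
have i1 : oI W W' `<=` W by move=> ? [].
have i2 : oI W W' `<=` W' by move=> ? [].
have iAB : oI W W' `<=` oI A B by move=> ? [/hA ? /hB ?].
have iU := subset_trans i1 hU.
apply/germP; exists (oI W W'), iAB, iU; split=> //.
rewrite !opM; congr (op _ _ _).
  rewrite (rres_comp _ _ (subset_trans i1 hA)) -(rres_comp hA i1) e1.
  exact: rres_comp.
rewrite (rres_comp _ _ (subset_trans i2 hB)) -(rres_comp hB i2) e2.
exact: rres_comp.
Qed.

Lemma germ_surj2 (p q : stalk) :
  exists U (Ux : oset U x) s t, p = germ Ux s /\ q = germ Ux t.
Proof.
have [U [Ux [s ->]]] := germ_surj p; have [V [Vx [t ->]]] := germ_surj q.
have UVx : oset (oI U V) x by [].
exists (oI U V), UVx, (rres O (@oIl _ _ _) s), (rres O (@oIr _ _ _) t).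
by rewrite !germ_res.
Qed.

Lemma germ_surj3 (p q r : stalk) : exists U (Ux : oset U x) s t u,
  [/\ p = germ Ux s, q = germ Ux t & r = germ Ux u].
Proof.
have [U [Ux [s [t [-> ->]]]]] := germ_surj2 p q.
have [V [Vx [u ->]]] := germ_surj r.
have UVx : oset (oI U V) x by [].
exists (oI U V), UVx, (rres O (@oIl _ _ _) s),
  (rres O (@oIl _ _ _) t), (rres O (@oIr _ _ _) u).
by rewrite !germ_res.
Qed.

Definition stalk_add := stalk_op (fun U s t => s + t).
Definition stalk_mul := stalk_op (fun U s t => s * t).
(* Only the second argument is used. *)
Definition stalk_opp p := stalk_op (fun U _ t => - t) p p.

Lemma stalk_addE (U : opens X) (Ux : oset U x) s t :
  stalk_add (germ Ux s) (germ Ux t) = germ Ux (s + t).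
Proof. by apply: (stalk_opE (op := fun U s t => s + t)) => *; rewrite rmorphD. Qed.

Lemma stalk_mulE (U : opens X) (Ux : oset U x) s t :
  stalk_mul (germ Ux s) (germ Ux t) = germ Ux (s * t).
Proof. by apply: (stalk_opE (op := fun U s t => s * t)) => *; rewrite rmorphM. Qed.

Lemma stalk_oppE (U : opens X) (Ux : oset U x) s :
  stalk_opp (germ Ux s) = germ Ux (- s).
Proof. by apply: (stalk_opE (op := fun U s t => - t)) => *; rewrite rmorphN. Qed.

Definition stalk0 : stalk := @germ (oT X) I 0.
Definition stalk1 : stalk := @germ (oT X) I 1.

Lemma stalk0E (U : opens X) (Ux : oset U x) : stalk0 = germ Ux 0.
Proof. by rewrite /stalk0 -(germ_res _ Ux (@sub_oT _ _)) rmorph0. Qed.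

Lemma stalk1E (U : opens X) (Ux : oset U x) : stalk1 = germ Ux 1.
Proof. by rewrite /stalk1 -(germ_res _ Ux (@sub_oT _ _)) rmorph1. Qed.

Lemma stalk_addA : associative stalk_add.
Proof.
move=> p q r; have [U [Ux [s [t [u [-> -> ->]]]]]] := germ_surj3 p q r.
by rewrite !stalk_addE addrA.
Qed.

Lemma stalk_addC : commutative stalk_add.
Proof.
move=> p q; have [U [Ux [s [t [-> ->]]]]] := germ_surj2 p q.
by rewrite !stalk_addE addrC.
Qed.

Lemma stalk_add0 : left_id stalk0 stalk_add.
Proof.
move=> p; have [U [Ux [s ->]]] := germ_surj p.
by rewrite (stalk0E Ux) stalk_addE add0r.
Qed.

Lemma stalk_addN : left_inverse stalk0 stalk_opp stalk_add.
Proof.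
move=> p; have [U [Ux [s ->]]] := germ_surj p.
by rewrite (stalk0E Ux) stalk_oppE stalk_addE addNr.
Qed.

HB.instance Definition _ :=
  GRing.isZmodule.Build stalk stalk_addA stalk_addC stalk_add0 stalk_addN.

Lemma stalk_mulA : associative stalk_mul.
Proof.
move=> p q r; have [U [Ux [s [t [u [-> -> ->]]]]]] := germ_surj3 p q r.
by rewrite !stalk_mulE mulrA.
Qed.

Lemma stalk_mulC : commutative stalk_mul.
Proof.
move=> p q; have [U [Ux [s [t [-> ->]]]]] := germ_surj2 p q.
by rewrite !stalk_mulE mulrC.
Qed.

Lemma stalk_mul1 : left_id stalk1 stalk_mul.
Proof.
move=> p; have [U [Ux [s ->]]] := germ_surj p.
by rewrite (stalk1E Ux) stalk_mulE mul1r.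
Qed.

Lemma stalk_mulDl : left_distributive stalk_mul stalk_add.
Proof.
move=> p q r; have [U [Ux [s [t [u [-> -> ->]]]]]] := germ_surj3 p q r.
by rewrite !(stalk_mulE, stalk_addE) mulrDl.
Qed.

HB.instance Definition _ := GRing.Zmodule_isComPzRing.Build stalk
  stalk_mulA stalk_mulC stalk_mul1 stalk_mulDl.

Lemma germD (U : opens X) (Ux : oset U x) s t :
  germ Ux (s + t) = germ Ux s + germ Ux t.
Proof. by rewrite -stalk_addE. Qed.

Lemma germM (U : opens X) (Ux : oset U x) s t :
  germ Ux (s * t) = germ Ux s * germ Ux t.
Proof. by rewrite -stalk_mulE. Qed.

Lemma germ0 (U : opens X) (Ux : oset U x) : germ Ux 0 = 0.
Proof. by rewrite -stalk0E. Qed.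

Lemma germ1 (U : opens X) (Ux : oset U x) : germ Ux 1 = 1.
Proof. by rewrite -stalk1E. Qed.

End Stalk.

Section AffineOpens.
Variables (X : topologicalType) (O : ring_sheaf X).

Definition nonvanishing_locus (U : opens X) (f : O U) : set X :=
  [set x | exists Ux : oset U x, is_unit (germ Ux f)].

Lemma nonvanishing_locus_open (U : opens X) (f : O U) :
  open (nonvanishing_locus f).
Proof.
have -> : nonvanishing_locus f =
    \bigcup_(W in [set W : opens X | W `<=` nonvanishing_locus f]) W.
  apply/seteqP; split=> [x [Ux [b]]|x [W /= hW Wx]]; last exact: hW.
  have [V [Vx [t ->]]] := germ_surj b.
  rewrite -(germ_res Ux (V := oI U V) (conj Ux Vx) (@oIl _ _ _)).
  rewrite -(germ_res Vx (V := oI U V) (conj Ux Vx) (@oIr _ _ _)).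
  rewrite -germM -(germ1 O (U := oI U V) (conj Ux Vx)).
  move=> /germP[W [h [h' [Wx]]]]; rewrite rmorphM rmorph1 => e.
  exists W => //= y Wy; have [Uy Vy] := h _ Wy.
  exists Uy, (germ Wy (rres O h (rres O (@oIr _ _ _) t))).
  by rewrite -(germ_res Uy Wy (subset_trans h (@oIl _ _ _)))
    -(rres_comp (@oIl _ _ _) h) -germM e germ1.
by apply: bigcup_open => W _; exact: oset_open.
Qed.

Definition basic_open (U : opens X) (f : O U) : opens X :=
  Opens (nonvanishing_locus_open f).

Lemma basic_open_sub (U : opens X) (f : O U) : basic_open f `<=` U.
Proof. by move=> x []. Qed.

Definition point_ideal (U : opens X) x (Ux : oset U x) : set (O U) :=
  [set f | ~ is_unit (germ Ux f)].

(* With [A = O U], the map sending a point of [U] to the prime ideal of the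
   sections vanishing there is a homeomorphism onto the prime spectrum of [A]
   (the first three clauses; the sets [basic_open f] correspond to the basic
   opens [D(f)]), and it identifies the structure sheaf of the spectrum, which
   is the sheaf whose sections over [D(f)] are [A_f], with [O] restricted to
   [U] (the last clause). *)
Definition affine_open (U : opens X) :=
  [/\ forall x y (Ux : oset U x) (Uy : oset U y),
        point_ideal Ux = point_ideal Uy -> x = y,
      forall P : set (O U), is_prime P ->
        exists x (Ux : oset U x), P = point_ideal Ux,
      forall (V : opens X) x, V `<=` U -> oset V x ->
        exists f : O U, oset (basic_open f) x /\ basic_open f `<=` V &
      forall f : O U, is_localization_away (rres O (@basic_open_sub U f)) f].

End AffineOpens.

Record scheme := Scheme {
  space :> topologicalType;
  structure_sheaf : ring_sheaf space;
  scheme_local : forall x, local_ring (stalk structure_sheaf x);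
  scheme_affine : forall x, exists U : opens space,
    oset U x /\ affine_open structure_sheaf U }.

(* A structure of scheme over [k] is a ring morphism from [k] to the ring of
   global sections. *)
Definition finite_type (k : pzRingType) (Y : scheme)
    (phi : {rmorphism k -> structure_sheaf Y (oT Y)}) :=
  exists n (U : 'I_n -> opens Y),
    (forall i, affine_open (structure_sheaf Y) (U i) /\
      finitely_generated_over
        (fun c => rres (structure_sheaf Y) (@sub_oT _ (U i)) (phi c))) /\
    forall y : Y, exists i, oset (U i) y.

Definition irreducible_scheme (Y : scheme) := irreducible_set [set: Y].

Record mod_sheaf (X : topologicalType) (O : ring_sheaf X) := ModSheaf {
  msec :> forall U : opens X, lmodType (O U);
  mres : forall U V : opens X, V `<=` U -> {additive msec U -> msec V};
  mresZ : forall (U V : opens X) (h : V `<=` U) a s,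
    mres h (a *: s) = rres O h a *: mres h s;
  mres_id : forall (U : opens X) (h : U `<=` U) s, mres h s = s;
  mres_comp : forall (U V W : opens X) (hVU : V `<=` U) (hWV : W `<=` V)
    (hWU : W `<=` U) s, mres hWV (mres hVU s) = mres hWU s;
  msep : forall (U : opens X) (I : Type) (V : I -> opens X)
    (hV : forall i, V i `<=` U), U `<=` \bigcup_i V i ->
    forall s t, (forall i, mres (hV i) s = mres (hV i) t) -> s = t;
  mglue : forall (U : opens X) (I : Type) (V : I -> opens X)
    (hV : forall i, V i `<=` U), U `<=` \bigcup_i V i ->
    forall s : forall i, msec (V i),
    (forall i j (W : opens X) (hi : W `<=` V i) (hj : W `<=` V j),
      mres hi (s i) = mres hj (s j)) ->
    exists t, forall i, mres (hV i) t = s i }.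

Section ModuleSheaves.
Variables (X : topologicalType) (O : ring_sheaf X).

Record mor (F G : mod_sheaf O) := Mor {
  mor_fun :> forall U : opens X, {linear F U -> G U};
  mor_res : forall (U V : opens X) (h : V `<=` U) s,
    mor_fun V (mres F h s) = mres G h (mor_fun U s) }.

Definition is_iso (F G : mod_sheaf O) (f : mor F G) := exists g : mor G F,
  (forall U s, g U (f U s) = s) /\ forall U t, f U (g U t) = t.

Definition direct_summand (M F : mod_sheaf O) := exists (N : mod_sheaf O)
  (i : mor M F) (p : mor F M) (j : mor N F) (q : mor F N),
  [/\ forall U s, p U (i U s) = s, forall U s, q U (j U s) = s,
      forall U s, q U (i U s) = 0, forall U s, p U (j U s) = 0 &
      forall U s, i U (p U s) + j U (q U s) = s].

Definition generates (F : mod_sheaf O) (U : opens X) n (g : 'I_n -> F U) :=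
  forall (V : opens X) (h : V `<=` U) (t : F V) x, oset V x ->
  exists (W : opens X) (hWV : W `<=` V) (hWU : W `<=` U) (c : 'I_n -> O W),
    oset W x /\ mres F hWV t = \sum_i c i *: mres F hWU (g i).

Definition sheaf_finite_type (F : mod_sheaf O) := forall x : X,
  exists (U : opens X) n (g : 'I_n -> F U), oset U x /\ generates g.

Definition is_relation (F : mod_sheaf O) (U V : opens X) (h : V `<=` U) n
    (s : 'I_n -> F U) (a : 'I_n -> O V) := \sum_i a i *: mres F h (s i) = 0.

(* For every open [U] and every finite family of sections of [F] over [U], the
   kernel of the induced morphism from [O^n] to [F] over [U] is of finite
   type. *)
Definition sheaf_finite_relations (F : mod_sheaf O) :=
  forall (U : opens X) n (s : 'I_n -> F U) x, oset U x ->
  exists (V : opens X) (h : V `<=` U) m (r : 'I_m -> 'I_n -> O V),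
  [/\ oset V x, forall j, is_relation h s (r j) &
    forall (W : opens X) (hWV : W `<=` V) (hWU : W `<=` U) (a : 'I_n -> O W),
    is_relation hWU s a -> forall y, oset W y ->
    exists (W' : opens X) (h1 : W' `<=` W) (h2 : W' `<=` V) (c : 'I_m -> O W'),
    oset W' y /\ forall i, rres O h1 (a i) = \sum_j c j * rres O h2 (r j i)].

Definition coherent (F : mod_sheaf O) :=
  sheaf_finite_type F /\ sheaf_finite_relations F.

Record subsheaf (F : mod_sheaf O) := Subsheaf {
  ssec :> forall U : opens X, set (F U);
  ssec0 : forall U, ssec (0 : F U);
  ssecD : forall U (s t : F U), ssec s -> ssec t -> ssec (s + t);
  ssecZ : forall U a (s : F U), ssec s -> ssec (a *: s);
  ssec_res : forall (U V : opens X) (h : V `<=` U) (s : F U),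
    ssec s -> ssec (mres F h s);
  ssec_local : forall (U : opens X) (s : F U),
    (forall x, oset U x -> exists (V : opens X) (h : V `<=` U),
      oset V x /\ ssec (mres F h s)) -> ssec s }.

Lemma ssecN (F : mod_sheaf O) (B : subsheaf F) U s : B U s -> B U (- s).
Proof. by rewrite -scaleN1r; exact: ssecZ. Qed.

Lemma ssecB (F : mod_sheaf O) (B : subsheaf F) U s t :
  B U s -> B U t -> B U (s - t).
Proof. by move=> Bs Bt; apply: ssecD => //; exact: ssecN. Qed.

End ModuleSheaves.

(* The sheaf [Z / B] for subsheaves [Z] and [B] of [F] (in general, the quotient
   of [Z] by its intersection with [B]). A section over [U] is encoded by the
   family [S] of all its local lifts to [Z]: [S V z] means that [z] is a section
   of [Z] over [V], contained in [U], whose class is the restriction to [V] of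
   the given section. *)
Section Quotient.
Variables (X : topologicalType) (O : ring_sheaf X) (F : mod_sheaf O).
Variables Z B : subsheaf F.

Implicit Types (U V W : opens X) (R : forall V : opens X, set (F V)).

Definition congruent V V' (z : F V) (z' : F V') :=
  forall W (h : W `<=` V) (h' : W `<=` V'), B W (mres F h z - mres F h' z').

Definition saturation U R V : set (F V) := [set z | [/\ V `<=` U, Z V z &
  forall V' z', R V' z' -> congruent z z']].
Arguments saturation : clear implicits.

Record qsec U := Qsec {
  lifts : forall V, set (F V);
  lifts_saturated : forall V, @lifts V = saturation U (@lifts) V;
  lifts_exist : forall x, oset U x -> exists V z, oset V x /\ @lifts V z }.
Arguments lifts {U} q V _.

Lemma congruent_sym V V' (z : F V) (z' : F V') :
  congruent z z' -> congruent z' z.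
Proof. by move=> e W h h'; rewrite -opprB; apply: ssecN. Qed.

Lemma congruent_res V V' W (h : W `<=` V) (z : F V) (z' : F V') :
  congruent z z' -> congruent (mres F h z) z'.
Proof. by move=> e W' h1 h2; rewrite (mres_comp _ _ (subset_trans h1 h)). Qed.

Lemma congruent_local V V' (z : F V) (z' : F V') :
  (forall x, oset V x -> oset V' x -> exists W (h : W `<=` V),
    oset W x /\ congruent (mres F h z) z') -> congruent z z'.
Proof.
move=> H W h h'; apply: ssec_local => x Wx.
have [W' [h1 [W'x e]]] := H x (h _ Wx) (h' _ Wx).
exists (oI W W'), (@oIl _ _ _); split=> //.
rewrite raddfB /= (mres_comp _ _ (subset_trans (@oIl _ W W') h)).
rewrite (mres_comp _ _ (subset_trans (@oIl _ W W') h')).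
rewrite -(mres_comp h1 (@oIr _ W W')); exact: e.
Qed.

(* Transitivity through a lift defined on all of the first open set. *)
Lemma congruent_trans V V' (z z0 : F V) (z' : F V') :
  congruent z z0 -> congruent z0 z' -> congruent z z'.
Proof.
move=> e e' W h h'; rewrite -(subrKA (mres F h z0)); apply: ssecD.
  exact: e.
exact: e'.
Qed.

Lemma congruent_refl V (z : F V) : congruent z z.
Proof.
move=> W h h'; rewrite -(mres_comp h (@subset_refl _ _) h').
by rewrite mres_id subrr; exact: ssec0.
Qed.

Lemma lifts_sub U (S : qsec U) V z : lifts S V z -> V `<=` U.
Proof. by rewrite lifts_saturated => -[]. Qed.

Lemma lifts_in U (S : qsec U) V z : lifts S V z -> Z V z.
Proof. by rewrite lifts_saturated => -[]. Qed.

Lemma lifts_congruent U (S : qsec U) V V' z z' :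
  lifts S V z -> lifts S V' z' -> congruent z z'.
Proof. by rewrite lifts_saturated => -[_ _]; apply. Qed.

Lemma lifts_res U (S : qsec U) V W (h : W `<=` V) z :
  lifts S V z -> lifts S W (mres F h z).
Proof.
move=> Sz; rewrite lifts_saturated; split.
- exact: subset_trans h (lifts_sub Sz).
- exact/ssec_res/(lifts_in Sz).
- by move=> V' z' Sz'; apply: congruent_res; exact: lifts_congruent Sz Sz'.
Qed.

Lemma qsec_eq U (S T : qsec U) : (forall x, oset U x -> exists V z,
  [/\ oset V x, lifts S V z & lifts T V z]) -> S = T.
Proof.
move=> H.
have sub (S1 S2 : qsec U) : (forall x, oset U x -> exists V z,
    [/\ oset V x, lifts S1 V z & lifts S2 V z]) ->
    forall V z, lifts S1 V z -> lifts S2 V z.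
  move=> H1 V z Sz; rewrite lifts_saturated; split.
  - exact: lifts_sub Sz.
  - exact: lifts_in Sz.
  move=> V' z' Tz'; apply: congruent_local => x Vx V'x.
  have [V0 [z0 [V0x S0 T0]]] := H1 x (lifts_sub Sz Vx).
  exists (oI V V0), (@oIl _ _ _); split=> //.
  apply: (@congruent_trans _ _ _ (mres F (@oIr _ _ _) z0)).
    by apply: lifts_congruent; apply: lifts_res; eassumption.
  by apply: lifts_congruent (lifts_res _ T0) Tz'.
have e : lifts S = lifts T.
  apply: functional_extensionality_dep => V; apply/seteqP; split=> z.
    exact: sub.
  apply: sub => x Ux; have [V' [z' [? ? ?]]] := H x Ux; by exists V', z'.
case: S T e {H sub} => l p q [l' p' q'] /= e.
by subst l'; congr Qsec; exact: Prop_irrelevance.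
Qed.

Section FromAtlas.
Variables (U : opens X) (R : forall V, set (F V)).
Arguments R : clear implicits.
Hypothesis R_sub : forall V z, R V z -> V `<=` U.
Hypothesis R_in : forall V z, R V z -> Z V z.
Hypothesis R_congr : forall V V' z z', R V z -> R V' z' -> congruent z z'.
Hypothesis R_exist : forall x, oset U x -> exists V z, oset V x /\ R V z.

Lemma sub_saturation V z : R V z -> saturation U R V z.
Proof.
move=> Rz; split; [exact: R_sub Rz|exact: R_in Rz|].
by move=> V' z' Rz'; exact: R_congr.
Qed.

Lemma atlas_saturated V : saturation U R V = saturation U (saturation U R) V.
Proof.
apply/seteqP; split=> z [VU Zz H]; split=> //; last first.
  by move=> V' z' Rz'; apply/H/sub_saturation.
move=> V' z' [V'U Zz' H']; apply: congruent_local => x Vx V'x.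
have [V0 [z0 [V0x R0]]] := R_exist (VU _ Vx).
exists (oI V V0), (@oIl _ _ _); split=> //.
apply: (@congruent_trans _ _ _ (mres F (@oIr _ _ _) z0)).
  apply/congruent_res/congruent_sym/congruent_res/congruent_sym.
  exact: H R0.
by apply/congruent_res/congruent_sym; exact: H' R0.
Qed.

Lemma atlas_exist x : oset U x -> exists V z, oset V x /\ saturation U R V z.
Proof.
move=> /R_exist[V [z [Vx Rz]]]; exists V, z; split=> //; exact: sub_saturation.
Qed.

Definition of_atlas : qsec U := Qsec atlas_saturated atlas_exist.

End FromAtlas.

Section Operations.
Variable U : opens X.
Implicit Types S T : qsec U.

HB.instance Definition _ := gen_eqMixin (qsec U).
HB.instance Definition _ := gen_choiceMixin (qsec U).

Lemma lifts2 S T x : oset U x -> exists V s t,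
  [/\ oset V x, lifts S V s & lifts T V t].
Proof.
move=> Ux; have [V [s [Vx Ss]]] := lifts_exist S Ux.
have [V' [t [V'x Tt]]] := lifts_exist T Ux.
exists (oI V V'), (mres F (@oIl _ _ _) s), (mres F (@oIr _ _ _) t).
by split=> //; apply: lifts_res.
Qed.

Lemma lifts3 S T T' x : oset U x -> exists V s t t',
  [/\ oset V x, lifts S V s, lifts T V t & lifts T' V t'].
Proof.
move=> Ux; have [V [s [t [Vx Ss Tt]]]] := lifts2 S T Ux.
have [V' [t' [V'x Tt']]] := lifts_exist T' Ux.
exists (oI V V'), (mres F (@oIl _ _ _) s), (mres F (@oIl _ _ _) t),
  (mres F (@oIr _ _ _) t').
by split=> //; apply: lifts_res.
Qed.

Program Definition qadd S T : qsec U :=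
  @of_atlas U (fun V => [set z | exists s t,
    [/\ lifts S V s, lifts T V t & z = s + t]]) _ _ _ _.
Next Obligation. by move=> S T V z [s [t [Ss _ _]]]; exact: lifts_sub Ss. Qed.
Next Obligation.
move=> S T V z [s [t [Ss Tt ->]]].
by apply: ssecD; [exact: lifts_in Ss|exact: lifts_in Tt].
Qed.
Next Obligation.
move=> S T V V' z z' [s [t [Ss Tt ->]]] [s' [t' [Ss' Tt' ->]]] W h h'.
rewrite !raddfD /= addrACA; apply: ssecD.
  exact: lifts_congruent Ss Ss' _ _ _.
exact: lifts_congruent Tt Tt' _ _ _.
Qed.
Next Obligation.
move=> S T x Ux; have [V [s [t [Vx Ss Tt]]]] := lifts2 S T Ux.
by exists V, (s + t); split=> //; exists s, t.
Qed.

Program Definition qzero : qsec U :=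
  @of_atlas U (fun V => [set z | V `<=` U /\ z = 0]) _ _ _ _.
Next Obligation. by move=> V z []. Qed.
Next Obligation. by move=> V z [_ ->]; exact: ssec0. Qed.
Next Obligation.
by move=> V V' z z' [_ ->] [_ ->] W h h'; rewrite !raddf0 addr0; exact: ssec0.
Qed.
Next Obligation. by move=> x Ux; exists U, 0; split=> //; split. Qed.

Program Definition qscale (a : O U) S : qsec U :=
  @of_atlas U (fun V => [set z | exists (h : V `<=` U) s,
    lifts S V s /\ z = rres O h a *: s]) _ _ _ _.
Next Obligation. by move=> a S V z [h _]. Qed.
Next Obligation.
by move=> a S V z [h [s [Ss ->]]]; apply: ssecZ; exact: lifts_in Ss.
Qed.
Next Obligation.
move=> a S V V' z z' [h1 [s [Ss ->]]] [h2 [s' [Ss' ->]]] W h h'.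
rewrite !mresZ (rres_comp _ _ (subset_trans h h1)).
rewrite (rres_comp _ _ (subset_trans h h1)) -scalerBr; apply: ssecZ.
exact: lifts_congruent Ss Ss' _ _ _.
Qed.
Next Obligation.
move=> a S x Ux; have [V [s [Vx Ss]]] := lifts_exist S Ux.
have h := lifts_sub Ss.
by exists V, (rres O h a *: s); split=> //; exists h, s.
Qed.

Definition qopp S := qscale (-1) S.

Lemma qaddE S T V s t :
  lifts S V s -> lifts T V t -> lifts (qadd S T) V (s + t).
Proof.
by move=> Ss Tt; apply: sub_saturation; try exact: qadd_obligation_1;
   try exact: qadd_obligation_2; try exact: qadd_obligation_3; exists s, t.
Qed.

Lemma qzeroE V : V `<=` U -> lifts qzero V 0.
Proof.
by move=> VU; apply: sub_saturation; try exact: qzero_obligation_1;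
   try exact: qzero_obligation_2; try exact: qzero_obligation_3.
Qed.

Lemma qscaleE a S V (h : V `<=` U) s :
  lifts S V s -> lifts (qscale a S) V (rres O h a *: s).
Proof.
by move=> Ss; apply: sub_saturation; try exact: qscale_obligation_1;
   try exact: qscale_obligation_2; try exact: qscale_obligation_3; exists h, s.
Qed.

Lemma qaddA : associative qadd.
Proof.
move=> S T T'; apply: qsec_eq => x Ux.
have [V [s [t [t' [Vx Ss Tt Tt']]]]] := lifts3 S T T' Ux.
exists V, (s + (t + t')); split=> //; first by do 2 apply: qaddE => //.
by rewrite addrA; do 2 apply: qaddE => //.
Qed.

Lemma qaddC : commutative qadd.
Proof.
move=> S T; apply: qsec_eq => x Ux.
have [V [s [t [Vx Ss Tt]]]] := lifts2 S T Ux.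
exists V, (s + t); split=> //; first exact: qaddE.
by rewrite addrC; exact: qaddE.
Qed.

Lemma qadd0 : left_id qzero qadd.
Proof.
move=> S; apply: qsec_eq => x Ux; have [V [s [Vx Ss]]] := lifts_exist S Ux.
exists V, s; split=> //; rewrite -[s]add0r; apply: qaddE => //.
exact/qzeroE/(lifts_sub Ss).
Qed.

Lemma qaddN : left_inverse qzero qopp qadd.
Proof.
move=> S; apply: qsec_eq => x Ux; have [V [s [Vx Ss]]] := lifts_exist S Ux.
have h := lifts_sub Ss.
exists V, (rres O h (-1) *: s + s); split=> //.
  by apply: qaddE => //; exact: qscaleE.
by rewrite rmorphN1 scaleN1r addNr; exact: qzeroE.
Qed.

HB.instance Definition _ :=
  GRing.isZmodule.Build (qsec U) qaddA qaddC qadd0 qaddN.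

Lemma qscaleA a b S : qscale a (qscale b S) = qscale (a * b) S.
Proof.
apply: qsec_eq => x Ux; have [V [s [Vx Ss]]] := lifts_exist S Ux.
have h := lifts_sub Ss.
exists V, (rres O h (a * b) *: s); split=> //; last exact: qscaleE.
by rewrite rmorphM -scalerA; do 2 apply: qscaleE.
Qed.

Lemma qscale1 : left_id 1 qscale.
Proof.
move=> S; apply: qsec_eq => x Ux; have [V [s [Vx Ss]]] := lifts_exist S Ux.
have h := lifts_sub Ss.
exists V, (rres O h 1 *: s); split=> //; first exact: qscaleE.
by rewrite rmorph1 scale1r.
Qed.

Lemma qscaleDr : right_distributive qscale qadd.
Proof.
move=> a S T; apply: qsec_eq => x Ux.
have [V [s [t [Vx Ss Tt]]]] := lifts2 S T Ux.
have h := lifts_sub Ss.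
exists V, (rres O h a *: (s + t)); split=> //.
  by apply: qscaleE; exact: qaddE.
by rewrite scalerDr; apply: qaddE; exact: qscaleE.
Qed.

Lemma qscaleDl S a b : qscale (a + b) S = qadd (qscale a S) (qscale b S).
Proof.
apply: qsec_eq => x Ux; have [V [s [Vx Ss]]] := lifts_exist S Ux.
have h := lifts_sub Ss.
exists V, (rres O h (a + b) *: s); split=> //; first exact: qscaleE.
by rewrite rmorphD scalerDl; apply: qaddE; exact: qscaleE.
Qed.

HB.instance Definition _ := GRing.Zmodule_isLmodule.Build (O U) (qsec U)
  qscaleA qscale1 qscaleDr qscaleDl.

End Operations.

Program Definition qres_fun U U' (hU : U' `<=` U) (S : qsec U) : qsec U' :=
  @of_atlas U' (fun V => [set z | V `<=` U' /\ lifts S V z]) _ _ _ _.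
Next Obligation. by move=> U U' hU S V z []. Qed.
Next Obligation. by move=> U U' hU S V z [_ Sz]; exact: lifts_in Sz. Qed.
Next Obligation.
by move=> U U' hU S V V' z z' [_ Sz] [_ Sz']; exact: lifts_congruent Sz Sz'.
Qed.
Next Obligation.
move=> U U' hU S x U'x; have [V [z [Vx Sz]]] := lifts_exist S (hU _ U'x).
exists (oI V U'), (mres F (@oIl _ _ _) z); split=> //; split; first exact: oIr.
exact: lifts_res.
Qed.

Lemma qresE U U' (hU : U' `<=` U) (S : qsec U) V z :
  V `<=` U' -> lifts S V z -> lifts (qres_fun hU S) V z.
Proof.
by move=> VU' Sz; apply: sub_saturation; try exact: qres_fun_obligation_1;
   try exact: qres_fun_obligation_2; try exact: qres_fun_obligation_3.
Qed.

Lemma lifts_small U (S : qsec U) U' x : oset U x -> oset U' x ->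
  exists V z, [/\ oset V x, V `<=` U' & lifts S V z].
Proof.
move=> Ux U'x; have [V [z [Vx Sz]]] := lifts_exist S Ux.
exists (oI V U'), (mres F (@oIl _ _ _) z); split=> //; first exact: oIr.
exact: lifts_res.
Qed.

Lemma qres_is_zmod_morphism U U' (hU : U' `<=` U) :
  zmod_morphism (qres_fun hU).
Proof.
move=> S T; apply: qsec_eq => x U'x.
have Ux := hU _ U'x.
have [V0 [s0 [t0 [V0x Ss0 Tt0]]]] := lifts2 S T Ux.
pose V := oI V0 U'; have VU' : V `<=` U' := @oIr _ _ _.
have Ss : lifts S V (mres F (@oIl _ _ _) s0) by exact: lifts_res.
have Tt : lifts T V (mres F (@oIl _ _ _) t0) by exact: lifts_res.
set s := mres _ _ _ in Ss; set t := mres _ _ _ in Tt.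
have VU := lifts_sub Ss.
exists V, (s + rres O VU (-1) *: t); split=> //.
  by apply: qresE => //; apply: qaddE => //; exact: qscaleE.
apply: qaddE; first exact: qresE.
have -> : rres O VU (-1) = rres O VU' (-1) by rewrite !rmorphN1.
by apply: qscaleE; exact: qresE.
Qed.

HB.instance Definition _ U U' (hU : U' `<=` U) :=
  GRing.isZmodMorphism.Build (qsec U) (qsec U') (qres_fun hU)
    (qres_is_zmod_morphism hU).

Definition qres U U' (hU : U' `<=` U) : {additive qsec U -> qsec U'} :=
  qres_fun hU.

Lemma qresZ U U' (hU : U' `<=` U) a (S : qsec U) :
  qres hU (a *: S) = rres O hU a *: qres hU S.
Proof.
apply: qsec_eq => x U'x.
have [V [s [Vx VU' Ss]]] := lifts_small S (hU _ U'x) U'x.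
have VU := lifts_sub Ss.
exists V, (rres O VU a *: s); split=> //.
  by apply: qresE => //; exact: qscaleE.
by rewrite -(rres_comp hU VU'); apply: qscaleE; exact: qresE.
Qed.

Lemma qres_id U (h : U `<=` U) (S : qsec U) : qres h S = S.
Proof.
apply: qsec_eq => x Ux; have [V [s [Vx Ss]]] := lifts_exist S Ux.
by exists V, s; split=> //; apply: qresE => //; exact: lifts_sub Ss.
Qed.

Lemma qres_comp U V W (hVU : V `<=` U) (hWV : W `<=` V) (hWU : W `<=` U)
  (S : qsec U) : qres hWV (qres hVU S) = qres hWU S.
Proof.
apply: qsec_eq => x Wx.
have [V0 [s [V0x V0W Ss]]] := lifts_small S (hWU _ Wx) Wx.
exists V0, s; split=> //; apply: qresE => //; apply: qresE => //.
exact: subset_trans hWV.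
Qed.

Lemma qres_lifts U U' (hU : U' `<=` U) (S : qsec U) V z :
  lifts (qres hU S) V z -> lifts S V z.
Proof.
move=> Sz; rewrite lifts_saturated; split.
- exact: subset_trans (lifts_sub Sz) hU.
- exact: lifts_in Sz.
move=> V' z' Sz'; apply: congruent_local => x Vx V'x.
exists (oI V V'), (@oIl _ _ _); split=> //.
apply: (@congruent_trans _ _ _ (mres F (@oIr _ _ _) z')).
  have VU' : oI V V' `<=` U' by move=> y [/(lifts_sub Sz)].
  apply: lifts_congruent (lifts_res _ Sz) _.
  by apply: qresE => //; exact: lifts_res.
exact/congruent_res/congruent_refl.
Qed.

Lemma qsep U (I : Type) (V : I -> opens X) (hV : forall i, V i `<=` U) :
  U `<=` \bigcup_i V i ->
  forall S T, (forall i, qres (hV i) S = qres (hV i) T) -> S = T.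
Proof.
move=> cov S T e; apply: qsec_eq => x Ux; have [i _ Vix] := cov _ Ux.
have [W [z [Wx Sz]]] := lifts_exist (qres (hV i) S) Vix.
exists W, z; split=> //; first exact: qres_lifts Sz.
by rewrite e in Sz; exact: qres_lifts Sz.
Qed.

Lemma qglue U (I : Type) (V : I -> opens X) (hV : forall i, V i `<=` U) :
  U `<=` \bigcup_i V i -> forall S : forall i, qsec (V i),
  (forall i j W (hi : W `<=` V i) (hj : W `<=` V j),
    qres hi (S i) = qres hj (S j)) ->
  exists T, forall i, qres (hV i) T = S i.
Proof.
move=> cov S comp.
pose R (W : opens X) : set (F W) := [set z | exists i, lifts (S i) W z].
have R_sub W z : R W z -> W `<=` U.
  by move=> [i /lifts_sub Sz]; exact: subset_trans (hV i).
have R_in W z : R W z -> Z W z by move=> [i /lifts_in].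
have R_congr W W' z z' : R W z -> R W' z' -> congruent z z'.
  move=> [i Sz] [j Sz'] W0 h h'.
  have hi := subset_trans h (lifts_sub Sz).
  have hj := subset_trans h' (lifts_sub Sz').
  have Si : lifts (qres hi (S i)) W0 (mres F h z).
    by apply: qresE => //; exact: lifts_res.
  have Sj : lifts (qres hj (S j)) W0 (mres F h' z').
    by apply: qresE => //; exact: lifts_res.
  rewrite -(comp i j _ hi hj) in Sj.
  have := lifts_congruent Si Sj (@subset_refl _ _) (@subset_refl _ _).
  by rewrite !mres_id.
have R_exist x : oset U x -> exists W z, oset W x /\ R W z.
  move=> /cov[i _ Vix]; have [W [z [Wx Sz]]] := lifts_exist (S i) Vix.
  by exists W, z; split=> //; exists i.
exists (of_atlas R_sub R_in R_congr R_exist) => i.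
apply: qsec_eq => x Vix; have [W [z [Wx Sz]]] := lifts_exist (S i) Vix.
exists W, z; split=> //; apply: qresE; first exact: lifts_sub Sz.
by apply: sub_saturation => //; exists i.
Qed.

Definition quotient_sheaf : mod_sheaf O :=
  ModSheaf qresZ qres_id qres_comp qsep qglue.

Definition is_class U (z : F U) (T : quotient_sheaf U) := lifts T U z.

Lemma is_class_exists U (z : F U) : Z U z -> exists! T, is_class z T.
Proof.
move=> Zz; pose R V : set (F V) := [set y | exists h : V `<=` U, y = mres F h z].
have R_sub V y : R V y -> V `<=` U by move=> [].
have R_in V y : R V y -> Z V y by move=> [h ->]; exact: ssec_res.
have R_congr V V' y y' : R V y -> R V' y' -> congruent y y'.
  move=> [h ->] [h' ->]; apply/congruent_res/congruent_sym/congruent_res.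
  exact: congruent_refl.
have R_exist x : oset U x -> exists V y, oset V x /\ R V y.
  move=> Ux; exists U, (mres F (@subset_refl _ _) z); split=> //.
  by exists (@subset_refl _ _).
have Tz : is_class z (of_atlas R_sub R_in R_congr R_exist).
  apply: sub_saturation => //; exists (@subset_refl _ _).
  by rewrite mres_id.
exists (of_atlas R_sub R_in R_congr R_exist); split=> // T' T'z.
by apply: qsec_eq => x Ux; exists U, z.
Qed.

Lemma is_class_eq0 U (z : F U) T : is_class z T -> (T = 0 <-> B U z).
Proof.
have z0 : lifts (0 : quotient_sheaf U) U 0 by exact: qzeroE.
move=> Tz; split=> [e|Bz].
  move: Tz; rewrite e => Tz.
  have := lifts_congruent Tz z0 (@subset_refl _ _) (@subset_refl _ _).
  by rewrite !mres_id subr0.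
apply: qsec_eq => x Ux; exists U, z; split=> //.
rewrite lifts_saturated; split=> //; first exact: lifts_in Tz.
move=> V' z' Sz'; apply: congruent_trans (lifts_congruent z0 Sz').
by move=> W h h'; rewrite !raddf0 addr0; exact: ssec_res.
Qed.

Lemma locally_is_class U (T : quotient_sheaf U) x : oset U x ->
  exists V (h : V `<=` U) z, oset V x /\ is_class z (mres quotient_sheaf h T).
Proof.
move=> Ux; have [V [z [Vx Tz]]] := lifts_exist T Ux.
by exists V, (lifts_sub Tz), z; split=> //; exact: qresE.
Qed.

End Quotient.

Section StructureSheafOfPoint.
Variables (X : topologicalType) (O : ring_sheaf X).

Definition regular_res (U V : opens X) (h : V `<=` U) :
  {additive (O U)^o -> (O V)^o} := rres O h.

Lemma regular_resZ (U V : opens X) (h : V `<=` U) a (s : (O U)^o) :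
  regular_res h (a *: s) = rres O h a *: regular_res h s.
Proof. exact: (rmorphM (rres O h)). Qed.

Definition regular_sheaf : mod_sheaf O :=
  @ModSheaf X O (fun U => (O U)^o) regular_res regular_resZ
    (@rres_id _ O) (@rres_comp _ O) (@rsep _ O) (@rglue _ O).

Program Definition whole_subsheaf (F : mod_sheaf O) : subsheaf F :=
  @Subsheaf X O F (fun U => setT) _ _ _ _ _.
Solve All Obligations with by [].

Variables (y : X) (y_local : local_ring (stalk O y)).

Program Definition point_ideal_sheaf : subsheaf regular_sheaf :=
  @Subsheaf X O regular_sheaf
    (fun U => [set s : O U | forall Uy : oset U y, point_ideal Uy s]) _ _ _ _ _.
Next Obligation.
by move=> U Uy; have [+ _ _] := y_local; rewrite /= -(germ0 O Uy).
Qed.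
Next Obligation.
move=> U s t Is It Uy; rewrite /point_ideal /= germD.
by have [_ + _] := y_local; apply; [exact: Is|exact: It].
Qed.
Next Obligation.
move=> U a s Is Uy; rewrite /point_ideal /= (germM Uy a s).
by have [_ _ +] := y_local; apply; exact: Is.
Qed.
Next Obligation.
move=> U V h s Is Vy; rewrite /point_ideal /= (germ_res (h _ Vy)).
exact: Is.
Qed.
Next Obligation.
move=> U s H Uy; have [V [h [Vy Is]]] := H _ Uy.
by rewrite /point_ideal /= -(germ_res Uy Vy h); exact: Is.
Qed.

(* The quotient of [O] by the ideal sheaf of sections vanishing at [y]: for a
   closed point, the skyscraper sheaf of the residue field. *)
Definition point_sheaf : mod_sheaf O :=
  quotient_sheaf (whole_subsheaf regular_sheaf) point_ideal_sheaf.

End StructureSheafOfPoint.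

Section Morphisms.
Variables (X : topologicalType) (O : ring_sheaf X).

Program Definition mor_id (F : mod_sheaf O) : mor F F :=
  @Mor X O F F (fun U => idfun) _.
Solve All Obligations with by [].

Program Definition mor_comp (F G H : mod_sheaf O) (g : mor G H) (f : mor F G) :
  mor F H := @Mor X O F H (fun U => g U \o f U) _.
Next Obligation. by move=> F G H g f U V h s /=; rewrite !mor_res. Qed.

Program Definition mor_zero (F G : mod_sheaf O) : mor F G :=
  @Mor X O F G (fun U => \0) _.
Next Obligation. by move=> F G U V h s /=; rewrite raddf0. Qed.

Program Definition mor_sign (n : nat) (F G : mod_sheaf O) (f : mor F G) :
  mor F G := @Mor X O F G (fun U => (-1) ^+ n \*: f U) _.
Next Obligation.
by move=> n F G f U V h s /=; rewrite mor_res mresZ rmorphXn rmorphN1.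
Qed.

Definition is_zero_sheaf (F : mod_sheaf O) := forall U (s : F U), s = 0.

Definition zero_sheaf : mod_sheaf O :=
  quotient_sheaf (whole_subsheaf (regular_sheaf O))
                 (whole_subsheaf (regular_sheaf O)).

Lemma zero_sheafP : is_zero_sheaf zero_sheaf.
Proof.
move=> U S; apply: qsec_eq => x Ux; have [V [s [Vx Ss]]] := lifts_exist S Ux.
exists V, s; split=> //; rewrite lifts_saturated; split=> //.
exact: lifts_sub Ss.
Qed.

End Morphisms.

(* Cohomological indexing, so that the homology sheaf [H_n] is the sheaf
   [homology E (- n)] below. The differential is given for all pairs of degrees
   and vanishes unless they are consecutive. *)
Record complex (X : topologicalType) (O : ring_sheaf X) := Complex {
  term :> int -> mod_sheaf O;
  diff : forall n m : int, mor (term n) (term m);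
  diff_shape : forall n m : int, m <> n + 1 -> forall U s, diff n m U s = 0;
  diff_diff : forall (n m p : int) U s, diff m p U (diff n m U s) = 0 }.
Arguments diff {X O} c n m.

Section Complexes.
Variables (X : topologicalType) (O : ring_sheaf X).
Implicit Types E F G : complex O.

Program Definition cycles E (n : int) : subsheaf (E n) :=
  @Subsheaf X O (E n) (fun U => [set s | diff E n (n + 1) U s = 0]) _ _ _ _ _.
Next Obligation. by move=> E n U; rewrite /= raddf0. Qed.
Next Obligation. by move=> E n U s t /= es et; rewrite raddfD /= es et addr0. Qed.
Next Obligation. by move=> E n U a s /= es; rewrite linearZ /= es scaler0. Qed.
Next Obligation. by move=> E n U V h s /= es; rewrite mor_res es raddf0. Qed.
Next Obligation.
move=> E n U s /= H.
pose I := {V : opens X | exists h : V `<=` U, diff E n (n + 1) V (mres _ h s) = 0}.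
have hV (i : I) : sval i `<=` U by case: i => V [].
apply: (@msep _ _ _ U I (fun i => sval i) hV).
  move=> x /H[V [h [Vx e]]].
  have p : exists h : V `<=` U, diff E n (n + 1) V (mres _ h s) = 0 by exists h.
  by exists (exist _ V p).
move=> [V p]; move: (hV _) => /= h; case: p => h' e.
by rewrite raddf0 -mor_res (Prop_irrelevance h h').
Qed.

(* The image sheaf of the differential. *)
Program Definition boundaries E (n : int) : subsheaf (E n) :=
  @Subsheaf X O (E n) (fun U => [set s | forall x, oset U x ->
    exists (V : opens X) (h : V `<=` U) (t : E (n - 1) V),
      oset V x /\ mres (E n) h s = diff E (n - 1) n V t]) _ _ _ _ _.
Next Obligation.
move=> E n U x Ux; exists U, (@subset_refl _ _), 0; split=> //.
by rewrite !raddf0.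
Qed.
Next Obligation.
move=> E n U s t Hs Ht x Ux.
have [V [h [u [Vx e]]]] := Hs _ Ux; have [V' [h' [u' [V'x e']]]] := Ht _ Ux.
have hU := subset_trans (@oIl _ V V') h.
exists (oI V V'), hU, (mres _ (@oIl _ _ _) u + mres _ (@oIr _ _ _) u').
split=> //; rewrite !raddfD /= !mor_res -e -e'.
by rewrite !(mres_comp _ _ hU).
Qed.
Next Obligation.
move=> E n U a s Hs x Ux; have [V [h [u [Vx e]]]] := Hs _ Ux.
exists V, h, (rres O h a *: u); split=> //.
by rewrite mresZ e linearZ.
Qed.
Next Obligation.
move=> E n U V h s Hs x Vx; have [V' [h' [u [V'x e]]]] := Hs _ (h _ Vx).
exists (oI V V'), (@oIl _ _ _), (mres _ (@oIr _ _ _) u); split=> //.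
have hU := subset_trans (@oIl _ V V') h.
by rewrite mor_res -e !(mres_comp _ _ hU).
Qed.
Next Obligation.
move=> E n U s H x Ux; have [V [h [Vx Hs]]] := H _ Ux.
have [V' [h' [u [V'x e]]]] := Hs _ Vx.
exists V', (subset_trans h' h), u; split=> //.
by rewrite -e; apply/esym/mres_comp.
Qed.

Definition homology E (n : int) : mod_sheaf O :=
  quotient_sheaf (cycles E n) (boundaries E n).

Program Definition shift E (i : int) : complex O :=
  @Complex X O (fun n => E (n + i))
    (fun n m => mor_sign `|i|%N (diff E (n + i) (m + i))) _ _.
Next Obligation.
move=> E i n m nm U s /=; rewrite diff_shape ?scaler0 // => e.
by apply: nm; apply: (addIr i); rewrite e addrAC.
Qed.
Next Obligation.
by move=> E i n m p U s /=; rewrite linearZ /= diff_diff !scaler0.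
Qed.

Definition in_degree_0 (F : mod_sheaf O) : complex O :=
  @Complex X O (fun n => if n is Posz 0 then F else zero_sheaf O)
    (fun n m => mor_zero _ _) (fun n m _ U s => erefl)
    (fun n m p U s => erefl).

Record chain_map E F := ChainMap {
  cmap :> forall n : int, mor (E n) (F n);
  cmap_diff : forall (n m : int) U s,
    cmap m U (diff E n m U s) = diff F n m U (cmap n U s) }.

Program Definition chain_id E : chain_map E E :=
  @ChainMap E E (fun n => mor_id (E n)) _.
Next Obligation. by move=> E n m U s /=. Qed.

Program Definition chain_comp E F G (g : chain_map F G) (f : chain_map E F) :
  chain_map E G := @ChainMap E G (fun n => mor_comp (g n) (f n)) _.
Next Obligation. by move=> E F G g f n m U s /=; rewrite !cmap_diff. Qed.

Program Definition chain_zero E F : chain_map E F :=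
  @ChainMap E F (fun n => mor_zero (E n) (F n)) _.
Next Obligation. by move=> E F n m U s /=; rewrite raddf0. Qed.

Definition homotopic E F (f g : chain_map E F) :=
  exists h : forall n m : int, mor (E n) (F m), forall n U s,
    f n U s - g n U s = diff F (n - 1) n U (h n (n - 1) U s)
                        + h (n + 1) n U (diff E n (n + 1) U s).

(* [phi] is the morphism induced by [f] on homology in degree [n]; since every
   section of [homology E n] is locally the class of a cycle, there is exactly
   one such [phi]. *)
Definition induced E F (f : chain_map E F) (n : int)
    (phi : mor (homology E n) (homology F n)) :=
  forall U (z : E n U) (T : homology E n U),
    is_class z T -> is_class (f n U z) (phi U T).

Definition quasi_iso E F (f : chain_map E F) := forall n : int,
  exists phi : mor (homology E n) (homology F n), induced f phi /\ is_iso phi.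

Definition bounded E := exists a b : int, forall n : int,
  (n < a)%R || (b < n)%R -> is_zero_sheaf (E n).

(* The objects are the bounded complexes of coherent sheaves; the morphisms are
   the left fractions [E <- apex -> F] of chain maps through such complexes, the
   left leg being a quasi-isomorphism, up to [fraction_eq]. That a complex is an
   object is kept as a predicate, so that complexes which are objects only by a
   theorem (skyscraper and homology sheaves on a noetherian scheme) can be used
   as source or target without a coherence proof. *)
Definition D_object E := bounded E /\ forall n, coherent (E n).

Record fraction E F := Fraction {
  apex : complex O; denom : chain_map apex E; numer : chain_map apex F }.

Definition D_morphism E F (r : fraction E F) :=
  D_object (apex r) /\ quasi_iso (denom r).

Definition fraction_eq E F (r r' : fraction E F) :=
  exists (W : complex O) (a : chain_map W (apex r)) (b : chain_map W (apex r')),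
  [/\ D_object W, quasi_iso (chain_comp (denom r) a),
      homotopic (chain_comp (denom r) a) (chain_comp (denom r') b) &
      homotopic (chain_comp (numer r) a) (chain_comp (numer r') b)].

Definition fraction_id E : fraction E E := Fraction (chain_id E) (chain_id E).

Definition fraction_zero E F : fraction E F :=
  Fraction (chain_id E) (chain_zero E F).

(* [t] is the composite of [r] followed by [r']. *)
Definition is_composite E F G (r : fraction E F) (r' : fraction F G)
    (t : fraction E G) :=
  exists (W : complex O) (a : chain_map W (apex r)) (b : chain_map W (apex r')),
  [/\ D_object W, quasi_iso a,
      homotopic (chain_comp (numer r) a) (chain_comp (denom r') b) &
      fraction_eq
        (Fraction (chain_comp (denom r) a) (chain_comp (numer r') b)) t].

Definition D_hom_zero E F :=
  forall r : fraction E F, D_morphism r -> fraction_eq r (fraction_zero E F).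

Definition D_isomorphic E F :=
  exists (r : fraction E F) (r' : fraction F E),
  [/\ D_morphism r, D_morphism r', is_composite r r' (fraction_id E) &
      is_composite r' r (fraction_id F)].

End Complexes.

Definition skyscraper (Y : scheme) (y : Y) : mod_sheaf (structure_sheaf Y) :=
  point_sheaf (scheme_local y).

(* Main.v *)
From HB Require Import structures.
Require Import Defs.
From mathcomp Require Import all_boot all_order all_algebra.
From mathcomp Require Import boolp classical_sets topology_structure.
From mathcomp Require Import ring zify mpoly.

Set Implicit Arguments.
Unset Strict Implicit.
Unset Printing Implicit Defensive.
Import Order.TTheory GRing.Theory Num.Theory.
Local Open Scope classical_set_scope.
Local Open Scope ring_scope.
Local Open Scope quotient_scope.

(* Let R be the local ring of Y at y_0, m its maximal ideal, and F the minimal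
   free complex of the stalk of E at y_0. A nonzero class of rank in F produces
   a nonzero morphism from E to a shifted skyscraper sheaf: such a morphism is
   realized on a subcomplex of (E + contractible free complex) that is cut out
   by a condition on the stalk at y_0, the Artin-Rees lemma ensuring that the
   inclusion is a quasi-isomorphism. Hence F vanishes outside homological
   degrees 0 .. d, and E is exact at all other points; by the Nullstellensatz
   every element of m has a power that kills the homology of F.

   That the embedding dimension n of R is at most d is a form of the improved
   new intersection theorem. A finite extension A of a polynomial ring k[x] with
   R a localization of A has an element c <> 0 of k[x] for which the powers of x
   are "regular up to c". As the x_j act nilpotently up to homotopy, c^r kills
   the higher homology of F. Comparing the Koszul complex of generators y of m
   with F along the summand k of H_0, and twisting by Frobenius after reducing
   everything modulo a prime p, one finds that n > d would put a fixed power of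
   c in (y_1^q, .., y_n^q) + (p) for all powers q of p, which contradicts Krull's
   intersection theorem. The same almost regularity shows that no ideal with
   fewer than d generators is m-primary; thus n = d, generators of m form a
   regular sequence, and F is exact in positive degrees. Finally the homology of
   E outside degree 0 vanishes at all closed points, hence everywhere, and E is
   isomorphic to H_0 through its truncation. *)

(** * Almost regular sequences and Koszul complexes *)

(** The local ring [R] is not known to be Cohen-Macaulay, so no system of parameters can be assumed
    regular; regularity is replaced by a uniform multiplier [c]. Since [c A] lies in a free
    [k[x]]-submodule of [A], the same [c] serves all powers of the coordinates. Frobenius raises the
    coordinates and the generators [y] to the power [q], while the exponent of [c] produced by the
    homological argument stays fixed. Characteristic zero is brought to this situation by a subring
    of [R] with finitely generated coefficients, in which some prime [p] is not invertible; if [k]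
    has characteristic [p], the same argument runs with [p = 0]. On the derived side a morphism is a
    fraction, and enough locally free sheaves need not exist, so a nonzero morphism must come with
    an explicit bounded coherent apex. Only the stalk at one closed point is altered, and coherence
    asks the altered stalk to contain a power of the maximal ideal times the whole stalk; hence
    Artin-Rees. The scheme may be nonreduced, so the number of coordinates is compared with [d] by
    counting monomials rather than in a function field. *)

Section MultiplesOfSequence.
Variables (B : comPzRingType) (X : nat -> B).

Definition seq_multiples j (M : lmodType B) : set M :=
  [set u | exists v : nat -> M, u = \sum_(l < j) X l *: v l].
Arguments seq_multiples : clear implicits.

Lemma seq_multiplesD j (M : lmodType B) u v :
  seq_multiples j M u -> seq_multiples j M v -> seq_multiples j M (u + v).
Proof.
move=> [a ->] [b ->]; exists (fun l => a l + b l).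
by rewrite -big_split; apply: eq_bigr => l _; rewrite scalerDr.
Qed.

Lemma seq_multiples_lin j (M N : lmodType B) (f : {linear M -> N}) u :
  seq_multiples j M u -> seq_multiples j N (f u).
Proof.
move=> [a ->]; exists (fun l => f (a l)).
by rewrite linear_sum; apply: eq_bigr => l _; rewrite linearZ.
Qed.

Lemma seq_multiplesZ j (M : lmodType B) a u :
  seq_multiples j M u -> seq_multiples j M (a *: u).
Proof. exact: (@seq_multiples_lin _ _ _ (a \*: idfun)). Qed.

Lemma seq_multiples0 j (M : lmodType B) : seq_multiples j M 0.
Proof. by exists (fun=> 0); rewrite big1 // => l _; rewrite scaler0. Qed.

(** With [c = 1] this is regularity of [X_0, .., X_(r-1)] on [M], without the condition that the
    quotient be nonzero; [c] measures the defect uniformly in [j]. *)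
Definition almost_regular_on (c : B) r (M : lmodType B) := forall j (u : M),
  (j < r)%N -> seq_multiples j M (X j *: u) -> seq_multiples j M (c *: u).

End MultiplesOfSequence.
Arguments seq_multiples {B} X j M _.
Arguments almost_regular_on {B} X c r M.

Section AlmostAcyclicity.
Variables (B : comPzRingType) (X : nat -> B) (c : B) (r s : nat).
Variables (D : nat -> lmodType B) (d : forall i, {linear D i.+1 -> D i}).
Variable h : forall (j : nat) i, {linear D i -> D i.+1}.
Hypothesis hom0 : forall j, (j < r)%N -> forall u : D 0%N,
  d 0 (h j 0 u) = X j *: u.
Hypothesis homS : forall j, (j < r)%N -> forall i (u : D i.+1),
  d i.+1 (h j i.+1 u) + h j i (d i u) = X j *: u.
Hypothesis dd : forall i u, d i (d i.+1 u) = 0.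
Hypothesis D_ar : forall i, almost_regular_on X c r (D i).
Hypothesis D_short : forall i, (s < i)%N -> forall u : D i, u = 0.

(** In degree 0 every element counts as a cycle, so that degree 0 yields a statement about the
    cokernel of [d 0]. *)
Let cycle_mod j i : D i -> Prop :=
  if i is i'.+1 then fun z => seq_multiples X j (D i') (d i' z) else fun=> True.

(* A cycle [z] modulo [X_0 .. X_(j-1)] has [X_j z = d w] with [w = h_j z], a
   cycle modulo [X_0 .. X_j] to which the induction hypothesis applies. *)
Lemma almost_acyclic_mod t j i (z : D i) : (j + t = r)%N -> (s < i + t)%N ->
  cycle_mod j z ->
  exists w, seq_multiples X j (D i) (c ^+ t *: z - d i w).
Proof.
elim: t j i z => [|t IH] j i z.
  (* With no element of the sequence left, the degree exceeds the length [s] and [z] itself is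
     zero. *)
  rewrite !addn0 => _ si _; exists 0; rewrite (D_short si z) ?raddf0 ?scaler0 ?subr0 ?addr0.
  exact: seq_multiples0.
rewrite addnS => jt si cz.
have jr : (j < r)%N by rewrite -jt ltnS leq_addr.
have [q qm dq] : exists2 q, seq_multiples X j (D i) q &
    d i (h j i z) = X j *: z - q.
  case: i z cz {si} => [|i] z cz.
    by exists 0; [exact: seq_multiples0|rewrite hom0 // subr0].
  exists (h j i (d i z)); first exact: seq_multiples_lin.
  by rewrite -homS // addrK.
have [|||v [a e]] := IH j.+1 i.+1 (h j i z).
- by rewrite addSn jt.
- by rewrite addSnnS.
- have [b eb] := qm; rewrite /= dq eb.
  exists (fun l => if l == j then z else - b l).
  rewrite big_ord_recr /= eqxx addrC; congr (_ + _).
  rewrite -sumrN; apply: eq_bigr => l _.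
  by rewrite (ltn_eqF (ltn_ord l)) scalerN.
(* [a j] is the coefficient of [X_j] in the relation for [h_j z]. Applying [d] to that relation
   shows that [X_j (c^t z - d a_j)] is a combination of the earlier [X_l]; one more factor [c]
   removes [X_j]. *)
exists (c *: a j).
rewrite linearZ exprS -scalerA -scalerBr.
apply: D_ar => //.
have -> : X j *: (c ^+ t *: z - d i (a j)) =
    d i (\sum_(l < j) X l *: a l) + c ^+ t *: q.
  have /(congr1 (d i)) := e; rewrite big_ord_recr /= linearB linearD /= dd subr0.
  rewrite !linearZ /= dq scalerBr => e'.
  by rewrite scalerBr scalerA mulrC -scalerA -[X in X - _](subrK (c ^+ t *: q)) e'
    addrAC addrK.
apply: seq_multiplesD; last exact: seq_multiplesZ.
by apply: seq_multiples_lin; exists a.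
Qed.

Lemma almost_acyclic i (z : D i.+1) : (s <= r)%N -> d i z = 0 ->
  exists w, c ^+ r *: z = d i.+1 w.
Proof.
move=> sr dz0; have [|||w [a]] := @almost_acyclic_mod r 0 i.+1 z.
- by rewrite add0n.
- by rewrite addSn ltnS (leq_trans sr) // leq_addl.
- by rewrite /= dz0; exact: seq_multiples0.
by rewrite big_ord0 => /subr0_eq; exists w.
Qed.

(** When the complex is strictly shorter than the sequence, degree 0 is reached as well; this is how
    ideals with too few generators are excluded. *)
Lemma almost_acyclic0 (z : D 0%N) : (s < r)%N -> exists w, c ^+ r *: z = d 0 w.
Proof.
move=> sr; have [|||w [a]] := @almost_acyclic_mod r 0 0%N z => //.
by rewrite big_ord0 => /subr0_eq; exists w.
Qed.

End AlmostAcyclicity.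

Section Cone.
Variables (B : comPzRingType) (u : B).
Variables (D : nat -> lmodType B) (d : forall i, {linear D i.+1 -> D i}).
Hypothesis dd : forall i v, d i (d i.+1 v) = 0.

(** The mapping cone of multiplication by [u]; iterated along a list it gives the Koszul complex
    without exterior powers. *)
Definition cone i : lmodType B := if i is i'.+1 then (D i * D i')%type else D 0.

Definition cone_fun i : cone i.+1 -> cone i :=
  match i return cone i.+1 -> cone i with
  | 0%N => fun p => d 0 p.1 + u *: p.2
  | i'.+1 => fun p => (d i'.+1 p.1 + u *: p.2, - d i' p.2)
  end.

Lemma cone_fun_linear i : linear (@cone_fun i).
Proof.
case: i => [|i] a p q /=.
  by rewrite linearP !scalerDr !scalerA [u * a]mulrC addrACA.
congr pair; rewrite /= linearP.
  by rewrite !scalerDr !scalerA [u * a]mulrC addrACA.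
by rewrite opprD scalerN.
Qed.

HB.instance Definition _ i := GRing.isLinear.Build B (cone i.+1) (cone i) *:%R
  (@cone_fun i) (@cone_fun_linear i).

Definition coned i : {linear cone i.+1 -> cone i} := @cone_fun i.

Lemma conedd i p : coned i (coned i.+1 p) = 0.
Proof.
case: i p => [|i] p; rewrite /coned /= linearD linearZ /= dd add0r scalerN subrr //.
by rewrite linearN /= dd !oppr0.
Qed.

Section LiftHomotopy.
Variables (h : forall i, {linear D i -> D i.+1}) (x : B).
Hypothesis hom0 : forall v, d 0 (h 0 v) = x *: v.
Hypothesis homS : forall i v, d i.+1 (h i.+1 v) + h i (d i v) = x *: v.

Definition coneh_fun i : cone i -> cone i.+1 :=
  match i return cone i -> cone i.+1 with
  | 0%N => fun p => (h 0 p, 0)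
  | i'.+1 => fun p => (h i'.+1 p.1, - h i' p.2)
  end.

Lemma coneh_fun_linear i : linear (@coneh_fun i).
Proof.
case: i => [|i] a p q /=; congr pair; rewrite /= ?linearP ?scaler0 ?addr0 ?opprD ?scalerN //.
Qed.

HB.instance Definition _ i := GRing.isLinear.Build B (cone i) (cone i.+1) *:%R
  (@coneh_fun i) (@coneh_fun_linear i).

Definition coneh i : {linear cone i -> cone i.+1} := @coneh_fun i.

Lemma coneh0 v : coned 0 (coneh 0 v) = x *: v.
Proof. by rewrite /coned /coneh /= scaler0 addr0 hom0. Qed.

Lemma conehS i v : coned i.+1 (coneh i.+1 v) + coneh i (coned i v) = x *: v.
Proof.
rewrite /coned /coneh; case: i v => [|i] [a b] /=.
  congr pair; rewrite /=.
    by rewrite linearD linearZ /= scalerN addrACA addNr addr0 homS.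
  by rewrite linearN opprK addr0 hom0.
congr pair; rewrite /=.
  by rewrite linearD linearZ /= scalerN addrACA addNr addr0 homS.
by rewrite !linearN !opprK homS.
Qed.

End LiftHomotopy.

(** The tautological homotopy from the unshifted copy of [D] to the shifted one, by which [u]
    becomes nullhomotopic on its own cone. *)
Definition cones_fun i : cone i -> cone i.+1 :=
  match i return cone i -> cone i.+1 with
  | 0%N => fun p => (0, p)
  | i'.+1 => fun p => (0, p.1)
  end.

Lemma cones_fun_linear i : linear (@cones_fun i).
Proof. by case: i => [|i] a p q /=; congr pair; rewrite /= ?scaler0 ?addr0. Qed.

HB.instance Definition _ i := GRing.isLinear.Build B (cone i) (cone i.+1) *:%R
  (@cones_fun i) (@cones_fun_linear i).

Definition cones i : {linear cone i -> cone i.+1} := @cones_fun i.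

Lemma cones0 v : coned 0 (cones 0 v) = u *: v.
Proof. by rewrite /coned /cones /= raddf0 add0r. Qed.

Lemma conesS i v : coned i.+1 (cones i.+1 v) + cones i (coned i v) = u *: v.
Proof.
rewrite /coned /cones; case: i v => [|i] [a b] /=; congr pair; rewrite /=.
- by rewrite raddf0 add0r addr0.
- by rewrite addrA addNr add0r.
- by rewrite raddf0 add0r addr0.
- by rewrite addrA addNr add0r.
Qed.

Lemma cone_almost_regular X c r (D_ar : forall i, almost_regular_on X c r (D i)) i :
  almost_regular_on X c r (cone i).
Proof.
case: i => [|i]; first exact: D_ar.
move=> j [a b] jr /= [v e].
have ea : seq_multiples X j (D i.+1) (X j *: a).
  by exists (fun l => (v l).1); rewrite -[LHS]/((X j *: (a, b)).1) e raddf_sum.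
have eb : seq_multiples X j (D i) (X j *: b).
  by exists (fun l => (v l).2); rewrite -[LHS]/((X j *: (a, b)).2) e raddf_sum.
have [a' ea'] := D_ar _ _ _ jr ea; have [b' eb'] := D_ar _ _ _ jr eb.
exists (fun l => (a' l, b' l)).
have -> : \sum_(l < j) X l *: (a' l, b' l) =
    (\sum_(l < j) X l *: a' l, \sum_(l < j) X l *: b' l) :> D i.+1 * D i.
  by rewrite [LHS]surjective_pairing !raddf_sum.
by rewrite -ea' -eb'.
Qed.

End Cone.

Section Koszul.
Variable B : comPzRingType.

Fixpoint ideal_seq (us : seq B) : set B :=
  if us is u :: us' then [set a | exists b c, ideal_seq us' c /\ a = b * u + c]
  else [set 0].

Lemma ideal_seq_comb us a b c : ideal_seq us a -> ideal_seq us b ->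
  ideal_seq us (c * a + b).
Proof.
elim: us a b => [|u us IH] a b /=; first by move=> -> ->; rewrite mulr0 addr0.
move=> [a1 [a2 [Ia ->]]] [b1 [b2 [Ib ->]]].
exists (c * a1 + b1), (c * a2 + b2); split; first exact: IH.
by rewrite mulrDr mulrDl !mulrA addrACA.
Qed.

(** Iterated cones. For [x = a u + b] with [b] in the ideal of the remaining elements, the homotopy
    is [a] times the tautological one for [u] plus the lift of the one for [b]. The map [eta]
    identifies degree 0 with [B], so that the cokernel of [d 0] can be compared with the quotient by
    the ideal. *)
Lemma koszul_complex (us : seq B) X c r : almost_regular_on X c r B^o ->
  exists (D : nat -> lmodType B) (d : forall i, {linear D i.+1 -> D i})
    (eta : {linear B^o -> D 0%N}),
  [/\ forall i v, d i (d i.+1 v) = 0,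
      forall i, (size us < i)%N -> forall v : D i, v = 0,
      forall i, almost_regular_on X c r (D i),
      bijective eta /\ forall w a, d 0%N w = eta a -> ideal_seq us a &
      forall x, ideal_seq us x -> exists h : forall i, {linear D i -> D i.+1},
        (forall v, d 0 (h 0 v) = x *: v) /\
        forall i v, d i.+1 (h i.+1 v) + h i (d i v) = x *: v].
Proof.
move=> B_ar; elim: us => [|u us [D [d [eta [dd sh ar [eta_bij im] nh]]]]].
  pose D i : lmodType B := if i is 0%N then B^o else 'rV[B]_0.
  have D0 i (v : D i.+1) : v = 0 by rewrite [v]thinmx0.
  exists D, (fun i => \0), (idfun : {linear B^o -> B^o}); split=> //.
  - by case=> // i _ v; exact: D0.
  - case=> [|i]; first exact: B_ar.
    by move=> j v _ _; rewrite [v]D0 scaler0; exact: seq_multiples0.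
  - by split=> [|w a /= <-] //; exists id.
  - move=> x /= ->; exists (fun i => \0); split=> [v|i v]; rewrite /= ?scale0r //.
    by rewrite addr0.
exists (cone D), (coned u d), eta; split.
- exact: conedd.
- by case=> [|i] //= si [a b]; rewrite (sh _ _ a) ?(sh _ _ b) // ltnW.
- exact: cone_almost_regular.
- split=> // w a; rewrite /coned /= => e.
  have [g ge eg] := eta_bij.
  exists (g w.2), (a - g w.2 * u); split; last by rewrite addrC subrK.
  apply: (im w.1); rewrite raddfB /= -e -[in X in _ - eta X]mulrC.
  by rewrite -[u * _]/(u *: (g w.2 : B^o)) linearZ /= eg addrK.
- move=> x /= [a [b [/nh[h [h0 hS]] ->]]].
  pose H i : {linear cone D i -> cone D i.+1} :=
    a \*: cones D i \+ coneh h i.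
  have HE i v : H i v = a *: cones D i v + coneh h i v by [].
  exists H; split=> [v|i v].
    change (coned u d 0 (H 0 v) = (a * u + b) *: v).
    rewrite HE (linearD (coned u d 0)) (linearZ_LR (coned u d 0)) cones0.
    by rewrite (coneh0 u h0) scalerA scalerDl.
  change (coned u d i.+1 (H i.+1 v) + H i (coned u d i v) = (a * u + b) *: v).
  rewrite !HE (linearD (coned u d i.+1)) (linearZ_LR (coned u d i.+1)).
  by rewrite addrACA -scalerDr conesS (conehS u h0 hS) scalerA scalerDl.
Qed.

(** The Koszul complex on [us] has length less than [r], and elements of the ideal act
    nullhomotopically on it, so [c^r] kills its cokernel, the quotient of [B] by the ideal. *)
Lemma almost_regular_parameters (us : seq B) X c r :
  almost_regular_on X c r B^o -> (size us < r)%N ->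
  (forall j, (j < r)%N -> ideal_seq us (X j)) -> ideal_seq us (c ^+ r).
Proof.
move=> B_ar sr XI.
have [D [d [eta [dd sh ar [_ im] nh]]]] := koszul_complex us B_ar.
have H j : exists h : forall i, {linear D i -> D i.+1}, (j < r)%N ->
    (forall v, d 0 (h 0 v) = X j *: v) /\
        forall i v, d i.+1 (h i.+1 v) + h i (d i v) = X j *: v.
  have [/XI/nh[h hP]|jr] := ltnP j r; first by exists h.
  by exists (fun i => \0).
have [h hP] := choice H.
have [w] := @almost_acyclic0 _ X c r (size us) D d h (fun j jr => (hP j jr).1)
   (fun j jr => (hP j jr).2) dd ar sh (eta 1) sr.
rewrite -linearZ => /esym/im; rewrite /= ; by rewrite /GRing.scale /= mulr1.
Qed.

End Koszul.

Section Ideals.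
Variable B : comPzRingType.
Implicit Types I : set B.

Lemma idealD I a b : is_ideal I -> I a -> I b -> I (a + b).
Proof. by case=> _ + _; apply. Qed.

Lemma ideal0 I : is_ideal I -> I 0.
Proof. by case. Qed.

Lemma ideal_mull I a b : is_ideal I -> I b -> I (a * b).
Proof. by case=> _ _; apply. Qed.

Lemma ideal_mulr I a b : is_ideal I -> I a -> I (a * b).
Proof. by move=> II Ia; rewrite mulrC; exact: ideal_mull. Qed.

Lemma idealN I a : is_ideal I -> I a -> I (- a).
Proof. by move=> II Ia; rewrite -mulN1r; exact: ideal_mull. Qed.

Lemma idealB I a b : is_ideal I -> I a -> I b -> I (a - b).
Proof. by move=> II Ia Ib; apply: idealD => //; exact: idealN. Qed.

Lemma ideal_sum I (T : Type) (r : seq T) (P : pred T) (f : T -> B) :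
  is_ideal I -> (forall i, P i -> I (f i)) -> I (\sum_(i <- r | P i) f i).
Proof.
move=> II H; apply: (big_ind I) => // [|a b]; first exact: ideal0.
exact: idealD.
Qed.

Lemma generated_by_ideal n (g : 'I_n -> B) : is_ideal (generated_by g).
Proof.
split.
- by exists (fun=> 0); rewrite big1 // => i _; rewrite mul0r.
- move=> a b [c ->] [c' ->]; exists (fun i => c i + c' i).
  by rewrite -big_split; apply: eq_bigr => i _; rewrite mulrDl.
- move=> a b [c ->]; exists (fun i => a * c i).
  by rewrite mulr_sumr; apply: eq_bigr => i _; rewrite mulrA.
Qed.

Lemma generated_by_gen n (g : 'I_n -> B) i : generated_by g (g i).
Proof.
exists (fun j => (j == i)%:R); rewrite (bigD1 i) //= eqxx mul1r.
by rewrite big1 ?addr0 // => j /negPf ->; rewrite mul0r.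
Qed.

Definition entries_in I p q (M : 'M[B]_(p, q)) := forall i j, I (M i j).

Lemma entries_in_mull I p q r (M : 'M[B]_(p, q)) (N : 'M[B]_(q, r)) :
  is_ideal I -> entries_in I M -> entries_in I (M *m N).
Proof.
by move=> II HM i j; rewrite mxE; apply: ideal_sum => // k _; exact: ideal_mulr.
Qed.

Lemma entries_in_mulr I p q r (M : 'M[B]_(p, q)) (N : 'M[B]_(q, r)) :
  is_ideal I -> entries_in I N -> entries_in I (M *m N).
Proof.
by move=> II HM i j; rewrite mxE; apply: ideal_sum => // k _; exact: ideal_mull.
Qed.

Lemma entries_in_generated n (y : 'I_n -> B) p q (M : 'M[B]_(p, q)) :
  entries_in (generated_by y) M ->
  exists C : 'I_n -> 'M[B]_(p, q), M = \sum_i y i *: C i.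
Proof.
move=> H; have /choice[f fP] : forall ij, exists c : 'I_n -> B,
    M ij.1 ij.2 = \sum_i c i * y i by move=> ij; exact: H.
exists (fun i => \matrix_(a, b) f (a, b) i); apply/matrixP => a b.
rewrite summxE (fP (a, b)); apply: eq_bigr => i _.
by rewrite !mxE mulrC.
Qed.

End Ideals.

(** * Comparison of the Koszul complex with an almost exact minimal complex *)

Section KoszulComparison.
Variables (B : comPzRingType) (beta : nat -> nat).
Variable Dl : forall i, 'M[B]_(beta i.+1, beta i).
Variables (gam : B) (n : nat) (y : 'I_n -> B).
Let J := generated_by y.
Hypothesis dd : forall i, Dl i.+1 *m Dl i = 0.
Hypothesis almost_exact : forall i (z : 'rV_(beta i.+1)), z *m Dl i = 0 ->
  exists w, gam *: z = w *m Dl i.+1.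
Hypothesis Dl_min : forall i, entries_in J (Dl i).
Variables (e : 'rV[B]_(beta 0)) (eps : 'cV[B]_(beta 0)).
Hypothesis e_unimodular : e *m eps = 1%:M.
Variables (z : 'I_n -> 'rV[B]_(beta 1)) (rho : 'M[B]_(beta 1, n)).
Hypothesis z_boundary : forall i, z i *m Dl 0 = y i *: e.
Hypothesis z_free : forall i j, J ((z i *m rho) 0 j - (i == j)%:R).

Let JI : is_ideal J := generated_by_ideal y.

(** The combination [sum_i a_i z_i] is a cycle, so [gam] times it is a boundary and has entries in
    [J] by minimality; [rho] then reads off the [a_i] modulo [J]. *)
Lemma almost_minimal_generators a : \sum_i y i * a i = 0 ->
  forall i, J (gam * a i).
Proof.
move=> ay0 i.
have [|w ew] := @almost_exact 0 (\sum_i a i *: z i).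
  rewrite mulmx_suml (eq_bigr (fun i => (y i * a i) *: e)).
    by rewrite -scaler_suml ay0 scale0r.
  by move=> j _; rewrite -scalemxAl z_boundary scalerA mulrC.
have Jv : entries_in J (gam *: (\sum_i a i *: z i) *m rho).
  by rewrite ew; apply: entries_in_mull => //; exact: entries_in_mulr.
have := Jv 0 i; rewrite -scalemxAl mxE mulmx_suml summxE => Js.
have -> : gam * a i = gam * \sum_j (a j *: z j *m rho) 0 i
    - gam * \sum_j a j * ((z j *m rho) 0 i - (j == i)%:R).
  rewrite -mulrBr -sumrB; congr (_ * _).
  rewrite (bigD1 i) //= big1 ?addr0 => [|j /negPf ji];
    rewrite -scalemxAl mxE mulrBr opprB addrC subrK ?eqxx ?mulr1 //.
  by rewrite ji mulr0.
apply: idealB => //; apply: ideal_mull => //; apply: ideal_sum => // j _.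
exact: ideal_mull.
Qed.

Definition ksign (i : 'I_n) (I : {set 'I_n}) : B :=
  (-1) ^+ #|[set j in I | (j < i)%N]|.

(** The Koszul differential of the basis element indexed by [I], followed by [p], which is regarded
    as a linear map on the Koszul complex. *)
Definition kboundary m (p : {set 'I_n} -> 'rV[B]_m) (I : {set 'I_n}) :=
  \sum_(i in I) (ksign i I * y i) *: p (I :\ i).

Lemma ksign_swap (I : {set 'I_n}) i j : i \in I -> j \in I -> (i < j)%N ->
  ksign i I * ksign j (I :\ i) = - (ksign j I * ksign i (I :\ j)).
Proof.
move=> iI jI ij; rewrite /ksign.
have -> : [set l in I :\ j | (l < i)%N] = [set l in I | (l < i)%N].
  apply/setP => l; rewrite !inE; case: eqVneq => //= ->.
  by rewrite ltnNge ltnW // andbF.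
have -> : #|[set l in I | (l < j)%N]| = #|[set l in I :\ i | (l < j)%N]|.+1.
  rewrite (cardsD1 i) inE iI ij /= add1n; congr _.+1; apply: eq_card => l.
  by rewrite !inE andbA.
by rewrite exprS mulN1r mulNr opprK mulrC.
Qed.

Lemma kboundary_kboundary m (p : {set 'I_n} -> 'rV[B]_m) (I : {set 'I_n}) :
  \sum_(i in I) (ksign i I * y i) *: kboundary p (I :\ i) = 0.
Proof.
(* The sum over pairs of distinct indices is split by their order; the two halves cancel by
   [ksign_swap]. *)
pose f i j := (ksign i I * y i * (ksign j (I :\ i) * y j)) *: p (I :\ i :\ j).
have -> : \sum_(i in I) (ksign i I * y i) *: kboundary p (I :\ i) =
    \sum_(i in I) \sum_(j in I | j != i) f i j.
  apply: eq_bigr => i iI; rewrite scaler_sumr; apply: eq_big => [j|j _].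
    by rewrite !inE andbC.
  by rewrite scalerA.
rewrite (eq_bigr (fun i : 'I_n => \sum_(j in I | (i < j)%N) f i j +
    \sum_(j in I | (j < i)%N) f i j)); last first.
  move=> i iI; rewrite (bigID (fun j : 'I_n => (i < j)%N)) /=; congr (_ + _).
    apply: eq_bigl => j; rewrite -andbA; congr andb.
    by rewrite -val_eqE /=; case: ltngtP.
  apply: eq_bigl => j; rewrite -andbA -leqNgt; congr andb.
  by rewrite -val_eqE /=; case: ltngtP.
rewrite big_split /= [X in _ + X](exchange_big_dep (mem I)) /=; last first.
  by move=> ? ? _ /andP[].
rewrite -big_split big1 //= => i iI.
rewrite [X in _ + X](eq_bigl (fun j => (j \in I) && (i < j)%N)); last first.
  by move=> j; rewrite iI.
rewrite -big_split big1 //= => j /andP[jI ij]; rewrite /f.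
have -> : I :\ j :\ i = I :\ i :\ j.
  by apply/setP => l; rewrite !inE; case: (_ == _); case: (_ == _).
rewrite -scalerDl mulrACA (mulrACA (ksign j I)) (ksign_swap iI jI ij).
by rewrite (mulrC (y j)) mulNr addNr scale0r.
Qed.

(** A comparison map from the Koszul complex of [y] that extends the choice of [e] in degree 0. It
    commutes with the differentials only up to a factor [gam] in each degree, because a cycle is a
    boundary only after multiplication by [gam]. *)
Fixpoint psi a : {set 'I_n} -> 'rV[B]_(beta a) :=
  if a is a'.+1 then fun I =>
    xget 0 [set w | w *m Dl a' = gam *: kboundary (@psi a') I]
  else fun=> e.

Lemma psiP a (I : {set 'I_n}) : #|I| = a.+1 -> psi a.+1 I *m Dl a = gam *: kboundary (@psi a) I.
Proof.
elim: a I => [|a IH] I cI.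
  apply: (@xgetPex _ 0 [set w | w *m Dl 0 = _]) => /=.
  have /cards1P[i ->] : #|I| == 1%N by rewrite cI.
  exists (gam *: z i); rewrite -scalemxAl z_boundary /kboundary big_set1 /ksign.
  suff -> : [set j in [set i]%SET | (j < i)%N] = finset.set0.
    by rewrite cards0 expr0 mul1r.
  by apply/setP => j; rewrite !inE; case: eqVneq => // ->; rewrite ltnn.
apply: (@xgetPex _ 0 [set w | w *m Dl a.+1 = _]) => /=.
have [|w ew] := @almost_exact a (kboundary (@psi a.+1) I); last by exists w.
rewrite mulmx_suml (eq_bigr (fun i =>
  gam *: ((ksign i I * y i) *: kboundary (@psi a) (I :\ i)))).
  by rewrite -scaler_sumr kboundary_kboundary scaler0.
move=> i iI; rewrite -scalemxAl IH ?scalerA ?[gam * _]mulrC //.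
by move: cI; rewrite (cardsD1 i) iI => -[].
Qed.

(** Each degree costs two factors [gam]: one because [psi] is a chain map only up to [gam], one in
    [almost_minimal_generators]. The differential of the given combination is expressed through
    [psi] and also through [Dl = sum_l y_l C_l]; the difference is a relation among the [y_l], whose
    coefficients almost lie in [J]. *)
Lemma psi_almost_free a (w : {set 'I_n} -> B) :
  entries_in J (\sum_(I : {set 'I_n} | #|I| == a) w I *: psi a I) ->
  forall I : {set 'I_n}, #|I| = a -> J (gam ^+ a.*2 * w I).
Proof.
elim: a w => [|a IH] w H I cI.
  move/eqP: cI; rewrite cards_eq0 => /eqP ->.
  have := @entries_in_mull _ _ _ _ _ _ eps JI H.
  rewrite (big_pred1 finset.set0) => [|K]; last by rewrite cards_eq0.
  rewrite -scalemxAl e_unimodular => /(_ 0 0).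
  by rewrite !mxE eqxx mulr1n mulr1 expr0 mul1r.
have [i iI] : exists i, i \in I by apply/set0Pn; rewrite -card_gt0 cI.
(* The coefficient of [y_l] in the Koszul boundary of [sum_I w_I e_I], pushed forward by [psi]. *)
pose v l := \sum_(K : {set 'I_n} | #|K| == a)
   (if l \in K then 0 else ksign l (l |: K) * w (l |: K)) *: psi a K.
have [C eC] := entries_in_generated (@Dl_min a).
pose u := \sum_(I : {set 'I_n} | #|I| == a.+1) w I *: psi a.+1 I.
have e1 : u *m Dl a = gam *: \sum_l y l *: v l.
  rewrite mulmx_suml (eq_bigr (fun I : {set 'I_n} => \sum_(l in I)
     gam *: ((y l * (ksign l I * w I)) *: psi a (I :\ l)))); last first.
    move=> K /eqP cK; rewrite -scalemxAl psiP // scalerA mulrC -scalerA.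
    rewrite !scaler_sumr; apply: eq_bigr => l _; rewrite !scalerA.
    by congr (_ *: _); ring.
  rewrite (exchange_big_dep xpredT) //= scaler_sumr; apply: eq_bigr => l _.
  rewrite -!scaler_sumr; congr (_ *: _); rewrite scaler_sumr.
  rewrite [RHS](bigID (fun K : {set 'I_n} => l \in K)) /= [X in X + _]big1 ?add0r.
    rewrite (reindex_onto (fun K => l |: K) (fun K => K :\ l)) /=; last first.
      by move=> K /andP[_ lK]; rewrite finset.setD1K.
    apply: eq_big => [K|K]; last first.
      move=> /andP[/andP[cK _] /eqP eK].
      have lK : l \notin K by rewrite -eK !inE eqxx.
      by rewrite (negPf lK) eK scalerA.
    rewrite setU11 andbT andbC.
    have [lK|lK] := boolP (l \in K); rewrite ?andbF /=.
      by apply/negP => /andP[/eqP eK _]; move: lK; rewrite -eK !inE eqxx.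
    by rewrite setU1K // eqxx andbT cardsU1 lK.
  by move=> K /andP[_ ->]; rewrite scale0r scaler0.
have e2 : u *m Dl a = \sum_l y l *: (u *m C l).
  by rewrite {1}eC mulmx_sumr; apply: eq_bigr => l _; rewrite scalemxAr.
have rel j : J (gam * (gam * v i 0 j - (u *m C i) 0 j)).
  apply: (@almost_minimal_generators (fun l => gam * v l 0 j - (u *m C l) 0 j)).
  have /matrixP/(_ 0 j) : gam *: (\sum_l y l *: v l) - \sum_l y l *: (u *m C l) = 0.
    by rewrite -e1 -e2 subrr.
  rewrite scaler_sumr -sumrB summxE mxE => {2}<-; apply: eq_bigr => l _.
  by rewrite !mxE mulrBr mulrCA.
have Jv : entries_in J (gam ^+ 2 *: v i).
  move=> a0 j; rewrite ord1 mxE expr2 -mulrA.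
  rewrite -[gam * v i 0 j](subrK ((u *m C i) 0 j)) mulrDr.
  apply: (idealD JI); first exact: rel.
  by apply: (ideal_mull _ JI); apply: entries_in_mull.
have cK : #|I :\ i| = a by move: cI; rewrite (cardsD1 i) iI => -[].
pose w' (K : {set 'I_n}) := gam ^+ 2 * if i \in K then 0 else ksign i (i |: K) * w (i |: K).
have Jw' : entries_in J (\sum_(K : {set 'I_n} | #|K| == a) w' K *: psi a K).
  move: Jv; rewrite /v scaler_sumr.
  set s1 := bigop _ _ _; set s2' := bigop _ _ _; suff -> : s1 = s2' by [].
  by apply: eq_bigr => K _; rewrite scalerA.
have := ideal_mull (ksign i I) JI (IH w' Jw' (I :\ i) cK); rewrite /w'.
rewrite !inE eqxx finset.setD1K //=.
have s2 : ksign i I * ksign i I = 1 by rewrite -expr2 /ksign sqrr_sign.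
have -> : ksign i I * (gam ^+ a.*2 * (gam ^+ 2 * (ksign i I * w I))) =
    gam ^+ a.+1.*2 * w I.
  have -> : gam ^+ a.+1.*2 = gam ^+ a.*2 * gam ^+ 2.
    by rewrite -exprD doubleS addn2.
  by rewrite -[RHS]mul1r -s2; ring.
by [].
Qed.

(** In degree [n] the Koszul basis is the single full set, and its image lies in a module of rank 0;
    so the relation with coefficient 1 holds there. *)
Lemma koszul_comparison : beta n = 0%N -> J (gam ^+ n.*2).
Proof.
move=> bn; have := @psi_almost_free n (fun=> 1) _ finset.setT.
rewrite mulr1; apply; last by rewrite cardsT card_ord.
by move=> i j; have := ltn_ord j; rewrite [X in (_ < X)%N]bn.
Qed.

End KoszulComparison.

(** * Noether normalization and generic freeness *)

(** Uniqueness of digits in base [N], by which the weights in Nagata's substitution separate the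
    monomials of a polynomial. *)
Lemma digits_inj N n (m m' : 'I_n -> nat) :
  (forall i, m i < N)%N -> (forall i, m' i < N)%N ->
  (\sum_i m i * N ^ i = \sum_i m' i * N ^ i)%N -> m =1 m'.
Proof.
elim: n m m' => [|n IH] m m' mN m'N e i; first by case: i.
have N0 : (0 < N)%N by apply: leq_ltn_trans (mN ord0).
have S (f : 'I_n.+1 -> nat) : (\sum_i f i * N ^ i =
    f ord0 + (\sum_(i < n) f (lift ord0 i) * N ^ i) * N)%N.
  rewrite big_ord_recl expn0 muln1 big_distrl /=; congr (_ + _)%N.
  by apply: eq_bigr => j _; rewrite /= /bump /= expnS -mulnA [(N * _)%N]mulnC.
move: e; rewrite !S => e.
have e0 : m ord0 = m' ord0.
  by have := congr1 (modn^~ N) e; rewrite /= ![(_ + _ * N)%N]addnC !modnMDl !modn_small.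
have [j ->|->//] := unliftP ord0 i.
apply: (IH (m \o lift ord0) (m' \o lift ord0)) => /= [?|?|]; [exact: mN|exact: m'N|].
move: e; rewrite e0 => /addnI/eqP; rewrite eqn_pmul2r // => /eqP.
by [].
Qed.

Lemma integral_mmap (K : nzRingType) (A : comNzRingType)
    (iota : {rmorphism K -> A}) r (x : 'I_r -> A) (R : comNzRingType)
    (f : {rmorphism R -> A}) p :
  (forall c, integralOver f (iota c)) -> (forall i, integralOver f (x i)) ->
  integralOver f (mmap iota x p).
Proof.
move=> fk fx; rewrite /mmap; apply: (big_ind (integralOver f)).
- exact: integral0.
- exact: integral_add.
move=> m _; apply: integral_mul => //; rewrite /mmap1.
apply: (big_ind (integralOver f)).
- exact: integral1.
- exact: integral_mul.
move=> i _; elim: (m i) => [|j IH]; first by rewrite expr0; exact: integral1.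
by rewrite exprS; exact: integral_mul.
Qed.

Section NoetherNormalization.
Variables (k : fieldType) (A : comNzRingType) (iota : {rmorphism k -> A}).

Definition alg_indep r (x : 'I_r -> A) :=
  forall p : {mpoly k[r]}, mmap iota x p = 0 -> p = 0.

Lemma integral_mmap_iota r (x : 'I_r -> A) c :
  integralOver (mmap iota x) (iota c).
Proof. by rewrite -(mmapC x); exact: integral_id. Qed.

Lemma integral_trans_mmap r r' (x : 'I_r -> A) (x' : 'I_r' -> A) a :
  (forall i, integralOver (mmap iota x') (x i)) ->
  integralOver (mmap iota x) a -> integralOver (mmap iota x') a.
Proof.
move=> xx' [p pm pa]; apply: (@integral_root_monic _ _ _ a (map_poly (mmap iota x) p)).
- exact: monic_map.
- exact: pa.
apply/integral_poly => i; rewrite coef_map.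
apply: integral_mmap => // c; exact: integral_mmap_iota.
Qed.

Section NagataStep.
Variables (r : nat) (x : 'I_r.+1 -> A) (f : {mpoly k[r.+1]}).
Hypotheses (f0 : f != 0) (fx : mmap iota x f = 0).

(** Nagata's substitution [x_j = x'_j + x_0^(N^j)] for [j > 0]. As [N] exceeds every exponent
    occurring in [f], the weight [w] is injective on the monomials of [f]. *)
Let N := msize f.
Let x' (j : 'I_r) := x (lift ord0 j) - x ord0 ^+ (N ^ lift ord0 j).
Let v (j : 'I_r.+1) : {poly {mpoly k[r]}} :=
  if unlift ord0 j is Some j' then ('X_j')%:P + 'X^(N ^ j) else 'X.
Let h : {rmorphism k -> {poly {mpoly k[r]}}} := (@polyC _) \o (@mpolyC r k).
Let w (m : 'X_{1..r.+1}) := (\sum_j m j * N ^ j)%N.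

Let monic_deg (p : {poly {mpoly k[r]}}) d := p \is monic /\ size p = d.+1.

Let monic_degM p q a b : monic_deg p a -> monic_deg q b -> monic_deg (p * q) (a + b).
Proof.
move=> [pm sp] [qm sq]; split; first by rewrite monicMl.
by rewrite size_Mmonic ?monic_neq0 // sp sq addSn addnS.
Qed.

Let monic_deg_v m : monic_deg (mmap1 v m) (w m).
Proof.
have vm j : monic_deg (v j) (N ^ j).
  rewrite /v; case: unliftP => [j' ->|->]; last by split; rewrite ?monicX ?size_polyX.
  have s : (size ('X_j' : {mpoly k[r]})%:P < size ('X^(N ^ lift ord0 j') : {poly {mpoly k[r]}}))%N.
    rewrite size_polyXn ltnS (leq_trans (size_polyC_leq1 _)) // expn_gt0.
    by rewrite lt0n msize_poly_eq0 f0.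
  split; last by rewrite addrC size_polyDl // size_polyXn.
  by rewrite monicE addrC lead_coefDl // lead_coefXn.
rewrite /mmap1 /w; apply: (big_ind2 monic_deg) => [|p a q b|j _].
- by split; rewrite ?monic1 ?size_poly1.
- exact: monic_degM.
elim: (m j) => [|a IH]; first by split; rewrite ?monic1 ?size_poly1.
by rewrite exprS mulSn; apply: monic_degM.
Qed.

Let w_inj : {in msupp f &, injective w}.
Proof.
have lt m j : m \in msupp f -> (m j < N)%N.
  move=> mf; apply: leq_ltn_trans (msize_mdeg_lt mf).
  by rewrite mdegE (bigD1 j) //= leq_addr.
move=> m m' mf m'f e; apply/mnmP => j.
by apply: (@digits_inj N r.+1 m m') e j => i; apply: lt.
Qed.

(** After the substitution a single monomial of [f] reaches the largest degree in [x_0], so a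
    constant multiple of [f] is monic in [x_0] over [k[x']]. *)
Lemma nagata_integral : exists x'' : 'I_r -> A,
  forall i, integralOver (mmap iota x'') (x i).
Proof.
exists x'.
suff x0 : integralOver (mmap iota x') (x ord0).
  move=> i; have [j ->|->//] := unliftP ord0 i.
  rewrite -(subrK (x ord0 ^+ (N ^ lift ord0 j)) (x _)); apply: integral_add.
    have -> : x (lift ord0 j) - x ord0 ^+ (N ^ lift ord0 j) = x' j by [].
    by rewrite -(mmap1U x' j) -(mmapX _ iota); exact: integral_id.
  elim: (N ^ _)%N => [|a IH]; first by rewrite expr0; exact: integral1.
  by rewrite exprS; exact: integral_mul.
pose g := mmap h v f.
have [m0 m0f m0max] : exists2 m0, m0 \in msupp f &
    forall m, m \in msupp f -> (w m <= w m0)%N.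
  have := f0; rewrite -msupp_eq0; case: (msupp f) => // m s _.
  elim: s m => [|m' s IH] m; first by exists m; rewrite ?mem_head // => ?; rewrite inE => /eqP ->.
  have [m0 m0s m0m] := IH m'.
  have [le|lt] := leqP (w m) (w m0).
    exists m0; first by rewrite inE m0s orbT.
    by move=> l; rewrite inE => /orP[/eqP ->//|]; exact: m0m.
  exists m; rewrite ?mem_head // => l; rewrite inE => /orP[/eqP ->//|/m0m].
  by move=> /leq_trans; apply; exact: ltnW.
pose c := f@_m0.
have c0 : c != 0 by rewrite /c -mcoeff_msupp.
pose q := \sum_(m <- msupp f | m != m0) h f@_m * mmap1 v m.
have gE : g = h c * mmap1 v m0 + q by rewrite /g /mmap (bigD1_seq m0) //= msupp_uniq.
have [vm sv] := monic_deg_v m0.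
have sq : (size q <= w m0)%N.
  rewrite /q big_seq_cond; apply: (big_ind (fun p : {poly {mpoly k[r]}} => size p <= w m0)%N) => //.
  - by rewrite size_poly0.
  - by move=> p p' sp sp'; rewrite (leq_trans (size_polyD _ _)) // geq_max sp.
  move=> m /andP[mf mm0]; rewrite /h /= mul_polyC (leq_trans (size_scale_leq _ _)) //.
  rewrite (monic_deg_v m).2 ltn_neqAle m0max // andbT.
  by apply: contra mm0 => /eqP/w_inj -> //.
have monic_g : (c^-1)%:MP *: g \is monic.
  rewrite gE scalerDr /h /= mul_polyC scalerA -mpolyCM mulVf // mpolyC1 scale1r.
  rewrite monicE lead_coefDl; first by rewrite -monicE.
  by rewrite sv ltnS (leq_trans (size_scale_leq _ _)).
exists ((c^-1)%:MP *: g) => //.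
have cx : commr_rmorph (mmap iota x') (x ord0) by move=> ?; rewrite /GRing.comm mulrC.
have -> : root (map_poly (mmap iota x') ((c^-1)%:MP *: g)) (x ord0) =
  (horner_morph cx ((c^-1)%:MP *: g) == 0) by [].
rewrite -mul_polyC rmorphM /=.
suff -> : horner_morph cx g = mmap iota x f by rewrite fx mulr0.
pose H : {rmorphism _ -> A} := horner_morph cx; change (H g = mmap iota x f).
have HC c' : H (h c') = iota c' by rewrite /H /= horner_morphC; exact: mmapC.
have HX i : H ('X_i)%:P = x' i.
  by rewrite /H /= horner_morphC; apply: etrans (mmapX _ _ _) (mmap1U _ _).
rewrite /g /mmap rmorph_sum; apply: eq_bigr => m _; rewrite rmorphM HC.
congr (_ * _).
change (H (mmap1 v m) = mmap1 x m); rewrite /mmap1 rmorph_prod.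
apply: eq_bigr => j _; rewrite rmorphXn /H /=; congr (_ ^+ _).
rewrite /v; case: unliftP => [j' ->|->]; last by rewrite horner_morphX.
change (H (('X_j')%:P + 'X^(N ^ lift ord0 j')) = x (lift ord0 j')).
by rewrite rmorphD HX rmorphXn /H /= horner_morphX subrK.
Qed.

End NagataStep.

(** The least number [r] of elements over which all [a_i] are integral is taken; an algebraic
    relation among these elements would let the Nagata step lower [r]. *)
Theorem noether_normalization s (a : 'I_s -> A) : exists r (x : 'I_r -> A),
  alg_indep x /\ forall i, integralOver (mmap iota x) (a i).
Proof.
pose P r := `[< exists x : 'I_r -> A, forall i, integralOver (mmap iota x) (a i) >].
have exP : exists r, P r.
  exists s; apply/asboolP; exists a => i.
  by rewrite -(mmap1U a i) -(mmapX _ iota); exact: integral_id.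
case: (ex_minnP exP) => r /asboolP[x ax] minr; exists r, x; split=> // p px.
apply/eqP/negPn/negP => p0.
case: r x ax minr p px p0 => [|r] x ax minr p px p0.
  have e : p = (p@_0)%:MP.
    by apply/mpolyP => m; rewrite mcoeffC; have -> : m = 0%MM by [apply/mnmP => -[]]; rewrite eqxx mulr1.
  by move: px p0; rewrite e mmapC => /eqP; rewrite fmorph_eq0 mpolyC_eq0 => ->.
have [x' x'P] := nagata_integral p0 px.
have : (r.+1 <= r)%N; last by rewrite ltnn.
apply: minr; apply/asboolP; exists x' => i; exact: integral_trans_mmap (ax i).
Qed.

(** The family [b] consists of the monomials in [g] with all exponents below [N], where every [g_i]
    satisfies a monic equation of the same degree [N]. *)
Lemma finite_over_polynomials r (x : 'I_r -> A) n (g : 'I_n -> A) :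
  (forall i, integralOver (mmap iota x) (g i)) ->
  (forall S : set A, (forall c, S (iota c)) -> (forall i, S (g i)) ->
    (forall a b, S a -> S b -> S (a + b)) ->
    (forall a b, S a -> S b -> S (a * b)) -> forall a, S a) ->
  exists (T : finType) (b : T -> A), forall a, exists c : T -> {mpoly k[r]},
    a = \sum_t mmap iota x (c t) * b t.
Proof.
move=> int_g gen_g.
have [N eqN] : exists N, (0 < N)%N /\ forall i, exists c : 'I_N -> {mpoly k[r]},
    g i ^+ N = \sum_t mmap iota x (c t) * g i ^+ t.
  have /choice[P PP] i : exists p : {poly {mpoly k[r]}}, p \is monic /\
    root (map_poly (mmap iota x) p) (g i) by have [p ? ?] := int_g i; exists p.
  pose N := (\max_i size (P i)).+1; exists N; split=> // i.
  have [mP rP] := PP i.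
  (* Multiplication by a power of the variable brings all the equations to degree [N]. *)
  pose q := 'X^(N.+1 - size (P i)) * P i.
  have le : (size (P i) <= N.+1)%N by rewrite leqW // leqW // (leq_bigmax i).
  have mq : q \is monic by rewrite monicMl // monicXn.
  have sq : size q = N.+1.
    rewrite size_Mmonic ?monic_neq0 ?monicXn // size_polyXn addSn.
    by rewrite /= subnK.
  have : (map_poly (mmap iota x) q).[g i] = 0.
    by rewrite rmorphM hornerM (eqP rP) mulr0.
  rewrite (horner_coef_wide _ (n := N.+1)); last by rewrite (leq_trans (size_poly _ _)) ?sq.
  rewrite big_ord_recr /= coef_map /=.
  have -> : q`_N = 1 by move: mq; rewrite monicE /lead_coef sq => /eqP.
  rewrite rmorph1 mul1r => /eqP; rewrite addr_eq0 => /eqP e.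
  exists (fun t => - q`_t); rewrite -[LHS]opprK -e -sumrN.
  by apply: eq_bigr => t _; rewrite coef_map /= raddfN mulNr.
case: eqN => N0 eqN.
pose T := {ffun 'I_n -> 'I_N}.
pose b (al : T) := \prod_i g i ^+ al i.
exists T, b.
pose S : set A := [set a | exists c : T -> {mpoly k[r]}, a = \sum_t mmap iota x (c t) * b t].
have SD a a' : S a -> S a' -> S (a + a').
  move=> [c ->] [c' ->]; exists (fun t => c t + c' t); rewrite -big_split.
  by apply: eq_bigr => t _; rewrite raddfD mulrDl.
have S0 : S 0 by exists (fun=> 0); rewrite big1 // => t _; rewrite raddf0 mul0r.
have SZ p a : S a -> S (mmap iota x p * a).
  move=> [c ->]; exists (fun t => p * c t); rewrite mulr_sumr.
  by apply: eq_bigr => t _; rewrite rmorphM mulrA.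
have Sb t : S (b t).
  exists (fun s => (s == t)%:R); rewrite (bigD1 t) //= eqxx rmorph1 mul1r.
  by rewrite big1 ?addr0 // => s /negPf ->; rewrite raddf0 mul0r.
have Ssum (I : Type) (s : seq I) (P : pred I) F :
    (forall i, P i -> S (F i)) -> S (\sum_(i <- s | P i) F i).
  by move=> H; apply: (big_ind S).
pose upd (al : T) i t : T := [ffun j => if j == i then t else al j].
have bu al i t : b (upd al i t) = g i ^+ t * \prod_(j | j != i) g j ^+ al j.
  rewrite /b (bigD1 i) //= ffunE eqxx; congr (_ * _).
  by apply: eq_bigr => j /negPf ji; rewrite ffunE ji.
have ub al i : upd al i (al i) = al.
  by apply/ffunP => j; rewrite ffunE; case: eqP => // ->.
have Sg i a : S a -> S (g i * a).
  move=> [c ->]; rewrite mulr_sumr; apply: (Ssum) => t _; rewrite mulrCA; apply: (SZ).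
  rewrite -(ub t i) bu mulrA -exprS.
  have [lt|] := ltnP (t i).+1 N.
    by have := Sb (upd t i (Ordinal lt)); rewrite bu.
  move=> le; have -> : (t i).+1 = N by apply/eqP; rewrite eqn_leq ltn_ord.
  have [c' ->] := eqN i; rewrite mulr_suml; apply: Ssum => s _.
  by rewrite -mulrA -bu; exact: SZ.
have S1 : S 1.
  have -> : 1 = b [ffun=> Ordinal N0].
    by rewrite /b big1 // => i _; rewrite ffunE expr0.
  exact: Sb.
(* Closure of the span under products is not visible directly; the multipliers that map the span
   into itself are closed under sums and products, and they contain the generators. *)
move=> a; rewrite -[a]mulr1; move: (1) S1.
apply: (gen_g [set a | forall v, S v -> S (a * v)]) => /= [c|i|a1 a2|a1 a2] v.
- by rewrite -(mmapC x); exact: SZ.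
- exact: Sg.
- by move=> Sa' w Sw; rewrite mulrDl; apply: SD; auto.
- by move=> Sa' w Sw; rewrite -mulrA; auto.
Qed.

Section GenericFreeness.
Variables (r : nat) (x : 'I_r -> A) (T : finType) (b : T -> A).
Local Notation ev := (mmap iota x).
Hypothesis x_indep : alg_indep x.

Definition free_family (G : {set T}) := forall f : T -> {mpoly k[r]},
  \sum_(t in G) ev (f t) * b t = 0 -> forall t, t \in G -> f t = 0.

(** A free subfamily of largest cardinality makes each [b_t] dependent on it with a nonzero
    coefficient; [c] is the product of these coefficients. *)
Lemma generic_freeness : exists (G : {set T}) (c : {mpoly k[r]}),
  [/\ c != 0, free_family G & forall t, exists f : T -> {mpoly k[r]},
    ev c * b t = \sum_(s in G) ev (f s) * b s].
Proof.
have free0 : `[< free_family finset.set0 >] by apply/asboolP => f _ t; rewrite inE.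
case: (@arg_maxnP _ finset.set0 (fun G : {set T} => `[< free_family G >])
  (fun G : {set T} => #|G|) free0) => G /asboolP freeG maxG.
have dep t : exists cf : {mpoly k[r]} * (T -> {mpoly k[r]}), cf.1 != 0 /\
    ev cf.1 * b t = \sum_(s in G) ev (cf.2 s) * b s.
  have [tG|tG] := boolP (t \in G).
    exists (1, fun s => (s == t)%:R); split; first exact: oner_neq0.
    rewrite /= rmorph1 mul1r (bigD1 t) //= eqxx rmorph1 mul1r big1 ?addr0 //.
    by move=> s /andP[_ /negPf ->]; rewrite raddf0 mul0r.
  have : ~ free_family (t |: G).
    move=> /asboolP/maxG; rewrite /= cardsU1 tG add1n ltnn //.
  move=> /existsNP[f /not_implyP[ef /existsNP[s /not_implyP[sG fs]]]].
  move: ef; rewrite big_setU1 //= => ef.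
  exists (f t, fun s => - f s) => /=; split.
    apply/eqP => ft0; move: ef; rewrite ft0 raddf0 mul0r add0r => /freeG fG.
    by move: sG; rewrite !inE => /orP[/eqP es|/fG//]; apply: fs; rewrite es.
  move/eqP: ef; rewrite addr_eq0 => /eqP ->; rewrite -sumrN.
  by apply: eq_bigr => ? _; rewrite raddfN mulNr.
have /choice[cf cfP] := dep.
exists G, (\prod_t (cf t).1); split=> //.
  by apply/prodf_neq0 => t _; exact: (cfP t).1.
move=> t; exists (fun s => (\prod_(u | u != t) (cf u).1) * (cf t).2 s).
rewrite (bigD1 t) //= rmorphM mulrAC (cfP t).2 mulr_suml.
by apply: eq_bigr => s _; rewrite rmorphM mulrC mulrA.
Qed.

End GenericFreeness.

End NoetherNormalization.

Section CoefficientsIn.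
Variables (k : fieldType) (L : set k) (r : nat).

Definition is_subring (K : pzRingType) (S : set K) :=
  [/\ S 1, forall a b, S a -> S b -> S (a - b) & forall a b, S a -> S b -> S (a * b)].

Definition coefs_in (p : {mpoly k[r]}) := forall m, L p@_m.

Hypothesis L_sub : is_subring L.

Lemma subringB a b : L a -> L b -> L (a - b). Proof. by case: L_sub => _ + _; apply. Qed.
Lemma subringM a b : L a -> L b -> L (a * b). Proof. by case: L_sub => _ _; apply. Qed.
Lemma subring1 : L 1. Proof. by case: L_sub. Qed.
Lemma subring0 : L 0. Proof. by rewrite -(subrr 1); apply: subringB; exact: subring1. Qed.
Lemma subringN a : L a -> L (- a).
Proof. by rewrite -sub0r; apply: subringB; exact: subring0. Qed.
Lemma subringD a b : L a -> L b -> L (a + b).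
Proof. by move=> La Lb; rewrite -[b]opprK; apply: subringB => //; exact: subringN. Qed.

Lemma coefs_inB p q : coefs_in p -> coefs_in q -> coefs_in (p - q).
Proof. by move=> Lp Lq m; rewrite mcoeffB; exact: subringB. Qed.
Lemma coefs_inD p q : coefs_in p -> coefs_in q -> coefs_in (p + q).
Proof. by move=> Lp Lq m; rewrite mcoeffD; exact: subringD. Qed.
Lemma coefs_inM p q : coefs_in p -> coefs_in q -> coefs_in (p * q).
Proof.
move=> Lp Lq m; rewrite mcoeffM; apply: (big_ind L) => [||i _].
- exact: subring0.
- exact: subringD.
- exact: subringM.
Qed.
Lemma coefs_in1 : coefs_in 1.
Proof. by move=> m; rewrite mcoeff1; case: eqP => _; [exact: subring1|exact: subring0]. Qed.
Lemma coefs_in0 : coefs_in 0.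
Proof. by move=> m; rewrite mcoeff0; exact: subring0. Qed.
Lemma coefs_in_sum (I : Type) (s : seq I) (P : pred I) F :
  (forall i, P i -> coefs_in (F i)) -> coefs_in (\sum_(i <- s | P i) F i).
Proof. by move=> H; apply: (big_ind coefs_in) => // [|p q]; [exact: coefs_in0|exact: coefs_inD]. Qed.
Lemma coefs_inX n : coefs_in 'X_[n].
Proof. by move=> m; rewrite mcoeffX; case: eqP => _; [exact: subring1|exact: subring0]. Qed.
Lemma coefs_inZ a p : L a -> coefs_in p -> coefs_in (a *: p).
Proof. by move=> La Lp m; rewrite mcoeffZ; exact: subringM. Qed.

(* [a, 'X_0 ^ e, .., 'X_j ^ e] is a regular sequence on polynomials over [L]:
   sort the monomials of [u] by the first [l < j] with exponent at least [e]. *)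
Lemma polynomial_regular (a : k) (j : 'I_r) e (u u' : {mpoly k[r]})
    (v : 'I_r -> {mpoly k[r]}) : coefs_in u -> coefs_in u' ->
  'X_j ^+ e * u = \sum_(l < r | (l < j)%N) 'X_l ^+ e * v l + a *: u' ->
  exists (w : 'I_r -> {mpoly k[r]}) w', [/\ forall l, coefs_in (w l), coefs_in w' &
    u = \sum_(l < r | (l < j)%N) 'X_l ^+ e * w l + a *: w'].
Proof.
move=> Lu Lu' E.
have Xe (l : 'I_r) : 'X_l ^+ e = 'X_[U_(l) *+ e] :> {mpoly k[r]} by rewrite mpolyXn.
pose first (m : 'X_{1..r}) := [pick l : 'I_r | (l < j)%N && (e <= m l)%N].
pose w l := \sum_(m <- msupp u | first m == Some l) u@_m *: 'X_[(m - U_(l) *+ e)].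
pose w' := \sum_(m <- msupp u | first m == None) u'@_(m + U_(j) *+ e) *: 'X_[m].
exists w, w'; split.
- by move=> l; apply: coefs_in_sum => m _; apply: coefs_inZ => //; exact: coefs_inX.
- by apply: coefs_in_sum => m _; apply: coefs_inZ => //; exact: coefs_inX.
have none m : first m = None -> u@_m = a * u'@_(m + U_(j) *+ e).
  rewrite /first; case: pickP => // nf _.
  have := congr1 (mcoeff (m + U_(j) *+ e)) E.
  rewrite Xe mulrC [(m + _)%MM]addmC mcoeffMX mcoeffD mcoeffZ raddf_sum /= => ->.
  rewrite big1 ?add0r // => l lj; rewrite Xe mcoeffM big1 // => -[m1 m2] /=.
  move=> /eqP em; rewrite mcoeffX; case: eqP => [e1|_]; last by rewrite mul0r.
  have /mnmP/(_ l) := em; rewrite -e1 !mnmDE !mulmnE !mnm1E eqxx.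
  have /negbT := nf l; rewrite lj /= -ltnNge => ml.
  rewrite -val_eqE /= (gtn_eqF lj) mul0n add0n mul1n => eml.
  by move: ml; rewrite eml ltnNge leq_addr.
rewrite {1}(mpolyE u) (bigID (fun m => first m == None)) addrC /=; congr (_ + _).
  by rewrite /w' scaler_sumr; apply: eq_bigr => m /eqP/none ->; rewrite scalerA.
have -> : \sum_(l < r | (l < j)%N) 'X_l ^+ e * w l =
      \sum_(l < r | (l < j)%N) \sum_(m <- msupp u | first m == Some l) u@_m *: 'X_[m].
    apply: eq_bigr => l lj; rewrite /w mulr_sumr; apply: eq_bigr => m /eqP fm.
    rewrite -scalerAr Xe -mpolyXD addmC; congr (_ *: 'X_[_]).
    move: fm; rewrite /first; case: pickP => // l' /andP[_ le] [<-].
    apply/mnmP => i; rewrite mnmDE mnmBE mulmnE mnm1E.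
    by case: eqP => [<-|_]; rewrite ?mul1n ?subnK // mul0n subn0 addn0.
  rewrite (exchange_big_dep (fun m => first m != None)) /=; last first.
    by move=> l m _ /eqP ->.
  apply: eq_bigr => m; rewrite /first; case: pickP => // l /andP[lj _] _.
  rewrite (big_pred1 l) // => i; apply/andP/eqP => [[_ /eqP[]]//|->].
by rewrite lj eqxx.
Qed.

End CoefficientsIn.

(** * Finitely generated subrings of fields; transcendence degree *)

Lemma char0_ratr (k : fieldType) : [pchar k] =i pred0 ->
  exists f : {rmorphism rat -> k}, forall z : int, f z%:~R = z%:~R.
Proof.
move=> /pcharf0P ch0.
have intr0 (z : int) : (z%:~R == 0 :> k) = (z == 0).
  case: z => n; first by rewrite -pmulrn ch0.
  by rewrite NegzE mulrNz oppr_eq0 -pmulrn ch0.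
have injZtoQ : @injective rat int intr by apply: intr_inj.
have nz_den x : (denq x)%:~R != 0 :> k by rewrite intr0 denq_eq0.
have fz : zmod_morphism (@ratr k).
  move=> x y.
  apply: (canLR (mulfK (nz_den _))); apply: (mulIf (nz_den x)).
  rewrite mulrAC mulrBl divfK ?nz_den // mulrAC -!rmorphM.
  apply: (mulIf (nz_den y)); rewrite mulrAC mulrBl divfK ?nz_den //.
  rewrite -!(rmorphM, rmorphB); congr _%:~R; apply: injZtoQ.
  rewrite !(rmorphM, rmorphB) /= [_ - _]lock /= -lock !numqE.
  by rewrite (mulrAC y) -!mulrBl -mulrA mulrAC !mulrA.
have fm : monoid_morphism (@ratr k).
  split=> [|x y]; first by rewrite /ratr divr1.
  rewrite /ratr mulrC mulrAC; apply: canLR (mulKf (nz_den _)) _; rewrite !mulrA.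
  do 2!apply: canRL (mulfK (nz_den _)) _; rewrite -!rmorphM; congr _%:~R.
  apply: injZtoQ; rewrite !rmorphM [x * y]lock /= !numqE -lock.
  by rewrite -!mulrA mulrA mulrCA -!mulrA (mulrCA y).
pose f1 := GRing.isZmodMorphism.Build rat k (@ratr k) fz.
pose f2 := GRing.isMonoidMorphism.Build rat k (@ratr k) fm.
pose f : {rmorphism rat -> k} := HB.pack (@ratr k) f1 f2.
by exists f => z; exact: ratr_int.
Qed.

Lemma common_denominator (s : seq rat) : exists N : nat, (0 < N)%N /\
  forall c, c \in s -> exists z : int, N%:R * c = z%:~R.
Proof.
elim: s => [|c s [N [N0 Ns]]]; first by exists 1%N.
exists (N * `|denq c|)%N; split; first by rewrite muln_gt0 N0 absz_gt0 denq_neq0.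
move=> c'; rewrite inE => /orP[/eqP ->|/Ns[z ez]].
  exists (N%:Z * numq c); rewrite natrM rmorphM -mulrA; congr (_ * _).
  by rewrite [RHS]numqE mulrC natr_absz gtr0_norm ?denq_gt0.
by exists (`|denq c|%N%:Z * z); rewrite mulnC natrM -mulrA ez rmorphM.
Qed.

Lemma subring_range (K L : pzRingType) (f : {rmorphism K -> L}) : is_subring (range f).
Proof.
split; first by exists 1; rewrite ?rmorph1.
  by move=> _ _ [a _ <-] [b _ <-]; exists (a - b); rewrite ?rmorphB.
by move=> _ _ [a _ <-] [b _ <-]; exists (a * b); rewrite ?rmorphM.
Qed.

Section SubringSets.
Variables (L : pzRingType) (S : set L).
Hypothesis S_sub : is_subring S.

Lemma sring1 : S 1. Proof. by case: S_sub. Qed.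
Lemma sringB a b : S a -> S b -> S (a - b). Proof. by case: S_sub => _ + _; apply. Qed.
Lemma sringM a b : S a -> S b -> S (a * b). Proof. by case: S_sub => _ _; apply. Qed.
Lemma sring0 : S 0. Proof. by rewrite -(subrr 1); apply: sringB; exact: sring1. Qed.
Lemma sringN a : S a -> S (- a).
Proof. by rewrite -sub0r; apply: sringB; exact: sring0. Qed.
Lemma sringD a b : S a -> S b -> S (a + b).
Proof. by move=> La Lb; rewrite -[b]opprK; apply: sringB => //; exact: sringN. Qed.
Lemma sringX a n : S a -> S (a ^+ n).
Proof. by move=> Sa; elim: n => [|n IH]; rewrite ?exprS; [exact: sring1|exact: sringM]. Qed.
Lemma sring_sum (I : Type) (s : seq I) (P : pred I) F :
  (forall i, P i -> S (F i)) -> S (\sum_(i <- s | P i) F i).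
Proof. by move=> H; apply: (big_ind S) => // [|p q]; [exact: sring0|exact: sringD]. Qed.
Lemma sring_prod (I : Type) (s : seq I) (P : pred I) F :
  (forall i, P i -> S (F i)) -> S (\prod_(i <- s | P i) F i).
Proof. by move=> H; apply: (big_ind S) => // [|p q]; [exact: sring1|exact: sringM]. Qed.
Lemma sring_nat n : S n%:R.
Proof. by elim: n => [|n IH]; rewrite ?mulrS; [exact: sring0|apply: sringD => //; exact: sring1]. Qed.
Lemma sring_int (z : int) : S z%:~R.
Proof.
by case: z => n; rewrite ?NegzE ?mulrNz -pmulrn; [|apply: sringN]; exact: sring_nat.
Qed.
End SubringSets.

Lemma sring_mmap (K L : nzRingType) (S : set L) (S_sub : is_subring S) n
    (f : {rmorphism K -> L}) (x : 'I_n -> L) q :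
  (forall m, S (f q@_m)) -> (forall i, S (x i)) -> S (mmap f x q).
Proof.
move=> Sf Sx; apply: sring_sum => // m _; apply: sringM => //.
by apply: sring_prod => // i _; exact: sringX.
Qed.

Section NonInvertiblePrime.
Variables (k : fieldType) (n : nat) (a : 'I_n -> k).

(** In characteristic [p] the prime [p] is zero. In characteristic zero, Noether normalization over
    the rationals and a common denominator [N] make the [a_i] integral over [Z[1/N][x]]. An inverse
    of a prime [p > N] would be integral over that ring, hence lie in it, and comparing constant
    terms would make [p] divide a power of [N]. *)
Lemma exists_noninvertible_prime : exists p, prime p /\
  forall q : {mpoly int[n]}, mmap intr a q * p%:R <> 1.
Proof.
have [[p]|/forallNP ch0] := pselect (exists p, p \in [pchar k]).
  move=> /andP[pp /eqP p0]; exists p; split=> // q; rewrite p0 mulr0.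
  by apply/eqP; rewrite eq_sym oner_eq0.
have [iota iotaz] : exists f : {rmorphism rat -> k}, forall z : int, f z%:~R = z%:~R.
  by apply: char0_ratr => p; apply/negbTE/negP/ch0.
have [r [x [x_indep a_int]]] := noether_normalization iota a.
have /choice[P PP] i : exists p : {poly {mpoly rat[r]}}, p \is monic /\
    root (map_poly (mmap iota x) p) (a i) by have [p ? ?] := a_int i; exists p.
have [N [N0 NP]] : exists N : nat, (0 < N)%N /\
    forall i j m, exists z : int, N%:R * ((P i)`_j)@_m = z%:~R :> rat.
  have [N [N0 NP]] := common_denominator (flatten [seq flatten
    [seq [seq q@_m | m <- msupp q] | q <- P i : seq _] | i <- enum 'I_n]).
  exists N; split=> // i j m.
  have [m_in|/memN_msupp_eq0 ->] := boolP (m \in msupp (P i)`_j); last first.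
    by exists 0; rewrite mulr0.
  apply: NP; apply/flatten_mapP; exists i; first by rewrite mem_enum.
  have [lt|le] := ltnP j (size (P i)); last first.
    by move: m_in; rewrite nth_default // msupp0.
  apply/flatten_mapP; exists (P i)`_j; first exact: mem_nth.
  by apply/mapP; exists m.
have Nk : N%:R != 0 :> k.
  by rewrite -(rmorph_nat iota) fmorph_eq0 pnatr_eq0 -lt0n.
(* The ring [Z[1/N][x]] is presented as the image of an integral polynomial ring whose last variable
   goes to [1/N]. *)
pose X (j : 'I_r.+1) := if unlift ord_max j is Some j' then x j' else N%:R^-1.
pose psi : {rmorphism {mpoly int[r.+1]} -> k} := mmap intr X.
have psi_sub := subring_range psi.
have psiX j : range psi (X j).
  by exists 'X_j => //; rewrite /psi /= mmapX mmap1U.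
have psix i : range psi (x i).
  by have := psiX (lift ord_max i); rewrite /X liftK.
have psiV : range psi N%:R^-1 by have := psiX ord_max; rewrite /X unlift_none.
have psiP i j : range psi (mmap iota x (P i)`_j).
  apply: sring_mmap => // m; have [z ez] := NP i j m.
  have -> : iota ((P i)`_j)@_m = N%:R^-1 * z%:~R.
    by rewrite -iotaz -ez rmorphM rmorph_nat mulKf.
  by apply: sringM => //; exact: sring_int.
have a_int' i : integralOver psi (a i).
  have [mP rP] := PP i; pose d := (size (P i)).-1.
  have sP : size (P i) = d.+1 by rewrite prednK // lt0n size_poly_eq0 monic_neq0.
  have /choice[Q QP] j : exists Q, psi Q = mmap iota x (P i)`_j.
    by have [Q _ <-] := psiP i j; exists Q.
  exists ('X^d + \poly_(j < d) Q j).
    rewrite monicE lead_coefDl ?lead_coefXn // size_polyXn ltnS.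
    exact: size_poly.
  have -> : map_poly psi ('X^d + \poly_(j < d) Q j) = map_poly (mmap iota x) (P i) => //.
  apply/polyP => j; rewrite coef_map coefD coefXn coef_poly coef_map /=.
  have [lt|lt|->] := ltngtP j d.
  - by rewrite add0r QP.
  - by rewrite addr0 raddf0 nth_default ?sP // raddf0.
  - rewrite addr0 rmorph1; move: mP; rewrite monicE /lead_coef sP /= => /eqP ->.
    by rewrite rmorph1.
have [p pN pp] := prime_above N; exists p; split=> // q qp1.
set v := mmap intr a q in qp1.
have v_int : integralOver psi v.
  apply: integral_mmap => // z.
  by change (integralOver psi z%:~R); rewrite -(rmorph_int psi); exact: integral_id.
have vr : range psi v.
  have [g mg rg] := v_int; pose d := (size g).-1.
  have sg : size g = d.+1 by rewrite prednK // lt0n size_poly_eq0 monic_neq0.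
  move: rg; rewrite /root (horner_coef_wide _ (n := d.+1)); last first.
    by rewrite (leq_trans (size_poly _ _)) ?sg.
  rewrite big_ord_recr /= coef_map /=.
  have -> : g`_d = 1 by move: mg; rewrite monicE /lead_coef sg => /eqP.
  rewrite rmorph1 mul1r addr_eq0 => /eqP e.
  case: d sg e => [|d] sg e.
    by move: e; rewrite big_ord0 expr0 => /eqP; rewrite eq_sym oppr_eq0 oner_eq0.
  (* As [v p = 1], the monic equation of degree [d + 1] multiplied by [p^d] expresses [v] through
     its coefficients and powers of [p]. *)
  have -> : v = v ^+ d.+1 * p%:R ^+ d.
    by rewrite exprS -mulrA -exprMn qp1 expr1n mulr1.
  change (range psi (v ^+ d.+1 * p%:R ^+ d)).
  rewrite -[v ^+ d.+1]opprK -e mulNr mulr_suml; apply: (sringN psi_sub).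
  apply: (sring_sum psi_sub) => j _; rewrite coef_map -mulrA.
  apply: (sringM psi_sub); first by exists g`_j.
  have -> : p%:R ^+ d = p%:R ^+ j * p%:R ^+ (d - j) :> k.
    by rewrite -exprD subnKC // -ltnS.
  rewrite mulrA -exprMn qp1 expr1n mul1r.
  by apply: sringX => //; exact: sring_nat.
case: vr => Q _ evQ.
pose Z := range (intr : int -> rat).
have Z_sub : is_subring Z by exact: (subring_range (intr : {rmorphism int -> rat})).
pose D : set k := [set u | exists e (Q' : {mpoly rat[r]}),
  coefs_in Z Q' /\ N%:R ^+ e * u = mmap iota x Q'].
have ZN e : coefs_in Z (N%:R ^+ e : {mpoly rat[r]}).
  elim: e => [|e IH]; first exact: coefs_in1.
  rewrite exprS; apply: coefs_inM => // m; rewrite mcoeffMn mcoeff1.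
  by exists (N%:R * (m == 0%MM)%:R) => //; rewrite rmorphM !rmorph_nat mulr_natl.
have evN e : mmap iota x (N%:R ^+ e) = N%:R ^+ e by rewrite rmorphXn rmorph_nat.
have D_sub : is_subring D.
  split.
  - by exists 0%N, 1; split; [exact: coefs_in1|rewrite rmorph1 mulr1].
  - move=> u u' [e [q1 [Zq1 eu]]] [e' [q2 [Zq2 eu']]].
    exists (e + e')%N, (N%:R ^+ e' * q1 - N%:R ^+ e * q2); split.
      by apply: coefs_inB => //; apply: coefs_inM.
    by rewrite rmorphB !rmorphM /= !evN -eu -eu' exprD; ring.
  - move=> u u' [e [q1 [Zq1 eu]]] [e' [q2 [Zq2 eu']]].
    exists (e + e')%N, (q1 * q2); split; first exact: coefs_inM.
    by rewrite rmorphM /= -eu -eu' exprD; ring.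
have : D v.
  rewrite -evQ; apply: sring_mmap => // [m|j]; first exact: sring_int.
  rewrite /X; case: unliftP => [j' _|_].
    exists 0%N, 'X_j'; split; first exact: coefs_inX.
    by rewrite mul1r mmapX mmap1U.
  by exists 1%N, 1; split; [exact: coefs_in1|rewrite rmorph1 mulfV].
move=> [e [Q' [ZQ' eQ']]].
have /x_indep/(congr1 (mcoeff 0%MM)) : mmap iota x (N%:R ^+ e - p%:R *: Q') = 0.
  have iotap : iota p%:R = p%:R by exact: rmorph_nat.
  rewrite rmorphB /= evN mmapZ iotap -eQ'.
  by rewrite mulrCA [p%:R * v]mulrC qp1 mulr1 subrr.
have [z _ ez] := ZQ' 0%MM.
rewrite mcoeffB mcoeffZ mcoeff0 -ez -natrX mcoeffMn mcoeff1 eqxx => /eqP.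
have -> : true%:R *+ N ^ e - p%:R * z%:~R = ((N ^ e)%N%:Z - p%:Z * z)%:~R :> rat.
  by rewrite rmorphB rmorphM.
rewrite intr_eq0 subr_eq0 => /eqP eNp.
have : (p %| N ^ e)%N.
  have : (p%:Z %| (N ^ e)%N%:Z)%Z by rewrite eNp dvdz_mulr.
  by [].
rewrite Euclid_dvdX // => /andP[/dvdn_leq]; rewrite N0 => /(_ isT).
by rewrite leqNgt pN.
Qed.

End NonInvertiblePrime.

(** * A bound on transcendence degree by counting monomials *)

Section TranscendenceCount.
Variables (k : fieldType) (A : comNzRingType) (iota : {rmorphism k -> A}).

(** The monomial in the fractions [s_i / s0] with exponents [al], multiplied by [s0^(d D)], which
    clears the denominators of the whole box at once. The fractions will come from another affine
    open, with [s0] as common denominator. *)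
Definition box_monomial d D (s0 : A) (s : 'I_d -> A) (al : {ffun 'I_d -> 'I_D}) :=
  s0 ^+ (d * D - \sum_i al i) * \prod_i s i ^+ al i.

Definition box_independent d (s0 : A) (s : 'I_d -> A) := forall D
  (c : {ffun 'I_d -> 'I_D} -> k),
  \sum_al iota (c al) * box_monomial s0 s al = 0 -> forall al, c al = 0.

Lemma linear_dependence (I J : finType) (u : I -> A) (v : J -> A) (M : I -> J -> k) :
  (forall i, u i = \sum_j iota (M i j) * v j) -> (#|J| < #|I|)%N ->
  exists c : I -> k, (exists i, c i != 0) /\ \sum_i iota (c i) * u i = 0.
Proof.
move=> uE ltJI.
pose N := \matrix_(i < #|I|, j < #|J|) M (enum_val i) (enum_val j).
have : kermx N != 0.
  by rewrite kermx_eq0 -row_leq_rank -ltnNge (leq_ltn_trans (rank_leq_col _)).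
move=> /rowV0Pn[w wN w0].
exists (fun i => w 0 (enum_rank i)); split.
  have /rV0Pn[i wi] := w0; exists (enum_val i); by rewrite enum_valK.
have /sub_kermxP wN0 := wN.
transitivity (\sum_j iota ((w *m N) 0 (enum_rank j)) * v j); last first.
  by rewrite big1 // => j _; rewrite wN0 mxE raddf0 mul0r.
under eq_bigr => i _ do rewrite uE mulr_sumr.
rewrite exchange_big /=; apply: eq_bigr => j _.
rewrite mxE rmorph_sum mulr_suml /= (reindex_onto enum_val enum_rank) /=; last first.
  by move=> i _; rewrite enum_rankK.
apply: eq_big => [i|i _]; first by rewrite enum_valK eqxx.
by rewrite enum_valK mxE !enum_rankK rmorphM mulrA.
Qed.

Lemma msizeM_leD r (p q : {mpoly k[r]}) : (msize (p * q) <= msize p + msize q)%N.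
Proof.
have [->|p0] := eqVneq p 0; first by rewrite mul0r msize0.
have [->|q0] := eqVneq q 0; first by rewrite mulr0 msize0.
by rewrite msizeM // leq_pred.
Qed.

Lemma card_bmultinom r e : (#|{: 'X_{1..r < e}}| <= e ^ r)%N.
Proof.
case: e => [|e].
  by rewrite (_ : #|_| = 0%N) //; apply: eq_card0 => -[m i]; have := i; rewrite ltn0.
have lt (m : 'X_{1..r < e.+1}) i : (m i < e.+1)%N.
  apply: leq_ltn_trans (bmdeg m); by rewrite mdegE (bigD1 i) //= leq_addr.
pose f (m : 'X_{1..r < e.+1}) : {ffun 'I_r -> 'I_e.+1} := [ffun i => Ordinal (lt m i)].
have inj : injective f.
  move=> m m' /ffunP E; apply/val_inj/mnmP => i.
  by have := congr1 val (E i); rewrite !ffunE.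
by have := leq_card f inj; rewrite card_ffun !card_ord.
Qed.

(** The [D^d] monomials of a box lie among the combinations of the [b_t] with polynomial
    coefficients of size linear in [D], a space of dimension at most [C D^r]. For [D = C + 1]
    independence excludes [r < d]. *)
Lemma transcendence_bound d (s0 : A) (s : 'I_d -> A) r (x : 'I_r -> A) n (g : 'I_n -> A) :
  box_independent s0 s -> 
  (forall S : set A, (forall c, S (iota c)) -> (forall i, S (g i)) ->
    (forall a b, S a -> S b -> S (a + b)) ->
    (forall a b, S a -> S b -> S (a * b)) -> forall a, S a) ->
  (forall i, integralOver (mmap iota x) (g i)) -> (d <= r)%N.
Proof.
move=> s_indep gen_g int_g.
have [T [b gen_b]] := finite_over_polynomials int_g gen_g.
pose V e : set A := [set a | exists c : T -> {mpoly k[r]},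
  a = \sum_t mmap iota x (c t) * b t /\ forall t, (msize (c t) <= e)%N].
have VS e e' a : (e <= e')%N -> V e a -> V e' a.
  by move=> ee' [c [-> ce]]; exists c; split=> // t; exact: leq_trans ee'.
have Vex (I : finType) (u : I -> A) : exists e, forall i, V e (u i).
  have /choice[f fP] i : exists e, V e (u i).
    have [c ->] := gen_b (u i); exists (\max_t msize (c t)); exists c; split=> // t.
    exact: leq_bigmax.
  by exists (\max_i f i) => i; apply: VS (fP i); exact: leq_bigmax.
have VD e a a' : V e a -> V e a' -> V e (a + a').
  move=> [c [-> ce]] [c' [-> c'e]]; exists (fun t => c t + c' t); split.
    by rewrite -big_split; apply: eq_bigr => t _; rewrite raddfD mulrDl.
  by move=> t; rewrite (leq_trans (msizeD_le _ _)) // geq_max ce c'e.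
have V0 e : V e 0.
  exists (fun=> 0); split=> [|t]; last by rewrite msize0.
  by rewrite big1 // => t _; rewrite raddf0 mul0r.
have VZ e e' p a : (msize p <= e')%N -> V e a -> V (e + e')%N (mmap iota x p * a).
  move=> pe' [c [-> ce]]; exists (fun t => p * c t); split.
    by rewrite mulr_sumr; apply: eq_bigr => t _; rewrite rmorphM mulrA.
  by move=> t; rewrite (leq_trans (msizeM_leD _ _)) // addnC leq_add.
have Vsum e (I : finType) F : (forall i : I, V e (F i)) -> V e (\sum_i F i).
  by move=> H; apply: (big_ind (V e)) => // ? ?; exact: VD.
have [e1 Ve1] := Vex _ (fun st : T * T => b st.1 * b st.2).
have [e2 Ve2] := Vex _ s; have [e3 Ve3] := Vex _ (fun _ : unit => s0).
have [e4 Ve4] := Vex _ (fun _ : unit => 1).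
pose e0 := (e1 + e2 + e3 + e4)%N.
have VM a e a' : V e0 a -> V e a' -> V (e + e0.*2)%N (a * a').
  move=> [c [-> ce]] [c' [-> c'e]]; rewrite mulr_suml; apply: (Vsum) => t.
  rewrite mulr_sumr; apply: (Vsum) => t'; rewrite mulrACA -rmorphM.
  rewrite -addnn addnCA; apply: (VZ).
    by rewrite (leq_trans (msizeM_leD _ _)) // addnC leq_add.
  by apply: VS (Ve1 (t, t')); rewrite /e0 -!addnA leq_addr.
have VX a e n' a' : V e0 a -> V e a' -> V (e + n' * e0.*2)%N (a ^+ n' * a').
  move=> Va Va'; elim: n' => [|n' IH]; first by rewrite addn0 mul1r.
  by rewrite exprS -mulrA mulSn addnCA addnC; apply: VM.
have Vs0 : V e0 s0 by apply: VS (Ve3 tt); rewrite /e0 -addnA addnC -addnA leq_addr.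
have Vs i : V e0 (s i) by apply: VS (Ve2 i); rewrite /e0 addnAC -!addnA addnC -!addnA leq_addr.
have V1 : V e0 1 by apply: VS (Ve4 tt); rewrite /e0 leq_addl.
have Vprod (I : seq 'I_d) (al : 'I_d -> nat) :
    V (e0 + (\sum_(i <- I) al i) * e0.*2)%N (\prod_(i <- I) s i ^+ al i).
  elim: I => [|i I IH]; first by rewrite !big_nil addn0.
  by rewrite !big_cons mulnDl addnCA addnC; apply: VX.
have Vmon D (al : {ffun 'I_d -> 'I_D}) :
    V (e0 + (d * D) * e0.*2)%N (box_monomial s0 s al).
  have le : (\sum_i al i <= d * D)%N.
    rewrite -[d in (d * D)%N]card_ord -sum_nat_const leq_sum // => i _; exact: ltnW.
  rewrite /box_monomial -{1}(subnKC le) mulnDl addnA; exact: VX.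
pose C := (#|T| * (e0 + d * e0.*2) ^ r)%N.
have bound D : (0 < D)%N -> (D ^ d <= C * D ^ r)%N.
  move=> D0; set e := (e0 + (d * D) * e0.*2)%N.
  have le : (#|{: 'X_{1..r < e} * T}| <= C * D ^ r)%N.
    rewrite card_prod mulnC /C -mulnA leq_mul2l -expnMn; apply/orP; right.
    apply: leq_trans (card_bmultinom _ _) _; case: (r) => // r'.
    rewrite leq_exp2r // mulnDl /e leq_add //; first by rewrite leq_pmulr.
    by rewrite mulnAC.
  rewrite leqNgt; apply/negP => lt.
  have /choice[M MP] (al : {ffun 'I_d -> 'I_D}) : exists M : 'X_{1..r < e} * T -> k,
      box_monomial s0 s al = \sum_j iota (M j) * (mmap1 x j.1 * b j.2).
    have [c [-> ce]] := Vmon D al; exists (fun j : 'X_{1..r < e} * T => (c j.2)@_(j.1)).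
    rewrite -(pair_bigA _ (fun (m : 'X_{1..r < e}) t => iota (c t)@_m * (mmap1 x m * b t))) /=.
    rewrite exchange_big; apply: eq_bigr => t _ /=.
    rewrite (mmapE e (ce t)) mulr_suml; apply: eq_bigr => m _.
    by rewrite mulrA.
  have [|c [[al cal] /s_indep/(_ al)]] := linear_dependence MP.
    apply: leq_ltn_trans le _; by rewrite card_ffun !card_ord.
  by apply/eqP.
rewrite leqNgt; apply/negP => rd.
have := bound C.+1 isT; rewrite leqNgt => /negP; apply.
have : (C * C.+1 ^ r < C.+1 ^ r.+1)%N by rewrite expnS ltn_pmul2r ?expn_gt0.
by move=> /leq_trans; apply; rewrite leq_pexp2l.
Qed.

End TranscendenceCount.

(** * Almost regularity in localizations and reduction modulo a prime *)

Section QuotientOfSubring.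
Variables (R : comPzRingType) (S I : set R).
Hypothesis S_sub : is_subring S.
Hypothesis I0 : I 0.
Hypothesis IB : forall a b, I a -> I b -> I (a - b).
Hypothesis IM : forall a b, S a -> I b -> I (a * b).

(** Subrings are kept as sets in the ambient ring, so that entries of matrices over [R] can be
    tested for membership; this record is only an intermediate step towards the quotient of [S] by
    [I]. *)
Record sub_elt := SubElt { sval_ : R; sprop_ : S sval_ }.
HB.instance Definition _ := gen_eqMixin sub_elt.
HB.instance Definition _ := gen_choiceMixin sub_elt.

Definition subq_equiv (a b : sub_elt) : bool := `[< I (sval_ a - sval_ b) >].

Let IN a : I a -> I (- a). Proof. by rewrite -sub0r; exact: IB. Qed.
Let ID a b : I a -> I b -> I (a + b).
Proof. by move=> Ia Ib; rewrite -[b]opprK; apply: IB => //; exact: IN. Qed.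

Lemma subq_refl : reflexive subq_equiv.
Proof. by move=> a; apply/asboolP; rewrite subrr. Qed.
Lemma subq_sym : ssrbool.symmetric subq_equiv.
Proof.
have H a b : subq_equiv a b -> subq_equiv b a.
  by move=> /asboolP Iab; apply/asboolP; rewrite -opprB; exact: IN.
by move=> a b; apply/idP/idP; exact: H.
Qed.
Lemma subq_trans : transitive subq_equiv.
Proof.
move=> b a c /asboolP Iab /asboolP Ibc; apply/asboolP.
by rewrite -(subrKA (sval_ b)); exact: ID.
Qed.

Canonical subq_rel := EquivRel subq_equiv subq_refl subq_sym subq_trans.
(* Mentioning [S_sub] and [IM] lets the ring structure be inferred from the type. *)
Definition subquot := let _ := S_sub in let _ := IM in {eq_quot subq_rel}.
HB.instance Definition _ := Choice.on subquot.

(** Total on [R], with elements outside [S] sent to the class of 0, so that reduction can be applied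
    entrywise to matrices over [R]. *)
Definition to_subq (u : R) : subquot :=
  if pselect (S u) is left h then \pi_subquot (SubElt h) else
  \pi_subquot (SubElt (sring0 S_sub)).

Lemma to_subqE u v : S u -> S v -> (to_subq u = to_subq v <-> I (u - v)).
Proof.
move=> Su Sv; rewrite /to_subq; case: pselect => // hu; case: pselect => // hv.
by split=> [/eqmodP/asboolP|H]; [|apply/eqmodP/asboolP].
Qed.

Lemma to_subq_surj (q : subquot) : exists2 u, S u & q = to_subq u.
Proof.
exists (sval_ (repr q)); first exact: sprop_.
rewrite /to_subq; case: pselect => [h|[]]; last exact: sprop_.
rewrite -[LHS]reprK; congr (\pi_subquot _).
by case: (repr q) h => u p h; congr SubElt; exact: Prop_irrelevance.
Qed.

Definition subq_rep (q : subquot) := sval_ (repr q).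

Lemma subq_rep_in q : S (subq_rep q). Proof. exact: sprop_. Qed.

Lemma to_subqK u : S u -> I (subq_rep (to_subq u) - u).
Proof.
move=> Su; apply/(to_subqE (subq_rep_in _) Su).
rewrite [LHS]/to_subq; case: pselect => [h|[]]; last exact: subq_rep_in.
rewrite -[RHS]reprK; congr (\pi_subquot _).
rewrite /subq_rep in h *.
by case: (repr _) h => v p h; congr SubElt; exact: Prop_irrelevance.
Qed.

Definition subq_add p q := to_subq (subq_rep p + subq_rep q).
Definition subq_mul p q := to_subq (subq_rep p * subq_rep q).
Definition subq_opp p := to_subq (- subq_rep p).

Lemma subq_addE u v : S u -> S v -> subq_add (to_subq u) (to_subq v) = to_subq (u + v).
Proof.
move=> Su Sv; apply/to_subqE; try by apply: sringD => //; exact: subq_rep_in.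
by rewrite opprD addrACA; apply: ID; exact: to_subqK.
Qed.

Lemma subq_mulE u v : S u -> S v -> subq_mul (to_subq u) (to_subq v) = to_subq (u * v).
Proof.
move=> Su Sv; apply/to_subqE; try by apply: sringM => //; exact: subq_rep_in.
set u' := subq_rep _; set v' := subq_rep _.
have -> : u' * v' - u * v = u' * (v' - v) + v * (u' - u) by ring.
by apply: ID; apply: IM => //; [exact: subq_rep_in|exact: to_subqK|exact: to_subqK].
Qed.

Lemma subq_oppE u : S u -> subq_opp (to_subq u) = to_subq (- u).
Proof.
move=> Su; apply/to_subqE; try by apply: sringN => //; exact: subq_rep_in.
by rewrite -opprD; apply: IN; exact: to_subqK.
Qed.

Lemma subq_addA : associative subq_add.
Proof.
move=> p q r; have [u Su ->] := to_subq_surj p; have [v Sv ->] := to_subq_surj q.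
have [w Sw ->] := to_subq_surj r.
by rewrite !subq_addE ?addrA //; apply: sringD.
Qed.
Lemma subq_addC : commutative subq_add.
Proof. by move=> p q; rewrite /subq_add addrC. Qed.
Lemma subq_add0 : left_id (to_subq 0) subq_add.
Proof.
move=> p; have [u Su ->] := to_subq_surj p.
by rewrite subq_addE ?add0r //; exact: sring0.
Qed.
Lemma subq_addN : left_inverse (to_subq 0) subq_opp subq_add.
Proof.
move=> p; have [u Su ->] := to_subq_surj p.
by rewrite subq_oppE // subq_addE ?addNr //; exact: sringN.
Qed.
HB.instance Definition _ :=
  GRing.isZmodule.Build subquot subq_addA subq_addC subq_add0 subq_addN.

Lemma subq_mulA : associative subq_mul.
Proof.
move=> p q r; have [u Su ->] := to_subq_surj p; have [v Sv ->] := to_subq_surj q.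
have [w Sw ->] := to_subq_surj r.
by rewrite !subq_mulE ?mulrA //; apply: sringM.
Qed.
Lemma subq_mulC : commutative subq_mul.
Proof. by move=> p q; rewrite /subq_mul mulrC. Qed.
Lemma subq_mul1 : left_id (to_subq 1) subq_mul.
Proof.
move=> p; have [u Su ->] := to_subq_surj p.
by rewrite subq_mulE ?mul1r //; exact: sring1.
Qed.
Lemma subq_mulDl : left_distributive subq_mul subq_add.
Proof.
move=> p q r; have [u Su ->] := to_subq_surj p; have [v Sv ->] := to_subq_surj q.
have [w Sw ->] := to_subq_surj r.
by rewrite !(subq_addE, subq_mulE) ?mulrDl //; solve [apply: sringM => //|apply: sringD => //].
Qed.
HB.instance Definition _ := GRing.Zmodule_isComPzRing.Build subquot
  subq_mulA subq_mulC subq_mul1 subq_mulDl.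

Lemma to_subqD u v : S u -> S v -> to_subq (u + v) = to_subq u + to_subq v.
Proof. by move=> Su Sv; rewrite -subq_addE. Qed.
Lemma to_subqM u v : S u -> S v -> to_subq (u * v) = to_subq u * to_subq v.
Proof. by move=> Su Sv; rewrite -subq_mulE. Qed.
Lemma to_subqN u : S u -> to_subq (- u) = - to_subq u.
Proof. by move=> Su; rewrite -subq_oppE. Qed.
Lemma to_subq0 : to_subq 0 = 0. Proof. by []. Qed.
Lemma to_subq_eq0 u : S u -> (to_subq u = 0 <-> I u).
Proof. by move=> Su; rewrite -to_subq0 to_subqE ?subr0 //; exact: sring0. Qed.
Lemma to_subq_sum (J : Type) (s : seq J) (P : pred J) F : (forall i, P i -> S (F i)) ->
  to_subq (\sum_(i <- s | P i) F i) = \sum_(i <- s | P i) to_subq (F i).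
Proof.
move=> SF; elim: s => [|i s IH]; first by rewrite !big_nil.
rewrite !big_cons; case: ifP => // Pi; rewrite to_subqD ?IH //; first exact: SF.
exact: sring_sum.
Qed.
Lemma to_subqX u n : S u -> to_subq (u ^+ n) = to_subq u ^+ n.
Proof.
move=> Su; elim: n => [|n IH]; first by rewrite !expr0.
by rewrite !exprS to_subqM ?IH //; exact: sringX.
Qed.

End QuotientOfSubring.

Section IdealPowers.
Variables (R : comPzRingType) (n : nat) (y : 'I_n -> R).

(** The power [(y)^s] of the ideal generated by [y], in a recursive form that avoids enumerating
    monomials. *)
Fixpoint gpow s : set R := if s is s'.+1 then
  [set u | exists2 a : 'I_n -> R, (forall i, gpow s' (a i)) & u = \sum_i y i * a i]
  else setT.

Lemma gpow_ideal s : is_ideal (gpow s).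
Proof.
elim: s => [|s IH]; first by split.
split.
- by exists (fun=> 0) => [i|]; [exact: ideal0|rewrite big1 // => i _; rewrite mulr0].
- move=> u v [a Ha ->] [b Hb ->]; exists (fun i => a i + b i) => [i|].
    by apply: (idealD IH); [exact: Ha|exact: Hb].
  by rewrite -big_split; apply: eq_bigr => i _; rewrite mulrDr.
- move=> w u [a Ha ->]; exists (fun i => w * a i) => [i|]; first by apply: (ideal_mull _ IH); exact: Ha.
  by rewrite mulr_sumr; apply: eq_bigr => i _; rewrite mulrCA.
Qed.

Lemma gpowM s u v : generated_by y u -> gpow s v -> gpow s.+1 (u * v).
Proof.
move=> [c ->] sv; exists (fun i => c i * v) => [i|].
  by apply: ideal_mull => //; exact: gpow_ideal.
by rewrite mulr_suml; apply: eq_bigr => i _; rewrite mulrA [c i * y i]mulrC.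
Qed.

Lemma gpow_prod (I : Type) (s : seq I) (F : I -> R) (al : I -> nat) :
  (forall i, generated_by y (F i)) ->
  gpow (\sum_(i <- s) al i) (\prod_(i <- s) F i ^+ al i).
Proof.
move=> HF; elim: s => [|i s IH]; first by rewrite !big_nil.
rewrite !big_cons; elim: (al i) => [|j IHj]; first by rewrite expr0 mul1r.
by rewrite exprS addSn -mulrA; apply: gpowM.
Qed.

Lemma gpowS s t u : (s <= t)%N -> gpow t u -> gpow s u.
Proof.
elim: t s u => [|t IH] [|s] u //= st [a Ha ->].
by exists a => // i; apply: IH.
Qed.

Lemma gpowX i q : gpow q (y i ^+ q).
Proof.
elim: q => [|q IH] //; rewrite exprS; apply: gpowM => //; exact: generated_by_gen.
Qed.

End IdealPowers.

(** * Almost regular coordinates in a localization, and spreading out *)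

Section LocalizationOfAlgebra.
Variables (k : fieldType) (A : comNzRingType) (iota : {rmorphism k -> A}).
Variables (R : comPzRingType) (phi : {rmorphism A -> R}) (ev : {rmorphism R -> k}).
Hypothesis evK : forall c, ev (phi (iota c)) = c.
Hypothesis loc : forall u, exists w a, ev (phi w) != 0 /\ phi w * u = phi a.
Hypothesis ev_unit : forall u, ev u != 0 -> exists v, u * v = 1.
Variable f0 : A.
Hypothesis f0_unit : ev (phi f0) != 0.
Hypothesis f0_ker : forall a, phi a = 0 -> f0 * a = 0.
Variables (r : nat) (x : 'I_r -> A).
Hypothesis x_indep : alg_indep iota x.
Hypothesis x_origin : forall i, ev (phi (x i)) = 0.
Variables (T : finType) (b : T -> A).
Local Notation pev := (mmap iota x).
Hypothesis gen_b : forall a, exists c : T -> {mpoly k[r]}, a = \sum_t pev (c t) * b t.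
Variables (G : {set T}) (c : {mpoly k[r]}) (frel : T -> T -> {mpoly k[r]}).
Hypothesis free_G : free_family iota x b G.
Hypothesis frelP : forall t, pev c * b t = \sum_(s in G) pev (frel t s) * b s.
Variables (n : nat) (y : 'I_n -> R).
Hypothesis y_max : forall u, ev u = 0 -> generated_by y u.
Let gam := phi (pev c).

Let iotaR : {rmorphism k -> R} := phi \o iota.

(** An element is its value plus a combination [sum_i y_i d_i], and modulo [(y)^(s+1)] the [d_i]
    matter only modulo [(y)^s]. *)
Lemma finite_codimension s : exists (m : nat) (w : 'I_m -> R), forall u,
  exists a : 'I_m -> k, gpow y s (u - \sum_i iotaR (a i) * w i).
Proof.
elim: s => [|s [m [w wP]]]; first by exists 0%N, (fun=> 0) => u; exists (fun=> 0).
pose J : finType := ('I_1 + 'I_n * 'I_m)%type.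
pose w' (j : J) := if j is inr ij then y ij.1 * w ij.2 else 1.
suff H u : exists a : J -> k, gpow y s.+1 (u - \sum_j iotaR (a j) * w' j).
  exists #|J|, (fun i => w' (enum_val i)) => u; have [a aP] := H u.
  exists (fun i => a (enum_val i)).
  rewrite (reindex_onto enum_rank enum_val) /= => [|i _]; last by rewrite enum_valK.
  under eq_bigl => i do rewrite enum_rankK eqxx.
  by under eq_bigr => i _ do rewrite enum_rankK.
have [d ud] : generated_by y (u - iotaR (ev u)).
  by apply: y_max; rewrite rmorphB /= evK subrr.
have /choice[a aP] i := wP (d i).
exists (fun j => if j is inr ij then a ij.1 ij.2 else ev u).
exists (fun i => d i - \sum_j iotaR (a i j) * w j) => //.
rewrite big_sumType /= big_ord1 mulr1 opprD addrA ud.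
rewrite -(pair_bigA _ (fun i j => iotaR (a i j) * (y i * w j))) /= -sumrB.
apply: eq_bigr => i _; rewrite mulrBr mulrC; congr (_ - _).
by rewrite mulr_sumr; apply: eq_bigr => j _; rewrite mulrCA.
Qed.

Let subspace (N : set R) := N 0 /\ forall a u v, N u -> N v -> N (iotaR a * u + v).

(** The subspace is enlarged by the spanning vectors one at a time; a vector that is already
    congruent to a multiple of [v] is skipped, so that [v] never enters. At the end the subspace and
    [v] span everything. *)
Let hyperplane m (w : 'I_m -> R) N v : subspace N -> ~ N v ->
  (forall u, exists (e : k) (a : 'I_m -> k),
    N (u - iotaR e * v - \sum_i iotaR (a i) * w i)) ->
  exists N', [/\ subspace N', N `<=` N', ~ N' v & forall u, exists e, N' (u - iotaR e * v)].
Proof.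
elim: m w N => [|m IH] w N Nsub Nv NP.
  by exists N; split=> // u; have [e [a]] := NP u; rewrite big_ord0 subr0; exists e.
have [N0 NZ] := Nsub.
have ND u u' : N u -> N u' -> N (u + u').
  by move=> Nu Nu'; have := NZ 1 _ _ Nu Nu'; rewrite rmorph1 mul1r.
have NM a u : N u -> N (iotaR a * u).
  by move=> Nu; have := NZ a _ _ Nu N0; rewrite addr0.
have [[e0 Ne0]|noe] := pselect (exists e, N (w ord0 - iotaR e * v)).
  apply: (IH (fun i => w (lift ord0 i)) N) => // u; have [e [a H]] := NP u.
  exists (e + a ord0 * e0), (fun i => a (lift ord0 i)).
  have := ND _ _ H (NM (a ord0) _ Ne0); rewrite big_ord_recl.
  by congr N; rewrite rmorphD rmorphM; ring.
pose N1 : set R := [set u | exists a, N (u - iotaR a * w ord0)].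
have [||u|N' [N'sub N1N' N'v N'P]] := IH (fun i => w (lift ord0 i)) N1.
- split; first by exists 0; rewrite raddf0 mul0r subr0.
  move=> a u u' [d Hd] [d' Hd']; exists (a * d + d').
  by have := NZ a _ _ Hd Hd'; congr N; rewrite rmorphD rmorphM; ring.
- move=> [a Na]; have [a0|a0] := eqVneq a 0.
    by apply: Nv; move: Na; rewrite a0 raddf0 mul0r subr0.
  apply: noe; exists a^-1; have := NM (- a^-1) _ Na; congr N.
  have e : iotaR a^-1 * iotaR a = 1 by rewrite -rmorphM mulVf ?rmorph1.
  by rewrite raddfN /= -[in RHS](mul1r (w ord0)) -e; ring.
- have [e [a H]] := NP u; exists e, (fun i => a (lift ord0 i)), (a ord0).
  by move: H; rewrite big_ord_recl opprD addrCA addrC.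
exists N'; split=> // u Nu; apply: N1N'; exists 0.
by rewrite raddf0 mul0r subr0.
Qed.

(** Its purpose is to turn a question about ideals of [R] into one about subrings of [k], where a
    noninvertible prime is available. *)
Lemma linear_functional s v : ~ gpow y s v -> exists lam : R -> k,
  [/\ {morph lam : u u' / u + u'}, forall a u, lam (iotaR a * u) = a * lam u,
      forall u, gpow y s u -> lam u = 0 & lam v = 1].
Proof.
move=> sv; have [m [w wP]] := finite_codimension s.
have Is := gpow_ideal y s.
have [||u|N [[N0 NZ] sN Nv NP]] := @hyperplane m w (gpow y s) v.
- split; first exact: ideal0.
  by move=> a u u' Iu Iu'; apply: idealD => //; exact: ideal_mull.
- exact: sv.
- by have [a aP] := wP u; exists 0, a; rewrite raddf0 mul0r subr0.
have /choice[lam lamP] := NP.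
have ND u u' : N u -> N u' -> N (u + u').
  by move=> Nu Nu'; have := NZ 1 _ _ Nu Nu'; rewrite rmorph1 mul1r.
have NM a u : N u -> N (iotaR a * u).
  by move=> Nu; have := NZ a _ _ Nu N0; rewrite addr0.
have uniq e e' u : N (u - iotaR e * v) -> N (u - iotaR e' * v) -> e = e'.
  move=> H H'; apply/eqP; rewrite -subr_eq0; apply/negPn/negP => ee; apply: Nv.
  have := ND _ _ (NM (e - e')^-1 _ H') (NM (- (e - e')^-1) _ H); congr N.
  have e1 : iotaR (e - e')^-1 * iotaR (e - e') = 1 by rewrite -rmorphM mulVf ?rmorph1.
  by rewrite raddfN /= -[RHS]mul1r -e1 rmorphB; ring.
exists lam; split.
- move=> u u'; apply: (uniq _ _ (u + u')) => //.
  by have := ND _ _ (lamP u) (lamP u'); congr N; rewrite rmorphD; ring.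
- move=> a u; apply: (uniq _ _ (iotaR a * u)) => //.
  by have := NM a _ (lamP u); congr N; rewrite rmorphM; ring.
- move=> u /sN Nu; apply: (uniq _ _ u) => //.
  by rewrite raddf0 mul0r subr0.
- by apply: (uniq _ _ v) => //; rewrite rmorph1 mul1r subrr.
Qed.

(** The elements of [A] with coordinates over the coefficient ring [L]. They form a subring once [L]
    contains the coefficients of 1 and of the products [b_t b_u]. *)
Definition span_over (L : set k) : set A := [set a | exists2 g : T -> {mpoly k[r]},
  (forall t, coefs_in L (g t)) & a = \sum_t pev (g t) * b t].

Section SpanOver.
Variable L : set k.
Hypothesis L_sub : is_subring L.

Lemma span_overD a a' : span_over L a -> span_over L a' -> span_over L (a + a').
Proof.
move=> [g Lg ->] [g' Lg' ->]; exists (fun t => g t + g' t) => [t|].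
  exact: coefs_inD.
by rewrite -big_split; apply: eq_bigr => t _; rewrite raddfD mulrDl.
Qed.

Lemma span_overZ p a : coefs_in L p -> span_over L a -> span_over L (pev p * a).
Proof.
move=> Lp [g Lg ->]; exists (fun t => p * g t) => [t|]; first exact: coefs_inM.
by rewrite mulr_sumr; apply: eq_bigr => t _; rewrite rmorphM mulrA.
Qed.

Lemma span_over0 : span_over L 0.
Proof.
exists (fun=> 0) => [t|]; first exact: coefs_in0.
by rewrite big1 // => t _; rewrite raddf0 mul0r.
Qed.

Lemma span_over_sum (I : Type) (s : seq I) (P : pred I) F :
  (forall i, P i -> span_over L (F i)) -> span_over L (\sum_(i <- s | P i) F i).
Proof.
by move=> H; apply: (big_ind (span_over L)) => //; [exact: span_over0|exact: span_overD].
Qed.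

Lemma span_over_b t : span_over L (b t).
Proof.
exists (fun s => (s == t)%:R) => [s|].
  by case: (s == t); [exact: coefs_in1|exact: coefs_in0].
rewrite (bigD1 t) //= eqxx rmorph1 mul1r big1 ?addr0 // => s /negPf ->.
by rewrite raddf0 mul0r.
Qed.

Hypothesis L_frel : forall t s, coefs_in L (frel t s).

Lemma span_over_free a : span_over L a -> exists2 g : T -> {mpoly k[r]},
  (forall t, coefs_in L (g t)) & pev c * a = \sum_(s in G) pev (g s) * b s.
Proof.
move=> [g Lg ->]; exists (fun s => \sum_t g t * frel t s) => [s|].
  by apply: coefs_in_sum => // t _; exact: coefs_inM.
rewrite mulr_sumr.
under eq_bigr => t _ do rewrite mulrCA frelP mulr_sumr.
rewrite exchange_big /=; apply: eq_bigr => s _.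
by rewrite rmorph_sum mulr_suml; apply: eq_bigr => t _; rewrite rmorphM mulrA.
Qed.

(** Multiplication by [c] moves everything into the free module on [G], where coordinates can be
    compared and [polynomial_regular] applies. The scalar [a] will be a prime [p] in [spread_out]
    and 0 in [almost_regular_local]. *)
Lemma almost_regular_span (a : k) e (j : 'I_r) u u' (v : 'I_r -> A) :
  span_over L u -> span_over L u' -> (forall l, span_over L (v l)) ->
  x j ^+ e * u = \sum_(l < r | (l < j)%N) x l ^+ e * v l + iota a * u' ->
  exists (w : 'I_r -> A) w', [/\ forall l, span_over L (w l), span_over L w' &
    pev c * u = \sum_(l < r | (l < j)%N) x l ^+ e * w l + iota a * w'].
Proof.
move=> Lu Lu' Lv E.
have [U LU eU] := span_over_free Lu; have [U' LU' eU'] := span_over_free Lu'.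
have /choice[V VP] l : exists g : T -> {mpoly k[r]}, (forall t, coefs_in L (g t)) /\
    pev c * v l = \sum_(s in G) pev (g s) * b s.
  by have [g ? ?] := span_over_free (Lv l); exists g.
have pX l : pev ('X_l ^+ e) = x l ^+ e by rewrite rmorphXn /= mmapX mmap1U.
have rel s : s \in G ->
    'X_j ^+ e * U s = \sum_(l < r | (l < j)%N) 'X_l ^+ e * V l s + a *: U' s.
  move=> sG; apply/eqP; rewrite -subr_eq0; apply/eqP; move: s sG; apply: free_G.
  have E0 : pev c * (x j ^+ e * u - (\sum_(l < r | (l < j)%N) x l ^+ e * v l + iota a * u')) = 0.
    by rewrite E subrr mulr0.
  transitivity (pev c * (x j ^+ e * u -
    (\sum_(l < r | (l < j)%N) x l ^+ e * v l + iota a * u'))); last exact: E0.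
  rewrite mulrBr [in RHS]mulrCA eU mulrDr (mulrCA _ (iota a)) eU'.
  have -> : pev c * (\sum_(l < r | (l < j)%N) x l ^+ e * v l) =
      \sum_(s in G) pev (\sum_(l < r | (l < j)%N) 'X_l ^+ e * V l s) * b s.
    rewrite mulr_sumr.
    under eq_bigr => l _ do rewrite mulrCA (VP l).2 mulr_sumr.
    rewrite exchange_big /=; apply: eq_bigr => s _.
    rewrite rmorph_sum mulr_suml; apply: eq_bigr => l _.
    by rewrite rmorphM /= pX mulrA.
  rewrite !mulr_sumr -big_split -sumrB /=; apply: eq_bigr => s _.
  by rewrite rmorphB rmorphD rmorphM /= pX mmapZ mulrBl mulrDl !mulrA.
have /choice[W WP] s : exists W : ('I_r -> {mpoly k[r]}) * {mpoly k[r]}, s \in G ->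
    [/\ forall l, coefs_in L (W.1 l), coefs_in L W.2 &
    U s = \sum_(l < r | (l < j)%N) 'X_l ^+ e * W.1 l + a *: W.2].
  have [sG|] := boolP (s \in G); last by exists (fun=> 0, 0).
  have [W [W' H]] := polynomial_regular L_sub (LU s) (LU' s) (rel s sG).
  by exists (W, W').
exists (fun l => \sum_(s in G) pev ((W s).1 l) * b s), (\sum_(s in G) pev (W s).2 * b s).
split.
- move=> l; apply: span_over_sum => s sG; apply: span_overZ; last exact: span_over_b.
  by have [H _ _] := WP s sG; exact: H.
- apply: span_over_sum => s sG; apply: span_overZ; last exact: span_over_b.
  by have [_ H _] := WP s sG.
rewrite eU.
under [X in _ = X + _]eq_bigr => l _ do rewrite mulr_sumr.
rewrite exchange_big /= mulr_sumr -big_split; apply: eq_bigr => s sG.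
have [_ _ ->] := WP s sG; rewrite rmorphD rmorph_sum /= mmapZ mulrDl mulr_suml -mulrA.
by congr (_ + _); apply: eq_bigr => l _; rewrite rmorphM /= pX mulrA.
Qed.

End SpanOver.

Lemma common_loc (us : seq R) : exists2 w : A, ev (phi w) != 0 &
  forall u, u \in us -> exists a, phi w * u = phi a.
Proof.
elim: us => [|u us [w w0 wP]]; first by exists 1; rewrite ?rmorph1 ?oner_neq0.
have [w' [a [w'0 e]]] := loc u; exists (w * w').
  by rewrite rmorphM rmorphM mulf_neq0.
move=> u'; rewrite inE => /orP[/eqP ->|/wP[a' e']].
  by exists (w * a); rewrite !rmorphM -mulrA e.
by exists (w' * a'); rewrite !rmorphM mulrAC e' mulrC.
Qed.

(** A common denominator [w] clears fractions, and the relation lifts from [R] to [A] after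
    multiplication by [f0], which annihilates the kernel of [phi]. *)
Lemma almost_regular_local e (j : 'I_r) u (v : 'I_r -> R) :
  phi (x j) ^+ e * u = \sum_(l < r | (l < j)%N) phi (x l) ^+ e * v l ->
  exists w : 'I_r -> R, gam * u = \sum_(l < r | (l < j)%N) phi (x l) ^+ e * w l.
Proof.
move=> E; have [w w0 wP] := common_loc (u :: [seq v l | l <- enum 'I_r]).
have [U eU] : exists a, phi w * u = phi a by apply: wP; rewrite mem_head.
have /choice[V VP] l : exists a, phi w * v l = phi a.
  by apply: wP; rewrite inE map_f ?orbT ?mem_enum.
have k_sub : is_subring [set: k] by [].
have spT a : span_over setT a by have [g ->] := gen_b a; exists g.
have E0 : f0 * (x j ^+ e * U - \sum_(l < r | (l < j)%N) x l ^+ e * V l) = 0.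
  apply: f0_ker; rewrite rmorphB rmorphM rmorphXn -eU mulrCA E rmorph_sum.
  rewrite mulr_sumr -sumrB big1 // => l _.
  by rewrite rmorphM rmorphXn -VP mulrCA subrr.
have E1 : x j ^+ e * (f0 * U) =
    \sum_(l < r | (l < j)%N) x l ^+ e * (f0 * V l) + iota 0 * 0.
  rewrite mulr0 addr0; apply/eqP; rewrite -subr_eq0; apply/eqP.
  transitivity (f0 * (x j ^+ e * U - \sum_(l < r | (l < j)%N) x l ^+ e * V l)); last exact: E0.
  rewrite mulrBr [in RHS]mulrCA mulr_sumr; congr (_ - _).
  by apply: eq_bigr => l _; rewrite mulrCA.
have [W [W' [_ _ EW]]] := almost_regular_span k_sub (fun _ _ _ => I)
  (spT _) (spT _) (fun l => spT _) E1.
have [f' ef'] : exists f', phi (f0 * w) * f' = 1.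
  by apply: ev_unit; rewrite !rmorphM mulf_neq0.
exists (fun l => f' * phi (W l)).
move: EW => /(congr1 phi); rewrite raddf0 mul0r addr0 (rmorphM _ (pev c)) [X in _ = X]rmorph_sum.
rewrite (rmorphM _ f0) -eU => E2.
have -> : gam * u = f' * (phi (pev c) * (phi f0 * (phi w * u))).
  by rewrite -[LHS]mul1r -ef' rmorphM /gam; ring.
rewrite E2 mulr_sumr; by apply: eq_bigr => l _; rewrite rmorphM rmorphXn mulrCA.
Qed.

(** [S] consists of the fractions with denominator a power of [f] and numerator with coordinates in
    a finitely generated subring [L] of [k]. Besides the structure constants, [L] contains the
    necessary values of a functional [lam] that kills [(y)^s] and sends [gam^M] to 1. Since [lam]
    maps [S] to [L], where [p] is not invertible, the equation excluded in the last clause would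
    give [1 = p lam(a')]. *)
Lemma spread_out (us : seq R) M s : ~ gpow y s (gam ^+ M) -> exists (S : set R) p,
  [/\ is_subring S, prime p, (forall u, u \in us -> S u) /\ S gam, (forall i, S (phi (x i))) &
  (forall e (j : 'I_r) u u' (v : 'I_r -> R), S u -> S u' -> (forall l, S (v l)) ->
     phi (x j) ^+ e * u = \sum_(l < r | (l < j)%N) phi (x l) ^+ e * v l + p%:R * u' ->
     exists (w : 'I_r -> R) w', [/\ forall l, S (w l), S w' &
      gam * u = \sum_(l < r | (l < j)%N) phi (x l) ^+ e * w l + p%:R * w']) /\
  forall q (a : 'I_n -> R) a', (s <= q)%N -> (forall i, S (a i)) -> S a' ->
     gam ^+ M <> \sum_i y i ^+ q * a i + p%:R * a'].
Proof.
move=> gs; have [lam [lamD lamZ lam0 lam1]] := linear_functional gs.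
have [w w0 wP] := common_loc us.
have [f fE] : exists f, f = f0 * w by exists (f0 * w).
pose f1 := ev (phi f).
have f10 : f1 != 0 by rewrite /f1 fE !rmorphM mulf_neq0.
have /choice[num numP] u : exists a, u \in us -> phi f * u = phi a.
  have [/wP[a e]|] := boolP (u \in us); last by exists 0.
  by exists (f0 * a) => _; rewrite fE !rmorphM -mulrA e.
have /choice[cof cofP] := gen_b.
(* The products of the [b_t] make [span_over L] closed under multiplication; the numerators of [us]
   put [us] into [S]. *)
pose As := [:: 1; f] ++ [seq num u | u <- us] ++
  [seq b tu.1 * b tu.2 | tu <- enum ({: T * T})].
pose Ps := [seq cof at_.1 at_.2 | at_ <- allpairs pair As (enum T)] ++
  c :: [seq frel tu.1 tu.2 | tu <- enum ({: T * T})].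
(* Monomials of degree below [s] suffice, since [lam] vanishes on the others, the [x_i] being in the
   maximal ideal. The inverse of [f1] serves to expand [1 / f] modulo [(y)^s]. *)
pose ks := [:: f1; f1^-1] ++
  [seq lam (phi (mmap1 x mt.1 * b mt.2)) | mt : 'X_{1..r < s} * T <- enum {: 'X_{1..r < s} * T}].
pose Ls := ks ++ flatten [seq [seq p@_m | m <- msupp p] | p <- Ps].
pose av (i : 'I_(size Ls)) := nth 0 Ls i.
pose L := range (mmap intr av : {mpoly int[size Ls]} -> k).
have L_sub : is_subring L by exact: subring_range.
have LLs z : z \in Ls -> L z.
  move=> zL; have i : (index z Ls < size Ls)%N by rewrite index_mem.
  exists 'X_(Ordinal i) => //; by rewrite mmapX mmap1U /av /= nth_index.
have LPs p : p \in Ps -> coefs_in L p.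
  move=> pP m; have [mp|/memN_msupp_eq0 ->] := boolP (m \in msupp p); last exact: sring0.
  apply: LLs; rewrite mem_cat; apply/orP; right; apply/flatten_mapP.
  by exists p => //; apply/mapP; exists m.
have LAs a : a \in As -> span_over L a.
  move=> aA; exists (cof a) => [t|]; last exact: cofP.
  apply: LPs; rewrite mem_cat; apply/orP; left; apply/mapP.
  by exists (a, t) => //; apply: allpairs_f => //; rewrite mem_enum.
have L_frel t t' : coefs_in L (frel t t').
  apply: LPs; rewrite mem_cat inE; apply/orP; right; apply/orP; right.
  by apply/mapP; exists (t, t') => //; rewrite mem_enum.
have Lc : coefs_in L c by apply: LPs; rewrite mem_cat mem_head orbT.
have L1 : span_over L 1 by apply: LAs; rewrite mem_head.
have Lf : span_over L f by apply: LAs; rewrite !inE eqxx orbT.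
have LM a a' : span_over L a -> span_over L a' -> span_over L (a * a').
  move=> [g Lg ->] [g' Lg' ->]; rewrite mulr_suml; apply: span_over_sum => // t _.
  rewrite mulr_sumr; apply: span_over_sum => // t' _; rewrite mulrACA -rmorphM.
  apply: span_overZ => //; first exact: coefs_inM.
  apply: LAs; rewrite !mem_cat; apply/orP; right; apply/orP; right.
  by apply/mapP; exists (t, t') => //; rewrite mem_enum.
have LX a i : span_over L a -> span_over L (a ^+ i).
  by move=> La; elim: i => [|i IH]; rewrite ?exprS //; exact: LM.
have [p [pp pL]] := exists_noninvertible_prime av.
have f_unit i : exists v, phi f ^+ i * v = 1.
  have [v ev1] := ev_unit f10; exists (v ^+ i).
  by rewrite -exprMn ev1 expr1n.
pose S : set R := [set u | exists i a, span_over L a /\ phi f ^+ i * u = phi a].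
have S_sub : is_subring S.
  split.
  - by exists 0%N, 1; rewrite rmorph1 mulr1.
  - move=> u u' [i [a [La e]]] [i' [a' [La' e']]].
    exists (i + i')%N, (f ^+ i' * a + pev (-1) * (f ^+ i * a')); split.
      apply: span_overD => //; first by apply: LM => //; exact: LX.
      apply: span_overZ => //; last by apply: LM => //; exact: LX.
      by rewrite -sub0r; apply: coefs_inB => //; [exact: coefs_in0|exact: coefs_in1].
    by rewrite rmorphN1 mulN1r rmorphB !rmorphM !rmorphXn -e -e' exprD; ring.
  - move=> u u' [i [a [La e]]] [i' [a' [La' e']]].
    exists (i + i')%N, (a * a'); split; first exact: LM.
    by rewrite rmorphM -e -e' exprD; ring.
have SA a : span_over L a -> S (phi a) by exists 0%N, a; rewrite mul1r.
exists S, p; split=> //.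
- split; last by rewrite /gam -[pev c]mulr1; apply: SA; exact: span_overZ.
  move=> u uus; exists 1%N, (num u); split; last by rewrite expr1 numP.
  apply: LAs; rewrite !mem_cat; apply/orP; right; apply/orP; left.
  exact: map_f.
- move=> i; apply: SA; rewrite -[x i]mulr1 -(mmap1U x) -(mmapX _ iota).
  by apply: span_overZ => //; exact: coefs_inX.
- split.
    move=> e j u u' v Su Su' Sv E.
    have [i [U [LU eU]]] := Su; have [i' [U' [LU' eU']]] := Su'.
    have /choice[I' I'P] l : exists ia : nat * A, span_over L ia.2 /\
        phi f ^+ ia.1 * v l = phi ia.2.
      by have [a1 [a2 H]] := Sv l; exists (a1, a2).
    pose N := (i + i' + \sum_l (I' l).1)%N.
    have raise m1 m2 a u1 : (m1 <= m2)%N -> span_over L a -> phi f ^+ m1 * u1 = phi a ->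
        exists2 a', span_over L a' & phi f ^+ m2 * u1 = phi a'.
      move=> m12 La ea; exists (f ^+ (m2 - m1) * a); first by apply: LM => //; exact: LX.
      by rewrite rmorphM rmorphXn -ea mulrA -exprD subnK.
    have [|V LV eV] := raise _ N _ _ _ LU eU; first by rewrite /N -addnA leq_addr.
    have [|V' LV' eV'] := raise _ N _ _ _ LU' eU'; first by rewrite /N addnAC leq_addl.
    have /choice[Vl VlP] l : exists a, span_over L a /\ phi f ^+ N * v l = phi a.
      have [La ea] := I'P l.
      have [|a' ? ?] := raise _ N _ _ _ La ea; last by exists a'.
      by rewrite /N (bigD1 l) //= addnA addnAC leq_addl.
    have E0 : f0 * (x j ^+ e * V - (\sum_(l < r | (l < j)%N) x l ^+ e * Vl l + p%:R * V')) = 0.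
      apply: f0_ker; rewrite rmorphB rmorphD !rmorphM rmorphXn -eV mulrCA E rmorph_sum.
      rewrite rmorph_nat -eV' mulrDr mulr_sumr (mulrCA _ p%:R) opprD addrACA subrr addr0.
      rewrite -sumrB big1 // => l _.
      by rewrite rmorphM rmorphXn -(VlP l).2 mulrCA subrr.
    have E1 : x j ^+ e * (f * V) =
        \sum_(l < r | (l < j)%N) x l ^+ e * (f * Vl l) + iota p%:R * (f * V').
      rewrite rmorph_nat; apply/eqP; rewrite -subr_eq0; apply/eqP.
      transitivity (w * (f0 * (x j ^+ e * V -
        (\sum_(l < r | (l < j)%N) x l ^+ e * Vl l + p%:R * V')))); last by rewrite E0 mulr0.
      rewrite [RHS]mulrA (mulrC w) -fE mulrBr mulrDr mulr_sumr [in RHS]mulrCA.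
      rewrite (mulrCA f p%:R); congr (_ - (_ + _)).
      by apply: eq_bigr => l _; rewrite mulrCA.
    have [||l||W [W' [LW LW' EW]]] :=
      @almost_regular_span L L_sub L_frel p%:R e j (f * V) (f * V') (fun l => f * Vl l).
    - exact: LM.
    - exact: LM.
    - by apply: LM => //; exact: (VlP l).1.
    - exact: E1.
    have [f' ef'] := f_unit N.+1.
    have Sf' : S f'.
      by exists N.+1, 1; rewrite rmorph1.
    exists (fun l => f' * phi (W l)), (f' * phi W'); split.
    + by move=> l; apply: sringM => //; exact: SA.
    + by apply: sringM => //; exact: SA.
    move: EW => /(congr1 phi); rewrite rmorphD !rmorphM rmorph_nat [X in _ = X + _]rmorph_sum.
    rewrite -eV rmorph_nat => EW.
    have -> : gam * u = f' * (phi (pev c) * (phi f * (phi f ^+ N * u))).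
      by rewrite -[LHS]mul1r -ef' exprS /gam; ring.
    rewrite EW mulrDr mulr_sumr (mulrCA _ p%:R); congr (_ + _).
    by apply: eq_bigr => l _; rewrite rmorphM rmorphXn mulrCA.
move=> q a a' sq Sa Sa' E.
have lam_sum (I : finType) (F : I -> R) : lam (\sum_i F i) = \sum_i lam (F i).
  apply: (big_morph lam lamD).
  by have := lamZ 0 0; rewrite mulr0 mul0r.
have lam00 : lam 0 = 0 by have := lamZ 0 0; rewrite mulr0 mul0r.
have lamA a1 : span_over L a1 -> L (lam (phi a1)).
  move=> [g Lg ->]; rewrite rmorph_sum lam_sum; apply: sring_sum => // t _.
  rewrite /mmap mulr_suml rmorph_sum (big_morph lam lamD lam00).
  apply: sring_sum => // m _.
  rewrite -mulrA rmorphM lamZ; apply: sringM => //; first exact: Lg.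
  have [ms|ms] := ltnP (mdeg m) s.
    apply: LLs; rewrite mem_cat mem_cat; apply/orP; left; apply/orP; right.
    by apply/mapP; exists (BMultinom ms, t) => //; rewrite mem_enum.
  suff -> : lam (phi (mmap1 x m * b t)) = 0 by exact: sring0.
  apply: lam0; rewrite rmorphM; apply: (ideal_mulr _ (gpow_ideal y s)).
  apply: (gpowS ms); rewrite mdegE /mmap1 rmorph_prod.
  rewrite (eq_bigr (fun i => phi (x i) ^+ m i)) => [|i _]; last by rewrite rmorphXn.
  by apply: gpow_prod => i; apply: y_max; exact: x_origin.
have Llam u : S u -> L (lam u).
  move=> [i [d [Ld ed]]].
  (* As [f / f1] has value 1 at the point, [h^s] lies in [(y)^s], and the geometric sum [sg] inverts
     [f / f1] modulo [(y)^s]. An element of [S] is thereby replaced by one of [span_over L] without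
     changing the value of [lam]. *)
  pose h := 1 - iota f1^-1 * f.
  have Lf1 : span_over L (iota f1^-1).
    rewrite -[iota _]mulr1 -(mmapC x); apply: span_overZ => // m.
    rewrite mcoeffC; apply: sringM => //; last exact: sring_nat.
    by apply: LLs; rewrite mem_cat !inE eqxx orbT.
  have LN a1 : span_over L a1 -> span_over L (- a1).
    move=> La1; have -> : - a1 = pev (-1) * a1 by rewrite rmorphN1 mulN1r.
    apply: span_overZ => //; rewrite -sub0r.
    by apply: coefs_inB => //; [exact: coefs_in0|exact: coefs_in1].
  have Lh : span_over L h by apply: span_overD => //; apply: LN; exact: LM.
  pose sg := \sum_(j < s) h ^+ j.
  have Lsg : span_over L sg by apply: span_over_sum => // j _; exact: LX.
  pose a0 := iota f1^-1 ^+ i * sg ^+ i * d.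
  have La0 : span_over L a0 by apply: (LM) => //; apply: (LM); exact: (LX).
  suff D0 : gpow y s (u - phi a0).
    by rewrite -(subrK (phi a0) u) lamD (lam0 _ D0) add0r; exact: lamA.
  have hs : gpow y s (phi h ^+ s).
    have -> : phi h ^+ s = \prod_(j <- [:: tt]) phi h ^+ s by rewrite big_seq1.
    have -> : gpow y s = gpow y (\sum_(j <- [:: tt]) s)%N by rewrite big_seq1.
    apply: (gpow_prod _ (fun=> s)) => _; apply: y_max.
    by rewrite /h !rmorphB !rmorphM !rmorph1 evK mulVf ?subrr.
  have sgE : iota f1^-1 * f * sg = 1 - h ^+ s.
    have -> : iota f1^-1 * f = 1 - h by rewrite /h opprB addrCA subrr addr0.
    have := subrX1 h s => /(congr1 -%R); rewrite opprB => ->.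
    by rewrite -mulNr -/sg; congr (_ * _); rewrite [RHS]opprB.
  have -> : u - phi a0 = u * (1 - (1 - phi h ^+ s) ^+ i).
    rewrite mulrBr mulr1; congr (_ - _).
    rewrite /a0 rmorphM -ed mulrA mulrC; congr (_ * _).
    have -> : 1 - phi h ^+ s = phi (iota f1^-1 * f * sg).
      by rewrite sgE [RHS]rmorphB rmorph1 rmorphXn.
    by rewrite !rmorphM !rmorphXn !exprMn; ring.
  apply: (ideal_mull _ (gpow_ideal y s)).
  have Is := gpow_ideal y s.
  elim: i {ed a0 La0} => [|i IH]; first by rewrite expr0 subrr; exact: ideal0.
  have -> : 1 - (1 - phi h ^+ s) ^+ i.+1 =
    (1 - phi h ^+ s) * (1 - (1 - phi h ^+ s) ^+ i) + phi h ^+ s by rewrite exprS; ring.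
  by apply: (idealD Is) => //; exact: (ideal_mull _ Is).
have [P _ eP] := Llam _ Sa'.
apply: (pL P); rewrite eP mulrC -lamZ /iotaR /= rmorph_nat rmorph_nat -[RHS]lam1 E lamD.
rewrite lam_sum big1 ?add0r // => i _; apply: lam0; apply: (ideal_mulr _ (gpow_ideal y s)).
exact/(gpowS sq)/gpowX.
Qed.

End LocalizationOfAlgebra.

(** * The embedding dimension bound *)

Section FreeComplexes.
Variables (B : comPzRingType) (X : nat -> B) (c : B) (r : nat).

Lemma seq_multiples_rV j b (u : 'rV[B]_b) :
  seq_multiples X j 'rV[B]_b u <-> forall i, @seq_multiples B X j B^o (u 0 i).
Proof.
split=> [[v ->] i|H].
  exists (fun l => v l 0 i : B^o); rewrite summxE; apply: eq_bigr => l _.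
  by rewrite mxE.
have /choice[v vP] := H.
exists (fun l => \row_i v i l); apply/rowP => i; rewrite vP summxE.
by apply: eq_bigr => l _; rewrite !mxE.
Qed.

Lemma almost_regular_rV b : @almost_regular_on B X c r B^o ->
  almost_regular_on X c r 'rV[B]_b.
Proof.
move=> ar j u jr /seq_multiples_rV H; apply/seq_multiples_rV => i.
by have := ar j (u 0 i) jr; rewrite mxE; apply; have := H i; rewrite mxE.
Qed.

Variables (beta : nat -> nat) (Dl : forall i, 'M[B]_(beta i.+1, beta i)).
Variable H : forall (j : nat) i, 'M[B]_(beta i, beta i.+1).
Hypothesis H0 : forall j, (j < r)%N -> H j 0 *m Dl 0 = (X j)%:M.
Hypothesis HS : forall j, (j < r)%N -> forall i,
  H j i.+1 *m Dl i.+1 + Dl i *m H j i = (X j)%:M.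
Hypothesis dd : forall i, Dl i.+1 *m Dl i = 0.
Hypothesis ar : @almost_regular_on B X c r B^o.

Lemma free_complex_almost_exact d : (forall i, (d < i)%N -> beta i = 0%N) -> (d <= r)%N ->
  forall i (z : 'rV_(beta i.+1)), z *m Dl i = 0 ->
  exists w, c ^+ r *: z = w *m Dl i.+1.
Proof.
move=> short dr i z zD.
have [|||||w ew] := @almost_acyclic B X c r d (fun i => 'rV[B]_(beta i))
  (fun i => mulmxr (Dl i)) (fun j i => mulmxr (H j i)) _ _ _ _ _ i z dr zD.
- by move=> j jr u; rewrite /= -mulmxA H0 // mul_mx_scalar.
- by move=> j jr i' u /=; rewrite -!mulmxA -mulmxDr HS // mul_mx_scalar.
- by move=> i' u /=; rewrite -mulmxA dd mulmx0.
- by move=> i'; exact: almost_regular_rV.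
- move=> i' di u; move: u; rewrite (short _ di) => u; exact: thinmx0.
by exists w.
Qed.

End FreeComplexes.

(** * Reduction modulo a prime and Frobenius twists of matrices *)

Section FrobeniusTwist.
Variables (R : comPzRingType) (S : set R) (p : nat).
Hypothesis S_sub : is_subring S.
Hypothesis pp : prime p.

Definition pmult : set R := [set u | exists2 a, S a & u = p%:R * a].

Lemma pmult0 : pmult 0. Proof. by exists 0; [exact: sring0|rewrite mulr0]. Qed.
Lemma pmultB a b : pmult a -> pmult b -> pmult (a - b).
Proof.
by move=> [a' Sa ->] [b' Sb ->]; exists (a' - b'); [exact: sringB|rewrite mulrBr].
Qed.
Lemma pmultM a b : S a -> pmult b -> pmult (a * b).
Proof. by move=> Sa [b' Sb ->]; exists (a * b'); [exact: sringM|rewrite mulrCA]. Qed.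

Definition reduction : comPzRingType := subquot S_sub pmult0 pmultB pmultM.
Definition red (u : R) : reduction := to_subq S_sub pmult0 pmultB pmultM u.

Lemma redD u v : S u -> S v -> red (u + v) = red u + red v.
Proof. exact: to_subqD. Qed.
Lemma redM u v : S u -> S v -> red (u * v) = red u * red v.
Proof. exact: to_subqM. Qed.
Lemma red_eq0 u : S u -> (red u = 0 <-> pmult u).
Proof. exact: to_subq_eq0. Qed.
Lemma red_surj (v : reduction) : exists2 u, S u & v = red u.
Proof. exact: to_subq_surj. Qed.
Lemma red_sum (J : Type) (s : seq J) (P : pred J) F : (forall i, P i -> S (F i)) ->
  red (\sum_(i <- s | P i) F i) = \sum_(i <- s | P i) red (F i).
Proof. exact: to_subq_sum. Qed.
Lemma redX u n : S u -> red (u ^+ n) = red u ^+ n.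
Proof. exact: to_subqX. Qed.
Lemma redN u : S u -> red (- u) = - red u.
Proof. exact: to_subqN. Qed.
Lemma red1 : red 1 = 1. Proof. by []. Qed.
Lemma red0 : red 0 = 0. Proof. by []. Qed.

Lemma reduction_char : p%:R = 0 :> reduction.
Proof.
have natE n : n%:R = red n%:R.
  elim: n => [|n IH]; first by rewrite red0.
  by rewrite -[n.+1]addn1 !natrD IH redD //; [exact: sring_nat|exact: sring1].
rewrite natE; apply/red_eq0; first exact: sring_nat.
by exists 1; [exact: sring1|rewrite mulr1].
Qed.

Lemma exprDp (u v : reduction) e : (u + v) ^+ (p ^ e) = u ^+ (p ^ e) + v ^+ (p ^ e).
Proof.
have H (a b : reduction) : (a + b) ^+ p = a ^+ p + b ^+ p.
  rewrite exprDn; case: p pp reduction_char => // m pm cm.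
  rewrite big_ord_recl big_ord_recr /= /bump /= add1n subn0 subnn bin0 binn !expr0 mul1r mulr1.
  rewrite !mulr1n big1 ?add0r // => i _.
  have /dvdnP[t ->] : (m.+1 %| 'C(m.+1, 1 + i))%N.
    by apply: prime_dvd_bin => //; rewrite add1n /= ltnS; exact: ltn_ord.
  by rewrite mulrnA -mulr_natr cm mulr0.
elim: e => [|e IH]; first by rewrite expn0 !expr1.
by rewrite expnSr !exprM IH H.
Qed.

Variable e : nat.
(** Reduction followed by an iterated Frobenius. It is a ring morphism on [S] only, hence the
    membership conditions in the lemmas that follow. *)
Definition frob (u : R) : reduction := red u ^+ (p ^ e).

Lemma frobD u v : S u -> S v -> frob (u + v) = frob u + frob v.
Proof. by move=> Su Sv; rewrite /frob redD // exprDp. Qed.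
Lemma frobM u v : S u -> S v -> frob (u * v) = frob u * frob v.
Proof. by move=> Su Sv; rewrite /frob redM // exprMn. Qed.
Lemma frob0 : frob 0 = 0.
Proof. by rewrite /frob red0 expr0n expn_eq0 (gtn_eqF (prime_gt0 pp)). Qed.
Lemma frob1 : frob 1 = 1. Proof. by rewrite /frob red1 expr1n. Qed.
Lemma frobN u : S u -> frob (- u) = - frob u.
Proof.
move=> Su; apply/eqP; rewrite -addr_eq0 -frobD //; last exact: sringN.
by rewrite addNr frob0.
Qed.
Lemma frob_sum (J : Type) (s : seq J) (P : pred J) F : (forall i, P i -> S (F i)) ->
  frob (\sum_(i <- s | P i) F i) = \sum_(i <- s | P i) frob (F i).
Proof.
move=> SF; elim: s => [|i s IH]; first by rewrite !big_nil frob0.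
rewrite !big_cons; case: ifP => // Pi; rewrite frobD ?IH //; first exact: SF.
exact: sring_sum.
Qed.

Lemma frob_mulmx a b c (M : 'M[R]_(a, b)) (N : 'M_(b, c)) :
  entries_in S M -> entries_in S N ->
  map_mx frob (M *m N) = map_mx frob M *m map_mx frob N.
Proof.
move=> SM SN; apply/matrixP => i j; rewrite !mxE frob_sum; last first.
  by move=> l _; apply: sringM.
by apply: eq_bigr => l _; rewrite !mxE frobM.
Qed.

Lemma frob_addmx a b (M N : 'M[R]_(a, b)) : entries_in S M -> entries_in S N ->
  map_mx frob (M + N) = map_mx frob M + map_mx frob N.
Proof. by move=> SM SN; apply/matrixP => i j; rewrite !mxE frobD. Qed.

Lemma frob_scalar a u : map_mx frob (u%:M : 'M_a) = (frob u)%:M.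
Proof. by apply/matrixP => i j; rewrite !mxE; case: eqP; rewrite ?mulr1n ?mulr0n ?frob0. Qed.

Lemma entries_in_mul a b c (M : 'M[R]_(a, b)) (N : 'M_(b, c)) :
  entries_in S M -> entries_in S N -> entries_in S (M *m N).
Proof. by move=> SM SN i j; rewrite mxE; apply: sring_sum => // l _; apply: sringM. Qed.

End FrobeniusTwist.

Section Core.
Variables (k : fieldType) (A : comNzRingType) (iota : {rmorphism k -> A}).
Variables (R : comPzRingType) (phi : {rmorphism A -> R}) (ev : {rmorphism R -> k}).
Hypothesis evK : forall c, ev (phi (iota c)) = c.
Hypothesis loc : forall u, exists w a, ev (phi w) != 0 /\ phi w * u = phi a.
Hypothesis ev_unit : forall u, ev u != 0 -> exists v, u * v = 1.
Variable f0 : A.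
Hypothesis f0_unit : ev (phi f0) != 0.
Hypothesis f0_ker : forall a, phi a = 0 -> f0 * a = 0.
Variables (r : nat) (x : 'I_r -> A).
Hypothesis x_indep : alg_indep iota x.
Hypothesis x_origin : forall i, ev (phi (x i)) = 0.
Variables (T : finType) (b : T -> A).
Hypothesis gen_b : forall a, exists c : T -> {mpoly k[r]}, a = \sum_t mmap iota x (c t) * b t.
Variables (G : {set T}) (c : {mpoly k[r]}).
Hypothesis free_G : free_family iota x b G.
Hypothesis c_free : forall t, exists f : T -> {mpoly k[r]},
  mmap iota x c * b t = \sum_(s in G) mmap iota x (f s) * b s.
Variables (n : nat) (y : 'I_n -> R).
Hypothesis y_max : forall u, ev u = 0 -> generated_by y u.
Let gam := phi (mmap iota x c).
Hypothesis gam_separated : forall M, exists s, ~ gpow y s (gam ^+ M).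
Variables (d N : nat) (beta : nat -> nat) (Dl : forall i, 'M[R]_(beta i.+1, beta i)).
Hypothesis short : forall i, (d < i)%N -> beta i = 0%N.
Hypothesis dr : (d <= r)%N.
Hypothesis dd : forall i, Dl i.+1 *m Dl i = 0.
Hypothesis Dl_min : forall i, entries_in (generated_by y) (Dl i).
Variable H : forall (j : 'I_r) i, 'M[R]_(beta i, beta i.+1).
Hypothesis H0 : forall j, H j 0 *m Dl 0 = (phi (x j) ^+ N)%:M.
Hypothesis HS : forall j i,
  H j i.+1 *m Dl i.+1 + Dl i *m H j i = (phi (x j) ^+ N)%:M.
Variables (u0 : 'rV[R]_(beta 0)) (eps : 'cV[R]_(beta 0)).
Hypothesis u0_unimodular : u0 *m eps = 1%:M.
Variables (z : 'I_n -> 'rV[R]_(beta 1)) (rho : 'M[R]_(beta 1, n)).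
Hypothesis z_boundary : forall i, z i *m Dl 0 = y i *: u0.
Hypothesis z_free : forall i j, generated_by y ((z i *m rho) 0 j - (i == j)%:R).

Let mxs p q (M : 'M[R]_(p, q)) := [seq M ij.1 ij.2 | ij <- enum {: 'I_p * 'I_q}].

Let in_mxs p q (M : 'M[R]_(p, q)) i j : M i j \in mxs M.
Proof. by apply/mapP; exists (i, j) => //; rewrite mem_enum. Qed.

(** If [n > d], the twisted complex over [S / p S] has rank 0 in degree [n], and [koszul_comparison]
    puts a power of [gam] whose exponent does not depend on [q] into the ideal of the [q]-th powers
    of the [y_i]. The last clause of [spread_out] forbids this. *)
Theorem embedding_dimension_bound : (n <= d)%N.
Proof.
rewrite leqNgt; apply/negP => dn.
have bn : beta n = 0%N by exact: short.
(* The acyclicity lemma has the multiplier [gam^r], and [koszul_comparison] raises it to the power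
   [2 n]. *)
have [s sP] := gam_separated (r * n.*2).
have /choice[frel frelP] := c_free.
have Cex i : exists C : 'I_n -> 'M[R]_(beta i.+1, beta i),
    Dl i = \sum_l y l *: C l.
  have /choice[C0 C0P] (ab : 'I_(beta i.+1) * 'I_(beta i)) : exists c : 'I_n -> R,
    Dl i ab.1 ab.2 = \sum_l c l * y l by exact: Dl_min.
  exists (fun l => \matrix_(a, a') C0 (a, a') l); apply/matrixP => a a'.
  by rewrite (C0P (a, a')) summxE; apply: eq_bigr => l _; rewrite !mxE mulrC.
pose C i := sval (cid (Cex i)).
have CP i : Dl i = \sum_l y l *: C i l := svalP (cid (Cex i)).
have /choice[zt ztP] (ij : 'I_n * 'I_n) : exists c : 'I_n -> R,
  (z ij.1 *m rho) 0 ij.2 - (ij.1 == ij.2)%:R = \sum_l c l * y l by exact: z_free.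
(* All data of the comparison, including the coefficients witnessing that [Dl] and the differences
   in [z_free] have entries in [(y)], so that these memberships persist over [S]. *)
pose us := flatten [seq mxs (Dl i) ++ flatten [seq mxs (C i l) | l <- enum 'I_n] ++
    flatten [seq mxs (H j i) | j <- enum 'I_r] | i <- seq.iota 0 d] ++
  (mxs u0 ++ mxs eps ++ flatten [seq mxs (z i) | i <- enum 'I_n] ++ mxs rho) ++
  codom y ++ flatten [seq codom (zt ij) | ij <- enum {: 'I_n * 'I_n}].
have [S [p [S_sub pp [S_us Sgam] Sx [S_ar S_sep]]]] :=
  spread_out evK loc ev_unit f0_unit f0_ker x_origin gen_b free_G frelP y_max us sP.
pose q := (p ^ s)%N.
have sq : (s <= q)%N by rewrite ltnW // ltn_expl // prime_gt1.
have S_deg (i : nat) u : (u \in mxs (Dl i) ++ flatten [seq mxs (C i l) | l <- enum 'I_n] ++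
    flatten [seq mxs (H j i) | j <- enum 'I_r]) -> (i < d)%N -> S u.
  move=> ui id; apply: S_us; rewrite mem_cat; apply/orP; left; apply/flatten_mapP.
  by exists i => //; rewrite mem_iota.
have empty (i : nat) : (d <= i)%N -> 'I_(beta i.+1) -> False.
  by move=> di; rewrite short ?ltnS // => -[].
have SD i : entries_in S (Dl i).
  move=> a a'; have [id|/empty/(_ a)//] := ltnP i d.
  by apply: (S_deg i) => //; rewrite mem_cat in_mxs.
have SC i l : entries_in S (C i l).
  move=> a a'; have [id|/empty/(_ a)//] := ltnP i d.
  apply: (S_deg i) => //; rewrite !mem_cat; apply/orP; right; apply/orP; left.
  by apply/flatten_mapP; exists l; rewrite ?mem_enum ?in_mxs.
have SH j i : entries_in S (H j i).
  move=> a a'; have [id|/empty/(_ a')//] := ltnP i d.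
  apply: (S_deg i) => //; rewrite !mem_cat; apply/orP; right; apply/orP; right.
  by apply/flatten_mapP; exists j; rewrite ?mem_enum ?in_mxs.
have S2 u : u \in (mxs u0 ++ mxs eps ++ flatten [seq mxs (z i) | i <- enum 'I_n] ++ mxs rho) -> S u.
  by move=> uu; apply: S_us; rewrite mem_cat (mem_cat _ (_ ++ _)) uu orbT.
have Su0 : entries_in S u0 by move=> a a'; apply: S2; rewrite mem_cat in_mxs.
have Seps : entries_in S eps by move=> a a'; apply: S2; rewrite !mem_cat in_mxs orbT.
have Sz i : entries_in S (z i).
  move=> a a'; apply: S2; rewrite !mem_cat; apply/orP; right; apply/orP; right.
  apply/orP; left; apply/flatten_mapP; exists i; by rewrite ?mem_enum ?in_mxs.
have Srho : entries_in S rho by move=> a a'; apply: S2; rewrite !mem_cat in_mxs !orbT.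
have Sy i : S (y i) by apply: S_us; rewrite !mem_cat codom_f !orbT.
have Szt ij l : S (zt ij l).
  apply: S_us; rewrite !mem_cat; apply/orP; right; apply/orP; right; apply/orP; right.
  by apply/flatten_mapP; exists ij; rewrite ?mem_enum ?codom_f.
pose fr := frob p S_sub s.
pose Q := reduction p S_sub.
pose xx j : R := if insub j is Some i then phi (x i) else 0.
have Sxx j : S (xx j) by rewrite /xx; case: insub => [i|]; [exact: Sx|exact: sring0].
have xxE (j : 'I_r) : xx j = phi (x j) by rewrite /xx valK.
pose X j : Q := fr (xx j ^+ N).
have XE j : X j = red p S_sub (xx j ^+ (N * q)).
  by rewrite /X /fr /frob !redX // -exprM.
(* [X_j] is the class of [x_j^(N q)]. A relation over [S / p S] lifts to [S] with an error [p u'],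
   and [S_ar] for the exponent [N q] still has the multiplier [gam]. *)
have X_ar : @almost_regular_on Q X (red p S_sub gam) r Q^o.
  move=> j u jr [v E].
  have [u1 Su1 eu] := red_surj u.
  have /choice[v1 v1P] l : exists w, S w /\ v l = red p S_sub w.
    by have [w ? ?] := red_surj (v l); exists w.
  pose j' := Ordinal jr.
  have [u' Su' E'] : pmult S p (phi (x j') ^+ (N * q) * u1 -
      \sum_(l < r | (l < j')%N) phi (x l) ^+ (N * q) * v1 l).
    have Ss (l : 'I_r) : S (phi (x l) ^+ (N * q) * v1 l).
      by apply: sringM => //; [apply: sringX => //; exact: Sx|exact: (v1P l).1].
    have S1 : S (phi (x j') ^+ (N * q) * u1).
      by apply: sringM => //; apply: sringX => //; exact: Sx.
    apply/(red_eq0 p S_sub); first by apply: sringB => //; apply: sring_sum.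
    rewrite redD; [|exact: S1|by apply: sringN => //; apply: sring_sum].
    rewrite redN; last by apply: sring_sum.
    rewrite redM //; last by apply: sringX => //; exact: Sx.
    rewrite -xxE -XE -eu; apply/eqP; rewrite subr_eq0; apply/eqP.
    move: E; rewrite /GRing.scale /= => ->.
    rewrite red_sum // (big_ord_widen r (fun l => X l * v l) (ltnW jr)).
    apply: eq_bigr => l _; rewrite redM //; [|by apply: sringX => //; exact: Sx|exact: (v1P l).1].
    by rewrite -xxE -XE (v1P l).2.
  have [||l||w [w' [Sw Sw' Ew]]] := S_ar (N * q)%N j' u1 u' v1.
  - by [].
  - by [].
  - exact: (v1P l).1.
  - by rewrite -E' addrC subrK.
  exists (fun l => if insub l is Some i then red p S_sub (w i) else 0).
  rewrite /GRing.scale /= eu -redM // Ew.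
  have Ss (l : 'I_r) : S (phi (x l) ^+ (N * q) * w l).
    by apply: sringM => //; apply: sringX => //; exact: Sx.
  rewrite redD; [|by apply: sring_sum|by apply: sringM => //; exact: sring_nat].
  rewrite [X in _ + X](_ : _ = 0) ?addr0; last first.
    by apply/(red_eq0 p S_sub); [apply: sringM => //; exact: sring_nat|exists w'].
  rewrite red_sum // [RHS](big_ord_widen r (fun l =>
    X l * (if insub l is Some i then red p S_sub (w i) else 0)) (ltnW jr)).
  apply: eq_bigr => l _; rewrite valK redM //; last by apply: sringX => //; exact: Sx.
  by rewrite XE xxE.
pose HQ j i : 'M[Q]_(beta i, beta i.+1) :=
  if insub j is Some j' then map_mx fr (H j' i) else 0.
have frX (j : 'I_r) : fr (phi (x j) ^+ N) = X j by rewrite /X xxE.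
have exactQ : forall i (v : 'rV[Q]_(beta i.+1)), v *m map_mx fr (Dl i) = 0 ->
    exists w, red p S_sub gam ^+ r *: v = w *m map_mx fr (Dl i.+1).
  apply: (@free_complex_almost_exact Q X _ r beta _ HQ _ _ _ X_ar d) => //.
  - move=> j jr; rewrite /HQ insubT /= -frob_mulmx // H0 frob_scalar //.
    by rewrite -/fr frX.
  - move=> j jr i; rewrite /HQ insubT /= -!frob_mulmx // -frob_addmx //; try exact: entries_in_mul.
    by rewrite HS frob_scalar // -/fr frX.
  - move=> i; rewrite -frob_mulmx // dd; apply/matrixP => a a'; rewrite !mxE; exact: frob0.
have Jfr (v : 'I_n -> R) : (forall l, S (v l)) ->
    generated_by (fun i => fr (y i)) (fr (\sum_l v l * y l)).
  move=> Sv; exists (fun l => fr (v l)); rewrite /fr frob_sum // => [|l _]; last exact: sringM.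
  by apply: eq_bigr => l _; rewrite frobM.
have J : generated_by (fun i => fr (y i)) ((red p S_sub gam ^+ r) ^+ n.*2).
  refine (@koszul_comparison Q beta (fun i => map_mx fr (Dl i)) (red p S_sub gam ^+ r) n
    (fun i => fr (y i)) exactQ _ (map_mx fr u0) (map_mx fr eps) _
    (fun i => map_mx fr (z i)) (map_mx fr rho) _ _ bn).
  - move=> i a a'; rewrite mxE CP summxE.
    have -> : \sum_l (y l *: C i l) a a' = \sum_l C i l a a' * y l.
      by apply: eq_bigr => l _; rewrite mxE mulrC.
    by apply: Jfr => l; exact: SC.
  - by rewrite -frob_mulmx // u0_unimodular frob_scalar // frob1.
  - move=> i; rewrite -frob_mulmx // z_boundary; apply/matrixP => a a'.
    by rewrite !mxE frobM.
  - move=> i j; rewrite -frob_mulmx // mxE.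
    have Sij : S (i == j)%:R by apply: sring_nat.
    have -> : (i == j)%:R = fr (i == j)%:R.
      by rewrite /fr; case: eqP; rewrite ?frob1 ?frob0.
    rewrite -frobN // -frobD //; [|exact: entries_in_mul|exact: sringN].
    by rewrite (ztP (i, j)); apply: Jfr.
have {}J : generated_by (fun i => fr (y i)) (red p S_sub (gam ^+ (r * n.*2))).
  by rewrite redX // exprM.
have [a aP] := J.
have /choice[a1 a1P] i : exists w, S w /\ a i = red p S_sub w.
  by have [w ? ?] := red_surj (a i); exists w.
have Sya i : S (y i ^+ q * a1 i).
  by apply: sringM => //; [exact: sringX|exact: (a1P i).1].
have [a' Sa' ea'] : pmult S p (gam ^+ (r * n.*2) - \sum_i y i ^+ q * a1 i).
  apply/(red_eq0 p S_sub); first by apply: sringB => //; [exact: sringX|apply: sring_sum].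
  rewrite redD; [|exact: sringX|by apply: sringN => //; apply: sring_sum].
  rewrite redN; last by apply: sring_sum.
  rewrite aP red_sum // -sumrB big1 // => i _.
  rewrite redM //; [|exact: sringX|exact: (a1P i).1].
  by rewrite redX // (a1P i).2 mulrC /fr /frob subrr.
apply: (S_sep q a1 a' sq) => // [i|]; first exact: (a1P i).1.
by rewrite -ea' addrC subrK.
Qed.

End Core.

(** * Noetherian modules *)

Section Submodules.
Variables (R : comPzRingType) (M : lmodType R).
Implicit Types N P Z : set M.

Definition is_submod N :=
  [/\ N 0, forall u v, N u -> N v -> N (u + v) & forall a u, N u -> N (a *: u)].

Lemma smod0 N : is_submod N -> N 0. Proof. by case. Qed.
Lemma smodD N u v : is_submod N -> N u -> N v -> N (u + v). Proof. by case=> _ + _; apply. Qed.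
Lemma smodZ N a u : is_submod N -> N u -> N (a *: u). Proof. by case=> _ _; apply. Qed.
Lemma smodN N u : is_submod N -> N u -> N (- u).
Proof. by move=> sN Nu; rewrite -scaleN1r; apply: smodZ. Qed.
Lemma smodB N u v : is_submod N -> N u -> N v -> N (u - v).
Proof. by move=> sN Nu Nv; apply: smodD => //; apply: smodN. Qed.
Lemma smod_sum N (I : Type) (s : seq I) (Q : pred I) F : is_submod N ->
  (forall i, Q i -> N (F i)) -> N (\sum_(i <- s | Q i) F i).
Proof.
move=> sN H; apply: (big_ind N) => // [|u v]; first exact: smod0.
exact: smodD.
Qed.

Definition span_of n (g : 'I_n -> M) : set M :=
  [set u | exists c : 'I_n -> R, u = \sum_i c i *: g i].
Definition fg_submod N := exists n (g : 'I_n -> M), N = span_of g.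
Definition noetherian_mod := forall N, is_submod N -> fg_submod N.

Lemma span_of_submod n (g : 'I_n -> M) : is_submod (span_of g).
Proof.
split.
- by exists (fun=> 0); rewrite big1 // => i _; rewrite scale0r.
- move=> a b [c ->] [c' ->]; exists (fun i => c i + c' i).
  by rewrite -big_split; apply: eq_bigr => i _; rewrite scalerDl.
- move=> a b [c ->]; exists (fun i => a * c i).
  by rewrite scaler_sumr; apply: eq_bigr => i _; rewrite scalerA.
Qed.

Lemma span_of_gen n (g : 'I_n -> M) i : span_of g (g i).
Proof.
exists (fun j => (j == i)%:R); rewrite (bigD1 i) //= eqxx scale1r.
by rewrite big1 ?addr0 // => j /negPf ->; rewrite scale0r.
Qed.

Lemma span_of_min n (g : 'I_n -> M) N : is_submod N -> (forall i, N (g i)) -> span_of g `<=` N.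
Proof. by move=> sN Ng u [c ->]; apply: smod_sum => // i _; apply: smodZ. Qed.

Lemma fg_submod_fin N (T : finType) (g : T -> M) : is_submod N -> (forall t, N (g t)) ->
  (forall u, N u -> exists c : T -> R, u = \sum_t c t *: g t) -> fg_submod N.
Proof.
move=> sN Ng H; exists #|T|, (fun i => g (enum_val i)).
apply/seteqP; split=> [u /H[c ->]|]; last by apply: span_of_min.
apply: smod_sum => [|t _]; first exact: span_of_submod.
apply: smodZ; first exact: span_of_submod.
by rewrite -(enum_rankK t); exact: (span_of_gen (fun i => g (enum_val i))).
Qed.

(** Induction on the number of generators: the coefficients of the first generator form a finitely
    generated ideal, and after subtraction of lifts of its generators the rest lies in the span of
    the other ones. *)
Lemma noetherian_span n (g : 'I_n -> M) N : noetherian R ->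
  is_submod N -> N `<=` span_of g -> fg_submod N.
Proof.
move=> nR; elim: n g N => [|n IH] g N sN Ng.
  exists 0%N, g; apply/seteqP; split=> // u [c ->]; rewrite big_ord0; exact: smod0.
pose g' i := g (lift ord0 i).
pose I : set R := [set a | exists2 u, N u & span_of g' (u - a *: g ord0)].
have [|m [a aI]] := nR I.
  split.
  - exists 0; first exact: smod0.
    by rewrite scale0r subr0; exact: (smod0 (span_of_submod g')).
  - move=> a a' [u Nu Hu] [u' Nu' Hu']; exists (u + u'); first exact: smodD.
    by rewrite scalerDl opprD addrACA; exact: (smodD (span_of_submod g')).
  - move=> a a' [u Nu Hu]; exists (a *: u); first exact: smodZ.
    by rewrite -scalerA -scalerBr; exact: (smodZ _ (span_of_submod g')).
have /choice[ua uaP] i : exists u, N u /\ span_of g' (u - a i *: g ord0).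
  have [u ? ?] : I (a i) by rewrite aI; exact: generated_by_gen.
  by exists u.
pose N' : set M := [set u | N u /\ span_of g' u].
have [||m' [w N'w]] := IH g' N'.
- have sg := span_of_submod g'; split.
  + by split; [exact: smod0|exact: (smod0 sg)].
  + by move=> u v [Nu gu] [Nv gv]; split; [exact: smodD|exact: (smodD sg)].
  + by move=> b u [Nu gu]; split; [exact: smodZ|exact: (smodZ _ sg)].
- by move=> u [].
pose h (t : 'I_m + 'I_m') := match t with inl i => ua i | inr j => w j end.
apply: (@fg_submod_fin N _ h) => // [[i|j]|u Nu] /=.
- exact: (uaP i).1.
- by have [] : N' (w j) by rewrite N'w; exact: span_of_gen.
have [c cu] := Ng _ Nu.
have [b bc] : generated_by a (c ord0).
  rewrite -aI; exists u => //; rewrite cu big_ord_recl addrC addKr.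
  by exists (fun i => c (lift ord0 i)).
have [b' b'E] : span_of w (u - \sum_i b i *: ua i).
  rewrite -N'w; split.
    by apply: smodB => //; apply: smod_sum => // i _; apply: smodZ => //; exact: (uaP i).1.
  have -> : u - \sum_i b i *: ua i = (u - c ord0 *: g ord0) -
      \sum_i b i *: (ua i - a i *: g ord0).
    rewrite bc scaler_suml.
    under [X in _ = _ - X]eq_bigr => i _ do rewrite scalerBr scalerA.
    by rewrite sumrB opprB addrA subrK.
  apply: (smodB (span_of_submod g')).
    by rewrite cu big_ord_recl addrC addKr; exists (fun i => c (lift ord0 i)).
  apply: (smod_sum _ (span_of_submod g')) => i _.
  by apply: (smodZ _ (span_of_submod g')); exact: (uaP i).2.
exists (fun t => match t with inl i => b i | inr j => b' j end).
by rewrite big_sumType /= -b'E addrC subrK.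
Qed.

(** Without a maximal member a strictly increasing chain could be chosen; its union is finitely
    generated and therefore reached at a finite stage. *)
Lemma noetherian_mod_max (F : set (set M)) N0 : noetherian_mod -> F N0 ->
  (forall N, F N -> is_submod N) ->
  exists2 N, F N & forall N', F N' -> N `<=` N' -> N' `<=` N.
Proof.
move=> nM FN0 Fs; apply: contrapT => Hno.
have /choice[nx nxP] N : exists N', F N -> [/\ F N', N `<=` N' & ~ N' `<=` N].
  have [FN|] := pselect (F N); last by exists N.
  apply: contrapT => H; apply: Hno; exists N => // N' FN' NN'.
  by apply: contrapT => H'; apply: H; exists N'.
pose C i := iter i nx N0.
have FC i : F (C i) by elim: i => // i IH; have [] := nxP _ IH.
have CS i : C i `<=` C i.+1 by have [] := nxP _ (FC i).
have Cle i j : (i <= j)%N -> C i `<=` C j.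
  by move/subnK <-; elim: (j - i)%N => // t IH u /IH; exact: CS.
pose U : set M := [set u | exists i, C i u].
have sC i := Fs _ (FC i).
have [|n [g Ug]] := nM U.
  split.
  - by exists 0%N; exact: (smod0 (sC 0%N)).
  - move=> u v [i Cu] [j Cv]; exists (maxn i j); apply: (smodD (sC _)).
      exact: (Cle i _ (leq_maxl _ _)).
    exact: (Cle j _ (leq_maxr _ _)).
  - by move=> a u [i Cu]; exists i; apply: (smodZ _ (sC _)).
have /choice[t tP] i : exists j, C j (g i).
  by have : U (g i) by rewrite Ug; exact: span_of_gen.
pose m := \max_i t i.
have UC : U `<=` C m.
  rewrite Ug; apply: span_of_min => // i; apply: (Cle (t i)) => //.
  exact: (@leq_bigmax _ _ i).
have [_ _] := nxP _ (FC m); apply=> u Cu; apply: UC; by exists m.+1.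
Qed.

(** The product [I N], as the smallest submodule containing the products, so that inclusions are
    checked on generators. *)
Definition mulset (I : set R) N : set M := [set u | forall P, is_submod P ->
  (forall a v, I a -> N v -> P (a *: v)) -> P u].

Lemma mulset_submod I N : is_submod (mulset I N).
Proof.
split.
- by move=> P sP _; exact: smod0.
- by move=> u v Hu Hv P sP HP; apply: smodD => //; [exact: Hu|exact: Hv].
- by move=> a u Hu P sP HP; apply: smodZ => //; exact: Hu.
Qed.

Lemma mulset_min I N P : is_submod P -> (forall a v, I a -> N v -> P (a *: v)) ->
  mulset I N `<=` P.
Proof. by move=> sP HP u; apply. Qed.

Lemma mulset_in (I : set R) N a v : I a -> N v -> mulset I N (a *: v).
Proof. by move=> Ia Nv P sP; apply. Qed.

(* A family of generators of [N] modulo [P] of least size must be empty. *)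
Lemma nakayama (J : set R) N P : is_ideal J -> (forall a, J a -> is_unit (1 - a)) ->
  fg_submod N -> is_submod P ->
  (forall u, N u -> exists v w, [/\ mulset J N v, P w & u = v + w]) -> N `<=` P.
Proof.
move=> JI Ju fgN sP H.
have sN : is_submod N by have [n [g ->]] := fgN; exact: span_of_submod.
pose G n := `[< exists2 g : 'I_n -> M, (forall i, N (g i)) &
  forall u, N u -> exists c : 'I_n -> R, P (u - \sum_i c i *: g i) >].
have exG : exists n, G n.
  have [n [g Ng]] := fgN; exists n; apply/asboolP; exists g => [i|u].
    by rewrite Ng; exact: span_of_gen.
  by rewrite Ng => -[c ->]; exists c; rewrite subrr; exact: smod0.
case: (ex_minnP exG) => -[|n] /asboolP[g Ng gP] minn.
  by move=> u /gP[c]; rewrite big_ord0 subr0.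
suff /minn : G n by rewrite ltnn.
have JN v : mulset J N v -> exists2 c : 'I_n.+1 -> R, (forall i, J (c i)) &
    P (v - \sum_i c i *: g i).
  apply: (@mulset_min J N [set v | exists2 c : 'I_n.+1 -> R, (forall i, J (c i)) &
    P (v - \sum_i c i *: g i)]).
    split.
    - exists (fun=> 0) => [i|]; first exact: ideal0.
      by rewrite big1 ?subr0 => [|i _]; [exact: smod0|rewrite scale0r].
    - move=> u v' [c Jc Hc] [c' Jc' Hc']; exists (fun i => c i + c' i) => [i|].
        exact: (idealD JI).
      have := smodD sP Hc Hc'; rewrite addrACA -opprD -big_split; congr (P (_ - _)).
      by apply: eq_bigr => i _; rewrite scalerDl.
    - move=> a u [c Jc Hc]; exists (fun i => a * c i) => [i|]; first exact: (ideal_mull _ JI).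
      have := smodZ a sP Hc; rewrite scalerBr scaler_sumr; congr (P (_ - _)).
      by apply: eq_bigr => i _; rewrite scalerA.
  move=> a v' Ja /gP[c Hc]; exists (fun i => a * c i) => [i|]; first exact: (ideal_mulr _ JI).
  have := smodZ a sP Hc; rewrite scalerBr scaler_sumr; congr (P (_ - _)).
  by apply: eq_bigr => i _; rewrite scalerA.
have [v [w [/JN[c Jc Hc] Pw e0]]] := H _ (Ng ord0).
have [b eb] := Ju _ (Jc ord0).
pose s := \sum_(i < n) (b * c (lift ord0 i)) *: g (lift ord0 i).
have Ps : P (g ord0 - s).
  have := smodZ b sP (smodD sP Hc Pw); congr P.
  rewrite addrAC -e0 big_ord_recl scalerBr scalerDr scaler_sumr opprD addrA; congr (_ - _).
    by rewrite scalerA -scalerBl -{1}[b]mulr1 -mulrBr mulrC eb scale1r.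
  by apply: eq_bigr => i _; rewrite scalerA.
apply/asboolP; exists (fun i => g (lift ord0 i)) => // u /gP[a Ha].
exists (fun i => a ord0 * (b * c (lift ord0 i)) + a (lift ord0 i)).
have := smodD sP Ha (smodZ (a ord0) sP Ps); congr P.
rewrite big_ord_recl scalerBr addrA opprD addrA.
rewrite [u - _ - _ + _]addrAC subrK -addrA -opprD; congr (_ - _).
rewrite addrC scaler_sumr -big_split; apply: eq_bigr => i _.
by rewrite scalerDl scalerA.
Qed.

End Submodules.

Lemma noetherian_regular (R : comPzRingType) : noetherian R -> noetherian_mod R^o.
Proof.
move=> nR N [N0 ND NZ]; have [n [g Ng]] := nR N (And3 N0 ND NZ).
by exists n, g; rewrite Ng.
Qed.

(** * The Artin-Rees lemma and Krull's intersection theorem *)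

Section ArtinRees.
Variables (R : comPzRingType) (n : nat) (y : 'I_n -> R).

(** Pigeonhole: among more than [sum_i j_i] factors [y_i], some [y_i] occurs at least [j_i]
    times. *)
Lemma gpow_powers (j : 'I_n -> nat) s a : (\sum_i j i < s)%N -> gpow y s a ->
  generated_by (fun i => y i ^+ j i) a.
Proof.
elim: s j a => // s IH j a js [c Hc ->].
have JI := generated_by_ideal (fun i => y i ^+ j i).
apply: (ideal_sum _ JI) => i _.
have [j0|j0] := posnP (j i).
  by rewrite -[y i * c i]mulr1 -[X in _ * X](expr0 (y i)) -j0; apply: (ideal_mull _ JI);
    exact: (generated_by_gen (fun i => y i ^+ j i)).
pose j' l := if l == i then (j l).-1 else j l.
have js' : (\sum_l j' l < s)%N.
  rewrite -ltnS (leq_trans _ js) // ltnS (bigD1 i) //= [X in (_ < X)%N](bigD1 i) //=.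
  rewrite /j' eqxx -(ltn_predK j0) addSn ltnS leq_add2l leq_eqVlt; apply/orP; left.
  by apply/eqP; apply: eq_bigr => l /negPf ->.
have [b ->] := IH j' (c i) js' (Hc i).
rewrite mulr_sumr; apply: (ideal_sum _ JI) => l _; rewrite mulrCA; apply: (ideal_mull _ JI).
have [->|li] := eqVneq l i.
  by rewrite /j' eqxx -exprS (ltn_predK j0); exact: (generated_by_gen (fun i => y i ^+ j i)).
rewrite /j' (negPf li); apply: (ideal_mull _ JI).
exact: (generated_by_gen (fun i => y i ^+ j i)).
Qed.

Variables (M : lmodType R) (nM : noetherian_mod M).

(* Let [N'] be maximal among the submodules meeting [Z] in [I^t Z]. Each [y_i]
   has a power with [y_i^j M] in [N'], because the kernels of the powers of
   [y_i] on [M / N'] become stationary. *)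
Lemma artin_rees (Z : set M) t : is_submod Z -> exists N, forall u,
  mulset (gpow y N) setT u -> Z u -> mulset (gpow y t) Z u.
Proof.
move=> sZ; pose IZ := mulset (gpow y t) Z.
have sIZ : is_submod IZ by exact: mulset_submod.
pose F : set (set M) := [set N | [/\ is_submod N, IZ `<=` N & forall u, N u -> Z u -> IZ u]].
have [||N' [sN' IN' N'Z] maxN'] := @noetherian_mod_max R M F IZ nM.
- by split.
- by move=> N [].
have /choice[j jP] i : exists j, forall v, N' (y i ^+ j *: v).
  pose D j : set M := [set v | N' (y i ^+ j *: v)].
  have sD j : is_submod (D j).
    split.
    - by rewrite /D /= scaler0; exact: (smod0 sN').
    - by move=> u v; rewrite /D /= scalerDr; exact: (smodD sN').
    - by move=> a u Du; rewrite /D /= scalerA mulrC -scalerA; exact: (smodZ _ sN').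
  have [||_ [j ->] maxj] := @noetherian_mod_max R M [set N | exists j, N = D j] (D 0%N) nM.
  - by exists 0%N.
  - by move=> N [j ->].
  have Dj : D (j + t)%N `<=` D j.
    apply: maxj; first by exists (j + t)%N.
    by move=> v Dv; rewrite /D /= addnC exprD -scalerA; exact: (smodZ _ sN').
  (* For [z = y_i^j v + w] in [Z], the element [y_i^t z] lies in [I^t Z], so [y_i^(j+t) v] is in
     [N'], and then so is [y_i^j v] by stationarity. Thus [N''] still meets [Z] in [I^t Z], and
     maximality gives [N'' = N']. *)
  pose N'' : set M := [set u | exists v w, N' w /\ u = y i ^+ j *: v + w].
  have N'N'' : N' `<=` N'' by move=> u Nu; exists 0, u; rewrite scaler0 add0r.
  exists j => v; apply: (maxN' N'') => //; last first.
    by exists v, 0; rewrite addr0; split=> //; exact: (smod0 sN').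
  split.
  - split; first by apply: N'N''; exact: (smod0 sN').
    + move=> _ _ [v1 [w1 [Nw1 ->]]] [v2 [w2 [Nw2 ->]]].
      exists (v1 + v2), (w1 + w2); split; first exact: (smodD sN').
      by rewrite scalerDr addrACA.
    + move=> a _ [v1 [w1 [Nw1 ->]]]; exists (a *: v1), (a *: w1).
      split; first exact: (smodZ _ sN').
      by rewrite scalerDr !scalerA mulrC.
  - exact: subset_trans N'N''.
  - move=> z [v1 [w1 [Nw1 ez]]] Zz; apply: N'Z => //; rewrite ez.
    apply: (smodD sN') => //; apply: Dj.
    rewrite /D /= addnC exprD -scalerA.
    have -> : y i ^+ j *: v1 = z - w1 by rewrite ez addrK.
    rewrite scalerBr; apply: (smodB sN'); last exact: (smodZ _ sN').
    by apply: IN'; apply: mulset_in => //; exact: gpowX.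
exists (\sum_i j i).+1 => u Hu Zu; apply: N'Z => //.
move: Hu; apply: mulset_min => // a v Ha _.
have [b ->] := gpow_powers (ltnSn _) Ha.
rewrite scaler_suml; apply: (smod_sum _ sN') => i _.
by rewrite -scalerA; apply: (smodZ _ sN').
Qed.

End ArtinRees.

(** Artin-Rees for [Z = R u] and the first power gives [u = a u] with [a] in [(y)], and [1 - a] is a
    unit. *)
Lemma krull_intersection (R : comPzRingType) n (y : 'I_n -> R) u : noetherian R ->
  (forall a, generated_by y a -> is_unit (1 - a)) -> (forall s, gpow y s u) -> u = 0.
Proof.
move=> nR yu yP.
pose Z : set R^o := [set v | exists a, v = a * u].
have sZ : is_submod Z.
  split.
  - by exists 0; rewrite mul0r.
  - by move=> _ _ [a ->] [b ->]; exists (a + b); rewrite mulrDl.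
  - by move=> b _ [a ->]; exists (b * a); rewrite -mulrA.
have [N NP] := artin_rees y (noetherian_regular nR) 1 sZ.
have [a ya e] : [set v : R^o | exists2 a, generated_by y a & v = a * u] u.
  apply: (mulset_min _ _ (NP u _ _)).
  - split.
    + by exists 0; [exact: ideal0 (generated_by_ideal y)|rewrite mul0r].
    + move=> _ _ [a Ia ->] [b Ib ->]; exists (a + b); last by rewrite mulrDl.
      exact: (idealD (generated_by_ideal y)).
    + move=> b _ [a Ia ->]; exists (b * a); last by rewrite -mulrA.
      exact: (ideal_mull _ (generated_by_ideal y)).
  - move=> a _ [c _ ->] [b ->]; exists ((\sum_i y i * c i) * b); last by rewrite -mulrA.
    apply: (ideal_mulr _ (generated_by_ideal y)); exists c.
    by apply: eq_bigr => i _; rewrite mulrC.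
  - have := @mulset_in R R^o (gpow y N) setT u 1 (yP N) I.
    by rewrite /GRing.scale /= mulr1.
  - by exists 1; rewrite mul1r.
have [b eb] := yu a ya.
have : (1 - a) * u = 0 by rewrite mulrBl mul1r -e subrr.
by move/(congr1 ( *%R b)); rewrite mulrA (mulrC b) eb mul1r mulr0.
Qed.

Section PrimeFactors.
Variable R : comPzRingType.
Implicit Types (I : set R) (Qs : seq (set R)).

(** Containment in [I] of the product of the ideals of [Qs], expressed by successive colon sets
    instead of products of ideals. *)
Fixpoint prodin Qs I : Prop := if Qs is Q :: Qs' then
  forall a, Q a -> prodin Qs' [set b | I (a * b)] else I 1.

Lemma prodin_sub Qs I I' : I `<=` I' -> prodin Qs I -> prodin Qs I'.
Proof.
elim: Qs I I' => [|Q Qs IH] I I' II' /=; first exact: II'.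
by move=> H a Qa; apply: IH (H a Qa) => b /=; exact: II'.
Qed.

Lemma prodin_cat Q1 Q2 I1 I2 I : prodin Q1 I1 -> prodin Q2 I2 ->
  (forall u v, I1 u -> I2 v -> I (u * v)) -> prodin (Q1 ++ Q2) I.
Proof.
elim: Q1 I1 I => [|Q Q1 IH] I1 I /= H1 H2 H.
  by apply: prodin_sub H2 => v /(H _ _ H1); rewrite mul1r.
move=> a Qa; apply: (IH [set b | I1 (a * b)]) => // [|u v I1u I2v]; first exact: H1.
by rewrite /= mulrA; exact: H.
Qed.

Definition in_list Qs (Q : set R) := exists i, (i < size Qs)%N /\ nth setT Qs i = Q.

Lemma in_list_cons Qs Q Q' : in_list (Q :: Qs) Q' <-> Q' = Q \/ in_list Qs Q'.
Proof.
split=> [[[|i] [si /= <-]]|[->|[i [si <-]]]]; [by left|by right; exists i|by exists 0%N|].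
by exists i.+1.
Qed.

Lemma in_list_cat Q1 Q2 Q : in_list (Q1 ++ Q2) Q -> in_list Q1 Q \/ in_list Q2 Q.
Proof.
elim: Q1 => [|Q' Q1 IH]; first by right.
rewrite cat_cons => /in_list_cons[->|/IH[]]; [left|left|by right]; apply/in_list_cons.
  by left.
by right.
Qed.

Lemma prime_prodin Qs I P : is_prime P -> I `<=` P -> prodin Qs I ->
  exists Q, in_list Qs Q /\ Q `<=` P.
Proof.
move=> [PI P1 PP]; elim: Qs I => [|Q Qs IH] I IP /=; first by move=> /IP.
move=> H; have [QP|[a [Qa Pa]]] : Q `<=` P \/ exists a, Q a /\ ~ P a.
- have [|H'] := pselect (exists a, Q a /\ ~ P a); [by right|left=> a Qa].
  by apply: contrapT => Pa; apply: H'; exists a.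
- by exists Q; split=> //; apply/in_list_cons; left.
have [|Q' [HQ' Q'P]] := IH [set b | I (a * b)] _ (H a Qa).
  by move=> b /IP/PP[].
by exists Q'; split=> //; apply/in_list_cons; right.
Qed.

(** Noetherian induction. A maximal counterexample [J] is not prime; if [a b] is in [J] and neither
    factor is, the factors of [J + (a)] and of [J + (b)] together serve for [J]. *)
Lemma prime_factors I : noetherian R -> is_ideal I -> exists Qs,
  prodin Qs I /\ forall Q, in_list Qs Q -> is_prime Q /\ I `<=` Q.
Proof.
move=> nR II; apply: contrapT => bad.
pose F : set (set R^o) := [set J | is_ideal (J : set R) /\ ~ exists Qs,
  prodin Qs (J : set R) /\ forall Q, in_list Qs Q -> is_prime Q /\ J `<=` Q].
have [||J [JI Jbad] maxJ] := @noetherian_mod_max R R^o F I (noetherian_regular nR).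
- by split.
- by move=> J [[]].
have J1 : ~ J 1 by move=> J1; apply: Jbad; exists [::]; split=> // Q [i []].
have [JP|JP] := pselect (is_prime (J : set R)).
  apply: Jbad; exists [:: J : set R]; split; first by move=> a Ja; rewrite /= mulr1.
  by move=> Q /in_list_cons[->|[i []]] //; split=> // u.
have [a [b [Jab [Ja Jb]]]] : exists a b, J (a * b) /\ ~ J a /\ ~ J b.
  apply: contrapT => H; apply: JP; split=> // a b Jab.
  have [|Ja] := pselect (J a); [by left|right]; apply: contrapT => Jb.
  by apply: H; exists a, b.
pose add (c : R) : set R^o := [set u | exists v w, J w /\ u = v * c + w].
have addI c : is_ideal (add c : set R).
  split.
  - by exists 0, 0; rewrite mul0r addr0; split=> //; exact: (ideal0 JI).
  - move=> _ _ [v [w [Jw ->]]] [v' [w' [Jw' ->]]]; exists (v + v'), (w + w').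
    by split; [exact: (idealD JI)|rewrite mulrDl addrACA].
  - move=> d _ [v [w [Jw ->]]]; exists (d * v), (d * w).
    by split; [exact: (ideal_mull _ JI)|rewrite mulrDr mulrA].
have Jadd c : J `<=` add c by move=> u Ju; exists 0, u; rewrite mul0r add0r.
have addc c : add c c by exists 1, 0; rewrite mul1r addr0; split=> //; exact: (ideal0 JI).
have good c : ~ J c -> exists Qs,
    prodin Qs (add c : set R) /\ forall Q, in_list Qs Q -> is_prime Q /\ J `<=` Q.
  move=> Jc; apply: contrapT => H; apply: Jc; apply: (maxJ (add c)) => //.
  split=> // -[Qs [H1 H2]]; apply: H; exists Qs; split=> // Q /H2[QP aQ].
  by split=> //; exact: subset_trans aQ.
have [Q1 [H1 H1']] := good _ Ja; have [Q2 [H2 H2']] := good _ Jb.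
apply: Jbad; exists (Q1 ++ Q2); split; last by move=> Q /in_list_cat[/H1'|/H2'].
apply: (prodin_cat H1 H2) => _ _ [v [w [Jw ->]]] [v' [w' [Jw' ->]]].
have -> : (v * a + w) * (v' * b + w') = (v * v') * (a * b) + (v * a + w) * w' + v' * b * w by ring.
apply: (idealD JI); last exact: (ideal_mull _ JI).
by apply: (idealD JI); exact: (ideal_mull _ JI).
Qed.

End PrimeFactors.

Section Nullhomotopy.
Variables (R : comPzRingType) (beta : nat -> nat) (Dl : forall i, 'M[R]_(beta i.+1, beta i)).
Variables (a : R) (d : nat).
Hypothesis short : forall i, (d < i)%N -> beta i = 0%N.
Hypothesis dd : forall i, Dl i.+1 *m Dl i = 0.
Hypothesis a0 : forall v : 'rV_(beta 0), exists w, a *: v = w *m Dl 0.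
Hypothesis aS : forall i (v : 'rV_(beta i.+1)), v *m Dl i = 0 -> exists w, a *: v = w *m Dl i.+1.

Let good i (h : 'M[R]_(beta i, beta i.+1)) := Dl i *m h *m Dl i = a ^+ i.+1 *: Dl i.

Let rows p q t (N : 'M[R]_(p, q)) (D : 'M[R]_(t, q)) :
  (forall i, exists w, row i N = w *m D) -> exists h, N = h *m D.
Proof.
move=> /choice[w wP]; exists (\matrix_i w i); apply/row_matrixP => i.
by rewrite row_mul rowK wP.
Qed.

Let h0_exists : exists h : 'M[R]_(beta 0, beta 1), a%:M = h *m Dl 0.
Proof.
apply: rows => i; have [w ew] := a0 (row i 1%:M).
by exists w; rewrite -ew -linearZ /= scalemx1.
Qed.

Let step i (h : 'M[R]_(beta i, beta i.+1)) : good h -> exists h' : 'M[R]_(beta i.+1, beta i.+2),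
  (a ^+ i.+2)%:M = h' *m Dl i.+1 + a *: (Dl i *m h).
Proof.
move=> gh; have [|h' e] := rows (N := a *: ((a ^+ i.+1)%:M - Dl i *m h)) (D := Dl i.+1).
  move=> l; rewrite linearZ /=; apply: aS.
  by rewrite -row_mul mulmxBl mul_scalar_mx gh subrr row0.
by exists h'; rewrite -e scalerBr subrK -mul_scalar_mx -scalar_mxM -exprS.
Qed.

Let step_good i (h : 'M[R]_(beta i, beta i.+1)) (h' : 'M[R]_(beta i.+1, beta i.+2)) :
  (a ^+ i.+2)%:M = h' *m Dl i.+1 + a *: (Dl i *m h) -> good h'.
Proof.
move=> e; have e' : h' *m Dl i.+1 = (a ^+ i.+2)%:M - a *: (Dl i *m h) by rewrite e addrK.
rewrite /good -mulmxA e' mulmxBr mul_mx_scalar -scalemxAr mulmxA dd mul0mx scaler0.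
by rewrite subr0.
Qed.

(** The rows of [a^(i+1) - Dl_i h_i] are cycles, so [a] times them are boundaries; this defines
    [h_(i+1)] and raises the exponent by one in each degree. The factors [a^(d-i)] finally make all
    exponents equal to [d + 1]. *)
Lemma nullhomotopic_power : exists H : forall i, 'M[R]_(beta i, beta i.+1),
  H 0 *m Dl 0 = (a ^+ d.+1)%:M /\
  forall i, H i.+1 *m Dl i.+1 + Dl i *m H i = (a ^+ d.+1)%:M.
Proof.
have [h0 h0P] := h0_exists.
have g0 : good h0 by rewrite /good -mulmxA -h0P mul_mx_scalar expr1.
pose st i := {h : 'M[R]_(beta i, beta i.+1) | good h}.
pose nx i (h : st i) : st i.+1 :=
  exist _ _ (step_good (svalP (cid (step (svalP h))))).
pose h := nat_rect st (exist _ h0 g0) nx.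
have hS i : (a ^+ i.+2)%:M = sval (h i.+1) *m Dl i.+1 + a *: (Dl i *m sval (h i)).
  exact: (svalP (cid (step (svalP (h i))))).
exists (fun i => a ^+ (d - i) *: sval (h i)); split.
  by rewrite subn0 -scalemxAl -h0P -mul_scalar_mx -scalar_mxM -exprSr.
move=> i; have [id|di] := ltnP i d; last first.
  by apply/matrixP => l; exfalso; move: l; rewrite short ?ltnS // => -[].
rewrite -scalemxAl -scalemxAr (_ : (d - i)%N = (d - i.+1).+1); last by rewrite subnSK.
rewrite exprSr -scalerA -scalerDr -hS -mul_scalar_mx -scalar_mxM -exprD.
by congr ((a ^+ _)%:M); rewrite addnS subnK.
Qed.

End Nullhomotopy.

(** * Systems of parameters *)

Section IdealSeq.
Variable R : comPzRingType.
Implicit Types us vs : seq R.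

Lemma ideal_seq_ideal us : is_ideal (ideal_seq us).
Proof.
have I0 : ideal_seq us 0.
  by elim: us => //= u us IH; exists 0, 0; rewrite mul0r addr0.
split=> // [a b Ia Ib|a b Ib].
  by rewrite -[a]mul1r; exact: ideal_seq_comb.
by rewrite -[a * b]addr0; exact: ideal_seq_comb.
Qed.

Lemma ideal_seq_mem us u : u \in us -> ideal_seq us u.
Proof.
elim: us => // v us IH; rewrite inE => /orP[/eqP ->|/IH Iu] /=.
  by exists 1, 0; rewrite mul1r addr0; split=> //; exact: ideal0 (ideal_seq_ideal us).
by exists 0, u; rewrite mul0r add0r.
Qed.

Lemma ideal_seq_min us I : is_ideal I -> (forall u, u \in us -> I u) -> ideal_seq us `<=` I.
Proof.
move=> II; elim: us => [|u us IH] H a /=; first by move=> ->; exact: ideal0.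
move=> [b [c [Ic ->]]]; apply: (idealD II).
  by apply: (ideal_mull _ II); apply: H; rewrite mem_head.
by apply: IH Ic => v vus; apply: H; rewrite inE vus orbT.
Qed.

Lemma ideal_seq_sub us vs : (forall u, u \in us -> ideal_seq vs u) ->
  ideal_seq us `<=` ideal_seq vs.
Proof. by apply: ideal_seq_min; exact: ideal_seq_ideal. Qed.

Lemma ideal_seq_nth us a : ideal_seq us a -> generated_by (fun i : 'I_(size us) => nth 0 us i) a.
Proof.
apply: ideal_seq_min; first exact: generated_by_ideal.
move=> u uus; have i : (index u us < size us)%N by rewrite index_mem.
by rewrite -(nth_index 0 uus); exact: (generated_by_gen _ (Ordinal i)).
Qed.

End IdealSeq.

Lemma closed_field_infinite (k : closedFieldType) N : exists ls : seq k, uniq ls /\ size ls = N.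
Proof.
elim: N => [|N [ls [uls <-]]]; first by exists [::].
(* The additional factor ['X] keeps the polynomial nonconstant when the list is empty. *)
have [x /rootP px] : exists x, root (\prod_(a <- ls) ('X - a%:P) * 'X + 1) x.
  apply/closed_rootP; have m : \prod_(a <- ls) ('X - a%:P) \is monic by exact: monic_prod_XsubC.
  rewrite size_polyDl.
    by rewrite size_mulX ?monic_neq0 // size_prod_XsubC.
  by rewrite size_polyC oner_eq0 size_mulX ?monic_neq0 // size_prod_XsubC.
exists (x :: ls); split=> //=; rewrite uls andbT; apply/negP => xls.
move: px; rewrite hornerD hornerM hornerC; have /rootP -> : root (\prod_(a <- ls) ('X - a%:P)) x.
  by rewrite root_prod_XsubC.
by rewrite mul0r add0r => /eqP; rewrite oner_eq0.
Qed.

Section RegularParameters.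
Variables (k : closedFieldType) (R : comPzRingType).
Variables (kap : {rmorphism k -> R}) (ev : {rmorphism R -> k}).
Hypothesis evK : forall c, ev (kap c) = c.
Hypothesis ev_unit : forall u, ev u != 0 -> is_unit u.
Hypothesis nR : noetherian R.
Variables (n : nat) (y : 'I_n -> R).
Hypothesis y_ev : forall i, ev (y i) = 0.
Hypothesis y_gen : forall u, ev u = 0 -> generated_by y u.
Let m : set R := [set u | ev u = 0].

Lemma max_ideal : is_ideal m.
Proof.
split; first by rewrite /m /= rmorph0.
- by move=> a b ma mb; rewrite /m /= rmorphD ma mb addr0.
- by move=> a b mb; rewrite /m /= rmorphM mb mulr0.
Qed.

Lemma generated_max u : generated_by y u -> ev u = 0.
Proof.
by move=> [c ->]; apply: (ideal_sum _ max_ideal) => i _; apply: (ideal_mull _ max_ideal); exact: y_ev.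
Qed.

Lemma max_unit a : m a -> is_unit (1 - a).
Proof. by move=> ma; apply: ev_unit; rewrite rmorphB rmorph1 ma subr0 oner_neq0. Qed.

Lemma krull u : (forall s, gpow y s u) -> u = 0.
Proof.
by apply: krull_intersection => // a ya; apply: max_unit; exact: generated_max.
Qed.

(** For a proper ideal this is primariness to the maximal ideal. *)
Definition primary (I : set R) := exists N, gpow y N `<=` I.

Lemma gpow_pow q w : ev w = 0 -> gpow y q (w ^+ q).
Proof.
move=> /y_gen yw; elim: q => // q IH; rewrite exprS; exact: gpowM.
Qed.

(** High powers of the [x_j] lie in the ideal generated by the [q]-th powers of [ws]. Since [c] does
    not depend on the exponent, [almost_regular_parameters] puts [c^r] into every power of the
    maximal ideal, and Krull's theorem makes it zero. *)
Lemma no_small_parameters (x : nat -> R) c r :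
  (forall e, @almost_regular_on R (fun j => x j ^+ e) c r R^o) ->
  (forall j, ev (x j) = 0) -> (forall M, c ^+ M <> 0) ->
  forall ws, (size ws < r)%N -> (forall w, w \in ws -> ev w = 0) -> ~ primary (ideal_seq ws).
Proof.
move=> ar xm cn ws sr wm [N wsN]; apply: (cn r); apply: krull => q.
pose g (i : 'I_(size ws)) := nth 0 ws i.
pose us := [seq w ^+ q | w <- ws].
pose t := (\sum_(i < size ws) q).+1.
have : ideal_seq us (c ^+ r).
  apply: (almost_regular_parameters (ar (N * t)%N)); first by rewrite size_map.
  move=> j jr; rewrite exprM.
  have /ideal_seq_nth Ix : ideal_seq ws (x j ^+ N) by apply: wsN; exact: gpow_pow.
  have : gpow g t ((x j ^+ N) ^+ t).
    by elim: (t) => // t' IH; rewrite exprS; apply: gpowM.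
  move/(gpow_powers (ltnSn _)) => [b ->].
  apply: (ideal_sum _ (ideal_seq_ideal _)) => i _; apply: (ideal_mull _ (ideal_seq_ideal _)).
  by apply: ideal_seq_mem; apply: map_f; rewrite mem_nth.
apply: ideal_seq_min; first exact: gpow_ideal.
by move=> _ /mapP[w /wm mw ->]; exact: gpow_pow.
Qed.

(** The Vandermonde matrix of distinct constants is invertible over [k], so each [v_j] is a
    combination of the given elements of [Q]. *)
Lemma vandermonde_in (Q : set R) L (v : 'I_L -> R) (ls : 'I_L -> k) : is_ideal Q -> injective ls ->
  (forall i, Q (\sum_(j < L) kap (ls i) ^+ j * v j)) -> forall j, Q (v j).
Proof.
move=> QI inj H j.
pose V := Vandermonde L (\row_i ls i).
have Vu : V \in unitmx.
  rewrite unitmxE unitfE det_Vandermonde; apply/prodf_neq0 => i _.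
  apply/prodf_neq0 => i' ii'; rewrite !mxE subr_eq0; apply/eqP => /inj e.
  by rewrite e ltnn in ii'.
have -> : v j = \sum_i kap (invmx V i j) * \sum_(l < L) kap (ls i) ^+ l * v l.
  under eq_bigr do rewrite mulr_sumr; rewrite exchange_big /=.
  rewrite [RHS](eq_bigr (fun l => kap ((V *m invmx V) l j) * v l)).
    rewrite mulmxV // (bigD1 j) //= mxE eqxx rmorph1 mul1r big1 ?addr0 // => l /negPf lj.
    by rewrite mxE lj rmorph0 mul0r.
  move=> l _; rewrite mxE rmorph_sum mulr_suml; apply: eq_bigr => i _.
  by rewrite rmorphM !mxE rmorphXn mulrA; congr (_ * _); rewrite mulrC.
by apply: (ideal_sum _ QI) => i _; apply: (ideal_mull _ QI).
Qed.

Let comb (vs : seq R) (l : k) := \sum_(j < size vs) kap l ^+ j * nth 0 vs j.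

(** Avoidance by a one-parameter family: an ideal that misses some member of [vs] contains
    [comb vs l] for at most [size vs] values of [l], and [k] is infinite. *)
Let avoid_primes (vs : seq R) (Qs : seq (set R)) :
  (forall Q, in_list Qs Q -> is_ideal Q) -> exists l : k,
  forall Q, in_list Qs Q -> (exists2 v, v \in vs & ~ Q v) -> ~ Q (comb vs l).
Proof.
move=> QsI.
suff [l [_ lP]] : exists l, True /\ forall Q, in_list Qs Q ->
    (exists2 v, v \in vs & ~ Q v) -> ~ Q (comb vs l) by exists l.
have [ls [uls sls]] := closed_field_infinite k (size vs * size Qs).+1.
suff H : forall ls : seq k, uniq ls -> (size vs * size Qs < size ls)%N ->
    exists l, l \in ls /\ forall Q, in_list Qs Q -> (exists2 v, v \in vs & ~ Q v) -> ~ Q (comb vs l).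
  by have [|l [_ lP]] := H ls uls; [rewrite sls|exists l].
elim: Qs QsI {ls uls sls} => [|Q Qs IH] QsI ls uls sls.
  case: ls uls sls => // l ls _ _; exists l; rewrite mem_head; split=> // Q [i []] //.
have QI : is_ideal Q by apply: QsI; apply/in_list_cons; left.
have {}IH := IH (fun Q' H => QsI Q' (proj2 (in_list_cons _ _ _) (or_intror H))).
have [[v vvs Qv]|Qall] := pselect (exists2 v, v \in vs & ~ Q v); last first.
  have [|l [lls lP]] := IH ls uls.
  - by apply: leq_ltn_trans sls; rewrite leq_mul2l leqnSn orbT.
  by exists l; split=> // Q' /in_list_cons[->|/lP].
pose bad l := `[< Q (comb vs l) >].
have cbad : (count bad ls <= size vs)%N.
  rewrite leqNgt; apply/negP => big; apply: Qv.
  have iv : (index v vs < size vs)%N by rewrite index_mem.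
  have vE : v = nth 0 vs (Ordinal iv) by rewrite /= nth_index.
  pose bl := [seq l <- ls | bad l].
  have sbl : (size vs < size bl)%N by rewrite size_filter.
  rewrite vE; apply: (@vandermonde_in Q _ (fun i : 'I_(size vs) => nth 0 vs i)
    (fun i => nth 0 bl i)) => //.
    move=> i i' /eqP; rewrite nth_uniq; last exact: filter_uniq.
    - by move/eqP/val_inj.
    - exact: ltn_trans sbl.
    - exact: ltn_trans sbl.
  move=> i; have : nth 0 bl i \in bl by rewrite mem_nth // (ltn_trans _ sbl).
  by rewrite mem_filter => /andP[/asboolP].
have [||l [lls lP]] := IH [seq l <- ls | ~~ bad l].
- exact: filter_uniq.
- rewrite size_filter -(ltn_add2l (count bad ls)).
  rewrite (_ : (count bad ls + count (fun l => ~~ bad l) ls)%N = size ls); last first.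
    exact: (count_predC bad ls).
  by apply: leq_ltn_trans sls; rewrite /= mulnS leq_add2r.
move: lls; rewrite mem_filter => /andP[nb lls]; exists l; split=> // Q'.
by move=> /in_list_cons[-> _|/lP//]; move/asboolP: nb.
Qed.

Lemma prodin_max Qs I : is_ideal I -> (forall Q, in_list Qs Q -> m `<=` Q) ->
  prodin Qs I -> gpow y (size Qs) `<=` I.
Proof.
elim: Qs I => [|Q Qs IH] I II mQ /=.
  by move=> I1 a _; rewrite -[a]mulr1; exact: (ideal_mull _ II).
move=> H u [a Ha ->]; apply: (ideal_sum _ II) => i _.
apply: (IH [set b | I (y i * b)]) (Ha i).
- split; first by rewrite /= mulr0; exact: ideal0.
  + by move=> b b' Ib Ib'; rewrite /= mulrDr; exact: idealD.
  + by move=> b b' Ib'; rewrite /= mulrCA; exact: ideal_mull.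
- by move=> Q' HQ'; apply: mQ; apply/in_list_cons; right.
- by apply: H; apply: (mQ Q); [apply/in_list_cons; left|exact: y_ev].
Qed.

(* For [vs] of positive length take a prime factor [Q <> m] of [I = (us)] lying
   in the prime ideal [I + (w)], where [w], a general combination of [vs], is
   not in [Q]; then [Q = I + w Q]. *)
Lemma prime_of_parameters (vs us : seq R) :
  (forall u, u \in us ++ vs -> ev u = 0) -> (forall a, ev a = 0 -> ideal_seq (us ++ vs) a) ->
  (forall ws, (size ws < size us + size vs)%N -> (forall w, w \in ws -> ev w = 0) ->
     ~ primary (ideal_seq ws)) -> is_prime (ideal_seq us).
Proof.
elim: vs us => [|v vs IH] us in_m gen_m nP.
  rewrite cats0 in in_m gen_m.
  have E a : ideal_seq us a <-> ev a = 0.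
    split=> [|/gen_m//]; apply: (ideal_seq_min max_ideal) => u; exact: in_m.
  split; first exact: ideal_seq_ideal.
  - by move/E/eqP; rewrite rmorph1 oner_eq0.
  - move=> a b /E/eqP; rewrite rmorphM mulf_eq0 => /orP[]/eqP/E; by [left|right].
set I := ideal_seq us.
have II : is_ideal I by exact: ideal_seq_ideal.
have [Qs [prodQ primeQ]] := prime_factors nR II.
have [l lP] := @avoid_primes (v :: vs) Qs (fun Q H => let: And3 a _ _ := (primeQ Q H).1 in a).
set w := comb (v :: vs) l in lP.
have wE : w = v + \sum_(j < size vs) kap l ^+ j.+1 * nth 0 vs j.
  by rewrite /w /comb big_ord_recl expr0 mul1r.
have m_w : ev w = 0.
  apply: (ideal_sum _ max_ideal) => j _; apply: (ideal_mull _ max_ideal).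
  by apply: in_m; rewrite mem_cat mem_nth ?orbT.
have [I'I I'1 I'P] : is_prime (ideal_seq (w :: us)).
  apply: IH.
  - move=> u; rewrite cat_cons inE => /orP[/eqP ->//|]; rewrite mem_cat => /orP[]uu; apply: in_m.
      by rewrite mem_cat uu.
    by rewrite mem_cat inE uu !orbT.
  - move=> a /gen_m; apply: ideal_seq_sub => u.
    rewrite mem_cat inE => /or3P[uu|/eqP ->|uu].
    + by apply: ideal_seq_mem; rewrite inE mem_cat uu orbT.
    + have -> : v = w - \sum_(j < size vs) kap l ^+ j.+1 * nth 0 vs j by rewrite wE addrK.
      have J := ideal_seq_ideal ((w :: us) ++ vs).
      apply: (idealB J); first by apply: ideal_seq_mem; rewrite mem_head.
      apply: (ideal_sum _ J) => j _; apply: (ideal_mull _ J); apply: ideal_seq_mem.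
      by rewrite inE mem_cat mem_nth ?orbT.
    + by apply: ideal_seq_mem; rewrite inE mem_cat uu !orbT.
  - by move=> ws; rewrite /= addSnnS; exact: nP.
have II' : I `<=` ideal_seq (w :: us).
  by apply: ideal_seq_sub => u uu; apply: ideal_seq_mem; rewrite inE uu orbT.
have sub_m Q : is_prime Q -> Q `<=` m.
  move=> [QI Q1 _] a Qa; rewrite /m /=; apply: contrapT => /eqP/ev_unit[b ab].
  by apply: Q1; rewrite -ab; exact: (ideal_mulr _ QI).
(* If the prime [I + (w)] is smaller than [m], any factor of [I] inside it differs from [m]. If it
   equals [m], a factor other than [m] exists, as otherwise [I] would contain a power of [m] and
   have too few generators. *)
have [Q [HQ QI' [a ma Qa]]] : exists Q, [/\ in_list Qs Q, Q `<=` ideal_seq (w :: us) &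
    exists2 a, ev a = 0 & ~ Q a].
  have [[a [ma I'a]]|mI'] := pselect (exists a, ev a = 0 /\ ~ ideal_seq (w :: us) a).
    have [Q [HQ QI']] := prime_prodin (And3 I'I I'1 I'P) II' prodQ.
    by exists Q; split=> //; exists a => // /QI'.
  have {}mI' : m `<=` ideal_seq (w :: us).
    by move=> a ma; apply: contrapT => I'a; apply: mI'; exists a.
  apply: contrapT => H; apply: (nP us).
  - by rewrite /= addnS ltnS leq_addr.
  - by move=> u uu; apply: in_m; rewrite mem_cat uu.
  exists (size Qs); apply: prodin_max => // Q HQ a ma.
  apply: contrapT => Qa; apply: H; exists Q; split=> //; last by exists a.
  by apply: subset_trans mI'; apply: sub_m; exact: (primeQ Q HQ).1.
have [QP IQ] := primeQ Q HQ; have [QI Q1 QQ] := QP.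
(* With [w] in [Q], the choice of [l] would put all of [v :: vs] into [Q], hence all of the maximal
   ideal. *)
have Qw : ~ Q w.
  apply: lP => //; apply: contrapT => H; apply: Qa.
  move/gen_m: ma; apply: (ideal_seq_min QI) => u; rewrite mem_cat => /orP[uu|uu].
    by apply: IQ; exact: ideal_seq_mem.
  by apply: contrapT => Qu; apply: H; exists u.
suff -> : I = Q by [].
apply/seteqP; split=> //.
apply: (@nakayama R R^o m Q I) => //.
- exact: max_ideal.
- exact: max_unit.
- by case: QI => Q0 QD QM; apply: noetherian_regular.
move=> q Qq; have [b [a' [Ia' e]]] := QI' q Qq.
exists (b * w), a'; split=> //; rewrite mulrC; apply: (@mulset_in R R^o) => //.
have : Q (b * w).
  have -> : b * w = q - a' by rewrite e addrK.
  by apply: (idealB QI) => //; exact: IQ.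
by move/QQ => [].
Qed.

(** * Prime chains and regular sequences from generators of the maximal ideal *)

Section ParameterChains.
Variable us : seq R.
Let d := size us.
Hypothesis us_m : forall u, u \in us -> ev u = 0.
Hypothesis us_gen : forall a, ev a = 0 -> ideal_seq us a.
Hypothesis nP : forall ws, (size ws < d)%N -> (forall w, w \in ws -> ev w = 0) ->
     ~ primary (ideal_seq ws).

Let u_ i := nth 0 us i.
Let sub_seq (S : seq nat) := [seq u_ i | i <- S].

Let sub_m S : (forall i, i \in S -> (i < d)%N) -> forall u, u \in sub_seq S -> ev u = 0.
Proof. by move=> Sd u /mapP[i /Sd id ->]; apply: us_m; rewrite mem_nth. Qed.

Let compl (S : seq nat) := [seq i <- iota 0 d | i \notin S].

Let compl_size S : uniq S -> (forall i, i \in S -> (i < d)%N) -> (size S + size (compl S) = d)%N.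
Proof.
move=> uS Sd; rewrite -size_cat -[RHS](size_iota 0 d); apply: perm_size.
apply: uniq_perm; [|exact: iota_uniq|].
  rewrite cat_uniq uS filter_uniq ?iota_uniq // andbT; apply/hasPn => i.
  by rewrite mem_filter => /andP[].
move=> i; rewrite mem_cat mem_filter mem_iota /= add0n.
by have [/Sd ->|] := boolP (i \in S).
Qed.

Let sub_gen S : (forall i, (i < d)%N -> i \in S) -> forall a, ev a = 0 -> ideal_seq (sub_seq S) a.
Proof.
move=> HS a /us_gen; apply: ideal_seq_sub => u uu; apply: ideal_seq_mem; apply/mapP.
by exists (index u us); rewrite /u_ ?nth_index // HS // index_mem.
Qed.

(** Any subset of the generators can be taken as [us] in [prime_of_parameters], with the
    complementary generators as [vs]. *)
Lemma parameters_prime S : uniq S -> (forall i, i \in S -> (i < d)%N) -> is_prime (ideal_seq (sub_seq S)).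
Proof.
move=> uS Sd; have SCd i : i \in S ++ compl S -> (i < d)%N.
  by rewrite mem_cat mem_filter mem_iota => /orP[/Sd//|/and3P[]].
apply: (@prime_of_parameters (sub_seq (compl S))); rewrite -?map_cat.
- exact: sub_m SCd.
- apply: sub_gen => i id; rewrite mem_cat mem_filter mem_iota /= add0n id andbT.
  exact: orbN.
- by move=> ws; rewrite !size_map compl_size //; exact: nP.
Qed.

(** Otherwise [u_l] could be omitted, and fewer than [d] elements would generate the maximal
    ideal. *)
Lemma parameter_notin S l : uniq S -> (forall i, i \in S -> (i < d)%N) -> (l < d)%N -> l \notin S ->
  ~ ideal_seq (sub_seq S) (u_ l).
Proof.
move=> uS Sd ld lS Il; pose S' := S ++ compl (l :: S).
have S'd i : i \in S' -> (i < d)%N.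
  by rewrite mem_cat mem_filter mem_iota => /orP[/Sd//|/and3P[]].
apply: (nP (ws := sub_seq S')).
- rewrite size_map size_cat -addn1 -addnA addnCA addnC.
  by rewrite -(@compl_size (l :: S)) /= ?lS // => [|i]; rewrite ?inE; [rewrite addn1 addSn addnC|
    move=> /orP[/eqP ->|/Sd]].
- exact: sub_m.
exists 1%N => a [c _ ->].
have J := ideal_seq_ideal (sub_seq S').
apply: (ideal_sum _ J) => i _; apply: (ideal_mulr _ J).
move: (y_ev i) => /us_gen; apply: (ideal_seq_min J) => u uu.
have [e|e] := eqVneq (index u us) l.
  rewrite -(nth_index 0 uu) e -/(u_ l); apply: ideal_seq_sub Il => v /mapP[t tS ->].
  by apply: ideal_seq_mem; apply: map_f; rewrite mem_cat tS.
apply: ideal_seq_mem; rewrite -(nth_index 0 uu); apply: (map_f u_).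
rewrite mem_cat mem_filter mem_iota /= add0n index_mem uu andbT inE negb_or e /=.
exact: orbN.
Qed.

Lemma parameters_chain : exists P : 'I_d.+1 -> set R, prime_chain P.
Proof.
exists (fun i => ideal_seq (sub_seq (iota 0 i))); split.
  move=> i; apply: parameters_prime; first exact: iota_uniq.
  by move=> j; rewrite mem_iota add0n => /leq_trans; apply; rewrite -ltnS.
move=> i j ij; split.
  apply: ideal_seq_sub => _ /mapP[t ti ->]; apply: ideal_seq_mem; apply: map_f.
  move: ti; rewrite !mem_iota /= !add0n => /leq_trans; apply; exact: ltnW.
have id : (i < d)%N by apply: leq_trans ij _; rewrite -ltnS.
move/(_ (u_ i)) => H; apply: (@parameter_notin (iota 0 i) i) => //.
- exact: iota_uniq.
- by move=> t; rewrite mem_iota add0n => /ltn_trans; apply.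
- by rewrite mem_iota add0n ltnn.
by apply: H; apply: ideal_seq_mem; apply: map_f; rewrite mem_iota.
Qed.

Let K S (e : nat -> nat) := ideal_seq [seq u_ i ^+ e i | i <- S].
Let KI S e : is_ideal (K S e). Proof. exact: ideal_seq_ideal. Qed.

Let K_split S e i a : i \in S -> K S e a -> exists c b, K (rem i S) e b /\ a = c * u_ i ^+ e i + b.
Proof.
move=> iS; suff : K S e a -> K (i :: rem i S) e a by [].
apply: ideal_seq_sub => _ /mapP[t tS ->]; apply: ideal_seq_mem; apply: (map_f (fun i => u_ i ^+ e i)).
by rewrite -(perm_mem (perm_to_rem iS)).
Qed.

Let K_join S e i c b : i \in S -> K (rem i S) e b -> K S e (c * u_ i ^+ e i + b).
Proof.
move=> iS Kb; apply: (idealD (KI _ _)).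
  apply: (ideal_mull _ (KI _ _)); apply: ideal_seq_mem.
  exact: (map_f (fun i => u_ i ^+ e i)).
apply: ideal_seq_sub Kb => _ /mapP[t tS ->]; apply: ideal_seq_mem.
by apply: (map_f (fun i => u_ i ^+ e i)); rewrite (perm_mem (perm_to_rem iS)) inE tS orbT.
Qed.

Let K_eq S e e' : (forall i, i \in S -> e i = e' i) -> K S e = K S e'.
Proof. by move=> H; congr ideal_seq; apply/eq_in_map => i /H ->. Qed.

(** Induction on the total exponent. If all exponents are 1, the ideal is prime and does not contain
    [u_l]. Otherwise an exponent [e_i > 1] is lowered to [e_i - 1], which gives
    [a = a' u_i^(e_i - 1)] modulo the other generators; cancelling this power of [u_i] leaves a
    statement about [u_l a'] with exponent 1 at [i]. *)
Let nonzerodivisor N S e l a : (\sum_(i <- S) e i <= N)%N -> uniq S ->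
  (forall i, i \in S -> (i < d)%N) -> (forall i, (0 < e i)%N) -> (l < d)%N -> l \notin S ->
  K S e (u_ l * a) -> K S e a.
Proof.
elim: N S e l a => [|N IH] S e l a SN uS Sd e0 ld lS Kla.
  case: S SN uS Sd lS Kla => [|i S]; last by rewrite big_cons leqn0 addn_eq0 eqn0Ngt e0.
  move=> _ _ Sd _; have [_ _ PP] := @parameters_prime [::] isT Sd.
  by move=> /PP[/parameter_notin|//]; case.
have [[i iS ei]|all1] := pselect (exists2 i, i \in S & e i <> 1%N); last first.
  have E : K S e = ideal_seq (sub_seq S).
    rewrite /K /sub_seq; congr ideal_seq; apply/eq_in_map => i iS.
    by rewrite (_ : e i = 1%N) ?expr1 //; apply: contrapT => ei; apply: all1; exists i.
  move: Kla; rewrite E; have [_ _ PP] := parameters_prime uS Sd.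
  by move=> /PP[/parameter_notin|//]; case.
have ei1 : (1 < e i)%N by rewrite ltn_neqAle e0 andbT eq_sym; apply/eqP.
have uS' : uniq (rem i S) by exact: rem_uniq.
have S'S j : j \in rem i S -> j \in S by exact: mem_rem.
have iS' : i \notin rem i S by rewrite mem_rem_uniqF.
have lS' : l \notin rem i S by apply: contra lS; exact: S'S.
pose ew t := fun j => if j == i then t else e j.
have ewi t : ew t i = t by rewrite /ew eqxx.
have ewS' t : K (rem i S) (ew t) = K (rem i S) e.
  by apply: K_eq => j jS'; rewrite /ew; case: eqP => // ji; move: jS'; rewrite ji (negPf iS').
have ew0 t : (0 < t)%N -> forall j, (0 < ew t j)%N by move=> t0 j; rewrite /ew; case: eqP.
have sumE t : (\sum_(j <- S) ew t j = t + \sum_(j <- rem i S) e j)%N.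
  rewrite (perm_big _ (perm_to_rem iS)) /= big_cons ewi; congr (_ + _)%N.
  by apply: eq_big_seq => j jS'; rewrite /ew; case: eqP => // ji; move: jS'; rewrite ji (negPf iS').
have sumS : (\sum_(j <- S) e j = e i + \sum_(j <- rem i S) e j)%N.
  by rewrite (perm_big _ (perm_to_rem iS)) /= big_cons.
have less t : (t < e i)%N -> (\sum_(j <- S) ew t j <= N)%N.
  by move=> te; rewrite sumE -ltnS (leq_trans _ SN) // sumS ltn_add2r.
have [c [b [Kb Eb]]] := K_split iS Kla.
have [a' [b' [Kb' Ea]]] : exists a' b', K (rem i S) e b' /\ a = a' * u_ i ^+ (e i).-1 + b'.
  have [|a' [b' []]] := @K_split S (ew (e i).-1) i a iS.
    apply: (IH _ _ l) => //; first by apply: less; rewrite ltn_predL.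
    - by apply: ew0; rewrite -ltnS (ltn_predK ei1).
    rewrite Eb -(ltn_predK ei1) exprS mulrA -{2}(ewi (e i).-1).
    by apply: K_join => //; rewrite ewS'.
  by rewrite ewS' ewi => Kb' ->; exists a', b'.
have nz t f : K (rem i S) e (u_ i ^+ t * f) -> K (rem i S) e f.
  elim: t => [|t IHt]; first by rewrite mul1r.
  rewrite exprS -mulrA => H; apply: IHt; apply: (IH _ _ i) => //.
  - by rewrite -ltnS (leq_trans _ SN) // sumS -[X in (X < _)%N]add0n ltn_add2r ltnW.
  - by move=> j /S'S/Sd.
  - exact: Sd.
have Kf : K (rem i S) e (u_ l * a' - c * u_ i).
  apply: (nz (e i).-1).
  have -> : u_ i ^+ (e i).-1 * (u_ l * a' - c * u_ i) = b - u_ l * b'.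
    have E : u_ l * (a' * u_ i ^+ (e i).-1 + b') = c * (u_ i * u_ i ^+ (e i).-1) + b.
      by rewrite -Ea Eb -exprS (ltn_predK ei1).
    have -> : b = u_ l * (a' * u_ i ^+ (e i).-1 + b') - c * (u_ i * u_ i ^+ (e i).-1).
      by rewrite E addrC addKr.
    by ring.
  by apply: (idealB (KI _ _)) => //; apply: (ideal_mull _ (KI _ _)).
have [|a'' [b'' []]] := @K_split S (ew 1%N) i a' iS.
  apply: (IH _ _ l) => //; [exact: less|exact: ew0|].
  have -> : u_ l * a' = c * u_ i ^+ (ew 1%N i) + (u_ l * a' - c * u_ i).
    by rewrite ewi expr1 addrC subrK.
  by apply: K_join => //; rewrite ewS'.
rewrite ewS' ewi expr1 => Kb'' Ea'; rewrite Ea Ea' mulrDl -mulrA -exprS (ltn_predK ei1) -addrA.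
apply: K_join => //; apply: (idealD (KI _ _)) => //; exact: (ideal_mulr _ (KI _ _)).
Qed.

(** The factors of [u_j^e] are cancelled one at a time by [nonzerodivisor], which allows arbitrary
    exponents on the preceding generators. *)
Lemma parameters_regular e : (0 < e)%N ->
  @almost_regular_on R (fun j => nth 0 us j ^+ e) 1 d R^o.
Proof.
move=> e0 j u jd.
have E v : @seq_multiples R (fun j => nth 0 us j ^+ e) j R^o v <-> K (iota 0 j) (fun=> e) v.
  split=> [[w ->]|].
    apply: (ideal_sum _ (KI _ _)) => l _; rewrite /GRing.scale /=.
    apply: (ideal_mulr _ (KI _ _)); apply: ideal_seq_mem.
    by apply: (map_f (fun i => u_ i ^+ e)); rewrite mem_iota add0n /=.
  apply: (@ideal_seq_min R _ (@seq_multiples R (fun j => nth 0 us j ^+ e) j R^o)).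
    split=> [|a b|a b]; [exact: (@seq_multiples0 R _ j R^o)|exact: (@seq_multiplesD R _ j R^o)|].
    exact: (@seq_multiplesZ R _ j R^o).
  move=> u1 /mapP[i]; rewrite mem_iota add0n /= => ij ->.
  exists (fun l => (l == i)%:R); rewrite (bigD1 (Ordinal ij)) //= eqxx /GRing.scale /= mulr1.
  by rewrite big1 ?addr0 // => l; rewrite -val_eqE /= => /negPf ->; rewrite mulr0.
rewrite scale1r => /E; rewrite /GRing.scale /= => H; apply/E.
have : K (iota 0 j) (fun=> e) (u_ j ^+ e * u) by [].
elim: (X in u_ j ^+ X) => [|t IH]; first by rewrite mul1r.
rewrite exprS -mulrA => /(@nonzerodivisor _ _ _ j _ (leqnn _)) H'; apply: IH; apply: H' => //.
- exact: iota_uniq.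
- by move=> i; rewrite mem_iota add0n => /ltn_trans; apply.
- by rewrite mem_iota add0n ltnn.
Qed.

End ParameterChains.
End RegularParameters.

(** * Algebras of finite type over an algebraically closed field *)

Lemma rmorphism_exists (R S : pzRingType) (f : R -> S) : f 1 = 1 ->
  {morph f : x y / x - y} -> {morph f : x y / x * y} ->
  exists F : {rmorphism R -> S}, forall x, F x = f x.
Proof.
move=> f1 fB fM.
pose F : {rmorphism R -> S} := HB.pack f (GRing.isZmodMorphism.Build R S f fB)
  (GRing.isMonoidMorphism.Build R S f (f1, fM)).
by exists F.
Qed.

Lemma comNzRing_exists (A : comPzRingType) : 1 <> 0 :> A ->
  exists A' : comNzRingType, A = A' :> comPzRingType.
Proof.
move=> /eqP nz.
pose A' : comNzRingType := HB.pack (GRing.ComPzRing.sort A)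
  (GRing.PzSemiRing_isNonZero.Build (GRing.ComPzRing.sort A) nz).
by exists A'; case: A nz @A'.
Qed.

(** The value of [u] is the constant [c] for which [u - c] is a nonunit; its uniqueness yields
    compatibility with sums and products. *)
Lemma residue_field_morphism (k : fieldType) (R : comPzRingType) (kap : {rmorphism k -> R}) :
  local_ring R -> (forall u, exists c, nonunits (u - kap c)) ->
  exists ev : {rmorphism R -> k}, (forall c, ev (kap c) = c) /\
    forall u, ev u != 0 <-> is_unit u.
Proof.
move=> loc /choice[f fP].
have uniq u c c' : nonunits (u - kap c) -> nonunits (u - kap c') -> c = c'.
  move=> H H'; apply/eqP; rewrite -subr_eq0; apply/negPn/negP => cc.
  have : nonunits (kap (c - c')).
    have -> : kap (c - c') = (u - kap c') - (u - kap c) by rewrite rmorphB; ring.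
    exact: (idealB loc).
  by apply; exists (kap (c - c')^-1); rewrite -rmorphM mulfV ?rmorph1.
have n0 : nonunits (0 : R) by exact: ideal0 loc.
have [|u v|u v|ev evE] := @rmorphism_exists R k f.
- by apply: (uniq 1) => //; rewrite rmorph1 subrr.
- apply: (uniq (u - v)) => //.
  have -> : u - v - kap (f u - f v) = (u - kap (f u)) - (v - kap (f v)) by rewrite rmorphB; ring.
  exact: (idealB loc).
- apply: (uniq (u * v)) => //.
  have -> : u * v - kap (f u * f v) = u * (v - kap (f v)) + kap (f v) * (u - kap (f u)).
    by rewrite rmorphM; ring.
  by apply: (idealD loc); exact: (ideal_mull _ loc).
exists ev; split=> [c|u]; rewrite evE.
  by apply: (uniq (kap c)) => //; rewrite subrr.
split=> [fu|[v uv]].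
  apply: contrapT => nu; case/eqP: fu; apply: (uniq u) => //.
  by rewrite raddf0 subr0.
apply/eqP => fu0; have := fP u; rewrite fu0 raddf0 subr0; apply; by exists v.
Qed.

Section HilbertBasis.
Variables (C A : comPzRingType) (f : {rmorphism C -> A}) (a : A).
Hypothesis nC : noetherian C.
Hypothesis genA : forall u : A, exists N (b : nat -> C), u = \sum_(i < N) f (b i) * a ^+ i.

(** The argument on leading coefficients is run inside [A], where an element may have several
    expressions as a polynomial in [a]. Degrees are therefore replaced by the predicate [low], and
    [L d] collects the leading coefficients of all expressions of degree [d] for elements of [I]. *)
Lemma hilbert_basis : noetherian A.
Proof.
move=> I II.
pose low d (v : A) := exists b : nat -> C, v = \sum_(i < d) f (b i) * a ^+ i.
have lowD d v v' : low d v -> low d v' -> low d (v + v').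
  move=> [b ->] [b' ->]; exists (fun i => b i + b' i).
  by rewrite -big_split; apply: eq_bigr => i _; rewrite rmorphD mulrDl.
have lowZ d c v : low d v -> low d (f c * v).
  move=> [b ->]; exists (fun i => c * b i).
  by rewrite mulr_sumr; apply: eq_bigr => i _; rewrite rmorphM mulrA.
have low0 d : low d 0.
  by exists (fun=> 0); rewrite big1 // => i _; rewrite raddf0 mul0r.
have lowX d v : low d v -> low d.+1 (a * v).
  move=> [b ->]; exists (fun i => if i is i'.+1 then b i' else 0).
  rewrite big_ord_recl raddf0 mul0r add0r mulr_sumr; apply: eq_bigr => i _.
  by rewrite exprS; ring.
pose L d : set C^o := [set c | exists2 v, low d v & I (f c * a ^+ d + v)].
have LI d : is_ideal (L d : set C).
  split.
  - by exists 0; rewrite // raddf0 mul0r addr0; exact: ideal0.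
  - move=> c c' [v lv Iv] [v' lv' Iv']; exists (v + v'); first exact: lowD.
    by rewrite rmorphD mulrDl addrACA; exact: idealD.
  - move=> c c' [v lv Iv]; exists (f c * v); first exact: lowZ.
    by rewrite rmorphM -mulrA -mulrDr; exact: ideal_mull.
have LS d : L d `<=` L d.+1.
  move=> c [v lv Iv]; exists (a * v); first exact: lowX.
  by rewrite exprSr mulrA mulrC -mulrDr; exact: ideal_mull.
have Lle d e : (d <= e)%N -> L d `<=` L e.
  by move/subnK <-; elim: (e - d)%N => // t IH c /IH; exact: LS.
have [||_ [D ->] maxD] := @noetherian_mod_max C C^o [set N | exists d, N = L d] (L 0%N)
  (noetherian_regular nC).
- by exists 0%N.
- by move=> _ [d ->]; exact: LI.
have /choice[ng /choice[g gP]] d : exists n, exists g : nat -> C,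
    forall c, L d c <-> exists b : nat -> C, c = \sum_(i < n) b i * g i.
  have [n [g Lg]] := nC (LI d); exists n, (fun i => if insub i is Some j then g j else 0) => c.
  have E : forall b : nat -> C, \sum_(i < n) b i * (if insub (nat_of_ord i) is Some j then g j else 0) =
      \sum_(i < n) b i * g i by move=> b; apply: eq_bigr => i _; rewrite valK.
  rewrite -[L d c]/((L d : set C) c) Lg; split=> [[b ->]|[b ->]].
    pose b' i := if insub i is Some j then b j else 0.
    exists b'; rewrite (E b'); apply: eq_bigr => i _.
    by rewrite /b' valK.
  by exists (fun i => b i); exact: E.
have Lg d i : (i < ng d)%N -> L d (g d i).
  move=> id; apply/gP; exists (fun j => (j == i)%:R); rewrite (bigD1 (Ordinal id)) //= eqxx mul1r.
  by rewrite big1 ?addr0 // => j; rewrite -val_eqE /= => /negPf ->; rewrite mul0r.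
have /choice[w wP] (di : nat * nat) : exists w : A, (di.2 < ng di.1)%N ->
    I w /\ low di.1 (w - f (g di.1 di.2) * a ^+ di.1).
  have [/Lg[v lv Iv]|] := boolP (di.2 < ng di.1)%N; last by exists 0.
  by exists (f (g di.1 di.2) * a ^+ di.1 + v) => _; split=> //; rewrite (addrC _ v) addrK.
pose T : finType := {d : 'I_D.+1 & 'I_(ng d)}.
pose G (t : T) := w (nat_of_ord (tag t), nat_of_ord (tagged t)).
have IG t : I (G t) by have [] := wP (nat_of_ord (tag t), nat_of_ord (tagged t)) (ltn_ord _).
pose J : set A^o := [set u | exists c : T -> A, u = \sum_t c t * G t].
have JI : is_ideal (J : set A).
  split.
  - by exists (fun=> 0); rewrite big1 // => t _; rewrite mul0r.
  - move=> _ _ [c ->] [c' ->]; exists (fun t => c t + c' t).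
    by rewrite -big_split; apply: eq_bigr => t _; rewrite mulrDl.
  - move=> v _ [c ->]; exists (fun t => v * c t).
    by rewrite mulr_sumr; apply: eq_bigr => t _; rewrite mulrA.
have JG t : J (G t).
  exists (fun t' => (t' == t)%:R); rewrite (bigD1 t) //= eqxx mul1r big1 ?addr0 // => t' /negPf ->.
  by rewrite mul0r.
suff IJ d u : low d u -> I u -> J u.
  have [n [h Ih]] : fg_submod (I : set A^o).
    apply: (@fg_submod_fin A A^o I T G) => // u Iu; have [N [b ub]] := genA u.
    by apply: (IJ N) => //; exists b.
  by exists n, h; rewrite -[LHS]/(I : set A^o) Ih.
elim: d u => [|d IH] u; first by move=> [b ->] _; rewrite big_ord0; exact: (ideal0 JI).
move=> [b ->]; rewrite big_ord_recr /= => Iu.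
(* Beyond degree [D] the ideals [L d] no longer grow, so a leading coefficient in degree [d > D]
   already occurs in degree [D]. *)
pose e := minn d D.
have Lb : L e (b d).
  have Ld : L d (b d) by exists (\sum_(i < d) f (b i) * a ^+ i); [exists b|rewrite addrC].
  rewrite /e; case: leqP => // Dd.
  by apply: (maxD (L d)) Ld; [exists d|exact/Lle/ltnW].
have [c ec] := (gP e (b d)).1 Lb.
have eD : (e < D.+1)%N by rewrite ltnS geq_minr.
have ed : (e <= d)%N by rewrite geq_minl.
pose v := a ^+ (d - e) * \sum_(i < ng e) f (c i) * w (e, nat_of_ord i).
have Jv : J v.
  apply: (ideal_mull _ JI); apply: (ideal_sum _ JI) => i _; apply: (ideal_mull _ JI).
  exact: (JG (Tagged (fun d : 'I_D.+1 => 'I_(ng d)) (i : 'I_(ng (Ordinal eD))))).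
have Iv : I v.
  by apply: (ideal_mull _ II); apply: (ideal_sum _ II) => i _; apply: (ideal_mull _ II);
    have [] := wP (e, nat_of_ord i) (ltn_ord i).
clear u; set u := _ + _ in Iu *.
suff l : low d (u - v).
  by rewrite -(subrK v u); apply: (idealD JI) => //; apply: IH => //; exact: (idealB II).
have -> : u - v = \sum_(i < d) f (b i) * a ^+ i -
    a ^+ (d - e) * \sum_(i < ng e) f (c i) * (w (e, nat_of_ord i) - f (g e i) * a ^+ e).
  under [X in _ = _ - _ * X]eq_bigr => i _ do rewrite mulrBr.
  rewrite sumrB mulrBr -/v opprB addrA; congr (_ - _); rewrite /u; congr (_ + _).
  rewrite ec rmorph_sum -{1}(subnK ed) exprD mulr_suml mulr_sumr /=; apply: eq_bigr => i _.
  by rewrite rmorphM; ring.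
have lowXn t e' v' : low e' v' -> low (e' + t)%N (a ^+ t * v').
  elim: t => [|t IHt] lv; first by rewrite addn0 mul1r.
  by rewrite addnS exprS -mulrA; apply: lowX; exact: IHt.
apply: (lowD); first by exists b.
rewrite -mulN1r -(rmorphN1 f); apply: (lowZ); rewrite -[X in low X _](subnKC ed); apply: lowXn.
apply: (big_ind (low e)) => [||i _]; [exact: low0|exact: lowD|].
by apply: lowZ; have [] := wP (e, nat_of_ord i) (ltn_ord i).
Qed.

End HilbertBasis.

Lemma noetherian_image (C A : comPzRingType) (f : {rmorphism C -> A}) :
  noetherian C -> (forall u, exists c, u = f c) -> noetherian A.
Proof.
move=> nC surj; apply: (@hilbert_basis C A f 0) => // u.
have [c ->] := surj u; exists 1%N, (fun=> c); by rewrite big_ord1 expr0 mulr1.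
Qed.

Lemma mpoly_noetherian (k : fieldType) n : noetherian {mpoly k[n]}.
Proof.
elim: n => [|n IH].
  have C0 (p : {mpoly k[0]}) : p = (p@_0)%:MP.
    by apply/mpolyP => m; rewrite mcoeffC; have -> : m = 0%MM by [apply/mnmP => -[]]; rewrite eqxx mulr1.
  move=> I II; have [[p Ip p0]|I0] := pselect (exists2 p, I p & p != 0).
    have I1 : I 1.
      have {}p0 : p@_0 != 0 by move: p0; rewrite {1}(C0 p) mpolyC_eq0.
      have -> : 1 = (p@_0)^-1%:MP * p by rewrite {2}(C0 p) -mpolyCM mulVf.
      exact: ideal_mull.
    exists 1%N, (fun=> 1); apply/seteqP; split=> [q _|q _].
      by exists (fun=> q); rewrite big_ord1 mulr1.
    by rewrite -[q]mulr1; exact: ideal_mull.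
  exists 0%N, (fun=> 0); apply/seteqP; split=> [q Iq|q [c ->]]; last first.
    by rewrite big_ord0; exact: ideal0.
  exists (fun=> 0); rewrite big_ord0; apply/eqP/negPn/negP => q0.
  by apply: I0; exists q.
apply: (@hilbert_basis {mpoly k[n]} {mpoly k[n.+1]} (@mwiden n k) 'X_ord_max IH) => p.
have H0 : exists N (b : nat -> {mpoly k[n]}), 0 = \sum_(i < N) mwiden (b i) * 'X_ord_max ^+ i :> {mpoly k[n.+1]}.
  by exists 0%N, (fun=> 0); rewrite big_ord0.
rewrite (mpolyE p); elim/big_ind: _ => // [q q' [N [b ->]] [N' [b' ->]]|m _].
  exists (maxn N N'), (fun i => (if (i < N)%N then b i else 0) + (if (i < N')%N then b' i else 0)).
  rewrite (big_ord_widen (maxn N N') (fun i => mwiden (b i) * 'X_ord_max ^+ i) (leq_maxl _ _)).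
  rewrite (big_ord_widen (maxn N N') (fun i => mwiden (b' i) * 'X_ord_max ^+ i) (leq_maxr _ _)).
  rewrite [X in X + _]big_mkcond [X in _ + X]big_mkcond -big_split.
  apply: eq_bigr => i _ /=.
  by rewrite raddfD /= mulrDl; congr (_ + _); case: ifP => // _; rewrite raddf0 mul0r.
exists (m ord_max).+1, (fun i => if i == m ord_max then
  p@_m *: 'X_[[multinom m (widen_ord (leqnSn n) i) | i < n]] else 0).
rewrite big_ord_recr /= eqxx big1 ?add0r => [|i _]; last first.
  by rewrite ltn_eqF // raddf0 mul0r.
rewrite mwidenZ mwidenX -scalerAl mpolyXn -mpolyXD; congr (_ *: 'X_[_]).
apply/mnmP => i; rewrite mnmDE mulmnE mnm1E.
have [->|im] := eqVneq i ord_max; first by rewrite mnmwiden_ordmax mul1n.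
have lt : (i < n)%N.
  by rewrite ltn_neqAle -ltnS ltn_ord andbT; apply: contra im => /eqP ei; apply/eqP/val_inj.
have -> : i = widen_ord (leqnSn n) (Ordinal lt) by exact: val_inj.
by rewrite mnmwiden_widen mnmE mul0n addn0.
Qed.

(** * Hilbert's Nullstellensatz *)

Section FinitelyGeneratedAlgebras.
Variables (k : closedFieldType) (A : comNzRingType) (iota : {rmorphism k -> A}).
Variables (s : nat) (g : 'I_s -> A).
Hypothesis gen_g : forall S : set A, (forall c, S (iota c)) -> (forall i, S (g i)) ->
    (forall a b, S a -> S b -> S (a + b)) ->
    (forall a b, S a -> S b -> S (a * b)) -> forall a, S a.

Lemma mmap_surj a : exists p, a = mmap iota g p.
Proof.
move: a; apply: gen_g => [c|i|a b [p ->] [q ->]|a b [p ->] [q ->]].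
- by exists c%:MP; rewrite mmapC.
- by exists 'X_i; rewrite mmapX mmap1U.
- by exists (p + q); rewrite raddfD.
- by exists (p * q); rewrite rmorphM.
Qed.

Lemma fg_noetherian : noetherian A.
Proof. exact: (noetherian_image (@mpoly_noetherian k s) mmap_surj). Qed.

(** Noether normalization of the quotient [B]. A coordinate [x_0] would have an inverse in [B],
    integral over [k[x]]; multiplied by a power of [x_0], its monic equation becomes a polynomial
    relation which at the origin reads [1 = 0]. So there are no coordinates, [B] is integral over
    [k], and monic polynomials over [k] split. *)
Lemma maximal_residue (M : set A) : is_ideal M -> ~ M 1 ->
  (forall a, ~ M a -> exists b, M (1 - a * b)) -> forall a, exists c, M (a - iota c).
Proof.
move=> MI M1 Mmax.
have MP a b : M (a * b) -> M a \/ M b.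
  move=> Mab; have [|/Mmax[c Mc]] := pselect (M a); [by left|right].
  have -> : b = b * (1 - a * c) + a * b * c by ring.
  by apply: (idealD MI); [exact: (ideal_mull _ MI)|exact: (ideal_mulr _ MI)].
have TS : is_subring [set: A] by [].
pose B0 : comPzRingType := subquot TS (ideal0 MI) (fun a b => @idealB A M a b MI)
  (fun a b _ => @ideal_mull A M a b MI).
pose q (a : A) : B0 := to_subq TS (ideal0 MI) (fun a b => @idealB A M a b MI)
  (fun a b _ => @ideal_mull A M a b MI) a.
have q0 a : q a = 0 <-> M a by exact: to_subq_eq0.
have qs (b : B0) : exists a, b = q a.
  by have [a _ ->] := to_subq_surj b; exists a.
have [|a b|a b|Q QE] := @rmorphism_exists A B0 q.
- by [].
- by rewrite /q to_subqD // to_subqN.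
- exact: to_subqM.
have {}q0 a : Q a = 0 <-> M a by rewrite QE.
have {}qs (b : B0) : exists a, b = Q a by have [a ->] := qs b; exists a.
clear QE; clear q; clearbody B0.
have [|B eB] := @comNzRing_exists B0; first by rewrite -(rmorph1 Q) => /q0.
subst B0.
pose iB : {rmorphism k -> B} := Q \o iota.
have [r [x [xi xint]]] := noether_normalization iB (fun i => Q (g i)).
have int_all a : integralOver (mmap iB x) (Q a).
  move: a; apply: gen_g => //.
  - by move=> c; exact: (integral_mmap_iota iB x c).
  - by move=> a b; rewrite rmorphD; exact: integral_add.
  - by move=> a b; rewrite rmorphM; exact: integral_mul.
case: r x xi xint int_all => [|r] x xi xint int_all; last first.
  have [a ea] := qs (x ord0).
  have Ma : ~ M a.
    move=> /q0 a0; have : 'X_ord0 = 0 :> {mpoly k[r.+1]}.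
      by apply: xi; rewrite mmapX mmap1U ea a0.
    move/(congr1 (fun p : {mpoly k[r.+1]} => p@_(U_(ord0)%MM))).
    by rewrite mcoeffX eqxx mcoeff0 => /eqP; rewrite oner_eq0.
  have [b Mb] := Mmax _ Ma.
  have xb : x ord0 * Q b = 1.
    by apply/esym/eqP; rewrite ea -rmorphM -(rmorph1 Q) -subr_eq0 -rmorphB; apply/eqP/q0.
  have [p pm] := int_all b; rewrite /root (@horner_coef_wide _ (size p)) ?size_poly // => /eqP pr.
  set N := size p in pr.
  have N0 : (0 < N)%N by rewrite lt0n size_poly_eq0 monic_neq0.
  have : \sum_(i < N) p`_i * 'X_ord0 ^+ (N.-1 - i) = 0.
    apply: xi; rewrite rmorph_sum /=.
    transitivity (x ord0 ^+ N.-1 * \sum_(i < N) (map_poly (mmap iB x) p)`_i * Q b ^+ i); last first.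
      by rewrite pr mulr0.
    rewrite mulr_sumr; apply: eq_bigr => i _; rewrite rmorphM rmorphXn /= mmapX mmap1U coef_map.
    have iN : (i <= N.-1)%N by rewrite -ltnS (prednK N0).
    by rewrite -{2}(subnK iN) exprD mulrCA -!mulrA -exprMn xb expr1n mulr1 mulrC.
  move/(congr1 (mmap idfun (fun _ : 'I_r.+1 => 0 : k))); rewrite raddf0 rmorph_sum /=.
  rewrite -[N](prednK N0) big_ord_recr /= subnn expr0 mulr1.
  have -> : p`_N.-1 = 1 by exact/eqP/pm.
  rewrite rmorph1 big1 ?add0r => [/eqP|i _]; first by rewrite oner_eq0.
  by rewrite rmorphM rmorphXn /= mmapX mmap1U expr0n subn_eq0 leqNgt ltn_ord mulr0.
move=> a; have [p pm pr] := int_all a.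
have C0 (f : {mpoly k[0]}) : f = (f@_0)%:MP.
  by apply/mpolyP => m; rewrite mcoeffC; have -> : m = 0%MM by [apply/mnmP => -[]]; rewrite eqxx mulr1.
pose ev : {rmorphism {mpoly k[0]} -> k} := mmap idfun (fun _ : 'I_0 => 0).
have evE f : ev f = f@_0 by rewrite {1}(C0 f) /ev /= mmapC.
pose pk := map_poly ev p.
have [zs pkE] := closed_field_poly_normal pk.
have pk1 : lead_coef pk = 1 by apply/eqP; exact: monic_map.
have : \prod_(z <- zs) (Q a - iB z) = 0.
  have /rootP <- : root (map_poly iB pk) (Q a).
    congr (root _ _): pr; apply/polyP => i; rewrite !coef_map /= evE [X in mmap _ _ X]C0.
    by rewrite mmapC.
  rewrite pkE pk1 scale1r rmorph_prod horner_prod /=; apply: eq_bigr => z _.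
  by rewrite map_polyXsubC hornerXsubC.
elim: zs {pkE} => [|z zs IH]; first by rewrite big_nil => /eqP; rewrite oner_eq0.
rewrite big_cons => H.
have [b eb] := qs (\prod_(z <- zs) (Q a - iB z)).
have : M ((a - iota z) * b) by apply/q0; rewrite rmorphM rmorphB -eb.
by move=> /MP[|/q0]; [exists z|rewrite -eb; exact: IH].
Qed.

Lemma maximal_exists (I : set A) : is_ideal I -> ~ I 1 -> exists M : set A,
  [/\ is_ideal M, ~ M 1, I `<=` M & forall a, ~ M a -> exists b, M (1 - a * b)].
Proof.
move=> II I1.
pose F : set (set A^o) := [set J | [/\ is_ideal (J : set A), ~ J 1 & I `<=` J]].
have [||M [MI M1 IM] maxM] := @noetherian_mod_max A A^o F I (noetherian_regular fg_noetherian).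
- by split.
- by move=> N [].
exists M; split=> // a Ma; apply: contrapT => H; apply: Ma.
pose N : set A^o := [set u | exists b w, M w /\ u = a * b + w].
apply: (maxM N); last by exists 1, 0; rewrite mulr1 addr0; split=> //; exact: (ideal0 MI).
  split.
  - split.
    + by exists 0, 0; rewrite mulr0 addr0; split=> //; exact: (ideal0 MI).
    + move=> _ _ [b [w [Mw ->]]] [b' [w' [Mw' ->]]]; exists (b + b'), (w + w').
      by split; [exact: (idealD MI)|rewrite mulrDr addrACA].
    + move=> c _ [b [w [Mw ->]]]; exists (c * b), (c * w).
      by split; [exact: (ideal_mull _ MI)|rewrite mulrDr mulrCA].
  - move=> [b [w [Mw e]]]; apply: H; exists b.
    by rewrite e addrC addKr.
  - by move=> u Iu; exists 0, u; rewrite mulr0 add0r; split=> //; exact: IM.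
by move=> u Mu; exists 0, u; rewrite mulr0 add0r.
Qed.

Lemma weak_nullstellensatz (I : set A) : is_ideal I -> ~ I 1 ->
  exists ev : {rmorphism A -> k}, (forall c, ev (iota c) = c) /\ forall a, I a -> ev a = 0.
Proof.
move=> II I1; have [M [MI M1 IM Mmax]] := maximal_exists II I1.
have /choice[f fP] := maximal_residue MI M1 Mmax.
have uniq u c c' : M (u - iota c) -> M (u - iota c') -> c = c'.
  move=> H H'; apply/eqP; rewrite -subr_eq0; apply/negPn/negP => cc; apply: M1.
  have -> : 1 = iota (c - c')^-1 * ((u - iota c') - (u - iota c)).
    rewrite (_ : u - iota c' - (u - iota c) = iota (c - c')); last by rewrite rmorphB; ring.
    by rewrite -rmorphM mulVf ?rmorph1.
  by apply: (ideal_mull _ MI); exact: (idealB MI).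
have [|u v|u v|ev evE] := @rmorphism_exists A k f.
- by apply: (uniq 1) => //; rewrite rmorph1 subrr; exact: (ideal0 MI).
- apply: (uniq (u - v)) => //.
  have -> : u - v - iota (f u - f v) = (u - iota (f u)) - (v - iota (f v)) by rewrite rmorphB; ring.
  exact: (idealB MI).
- apply: (uniq (u * v)) => //.
  have -> : u * v - iota (f u * f v) = u * (v - iota (f v)) + iota (f v) * (u - iota (f u)).
    by rewrite rmorphM; ring.
  by apply: (idealD MI); exact: (ideal_mull _ MI).
exists ev; split=> [c|a Ia]; rewrite evE.
  by apply: (uniq (iota c)) => //; rewrite subrr; exact: (ideal0 MI).
by apply: (uniq a) => //; rewrite raddf0 subr0; exact: IM.
Qed.

End FinitelyGeneratedAlgebras.

(* Rabinowitsch: a point of [A[X]] killing [I] and [1 - aX] would be a zero of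
   [I] at which [a] does not vanish. *)
Lemma strong_nullstellensatz (k : closedFieldType) (A : comNzRingType)
    (iota : {rmorphism k -> A}) (I : set A) a :
  finitely_generated_over iota -> is_ideal I ->
  (forall ev : {rmorphism A -> k}, (forall c, ev (iota c) = c) ->
    (forall b, I b -> ev b = 0) -> ev a = 0) -> exists N, I (a ^+ N).
Proof.
move=> [s [g gen_g]] II H.
pose iP : {rmorphism k -> {poly A}} := polyC \o iota.
pose gP (i : 'I_s.+1) : {poly A} := if unlift ord0 i is Some j then (g j)%:P else 'X.
have gen_gP (S : set {poly A}) : (forall c, S (iP c)) -> (forall i, S (gP i)) ->
    (forall a b, S a -> S b -> S (a + b)) ->
    (forall a b, S a -> S b -> S (a * b)) -> forall p : {poly A}, S p.
  move=> SC Sg SD SM.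
  have SA b : S b%:P.
    move: b; apply: (gen_g [set b : A | S b%:P]) => [c|i|b c Sb Sc|b c Sb Sc].
    - exact: SC.
    - by have := Sg (lift ord0 i); rewrite /gP liftK.
    - by rewrite /= polyCD; exact: SD.
    - by rewrite /= polyCM; exact: SM.
  move=> p; elim/poly_ind: p => [|p c Sp]; first exact: (SA 0).
  apply: SD => //; apply: SM => //.
  by have := Sg ord0; rewrite /gP unlift_none.
pose J : set {poly A} := [set p | exists q r : {poly A}, (forall i, I q`_i) /\ p = q + (1 - a *: 'X) * r].
have JI : is_ideal J.
  split.
  - by exists 0, 0; split=> [i|]; rewrite ?mulr0 ?addr0 // coef0; exact: ideal0.
  - move=> _ _ [q [r [Iq ->]]] [q' [r' [Iq' ->]]]; exists (q + q'), (r + r'); split=> [i|].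
      by rewrite coefD; exact: idealD.
    by rewrite mulrDr addrACA.
  - move=> p _ [q [r [Iq ->]]]; exists (p * q), (p * r); split=> [i|].
      by rewrite coefM; apply: (ideal_sum _ II) => j _; exact: ideal_mull.
    by rewrite mulrDr mulrCA.
have [[q [r [Iq e]]]|J1] := pselect (J 1); last first.
  have [ev [evC evJ]] := weak_nullstellensatz gen_gP JI J1.
  pose evA : {rmorphism A -> k} := ev \o polyC.
  have a0 : evA a = 0.
    apply: H => [c|b Ib]; first exact: evC.
    apply: evJ; exists b%:P, 0; rewrite mulr0 addr0; split=> // i.
    by rewrite coefC; case: eqP => // _; exact: ideal0.
  have : ev (1 - a *: 'X) = 0.
    apply: evJ; exists 0, 1; rewrite mulr1 add0r; split=> // i.
    by rewrite coef0; exact: ideal0.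
  rewrite rmorphB rmorph1 -mul_polyC rmorphM.
  have -> : ev a%:P = 0 by exact: a0.
  by rewrite mul0r subr0 => /eqP; rewrite oner_eq0.
pose N := maxn (size q) (size r).
exists N.
(* Formally the substitution of [1/a] for the variable followed by multiplication by [a^N];
   multiples of [1 - a X] are killed by telescoping. *)
pose h (p : {poly A}) := \sum_(i < N.+1) p`_i * a ^+ (N - i).
have h1 : h 1 = a ^+ N.
  by rewrite /h big_ord_recl coefC eqxx mul1r subn0 big1 ?addr0 // => i _; rewrite coefC mul0r.
have hD p p' : h (p + p') = h p + h p'.
  by rewrite /h -big_split; apply: eq_bigr => i _; rewrite coefD mulrDl.
have hr : h ((1 - a *: 'X) * r) = 0.
  have tele n : (n <= N)%N -> \sum_(i < n.+1) ((1 - a *: 'X) * r)`_i * a ^+ (N - i) = r`_n * a ^+ (N - n).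
    elim: n => [|n IH] nN.
      rewrite big_ord1 mulrBl mul1r -scalerAl coefB coefZ coefXM /= mulr0 subr0 //.
    rewrite big_ord_recr /= IH 1?ltnW // mulrBl mul1r -scalerAl coefB coefZ coefXM /=.
    by rewrite -(subnSK nN) exprS; ring.
  rewrite /h tele // nth_default ?mul0r // leq_maxr.
  done.
rewrite -h1 e hD hr addr0; apply: (ideal_sum _ II) => i _; exact: ideal_mulr.
Qed.

Lemma localization_noetherian (A R : comPzRingType) (phi : {rmorphism A -> R}) : noetherian A ->
  (forall u, exists w a, is_unit (phi w) /\ phi w * u = phi a) -> noetherian R.
Proof.
move=> nA loc J JI.
pose I : set A := [set a | J (phi a)].
have [|n [g Ig]] := nA I.
  split; first by rewrite /I /= raddf0; exact: ideal0.
  - by move=> a b Ia Ib; rewrite /I /= rmorphD; exact: idealD.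
  - by move=> a b Ib; rewrite /I /= rmorphM; exact: ideal_mull.
exists n, (fun i => phi (g i)); apply/seteqP; split=> [u Ju|_ [c ->]]; last first.
  apply: (ideal_sum _ JI) => i _; apply: (ideal_mull _ JI).
  by have : I (g i) by rewrite Ig; exact: generated_by_gen.
have [w [a [[v wv] e]]] := loc u.
have [c ec] : generated_by g a by rewrite -Ig /I /= -e; exact: ideal_mull.
have -> : u = v * phi a by rewrite -e mulrA (mulrC v) wv mul1r.
rewrite ec rmorph_sum mulr_sumr; exists (fun i => v * phi (c i)).
by apply: eq_bigr => i _; rewrite rmorphM mulrA.
Qed.

Section TranslatedNormalization.
Variables (k : fieldType) (A : comNzRingType) (iota : {rmorphism k -> A}).

Lemma mmap_comp r (x : 'I_r -> A) (y : 'I_r -> {mpoly k[r]}) p :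
  mmap iota x (mmap (@mpolyC r k) y p) = mmap iota (fun i => mmap iota x (y i)) p.
Proof.
transitivity (mmap iota x (\sum_(m <- msupp p) (p@_m)%:MP * mmap1 y m)); first by [].
rewrite rmorph_sum [RHS]/mmap; apply: eq_bigr => m _.
rewrite rmorphM /= mmapC; congr (_ * _); rewrite /mmap1 rmorph_prod.
by apply: eq_bigr => i _; rewrite rmorphXn.
Qed.

Lemma mmap_id r (p : {mpoly k[r]}) : mmap (@mpolyC r k) (fun i => 'X_i) p = p.
Proof.
rewrite [RHS]mpolyE /mmap; apply: eq_bigr => m _.
by rewrite mul_mpolyC [in RHS]mpolyXE_id.
Qed.

End TranslatedNormalization.

(** Coordinates are translated by their values at the point; they stay independent because the
    substitution by the opposite translation undoes it. *)
Lemma centered_normalization (k : fieldType) (A : comNzRingType) (iota : {rmorphism k -> A})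
    (ev : {rmorphism A -> k}) s (g : 'I_s -> A) :
  (forall c, ev (iota c) = c) ->
  exists r (x : 'I_r -> A), [/\ alg_indep iota x, forall i, ev (x i) = 0 &
   forall i, integralOver (mmap iota x) (g i)].
Proof.
move=> evK; have [r [x [xi xint]]] := noether_normalization iota g.
pose x' i := x i - iota (ev (x i)).
exists r, x'; split.
- move=> p px.
  pose sh (c : 'I_r -> k) i : {mpoly k[r]} := 'X_i + (c i)%:MP.
  have shE c i : mmap iota x (sh c i) = x i + iota (c i) by rewrite raddfD /= mmapX mmap1U mmapC.
  pose p' := mmap (@mpolyC r k) (sh (fun i => - ev (x i))) p.
  have p'0 : p' = 0.
    apply: xi; rewrite /p' mmap_comp -[RHS]px; congr (mmap iota _ p); apply/funext => i.
    by rewrite shE rmorphN.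
  have : mmap (@mpolyC r k) (sh (fun i => ev (x i))) p' = p.
    rewrite /p' (mmap_comp (@mpolyC r k)) -[RHS]mmap_id; congr (mmap _ _ p); apply/funext => i.
    by rewrite raddfD /= mmapX mmap1U mmapC /sh -addrA -mpolyCD subrr addr0.
  by rewrite p'0 raddf0.
- by move=> i; rewrite rmorphB evK subrr.
- move=> i; apply: integral_trans_mmap (xint i) => j.
  rewrite -[x j](subrK (iota (ev (x j)))); apply: integral_add.
    by rewrite -[x j - _]/(x' j) -(mmap1U x' j) -(mmapX _ iota); exact: integral_id.
  exact: integral_mmap_iota.
Qed.

Section PrimeChains.
Variables (k : fieldType) (B : comPzRingType) (iota : {rmorphism k -> B}).

Lemma sum_ffun_recl (V : nmodType) (J : finType) d (F : {ffun 'I_d.+1 -> J} -> V) :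
  \sum_al F al = \sum_(j : J) \sum_(al : {ffun 'I_d -> J})
    F [ffun i => if unlift ord0 i is Some i' then al i' else j].
Proof.
pose h (p : J * {ffun 'I_d -> J}) : {ffun 'I_d.+1 -> J} :=
  [ffun i => if unlift ord0 i is Some i' then p.2 i' else p.1].
rewrite pair_bigA /= (reindex h) //.
exists (fun al : {ffun 'I_d.+1 -> J} => (al ord0, [ffun i => al (lift ord0 i)])) => [[j al] _|al _].
  rewrite /h ffunE unlift_none; congr pair; apply/ffunP => i.
  by rewrite !ffunE liftK.
apply/ffunP => i; rewrite !ffunE; case: unliftP => [i' ->|->] //=.
by rewrite ffunE.
Qed.

(** The least power of [t_0] whose coefficient does not vanish can be divided out modulo [P_0],
    since [t_0] is not in [P_0]. Because [t_0] lies in [P_1], that coefficient then lies in [P_1],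
    and induction applies to the chain starting at [P_1]. *)
Lemma chain_independent d (P : 'I_d.+1 -> set B) (t : 'I_d -> B) :
  (forall i, is_prime (P i)) ->
  (forall i : 'I_d, P (widen_ord (leqnSn d) i) `<=` P (lift ord0 i)) ->
  (forall i : 'I_d, P (lift ord0 i) (t i) /\ ~ P (widen_ord (leqnSn d) i) (t i)) ->
  forall D (c : {ffun 'I_d -> 'I_D} -> k),
  P ord0 (\sum_al iota (c al) * \prod_i t i ^+ al i) -> forall al, c al = 0.
Proof.
elim: d P t => [|d IH] P t prP incP tP D c Pc al.
  apply/eqP/negPn/negP => c0.
  have [PI P1 _] := prP ord0; apply: P1.
  have e (al' : {ffun 'I_0 -> 'I_D}) : al' = al by apply/ffunP => -[].
  move: Pc; rewrite (eq_bigr (fun=> iota (c al))) => [|al' _]; last first.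
    by rewrite (e al') big_ord0 mulr1.
  rewrite sumr_const (_ : #|_| = 1%N); last by rewrite card_ffun !card_ord expn0.
  rewrite mulr1n => Pc; rewrite -(rmorph1 iota) -(mulVf c0) rmorphM; exact: (ideal_mull _ PI).
pose fc (j : 'I_D) (a : {ffun 'I_d -> 'I_D}) : {ffun 'I_d.+1 -> 'I_D} :=
  [ffun i => if unlift ord0 i is Some i' then a i' else j].
pose G j := \sum_a iota (c (fc j a)) * \prod_i t (lift ord0 i) ^+ a i.
have E : \sum_al iota (c al) * \prod_i t i ^+ al i = \sum_(j < D) t ord0 ^+ j * G j.
  rewrite sum_ffun_recl; apply: eq_bigr => j _; rewrite mulr_sumr; apply: eq_bigr => a _.
  rewrite big_ord_recl ffunE unlift_none mulrCA; congr (_ * (_ * _)).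
  by apply: eq_bigr => i _; rewrite ffunE liftK.
have [PI P1 PP] := prP ord0.
have w0 : widen_ord (leqnSn d.+1) ord0 = ord0 by exact: val_inj.
have [t1 t0] := tP ord0; rewrite w0 in t0.
have cj (j : 'I_D) : forall a, c (fc j a) = 0.
  have [n] := ubnP (nat_of_ord j); elim: n j => // n IHn j; rewrite ltnS => jn.
  have [PI1 _ _] := prP (lift ord0 ord0).
  apply: (IH (fun i => P (lift ord0 i)) (fun i => t (lift ord0 i))).
  - by move=> i; exact: prP.
  - move=> i u Pu; apply: (incP (lift ord0 i)); move: Pu; congr (P _ u); exact: val_inj.
  - move=> i; have [H1 H2] := tP (lift ord0 i); split=> // H; apply: H2; move: H.
    by congr (P _ _); exact: val_inj.
  rewrite -/(G j).
  pose rest := \sum_(j' < D | (j < j')%N) t ord0 ^+ (j' - j).-1 * G j'.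
  have /PP : P ord0 (t ord0 ^+ j * (G j + t ord0 * rest)).
    move: Pc; rewrite E; congr (P ord0 _).
    rewrite (bigD1 j) //= mulrDr; congr (_ + _).
    rewrite (bigID (fun j' : 'I_D => (j < j')%N)) /= [X in _ + X]big1 ?addr0 => [|j' /andP[jj' j'j]].
      rewrite /rest !mulr_sumr; apply: eq_big => [j'|j' /andP[_ jj']].
        by rewrite andb_idl // => /gtn_eqF; rewrite -val_eqE => ->.
      rewrite mulrA -exprSr mulrA -exprD; congr (t ord0 ^+ _ * _).
      by rewrite addSn -addnS prednK ?subn_gt0 // subnKC // ltnW.
    have lt : (j' < j)%N by rewrite ltn_neqAle -val_eqE in jj' *; rewrite jj' leqNgt.
    rewrite [G j']big1 ?mulr0 // => a _.
    by rewrite IHn ?raddf0 ?mul0r // (leq_trans lt).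
  case=> [|H].
    elim: (nat_of_ord j) => [|n' IHn'] //; rewrite exprS => /PP[//|]; exact: IHn'.
  have -> : G j = (G j + t ord0 * rest) - t ord0 * rest by rewrite addrK.
  apply: (idealB PI1); last exact: (ideal_mulr _ PI1).
  by have := incP ord0; rewrite w0; apply.
have -> : al = fc (al ord0) [ffun i => al (lift ord0 i)].
  apply/ffunP => i; rewrite !ffunE; case: unliftP => [i' ->|->] //=.
  by rewrite ffunE.
exact: cj.
Qed.

End PrimeChains.

(** * Stalks of sheaves of modules *)

Arguments lifts {X O F Z B U} q V _.

Lemma common_open (X : topologicalType) (x : X) n (P : 'I_n -> opens X -> Prop) (U0 : opens X) :
  oset U0 x -> (forall i (U V : opens X), V `<=` U -> P i U -> P i V) ->
  (forall i, exists U, oset U x /\ P i U) ->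
  exists U : opens X, [/\ oset U x, U `<=` U0 & forall i, P i U].
Proof.
move=> U0x mono; elim: n P mono => [|n IH] P mono H; first by exists U0; split=> // -[].
have [||U [Ux UU0 PU]] := IH (fun i => P (lift ord0 i)).
- by move=> i U V; exact: mono.
- by move=> i; exact: H.
have [V [Vx PV]] := H ord0; exists (oI U V); split=> //.
  exact: subset_trans (@oIl _ _ _) UU0.
move=> i; have [j ->|->] := unliftP ord0 i; first exact: mono (@oIl _ _ _) (PU j).
exact: mono (@oIr _ _ _) PV.
Qed.

Section ModuleStalk.
Variables (X : topologicalType) (O : ring_sheaf X) (F : mod_sheaf O) (x : X).

Record mpregerm := MPregerm { mgdom : opens X; mgmem : oset mgdom x; mgval : F mgdom }.
HB.instance Definition _ := gen_eqMixin mpregerm.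
HB.instance Definition _ := gen_choiceMixin mpregerm.

Definition mgerm_equiv (g h : mpregerm) := exists (W : opens X)
  (hg : W `<=` mgdom g) (hh : W `<=` mgdom h),
  oset W x /\ mres F hg (mgval g) = mres F hh (mgval h).

Definition mgerm_equivb (g h : mpregerm) : bool := `[< mgerm_equiv g h >].

Lemma mgerm_equivb_refl : reflexive mgerm_equivb.
Proof.
move=> g; apply/asboolP; exists (mgdom g), (@subset_refl _ _), (@subset_refl _ _).
by split=> //; exact: mgmem.
Qed.

Lemma mgerm_equivb_sym : ssrbool.symmetric mgerm_equivb.
Proof.
by move=> g h; apply/asboolP/asboolP => -[W [a [b [Wx e]]]]; exists W, b, a.
Qed.

Lemma mgerm_equivb_trans : transitive mgerm_equivb.
Proof.
move=> h g l /asboolP[W [a [b [Wx e]]]] /asboolP[W' [a' [b' [W'x e']]]].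
apply/asboolP; exists (oI W W').
have iW : oI W W' `<=` W by move=> ? [].
have iW' : oI W W' `<=` W' by move=> ? [].
exists (subset_trans iW a), (subset_trans iW' b'); split=> //.
rewrite -(mres_comp a iW) e -(mres_comp b' iW') -e'.
have hh := subset_trans iW b.
by rewrite (mres_comp b iW hh) (mres_comp a' iW' hh).
Qed.

Canonical mgerm_equiv_rel :=
  EquivRel mgerm_equivb mgerm_equivb_refl mgerm_equivb_sym mgerm_equivb_trans.

Definition mstalk := {eq_quot mgerm_equiv_rel}.
HB.instance Definition _ := Choice.on mstalk.

Definition mgerm (U : opens X) (Ux : oset U x) (s : F U) : mstalk :=
  \pi_mstalk (MPregerm Ux s).

Lemma mgermP (U V : opens X) (Ux : oset U x) (Vx : oset V x) s t :
  mgerm Ux s = mgerm Vx t <-> exists (W : opens X) (hU : W `<=` U)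
  (hV : W `<=` V), oset W x /\ mres F hU s = mres F hV t.
Proof.
split=> [/eqmodP/asboolP[W [a [b e]]]|[W [a [b e]]]]; first by exists W, a, b.
by apply/eqmodP/asboolP; exists W, a, b.
Qed.

Lemma mgerm_res (U V : opens X) (Ux : oset U x) (Vx : oset V x) (h : V `<=` U) s :
  mgerm Vx (mres F h s) = mgerm Ux s.
Proof.
apply/mgermP; exists V, (@subset_refl _ _), h; split=> //.
exact: (mres_comp h _ h).
Qed.

Lemma mgerm_surj (p : mstalk) : exists U (Ux : oset U x) s, p = mgerm Ux s.
Proof.
exists (mgdom (repr p)), (mgmem (repr p)), (mgval (repr p)).
by rewrite /mgerm; case: (repr p) (reprK p) => /= U Ux s <-.
Qed.

Lemma mgerm_small (p : mstalk) (U0 : opens X) : oset U0 x ->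
  exists U (Ux : oset U x) s, U `<=` U0 /\ p = mgerm Ux s.
Proof.
move=> U0x; have [U [Ux [s ->]]] := mgerm_surj p.
have W : oset (oI U U0) x by [].
exists (oI U U0), W, (mres F (@oIl _ _ _) s); rewrite mgerm_res; split=> //; exact: oIr.
Qed.

Lemma mgerm_family n (p : 'I_n -> mstalk) (U0 : opens X) : oset U0 x ->
  exists U (Ux : oset U x) (s : 'I_n -> F U), U `<=` U0 /\ forall i, p i = mgerm Ux (s i).
Proof.
move=> U0x.
have [||U [Ux UU0 H]] := @common_open X x n (fun i U => exists (U' : opens X) (h : U `<=` U')
  (U'x : oset U' x) s, p i = mgerm U'x s) U0 U0x.
- by move=> i U V h [U' [h' [U'x [s e]]]]; exists U', (subset_trans h h'), U'x, s.
- move=> i; have [U [Ux [s e]]] := mgerm_surj (p i); exists U; split=> //.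
  by exists U, (@subset_refl _ _), Ux, s.
have /choice[s sP] i : exists s, p i = mgerm Ux s.
  by have [U' [h [U'x [s ->]]]] := H i; exists (mres F h s); rewrite mgerm_res.
by exists U, Ux, s.
Qed.

Definition mstalk_add (p q : mstalk) : mstalk :=
  @mgerm (oI (mgdom (repr p)) (mgdom (repr q)))
    (conj (mgmem (repr p)) (mgmem (repr q)))
    (mres F (@oIl _ _ _) (mgval (repr p)) + mres F (@oIr _ _ _) (mgval (repr q))).

Lemma mstalk_addE (U : opens X) (Ux : oset U x) s t :
  mstalk_add (mgerm Ux s) (mgerm Ux t) = mgerm Ux (s + t).
Proof.
rewrite /mstalk_add.
have e1 := reprK (mgerm Ux s); have e2 := reprK (mgerm Ux t).
case: (repr (mgerm Ux s)) e1 => /= A Ax a /mgermP[W [hA [hU [Wx e1]]]].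
case: (repr (mgerm Ux t)) e2 => /= B Bx b /mgermP[W' [hB [hU' [W'x e2]]]].
have i1 : oI W W' `<=` W by move=> ? [].
have i2 : oI W W' `<=` W' by move=> ? [].
have iAB : oI W W' `<=` oI A B by move=> ? [/hA ? /hB ?].
have iU := subset_trans i1 hU.
apply/mgermP; exists (oI W W'), iAB, iU; split=> //.
rewrite !raddfD; congr (_ + _).
  rewrite (mres_comp _ _ (subset_trans i1 hA)) -(mres_comp hA i1) e1.
  exact: mres_comp.
rewrite (mres_comp _ _ (subset_trans i2 hB)) -(mres_comp hB i2) e2.
exact: mres_comp.
Qed.

Definition mstalk_scale (a : stalk O x) (q : mstalk) : mstalk :=
  @mgerm (oI (gdom (repr a)) (mgdom (repr q)))
    (conj (gmem (repr a)) (mgmem (repr q)))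
    (rres O (@oIl _ _ _) (gval (repr a)) *: mres F (@oIr _ _ _) (mgval (repr q))).

Lemma mstalk_scaleE (U : opens X) (Ux : oset U x) a t :
  mstalk_scale (germ Ux a) (mgerm Ux t) = mgerm Ux (a *: t).
Proof.
rewrite /mstalk_scale.
have e1 := reprK (germ Ux a); have e2 := reprK (mgerm Ux t).
case: (repr (germ Ux a)) e1 => /= A Ax a' /germP[W [hA [hU [Wx e1]]]].
case: (repr (mgerm Ux t)) e2 => /= B Bx b /mgermP[W' [hB [hU' [W'x e2]]]].
have i1 : oI W W' `<=` W by move=> ? [].
have i2 : oI W W' `<=` W' by move=> ? [].
have iAB : oI W W' `<=` oI A B by move=> ? [/hA ? /hB ?].
have iU := subset_trans i1 hU.
apply/mgermP; exists (oI W W'), iAB, iU; split=> //.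
rewrite !mresZ; congr (_ *: _).
  rewrite (rres_comp _ _ (subset_trans i1 hA)) -(rres_comp hA i1) e1.
  exact: rres_comp.
rewrite (mres_comp _ _ (subset_trans i2 hB)) -(mres_comp hB i2) e2.
exact: mres_comp.
Qed.

Definition mstalk0 : mstalk := @mgerm (oT X) I 0.

Lemma mstalk0E (U : opens X) (Ux : oset U x) : mstalk0 = mgerm Ux 0.
Proof. by rewrite /mstalk0 -(mgerm_res _ Ux (@sub_oT _ _)) raddf0. Qed.

Definition mstalk_opp (p : mstalk) := mstalk_scale (-1) p.

Lemma mgerm_surj3 (p q r : mstalk) : exists U (Ux : oset U x) s t u,
  [/\ p = mgerm Ux s, q = mgerm Ux t & r = mgerm Ux u].
Proof.
have [U [Ux [s ->]]] := mgerm_surj p; have [V [Vx [t [VU ->]]]] := mgerm_small q Ux.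
have [W [Wx [u [WV ->]]]] := mgerm_small r Vx.
exists W, Wx, (mres F (subset_trans WV VU) s), (mres F WV t), u.
by rewrite !mgerm_res.
Qed.

Lemma germ_mgerm_surj (a b : stalk O x) (p q : mstalk) : exists U (Ux : oset U x) a' b' s t,
  [/\ a = germ Ux a', b = germ Ux b', p = mgerm Ux s & q = mgerm Ux t].
Proof.
have [U [Ux [a' [b' [-> ->]]]]] := germ_surj2 a b.
have [V [Vx [s [VU ->]]]] := mgerm_small p Ux.
have [W [Wx [t [WV ->]]]] := mgerm_small q Vx.
exists W, Wx, (rres O (subset_trans WV VU) a'), (rres O (subset_trans WV VU) b'), (mres F WV s), t.
by rewrite !germ_res mgerm_res.
Qed.

Lemma mstalk_addA : associative mstalk_add.
Proof.
move=> p q r; have [U [Ux [s [t [u [-> -> ->]]]]]] := mgerm_surj3 p q r.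
by rewrite !mstalk_addE addrA.
Qed.

Lemma mstalk_addC : commutative mstalk_add.
Proof.
move=> p q; have [U [Ux [s [t [_ [-> -> _]]]]]] := mgerm_surj3 p q q.
by rewrite !mstalk_addE addrC.
Qed.

Lemma mstalk_add0 : left_id mstalk0 mstalk_add.
Proof.
move=> p; have [U [Ux [s ->]]] := mgerm_surj p.
by rewrite (mstalk0E Ux) mstalk_addE add0r.
Qed.

Lemma germN1 (U : opens X) (Ux : oset U x) : -1 = germ Ux (-1) :> stalk O x.
Proof.
by apply/eqP; rewrite eq_sym -subr_eq0 opprK -(germ1 O Ux) -germD addNr germ0.
Qed.

Lemma mstalk_addN : left_inverse mstalk0 mstalk_opp mstalk_add.
Proof.
move=> p; have [U [Ux [s ->]]] := mgerm_surj p.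
by rewrite /mstalk_opp (germN1 Ux) mstalk_scaleE mstalk_addE scaleN1r addNr -mstalk0E.
Qed.

HB.instance Definition _ :=
  GRing.isZmodule.Build mstalk mstalk_addA mstalk_addC mstalk_add0 mstalk_addN.

Lemma mstalk_scaleA a b p : mstalk_scale a (mstalk_scale b p) = mstalk_scale (a * b) p.
Proof.
have [U [Ux [a' [b' [s [_ [-> -> -> _]]]]]]] := germ_mgerm_surj a b p p.
by rewrite -germM !mstalk_scaleE scalerA.
Qed.

Lemma mstalk_scale1 : left_id 1 mstalk_scale.
Proof.
move=> p; have [U [Ux [s ->]]] := mgerm_surj p.
by rewrite -(germ1 O Ux) mstalk_scaleE scale1r.
Qed.

Lemma mstalk_scaleDr : right_distributive mstalk_scale +%R.
Proof.
move=> a p q; have [U [Ux [a' [b' [s [t [-> _ -> ->]]]]]]] := germ_mgerm_surj a a p q.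
by rewrite /GRing.add /= !(mstalk_scaleE, mstalk_addE) scalerDr.
Qed.

Lemma mstalk_scaleDl p a b : mstalk_scale (a + b) p = mstalk_scale a p + mstalk_scale b p.
Proof.
have [U [Ux [a' [b' [s [_ [-> -> -> _]]]]]]] := germ_mgerm_surj a b p p.
by rewrite -germD !mstalk_scaleE scalerDl -mstalk_addE.
Qed.

HB.instance Definition _ := GRing.Zmodule_isLmodule.Build (stalk O x) mstalk
  mstalk_scaleA mstalk_scale1 mstalk_scaleDr mstalk_scaleDl.

Lemma mgermD (U : opens X) (Ux : oset U x) s t : mgerm Ux (s + t) = mgerm Ux s + mgerm Ux t.
Proof. by rewrite -mstalk_addE. Qed.
Lemma mgermZ (U : opens X) (Ux : oset U x) a t : mgerm Ux (a *: t) = germ Ux a *: mgerm Ux t.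
Proof. by rewrite -mstalk_scaleE. Qed.
Lemma mgerm0 (U : opens X) (Ux : oset U x) : mgerm Ux 0 = 0.
Proof. by rewrite -mstalk0E. Qed.
Lemma mgermN (U : opens X) (Ux : oset U x) t : mgerm Ux (- t) = - mgerm Ux t.
Proof. by apply/eqP; rewrite -addr_eq0 -mgermD addNr mgerm0. Qed.
Lemma mgermB (U : opens X) (Ux : oset U x) s t : mgerm Ux (s - t) = mgerm Ux s - mgerm Ux t.
Proof. by rewrite mgermD mgermN. Qed.
Lemma mgerm_sum (U : opens X) (Ux : oset U x) (I : Type) (r : seq I) (P : pred I) (f : I -> F U) :
  mgerm Ux (\sum_(i <- r | P i) f i) = \sum_(i <- r | P i) mgerm Ux (f i).
Proof. exact: (big_morph _ (mgermD Ux) (mgerm0 Ux)). Qed.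

Lemma mgerm_eq0 (U : opens X) (Ux : oset U x) s : mgerm Ux s = 0 ->
  exists (V : opens X) (h : V `<=` U), oset V x /\ mres F h s = 0.
Proof.
rewrite -(mgerm0 Ux) => /mgermP[V [h [h' [Vx e]]]]; exists V, h; split=> //.
by rewrite e raddf0.
Qed.

End ModuleStalk.

Lemma mgerm_eq (X : topologicalType) (O : ring_sheaf X) (F : mod_sheaf O) (U : opens X) (s t : F U) :
  (forall x (Ux : oset U x), mgerm Ux s = mgerm Ux t) -> s = t.
Proof.
move=> H.
pose I := {V : opens X | exists h : V `<=` U, mres F h s = mres F h t}.
have hV (i : I) : sval i `<=` U by case: i => V [].
apply: (@msep _ _ _ U I (fun i => sval i) hV).
  move=> x Ux; have /mgermP[V [h [h' [Vx e]]]] := H x Ux.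
  have p : exists h : V `<=` U, mres F h s = mres F h t.
    by exists h; rewrite e (Prop_irrelevance h h').
  by exists (exist _ V p).
move=> [V p]; move: (hV _) => /= h; case: p => h' e.
by rewrite (Prop_irrelevance h h').
Qed.

Section StalkMap.
Variables (X : topologicalType) (O : ring_sheaf X) (x : X).

Definition smap_fun (F G : mod_sheaf O) (f : mor F G) (p : mstalk F x) : mstalk G x :=
  mgerm (mgmem (repr p)) (f _ (mgval (repr p))).

Lemma smap_funE (F G : mod_sheaf O) (f : mor F G) (U : opens X) (Ux : oset U x) s :
  smap_fun f (mgerm Ux s) = mgerm Ux (f U s).
Proof.
rewrite /smap_fun; have e1 := reprK (mgerm Ux s).
case: (repr (mgerm Ux s)) e1 => /= A Ax a /mgermP[W [hA [hU [Wx e1]]]].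
by apply/mgermP; exists W, hA, hU; split=> //; rewrite -!mor_res e1.
Qed.

Lemma smap_is_linear (F G : mod_sheaf O) (f : mor F G) : linear (smap_fun f).
Proof.
move=> a p q; have [U [Ux [a' [_ [s [t [-> _ -> ->]]]]]]] := germ_mgerm_surj a a p q.
by rewrite -mgermZ -mgermD !smap_funE linearP mgermD mgermZ.
Qed.

HB.instance Definition _ (F G : mod_sheaf O) (f : mor F G) :=
  GRing.isLinear.Build (stalk O x) (mstalk F x) (mstalk G x) *:%R (smap_fun f) (smap_is_linear f).

Definition smap (F G : mod_sheaf O) (f : mor F G) : {linear mstalk F x -> mstalk G x} := smap_fun f.

Lemma smapE (F G : mod_sheaf O) (f : mor F G) (U : opens X) (Ux : oset U x) s :
  smap f (mgerm Ux s) = mgerm Ux (f U s).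
Proof. exact: smap_funE. Qed.

End StalkMap.

Section QuotientMap.
Variables (X : topologicalType) (O : ring_sheaf X) (F G : mod_sheaf O) (f : mor F G).
Variables (Z B : subsheaf F) (Z' B' : subsheaf G).
Hypothesis fZ : forall U s, Z U s -> Z' U (f U s).
Hypothesis fB : forall U s, B U s -> B' U (f U s).

Program Definition qmap_fun U (T : quotient_sheaf Z B U) : quotient_sheaf Z' B' U :=
  @of_atlas _ _ _ Z' B' U (fun V => [set z' | exists z, lifts T V z /\ z' = f V z]) _ _ _ _.
Next Obligation. by move=> U T V z [s [Ts _]]; exact: lifts_sub Ts. Qed.
Next Obligation. by move=> U T V z [s [Ts ->]]; apply: fZ; exact: lifts_in Ts. Qed.
Next Obligation.
move=> U T V V' z z' [s [Ts ->]] [s' [Ts' ->]] W h h'.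
by rewrite -!mor_res -raddfB; apply: fB; exact: lifts_congruent Ts Ts' _ _ _.
Qed.
Next Obligation.
move=> U T x Ux; have [V [z [Vx Tz]]] := lifts_exist T Ux.
by exists V, (f V z); split=> //; exists z.
Qed.

Lemma qmap_funE U (T : quotient_sheaf Z B U) V z : lifts T V z -> lifts (qmap_fun T) V (f V z).
Proof.
by move=> Tz; apply: sub_saturation; try exact: qmap_fun_obligation_1;
   try exact: qmap_fun_obligation_2; try exact: qmap_fun_obligation_3; exists z.
Qed.

Lemma qmap_is_linear U : linear (@qmap_fun U).
Proof.
move=> a S T; apply: qsec_eq => x Ux; have [V [s [t [Vx Ss Tt]]]] := lifts2 S T Ux.
have h := lifts_sub Ss.
exists V, (f V (rres O h a *: s + t)); split=> //.
  by apply: qmap_funE; apply: qaddE => //; exact: qscaleE.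
by rewrite linearP; apply: qaddE; [apply: qscaleE|]; exact: qmap_funE.
Qed.

HB.instance Definition _ U := GRing.isLinear.Build (O U) (quotient_sheaf Z B U)
  (quotient_sheaf Z' B' U) *:%R (@qmap_fun U) (@qmap_is_linear U).

Program Definition qmap : mor (quotient_sheaf Z B) (quotient_sheaf Z' B') :=
  @Mor _ _ _ _ (fun U => @qmap_fun U : {linear _ -> _}) _.
Next Obligation.
move=> U V h T; apply: qsec_eq => x Vx; have [W [z [Wx WV Tz]]] := lifts_small T (h _ Vx) Vx.
exists W, (f W z); split=> //; first by apply: qmap_funE; apply: qresE.
by apply: qresE => //; exact: qmap_funE.
Qed.

Lemma qmap_class U z T : is_class z T -> is_class (f U z) (qmap U T).
Proof. exact: qmap_funE. Qed.

End QuotientMap.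

(** Injectivity makes local preimages unique, so they agree on overlaps and glue. *)
Lemma iso_of_local (X : topologicalType) (O : ring_sheaf X) (F G : mod_sheaf O) (f : mor F G) :
  (forall U s, f U s = 0 -> s = 0) ->
  (forall (U : opens X) (t : G U) x, oset U x -> exists (V : opens X) (h : V `<=` U) s,
     oset V x /\ f V s = mres G h t) -> is_iso f.
Proof.
move=> inj loc.
have injf U s s' : f U s = f U s' -> s = s'.
  by move=> e; apply/eqP; rewrite -subr_eq0; apply/eqP/inj; rewrite raddfB /= e subrr.
have surj U (t : G U) : exists s, f U s = t.
  pose I := {V : opens X | exists (h : V `<=` U) s, f V s = mres G h t}.
  have hV (i : I) : sval i `<=` U by case: i => V [].
  have H : forall i : I, exists s, f (sval i) s = mres G (hV i) t.
    move=> [V p]; move: (hV _) => /= h; case: p => h' [s e].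
    by exists s; rewrite e (Prop_irrelevance h h').
  pose s i := sval (cid (H i)).
  have sP i : f (sval i) (s i) = mres G (hV i) t by exact: (svalP (cid (H i))).
  have cov : U `<=` \bigcup_i oset (sval (i : I)).
    move=> x /(loc U t x)[V [h [s0 [Vx e]]]].
    have p : exists (h : V `<=` U) s, f V s = mres G h t by exists h, s0.
    by exists (exist _ V p).
  have [|s0 s0P] := @mglue _ _ F U I (fun i => sval i) hV cov s.
    move=> i j W hi hj; apply: injf; rewrite !mor_res !sP.
    by rewrite !(mres_comp _ _ (subset_trans hi (hV i))).
  exists s0; apply: (msep cov) => i; by rewrite -mor_res s0P sP.
pose g U (t : G U) := sval (cid (surj U t)).
have gP U t : f U (g U t) = t by exact: (svalP (cid (surj U t))).
have glin U : linear (g U).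
  by move=> a s t; apply: injf; rewrite linearP !gP.
pose gl U : {linear G U -> F U} := HB.pack (g U) (GRing.isLinear.Build _ _ _ _ (g U) (glin U)).
have gres (U V : opens X) (h : V `<=` U) t : gl V (mres G h t) = mres F h (gl U t).
  by apply: injf; rewrite mor_res /= !gP.
exists (Mor gres); split=> U s /=; last exact: gP.
by apply: injf; rewrite gP.
Qed.

(** * Quasi-isomorphisms tested on stalks *)

Section QuasiIsomorphisms.
Variables (X : topologicalType) (O : ring_sheaf X).
Implicit Types E F : complex O.

Definition sdiff E x n m : {linear mstalk (E n) x -> mstalk (E m) x} := smap x (diff E n m).

Lemma sdiff_diff E x n m p u : sdiff E x m p (sdiff E x n m u) = 0.
Proof.
have [U [Ux [s ->]]] := mgerm_surj u.
by rewrite /sdiff !smapE diff_diff mgerm0.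
Qed.

(** Injectivity and surjectivity on the homology of the stalk complexes, written with cycles and
    boundaries so that no quotient modules are formed. *)
Definition stalk_qis E F (f : chain_map E F) x := forall n : int,
  (forall z, sdiff E x n (n + 1) z = 0 -> (exists w, smap x (f n) z = sdiff F x (n - 1) n w) ->
     exists w, z = sdiff E x (n - 1) n w) /\
  (forall z, sdiff F x n (n + 1) z = 0 -> exists z' w, sdiff E x n (n + 1) z' = 0 /\
     z = smap x (f n) z' + sdiff F x (n - 1) n w).

Lemma cycle_germ E x n (z : mstalk (E n) x) : sdiff E x n (n + 1) z = 0 ->
  exists (U : opens X) (Ux : oset U x) s, cycles E n U s /\ z = mgerm Ux s.
Proof.
have [U [Ux [s ->]]] := mgerm_surj z; rewrite /sdiff smapE => /mgerm_eq0[V [h [Vx e]]].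
by exists V, Vx, (mres _ h s); rewrite mgerm_res; split=> //=; rewrite mor_res.
Qed.

Lemma boundary_germ E (U : opens X) x (Ux : oset U x) n s : boundaries E n U s ->
  exists w, mgerm Ux s = sdiff E x (n - 1) n w.
Proof.
move=> /(_ x Ux)[V [h [t [Vx e]]]]; exists (mgerm Vx t).
by rewrite /sdiff smapE -e mgerm_res.
Qed.

Lemma germ_boundary E (U : opens X) x (Ux : oset U x) n s w :
  mgerm Ux s = sdiff E x (n - 1) n w ->
  exists (V : opens X) (h : V `<=` U), oset V x /\ boundaries E n V (mres _ h s).
Proof.
have [W [Wx [t ->]]] := mgerm_surj w; rewrite /sdiff smapE => /mgermP[V [h [h' [Vx e]]]].
exists V, h; split=> // y Vy; exists V, (@subset_refl _ _), (mres _ h' t); split=> //.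
by rewrite mres_id e mor_res.
Qed.

Lemma quasi_iso_stalk E F (f : chain_map E F) x : quasi_iso f -> stalk_qis f x.
Proof.
move=> qf n; have [phi [ind [psi [psiK phiK]]]] := qf n; split.
  move=> z /cycle_germ[U [Ux [s [Zs ->]]]] [w]; rewrite smapE => /germ_boundary[V [h [Vx Bs]]].
  have [T [Tz _]] := is_class_exists (boundaries E n) (Zs).
  have TV : is_class (mres _ h s) (mres (homology E n) h T).
    by apply: qresE => //; exact: lifts_res.
  have := ind _ _ _ TV; rewrite mor_res => cl.
  have /(congr1 (psi V)) : phi V (mres (homology E n) h T) = 0.
    by apply/(is_class_eq0 cl).
  rewrite psiK raddf0 => /(is_class_eq0 TV) Bs'.
  have [w' e] := boundary_germ Vx Bs'; exists w'; by rewrite -e mgerm_res.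
move=> z /cycle_germ[U [Ux [s [Zs ->]]]].
have [T' [T's _]] := is_class_exists (boundaries F n) (Zs).
have [V [h [z' [Vx cz']]]] := locally_is_class (psi U T') Ux.
have c1 : is_class (f n V z') (mres (homology F n) h T').
  by rewrite -[T']phiK -mor_res; exact: ind.
have c2 : is_class (mres _ h s) (mres (homology F n) h T').
  by apply: qresE => //; exact: lifts_res.
have B12 : boundaries F n V (mres _ h s - f n V z').
  have := lifts_congruent c2 c1 (@subset_refl _ _) (@subset_refl _ _).
  by rewrite !mres_id.
have [w e] := boundary_germ Vx B12.
exists (mgerm Vx z'), w; split.
  by rewrite /sdiff smapE (lifts_in cz') mgerm0.
by rewrite -e smapE mgermB mgerm_res addrC subrK.
Qed.

Lemma stalk_quasi_iso E F (f : chain_map E F) : (forall x, stalk_qis f x) -> quasi_iso f.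
Proof.
move=> qf n.
have fZ U s : cycles E n U s -> cycles F n U (f n U s).
  by move=> /= e; rewrite -cmap_diff e raddf0.
have fB U s : boundaries E n U s -> boundaries F n U (f n U s).
  move=> Bs x /Bs[V [h [t [Vx e]]]]; exists V, h, (f (n - 1) V t); split=> //.
  by rewrite -mor_res e cmap_diff.
exists (qmap fZ fB); split; first by move=> U z T; exact: qmap_class.
apply: iso_of_local => [U T T0|U T x Ux].
  apply: qsec_eq => x Ux; have [V [z [Vx Tz]]] := lifts_exist T Ux.
  have hV := lifts_sub Tz.
  have B0 : boundaries F n V (f n V z).
    have cl : is_class (f n V z) (mres (homology F n) hV (qmap fZ fB U T)).
      by apply: qresE => //; exact: qmap_funE.
    by apply/(is_class_eq0 cl); rewrite T0 raddf0.
  have [w ew] := boundary_germ Vx B0.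
  have [w' ew'] : exists w, mgerm Vx z = sdiff E x (n - 1) n w.
    apply: (qf x n).1; last by exists w; rewrite smapE.
    by rewrite /sdiff smapE (lifts_in Tz) mgerm0.
  have [W [h [Wx BW]]] := germ_boundary ew'.
  exists W, (mres _ h z); split=> //; first exact: lifts_res.
  have Wz : cycles E n W (mres _ h z) by apply: ssec_res; exact: lifts_in Tz.
  rewrite lifts_saturated; split=> //; first exact: subset_trans hV.
  move=> V' z' S0.
  have z0 : lifts (0 : homology E n U) W 0 by apply: qzeroE; exact: subset_trans hV.
  apply: congruent_trans (lifts_congruent z0 S0).
  by move=> W' h1 h2; rewrite !raddf0 addr0; exact: ssec_res.
have [V [h [z [Vx cz]]]] := locally_is_class T Ux.
have [|z' [w [cz' e]]] := (qf x n).2 (mgerm Vx z).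
  by rewrite /sdiff smapE (lifts_in cz) mgerm0.
have [U' [U'x [s [Zs es]]]] := cycle_germ cz'.
have [] := @germ_boundary F (oI V U') x (conj Vx U'x) n
  (mres _ (@oIl _ _ _) z - mres _ (@oIr _ _ _) (f n U' s)) w.
  by rewrite mgermB !mgerm_res e es smapE addrC addKr.
move=> W [hW [Wx BW]].
have hWU : W `<=` U := subset_trans (subset_trans hW (@oIl _ _ _)) h.
have hWU' : W `<=` U' by exact: subset_trans hW (@oIr _ _ _).
have [S [cS _]] := is_class_exists (boundaries E n) (ssec_res hWU' Zs).
exists W, hWU, S; split=> //; apply: qsec_eq => y Wy.
exists W, (mres _ hW (mres _ (@oIl _ _ _) z)); split=> //; last first.
  apply: qresE => //; apply: lifts_res; apply: lifts_res.
  by rewrite /is_class in cz; exact: qres_lifts cz.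
have c1 : is_class (f n W (mres _ hWU' s)) (qmap fZ fB W S) by exact: qmap_class.
rewrite lifts_saturated; split=> //.
  by do 2 apply: ssec_res; exact: lifts_in cz.
move=> V' z'' S''; apply: congruent_trans (lifts_congruent c1 S'').
move=> W' h1 h2; rewrite mor_res -(Prop_irrelevance h1 h2) -raddfB; apply: ssec_res.
move: BW; rewrite raddfB /= (mres_comp _ _ hWU') //.
Qed.

End QuasiIsomorphisms.

(** * Subsheaves, free sheaves and products *)

Section SubSheaf.
Variables (X : topologicalType) (O : ring_sheaf X) (F : mod_sheaf O) (B : subsheaf F).
Implicit Types U V W : opens X.

Section Sections.
Variable U : opens X.

Record subsec := SubSec { ssv : F U; ssvP : B U ssv }.
HB.instance Definition _ := gen_eqMixin subsec.
HB.instance Definition _ := gen_choiceMixin subsec.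

Lemma subsec_eq s t : ssv s = ssv t -> s = t.
Proof.
case: s t => s Bs [t Bt] /= e; subst t; congr SubSec; exact: Prop_irrelevance.
Qed.

Definition subsec_add s t := SubSec (ssecD (ssvP s) (ssvP t)).
Definition subsec_zero := SubSec (ssec0 B U).
Definition subsec_opp s := SubSec (ssecN (ssvP s)).
Definition subsec_scale a s := SubSec (ssecZ a (ssvP s)).

Lemma subsec_addA : associative subsec_add.
Proof. by move=> s t u; apply: subsec_eq; exact: addrA. Qed.
Lemma subsec_addC : commutative subsec_add.
Proof. by move=> s t; apply: subsec_eq; exact: addrC. Qed.
Lemma subsec_add0 : left_id subsec_zero subsec_add.
Proof. by move=> s; apply: subsec_eq; exact: add0r. Qed.
Lemma subsec_addN : left_inverse subsec_zero subsec_opp subsec_add.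
Proof. by move=> s; apply: subsec_eq; exact: addNr. Qed.
HB.instance Definition _ := GRing.isZmodule.Build subsec
  subsec_addA subsec_addC subsec_add0 subsec_addN.

Lemma subsec_scaleA a b s : subsec_scale a (subsec_scale b s) = subsec_scale (a * b) s.
Proof. by apply: subsec_eq; exact: scalerA. Qed.
Lemma subsec_scale1 : left_id 1 subsec_scale.
Proof. by move=> s; apply: subsec_eq; exact: scale1r. Qed.
Lemma subsec_scaleDr : right_distributive subsec_scale +%R.
Proof. by move=> a s t; apply: subsec_eq; exact: scalerDr. Qed.
Lemma subsec_scaleDl s a b : subsec_scale (a + b) s = subsec_scale a s + subsec_scale b s.
Proof. by apply: subsec_eq; exact: scalerDl. Qed.
HB.instance Definition _ := GRing.Zmodule_isLmodule.Build (O U) subsec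
  subsec_scaleA subsec_scale1 subsec_scaleDr subsec_scaleDl.

Lemma ssv_is_linear : linear ssv. Proof. by []. Qed.
HB.instance Definition _ := GRing.isLinear.Build (O U) subsec (F U) *:%R ssv ssv_is_linear.

End Sections.

Definition subsec_res U V (h : V `<=` U) (s : subsec U) : subsec V := SubSec (ssec_res h (ssvP s)).

Lemma subsec_res_zmod U V (h : V `<=` U) : zmod_morphism (subsec_res h).
Proof. by move=> s t; apply: subsec_eq; exact: raddfB. Qed.
HB.instance Definition _ U V (h : V `<=` U) :=
  GRing.isZmodMorphism.Build (subsec U) (subsec V) (subsec_res h) (subsec_res_zmod h).

Lemma subsec_resZ U V (h : V `<=` U) a (s : subsec U) :
  subsec_res h (a *: s) = rres O h a *: subsec_res h s.
Proof. by apply: subsec_eq; exact: mresZ. Qed.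

Lemma subsec_res_id U (h : U `<=` U) (s : subsec U) : subsec_res h s = s.
Proof. by apply: subsec_eq; exact: mres_id. Qed.

Lemma subsec_res_comp U V W (hVU : V `<=` U) (hWV : W `<=` V) (hWU : W `<=` U) (s : subsec U) :
  subsec_res hWV (subsec_res hVU s) = subsec_res hWU s.
Proof. by apply: subsec_eq; exact: mres_comp. Qed.

Lemma subsec_sep U (I : Type) (V : I -> opens X) (hV : forall i, V i `<=` U) :
  U `<=` \bigcup_i V i -> forall s t : subsec U,
  (forall i, subsec_res (hV i) s = subsec_res (hV i) t) -> s = t.
Proof.
move=> cov s t H; apply: subsec_eq; apply: (msep cov) => i.
exact: (congr1 (@ssv _) (H i)).
Qed.

Lemma subsec_glue U (I : Type) (V : I -> opens X) (hV : forall i, V i `<=` U) :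
  U `<=` \bigcup_i V i -> forall s : forall i, subsec (V i),
  (forall i j W (hi : W `<=` V i) (hj : W `<=` V j),
    subsec_res hi (s i) = subsec_res hj (s j)) ->
  exists t, forall i, subsec_res (hV i) t = s i.
Proof.
move=> cov s comp.
have [|t tP] := @mglue _ _ F U I V hV cov (fun i => ssv (s i)).
  by move=> i j W hi hj; exact: (congr1 (@ssv _) (comp i j W hi hj)).
have Bt : B U t.
  apply: ssec_local => x Ux; have [i _ Vix] := cov x Ux.
  by exists (V i), (hV i); rewrite tP; split=> //; exact: ssvP.
by exists (SubSec Bt) => i; apply: subsec_eq; exact: tP.
Qed.

Definition sub_sheaf : mod_sheaf O :=
  ModSheaf subsec_resZ subsec_res_id subsec_res_comp subsec_sep subsec_glue.

Program Definition sub_inc : mor sub_sheaf F :=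
  @Mor _ _ sub_sheaf F (fun U => @ssv U : {linear subsec U -> F U}) _.
Next Obligation. by []. Qed.

Section Lift.
Variables (G : mod_sheaf O) (f : mor G F).
Hypothesis fB : forall U s, B U (f U s).

Definition sub_lift_fun U (s : G U) : subsec U := SubSec (fB s).
Lemma sub_lift_linear U : linear (@sub_lift_fun U).
Proof. by move=> a s t; apply: subsec_eq; exact: linearP. Qed.
HB.instance Definition _ U := GRing.isLinear.Build (O U) (G U) (subsec U) *:%R
  (@sub_lift_fun U) (@sub_lift_linear U).
Program Definition sub_lift : mor G sub_sheaf :=
  @Mor _ _ G sub_sheaf (fun U => @sub_lift_fun U : {linear G U -> subsec U}) _.
Next Obligation. by move=> U V h s; apply: subsec_eq; exact: mor_res. Qed.

End Lift.

Lemma sub_stalk_inj x : injective (smap x sub_inc).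
Proof.
move=> p q; have [U [Ux [s [t [_ [-> -> _]]]]]] := mgerm_surj3 p q q.
rewrite !smapE => /mgermP[W [h [h' [Wx e]]]].
by apply/mgermP; exists W, h, h'; split=> //; exact: subsec_eq.
Qed.

Lemma sub_stalk_im x (U : opens X) (Ux : oset U x) s : B U s ->
  exists p, smap x sub_inc p = mgerm Ux s.
Proof. by move=> Bs; exists (@mgerm _ _ sub_sheaf x U Ux (SubSec Bs)); rewrite smapE. Qed.

Lemma sub_stalk_ex x p : exists (U : opens X) (Ux : oset U x) s,
  B U s /\ smap x sub_inc p = mgerm Ux s.
Proof.
have [U [Ux [s ->]]] := mgerm_surj p.
by exists U, Ux, (ssv s); rewrite smapE; split=> //; exact: ssvP.
Qed.

Lemma ssv_res U V (h : V `<=` U) (s : sub_sheaf U) : ssv (mres sub_sheaf h s) = mres F h (ssv s).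
Proof. by []. Qed.

(** Relations among sections of a subsheaf are relations in the ambient sheaf, so local generation
    is all that has to be supplied. *)
Lemma sub_coherent : coherent F ->
  (forall x, exists (U : opens X) n (g : 'I_n -> F U), [/\ oset U x, forall i, B U (g i) &
    forall (V : opens X) (h : V `<=` U) (t : F V) x', B V t -> oset V x' ->
    exists (W : opens X) (hWV : W `<=` V) (hWU : W `<=` U) (c : 'I_n -> O W),
    oset W x' /\ mres F hWV t = \sum_i c i *: mres F hWU (g i)]) -> coherent sub_sheaf.
Proof.
move=> [_ rel] gen; split.
  move=> x; have [U [n [g [Ux Bg gP]]]] := gen x.
  exists U, n, (fun i => SubSec (Bg i) : sub_sheaf U); split=> // V h t x' Vx'.
  have [W [hWV [hWU [c [Wx' e]]]]] := gP V h (ssv t) x' (ssvP t) Vx'.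
  exists W, hWV, hWU, c; split=> //; apply: subsec_eq; rewrite ssv_res e.
  by rewrite (linear_sum (@ssv W)); apply: eq_bigr => i _.
move=> U n s x Ux; have [V [h [m [r [Vx rP rG]]]]] := rel U n (fun i => ssv (s i)) x Ux.
have relE W (hW : W `<=` U) (a : 'I_n -> O W) :
    is_relation hW s a <-> is_relation hW (fun i => ssv (s i)) a.
  rewrite /is_relation; split=> [/(congr1 (@ssv W))|e].
    by rewrite (linear_sum (@ssv W)) => e; rewrite -[RHS]e; apply: eq_bigr.
  by apply: subsec_eq; rewrite (linear_sum (@ssv W)) -[RHS]e; apply: eq_bigr.
exists V, h, m, r; split=> // [j|W hWV hWU a /relE Ha y Wy]; first exact/relE.
exact: rG Ha y Wy.
Qed.

End SubSheaf.

Section SubComplex.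
Variables (X : topologicalType) (O : ring_sheaf X) (E : complex O).
Variable B : forall n, subsheaf (E n).
Hypothesis Bd : forall n m U s, B n U s -> B m U (diff E n m U s).

Definition sub_diff n m : mor (sub_sheaf (B n)) (sub_sheaf (B m)) :=
  @sub_lift X O (E m) (B m) (sub_sheaf (B n)) (mor_comp (diff E n m) (sub_inc (B n)))
    (fun U s => Bd m (ssvP s)).

Program Definition subcomplex : complex O :=
  @Complex X O (fun n => sub_sheaf (B n)) sub_diff _ _.
Next Obligation. by move=> n m nm U s; apply: subsec_eq; exact: diff_shape. Qed.
Next Obligation. by move=> n m p U s; apply: subsec_eq; exact: diff_diff. Qed.

Program Definition subcomplex_inc : chain_map subcomplex E :=
  @ChainMap X O subcomplex E (fun n => sub_inc (B n)) _.
Next Obligation. by []. Qed.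

Lemma sdiff_inc x n m p :
  smap x (sub_inc (B m)) (sdiff subcomplex x n m p) = sdiff E x n m (smap x (sub_inc (B n)) p).
Proof.
have [U [Ux [s ->]]] := mgerm_surj p.
transitivity (mgerm Ux (diff E n m U (ssv s))).
  rewrite /sdiff (smapE (diff subcomplex n m)); exact: (smapE (sub_inc (B m))).
by rewrite (smapE (sub_inc (B n))) /sdiff smapE.
Qed.

Lemma subcomplex_bounded : bounded E -> bounded subcomplex.
Proof.
move=> [a [b H]]; exists a, b => n nab U s; apply: subsec_eq; exact: (H n nab U).
Qed.

End SubComplex.

Section FreeSheaf.
Variables (X : topologicalType) (O : ring_sheaf X) (b : nat).

Definition free_res (U V : opens X) (h : V `<=` U) (s : 'rV[O U]_b) : 'rV[O V]_b :=
  map_mx (rres O h) s.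

Lemma free_res_zmod (U V : opens X) (h : V `<=` U) : zmod_morphism (free_res h).
Proof. by move=> s t; apply/rowP => i; rewrite !mxE rmorphB. Qed.
HB.instance Definition _ (U V : opens X) (h : V `<=` U) :=
  GRing.isZmodMorphism.Build 'rV[O U]_b 'rV[O V]_b (free_res h) (free_res_zmod h).

Lemma free_resZ (U V : opens X) (h : V `<=` U) a (s : 'rV[O U]_b) :
  free_res h (a *: s) = rres O h a *: free_res h s.
Proof. by apply/rowP => i; rewrite !mxE rmorphM. Qed.

Lemma free_res_id (U : opens X) (h : U `<=` U) (s : 'rV[O U]_b) : free_res h s = s.
Proof. by apply/rowP => i; rewrite !mxE rres_id. Qed.

Lemma free_res_comp (U V W : opens X) (hVU : V `<=` U) (hWV : W `<=` V) (hWU : W `<=` U)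
  (s : 'rV[O U]_b) : free_res hWV (free_res hVU s) = free_res hWU s.
Proof. by apply/rowP => i; rewrite !mxE; exact: rres_comp. Qed.

Lemma free_sep (U : opens X) (I : Type) (V : I -> opens X) (hV : forall i, V i `<=` U) :
  U `<=` \bigcup_i V i -> forall s t : 'rV[O U]_b,
  (forall i, free_res (hV i) s = free_res (hV i) t) -> s = t.
Proof.
move=> cov s t H; apply/rowP => j; apply: (rsep cov) => i.
by have := congr1 (fun v : 'rV[O (V i)]_b => v 0 j) (H i); rewrite !mxE.
Qed.

Lemma free_glue (U : opens X) (I : Type) (V : I -> opens X) (hV : forall i, V i `<=` U) :
  U `<=` \bigcup_i V i -> forall s : forall i, 'rV[O (V i)]_b,
  (forall i j (W : opens X) (hi : W `<=` V i) (hj : W `<=` V j),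
    free_res hi (s i) = free_res hj (s j)) ->
  exists t, forall i, free_res (hV i) t = s i.
Proof.
move=> cov s comp.
have /choice[t tP] j : exists t, forall i, rres O (hV i) t = s i 0 j.
  apply: rglue => // i i' W hi hj.
  by have := congr1 (fun v : 'rV[O W]_b => v 0 j) (comp i i' W hi hj); rewrite !mxE.
by exists (\row_j t j) => i; apply/rowP => j; rewrite !mxE; exact: tP.
Qed.

Definition free_sheaf : mod_sheaf O :=
  ModSheaf free_resZ free_res_id free_res_comp free_sep free_glue.

Lemma free_finite_type : sheaf_finite_type free_sheaf.
Proof.
move=> x; exists (oT X), b, (fun i => delta_mx 0 i : 'rV[O (oT X)]_b); split=> // V h t x' Vx'.
exists V, (@subset_refl _ _), h, (fun i => t 0 i); split=> //.
rewrite mres_id {1}(row_sum_delta t); apply: eq_bigr => i _; congr (_ *: _).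
by apply/rowP => j; rewrite !mxE rmorph_nat.
Qed.

Variable x : X.

Definition germ_row (p : mstalk free_sheaf x) : 'rV[stalk O x]_b :=
  map_mx (germ (mgmem (repr p))) (mgval (repr p)).

Lemma germ_rowE (U : opens X) (Ux : oset U x) (s : free_sheaf U) :
  germ_row (mgerm Ux s) = map_mx (germ Ux) s.
Proof.
rewrite /germ_row; have e1 := reprK (mgerm Ux s).
case: (repr (mgerm Ux s)) e1 => /= A Ax a /mgermP[W [hA [hU [Wx e1]]]].
apply/rowP => j; rewrite !mxE; apply/germP; exists W, hA, hU; split=> //.
by have := congr1 (fun v : 'rV_b => v 0 j) e1; rewrite !mxE.
Qed.

Lemma germ_row_linear : linear germ_row.
Proof.
move=> a p q; have [U [Ux [a' [_ [s [t [-> _ -> ->]]]]]]] := germ_mgerm_surj a a p q.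
rewrite -mgermZ -mgermD !germ_rowE; apply/rowP => j; rewrite !mxE.
by rewrite germD germM.
Qed.
HB.instance Definition _ := GRing.isLinear.Build (stalk O x) (mstalk free_sheaf x)
  'rV[stalk O x]_b *:%R germ_row germ_row_linear.

Lemma germ_row_inj : injective germ_row.
Proof.
move=> p q; have [U [Ux [s [t [_ [-> -> _]]]]]] := mgerm_surj3 p q q.
rewrite !germ_rowE => e.
have [||W [Wx WU H]] := @common_open X x b (fun j V => exists (V' : opens X) (h : V `<=` V')
  (h' : V' `<=` U), rres O h' (s 0 j) = rres O h' (t 0 j)) U Ux.
- by move=> j V V' h [V1 [h1 [h2 ee]]]; exists V1, (subset_trans h h1), h2.
- move=> j; have := congr1 (fun v : 'rV_b => v 0 j) e; rewrite !mxE => /germP[W [h [h' [Wx ee]]]].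
  by exists W; split=> //; exists W, (@subset_refl _ _), h; rewrite ee (Prop_irrelevance h h').
apply/mgermP; exists W, WU, WU; split=> //; apply/rowP => j; rewrite !mxE.
have [V' [h [h' ee]]] := H j.
by rewrite -(rres_comp h' h) ee (rres_comp h' h WU).
Qed.

Lemma germ_row_surj v : exists p, germ_row p = v.
Proof.
have [||U [Ux _ H]] := @common_open X x b (fun j U => exists (U' : opens X) (h : U `<=` U')
  (U'x : oset U' x) s, v 0 j = germ U'x s) (oT X) I.
- by move=> i U V h [U' [h' [U'x [s e]]]]; exists U', (subset_trans h h'), U'x, s.
- move=> j; have [U [Ux [s e]]] := germ_surj (v 0 j); exists U; split=> //.
  by exists U, (@subset_refl _ _), Ux, s.
have /choice[s sP] j : exists s, v 0 j = germ Ux s.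
  by have [U' [h [U'x [s ->]]]] := H j; exists (rres O h s); rewrite germ_res.
exists (@mgerm _ _ free_sheaf x U Ux (\row_j s j)); rewrite germ_rowE.
by apply/rowP => j; rewrite !mxE sP.
Qed.

End FreeSheaf.

Section ProductSheaf.
Variables (X : topologicalType) (O : ring_sheaf X) (F G : mod_sheaf O).
Implicit Types U V W : opens X.

Definition prod_res_fun (U V : opens X) (h : V `<=` U) (s : F U * G U) : F V * G V :=
  (mres F h s.1, mres G h s.2).
Lemma prod_res_zmod (U V : opens X) (h : V `<=` U) : zmod_morphism (prod_res_fun h).
Proof. by move=> s t; rewrite /prod_res_fun /= !raddfB. Qed.
HB.instance Definition _ (U V : opens X) (h : V `<=` U) :=
  GRing.isZmodMorphism.Build (F U * G U)%type (F V * G V)%type (prod_res_fun h) (prod_res_zmod h).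

Program Definition prod_sheaf : mod_sheaf O :=
  @ModSheaf X O (fun U => (F U * G U)%type : lmodType (O U))
    (fun U V h => prod_res_fun h : {additive _ -> _}) _ _ _ _ _.
Next Obligation. by move=> U V h a s; exact: (congr2 pair (mresZ h a s.1) (mresZ h a s.2)). Qed.
Next Obligation. by move=> U h [s t]; exact: (congr2 pair (mres_id h s) (mres_id h t)). Qed.
Next Obligation.
move=> U V W h1 h2 h3 [s t]; exact: (congr2 pair (mres_comp h1 h2 h3 s) (mres_comp h1 h2 h3 t)).
Qed.
Next Obligation.
move=> U I V hV cov [s s'] [t t'] H; congr pair; apply: (msep cov) => i.
  exact: (congr1 fst (H i)).
exact: (congr1 snd (H i)).
Qed.
Next Obligation.
move=> U I V hV cov s comp.
have [|t tP] := @mglue _ _ F U I V hV cov (fun i => (s i).1).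
  by move=> i j W hi hj; exact: (congr1 fst (comp i j W hi hj)).
have [|t' t'P] := @mglue _ _ G U I V hV cov (fun i => (s i).2).
  by move=> i j W hi hj; exact: (congr1 snd (comp i j W hi hj)).
by exists (t, t') => i; rewrite /= /prod_res_fun /= tP t'P; case: (s i).
Qed.

Program Definition prod_fst : mor prod_sheaf F := @Mor _ _ prod_sheaf F (fun U => fst) _.
Next Obligation. by []. Qed.
Program Definition prod_snd : mor prod_sheaf G := @Mor _ _ prod_sheaf G (fun U => snd) _.
Next Obligation. by []. Qed.

Section Pairing.
Variables (H : mod_sheaf O) (f : mor H F) (g : mor H G).
Definition pairing_fun U (s : H U) : F U * G U := (f U s, g U s).
Lemma pairing_linear U : linear (@pairing_fun U).
Proof. by move=> a s t; rewrite /pairing_fun !linearP. Qed.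
HB.instance Definition _ U := GRing.isLinear.Build (O U) (H U) (F U * G U)%type *:%R
  (@pairing_fun U) (@pairing_linear U).
Program Definition pairing : mor H prod_sheaf :=
  @Mor _ _ H prod_sheaf (fun U => @pairing_fun U : {linear _ -> _}) _.
Next Obligation. by move=> U V h s; rewrite /= /pairing_fun !mor_res. Qed.
End Pairing.

Lemma prod_stalk_inj x (p q : mstalk prod_sheaf x) :
  smap x prod_fst p = smap x prod_fst q -> smap x prod_snd p = smap x prod_snd q -> p = q.
Proof.
have [U [Ux [s [t [_ [-> -> _]]]]]] := mgerm_surj3 p q q.
rewrite !smapE => /mgermP[W [h [h' [Wx e]]]] /mgermP[W' [k [k' [W'x e']]]].
have hU : oI W W' `<=` U by exact: subset_trans (@oIl _ _ _) h.
apply/mgermP; exists (oI W W'), hU, hU; split=> //; rewrite /= /prod_res_fun; congr pair.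
  by rewrite -(mres_comp h (@oIl _ _ _)) e (mres_comp h' _ hU).
by rewrite -(mres_comp k (@oIr _ _ _)) e' (mres_comp k' _ hU).
Qed.

Lemma prod_stalk_surj x (u : mstalk F x) (v : mstalk G x) :
  exists p, smap x prod_fst p = u /\ smap x prod_snd p = v.
Proof.
have [U [Ux [s ->]]] := mgerm_surj u; have [V [Vx [t [VU ->]]]] := mgerm_small v Ux.
exists (@mgerm _ _ prod_sheaf x V Vx (mres F VU s, t)); rewrite !smapE; split=> //.
exact: mgerm_res.
Qed.

(** Relations are solved in succession: generating relations for the first components are
    substituted into the second components, and relations among the resulting sections of [G] give
    those of the product. *)
Lemma prod_coherent : coherent F -> coherent G -> coherent prod_sheaf.
Proof.
move=> [Fft Frel] [Gft Grel]; split.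
  move=> x; have [U [n [g [Ux gP]]]] := Fft x; have [V [m [g' [Vx g'P]]]] := Gft x.
  pose e (i : 'I_(n + m)) : prod_sheaf (oI U V) := match split i with
    | inl i => (mres F (@oIl _ _ _) (g i), 0) | inr j => (0, mres G (@oIr _ _ _) (g' j)) end.
  exists (oI U V), (n + m)%N, e; split=> // W h [t t'] y Wy.
  have [W1 [h1 [h1U [c [W1y ec]]]]] := gP W (subset_trans h (@oIl _ _ _)) t y Wy.
  have [W2 [h2 [h2V [c' [W2y ec']]]]] := g'P W1 (subset_trans h1 (subset_trans h (@oIr _ _ _)))
    (mres G h1 t') y W1y.
  have hW2 := subset_trans h2 h1.
  exists W2, hW2, (subset_trans hW2 h), (fun i => match split i with
    | inl i => rres O h2 (c i) | inr j => c' j end); split=> //.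
  rewrite big_split_ord /=.
  rewrite (eq_bigr (fun i => (rres O h2 (c i) *: mres F (subset_trans h2 h1U) (g i), 0))); last first.
    move=> i _; rewrite /e !(unsplitK (inl i)) /prod_res_fun /= raddf0.
    by rewrite (mres_comp _ _ (subset_trans h2 h1U)); exact: (congr2 pair erefl (scaler0 _ _)).
  rewrite [X in _ + X](eq_bigr (fun i => (0, c' i *: mres G h2V (g' i)))); last first.
    move=> i _; rewrite /e !(unsplitK (inr i)) /prod_res_fun /= raddf0.
    by rewrite (mres_comp _ _ h2V); exact: (congr2 pair (scaler0 _ _) erefl).
  have fsum (I : Type) (r : seq I) (f : I -> F W2) (f' : I -> G W2) :
      \sum_(i <- r) ((f i, f' i) : prod_sheaf W2) = (\sum_(i <- r) f i, \sum_(i <- r) f' i).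
    by elim: r => [|i r IH]; rewrite ?big_nil ?big_cons ?IH.
  rewrite !fsum !big1_eq -[RHS]/((_ + 0, 0 + _)) addr0 add0r /prod_res_fun /=; congr pair.
    rewrite -(mres_comp h1 h2) ec raddf_sum; apply: eq_bigr => i _.
    by rewrite mresZ (mres_comp _ _ (subset_trans h2 h1U)).
  by rewrite -(mres_comp h1 h2) ec'.
move=> U n s x Ux.
have [V [h [m [r [Vx rP rG]]]]] := Frel U n (fun i => (s i).1) x Ux.
pose s' (j : 'I_m) : G V := \sum_i r j i *: mres G h (s i).2.
have [V' [h' [m' [r' [V'x r'P r'G]]]]] := Grel V m s' x Vx.
pose rr (j : 'I_m') (i : 'I_n) : O V' := \sum_l r' j l * rres O h' (r l i).
have hU := subset_trans h' h.
have fst_sum W (hW : W `<=` U) (a : 'I_n -> O W) :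
    (\sum_i a i *: mres prod_sheaf hW (s i)).1 = \sum_i a i *: mres F hW (s i).1.
  by rewrite (linear_sum (@fst (F W) (G W))).
have snd_sum W (hW : W `<=` U) (a : 'I_n -> O W) :
    (\sum_i a i *: mres prod_sheaf hW (s i)).2 = \sum_i a i *: mres G hW (s i).2.
  by rewrite (linear_sum (@snd (F W) (G W))).
have relE W (hW : W `<=` U) (a : 'I_n -> O W) : is_relation hW s a <->
    is_relation hW (fun i => (s i).1) a /\ is_relation hW (fun i => (s i).2) a.
  rewrite /is_relation -fst_sum -snd_sum; split=> [->//|[]].
  by case: (\sum_i _) => f g /= -> ->.
have comb W (hWV : W `<=` V) (hWU : W `<=` U) (c : 'I_m -> O W) (H : mod_sheaf O) (t : 'I_n -> H U) :
    \sum_i (\sum_l c l * rres O hWV (r l i)) *: mres H hWU (t i) =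
    \sum_l c l *: mres H hWV (\sum_i r l i *: mres H h (t i)).
  under eq_bigr do rewrite scaler_suml.
  rewrite exchange_big /=; apply: eq_bigr => l _.
  rewrite raddf_sum scaler_sumr; apply: eq_bigr => i _.
  by rewrite mresZ scalerA (mres_comp _ _ hWU).
exists V', hU, m', rr; split=> // [j|W hWV' hWU a /relE[Ha1 Ha2] y Wy].
  apply/relE; split; rewrite /is_relation /rr comb.
    by rewrite big1 // => l _; rewrite rP raddf0 scaler0.
  exact: r'P.
have hWV := subset_trans hWV' h'.
have [W1 [h1 [h1V [c [W1y ec]]]]] := rG W hWV hWU a Ha1 y Wy.
have h1U := subset_trans h1 hWU.
have h1V' := subset_trans h1 hWV'.
have [W2 [h2 [h2V' [c' [W2y ec']]]]] : exists W' (h1 : W' `<=` W1) (h2 : W' `<=` V') c',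
    oset W' y /\ forall i, rres O h1 (c i) = \sum_j c' j * rres O h2 (r' j i).
  apply: (r'G W1 h1V' h1V c) => //.
  rewrite /is_relation /s' -(comb W1 h1V h1U c G) -[RHS](raddf0 (mres G h1)) -[X in mres G h1 X]Ha2.
  rewrite raddf_sum; apply: eq_bigr => i _; rewrite mresZ ec; congr (_ *: _).
  by rewrite (mres_comp _ _ h1U).
exists W2, (subset_trans h2 h1), h2V', c'; split=> // i.
rewrite -(rres_comp h1 h2) ec rmorph_sum /rr.
under [RHS]eq_bigr do rewrite rmorph_sum mulr_sumr.
rewrite exchange_big /=; apply: eq_bigr => l _; rewrite rmorphM ec' mulr_suml.
apply: eq_bigr => j _; rewrite rmorphM mulrA; congr (_ * _).
by rewrite (rres_comp _ _ (subset_trans h2 h1V)) (rres_comp _ _ (subset_trans h2 h1V)).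
Qed.

End ProductSheaf.

Section PointSubsheaf.
Variables (X : topologicalType) (O : ring_sheaf X) (F : mod_sheaf O) (y : X).
Variables (N : set (mstalk F y)) (sN : is_submod N).

(** For a closed point [y] this alters the sheaf at [y] only, replacing the stalk there by [N]. *)
Program Definition point_subsheaf : subsheaf F :=
  @Subsheaf X O F (fun U => [set s | forall Uy : oset U y, N (mgerm Uy s)]) _ _ _ _ _.
Next Obligation. by move=> U Uy; rewrite mgerm0; exact: smod0. Qed.
Next Obligation. by move=> U s t Ns Nt Uy; rewrite mgermD; exact: smodD. Qed.
Next Obligation. by move=> U a s Ns Uy; rewrite mgermZ; exact: smodZ. Qed.
Next Obligation. by move=> U V h s Ns Vy; rewrite (mgerm_res (h _ Vy)); exact: Ns. Qed.
Next Obligation.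
move=> U s H Uy; have [V [h [Vy Ns]]] := H _ Uy.
by rewrite -(mgerm_res Uy Vy h); exact: Ns.
Qed.

Lemma point_stalk p : N (smap y (sub_inc point_subsheaf) p).
Proof.
have [U [Uy [s [Ns ->]]]] := sub_stalk_ex p; exact: Ns.
Qed.

Lemma point_stalk_lift u : N u -> exists p, smap y (sub_inc point_subsheaf) p = u.
Proof.
have [U [Uy [s ->]]] := mgerm_surj u => Nu; apply: sub_stalk_im => Uy'.
by rewrite (Prop_irrelevance Uy' Uy).
Qed.

Hypothesis y_closed : closed [set y].

Definition open_off : opens X := Opens (closed_openC y_closed).

Lemma off_stalk_lift x u : x <> y -> exists p, smap x (sub_inc point_subsheaf) p = u.
Proof.
move=> xy; have [|U [Ux [s [UO ->]]]] := @mgerm_small _ _ F x u open_off; first by [].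
by apply: sub_stalk_im => Uy; have := UO _ Uy; case.
Qed.

End PointSubsheaf.

(** * Minimal resolutions over a local ring *)

Lemma mulset_map (R : comPzRingType) (M N : lmodType R) (f : {linear M -> N}) I P Q u :
  (forall v, P v -> Q (f v)) -> mulset I P u -> mulset I Q (f u).
Proof.
move=> PQ; apply: (@mulset_min R M I P [set u | mulset I Q (f u)]).
  have sQ := mulset_submod I Q; split.
  - by rewrite /= raddf0; exact: (smod0 sQ).
  - by move=> v w Hv Hw; rewrite /= raddfD; exact: (smodD sQ).
  - by move=> a v Hv; rewrite /= linearZ; exact: (smodZ _ sQ).
by move=> a v Ia Pv; rewrite /= linearZ; apply: mulset_in => //; exact: PQ.
Qed.

Lemma noetherian_prod (R : comPzRingType) (M : lmodType R) q : noetherian R ->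
  noetherian_mod M -> noetherian_mod (M * 'rV[R]_q)%type.
Proof.
move=> nR nM N sN.
have [|n [g gT]] := nM setT; first by split.
pose h (i : 'I_(n + q)) : (M * 'rV[R]_q)%type := match split i with
  | inl i => (g i, 0) | inr j => (0, delta_mx 0 j) end.
apply: (@noetherian_span R _ _ h) => // -[u v] _.
have [c ->] : span_of g u by rewrite -gT.
exists (fun i => match split i with inl i => c i | inr j => v 0 j end).
rewrite big_split_ord /=.
rewrite (eq_bigr (fun i => (c i *: g i, 0))) => [|i _]; last first.
  by rewrite /h !(unsplitK (inl i)); exact: (congr2 pair erefl (scaler0 _ _)).
rewrite [X in _ + X](eq_bigr (fun j => (0, v 0 j *: delta_mx 0 j))) => [|i _]; last first.
  by rewrite /h !(unsplitK (inr i)); exact: (congr2 pair (scaler0 _ _) erefl).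
have fsum (I : Type) (r : seq I) (f : I -> M) (f' : I -> 'rV[R]_q) :
    \sum_(i <- r) ((f i, f' i) : M * 'rV[R]_q) = (\sum_(i <- r) f i, \sum_(i <- r) f' i).
  by elim: r => [|i r IH]; rewrite ?big_nil ?big_cons ?IH.
by rewrite !fsum !big1_eq -[RHS]/((_ + 0, 0 + _)) addr0 add0r -row_sum_delta.
Qed.

Section MinimalGenerators.
Variables (R : comPzRingType) (m : set R).
Hypothesis mI : is_ideal m.
Hypothesis m_unit1 : forall a, m a -> is_unit (1 - a).
Hypothesis m_unit : forall a, ~ m a -> is_unit a.

Lemma minimal_generators (M : lmodType R) (X D : set M) :
  fg_submod X -> is_submod D -> D `<=` X ->
  exists n (g : 'I_n -> M), [/\ forall i, X (g i),
    forall u, X u -> exists c : 'I_n -> R, D (u - \sum_i c i *: g i) &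
    forall c : 'I_n -> R, (exists v, mulset m X v /\ D (\sum_i c i *: g i - v)) ->
      forall i, m (c i)].
Proof.
move=> fgX sD DX.
have sX : is_submod X by have [n [g ->]] := fgX; exact: span_of_submod.
pose G n := `[< exists2 g : 'I_n -> M, (forall i, X (g i)) &
  forall u, X u -> exists c : 'I_n -> R, D (u - \sum_i c i *: g i) >].
have exG : exists n, G n.
  have [n [g Xg]] := fgX; exists n; apply/asboolP; exists g => [i|u].
    by rewrite Xg; exact: span_of_gen.
  by rewrite Xg => -[c ->]; exists c; rewrite subrr; exact: smod0.
case: (ex_minnP exG) => n /asboolP[g Xg gP] minn; exists n, g; split=> //.
move=> c [v [mv Dv]] i0; apply: contrapT => mc.
case: n g Xg gP minn c Dv i0 mc => [|n] g Xg gP minn c Dv i0 mc; first by case: i0 mc.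
have [b bc] := m_unit mc.
pose P : set M := [set u | exists a : 'I_n -> R, D (u - \sum_i a i *: g (lift i0 i))].
have sP : is_submod P.
  split.
  - exists (fun=> 0); rewrite big1 ?subr0 => [|i _]; [exact: (smod0 sD)|by rewrite scale0r].
  - move=> u u' [a Da] [a' Da']; exists (fun i => a i + a' i).
    have := smodD sD Da Da'; congr D; rewrite addrACA -opprD -big_split; congr (_ - _).
    by apply: eq_bigr => i _; rewrite scalerDl.
  - move=> e u [a Da]; exists (fun i => e * a i).
    have := smodZ e sD Da; congr D; rewrite scalerBr scaler_sumr; congr (_ - _).
    by apply: eq_bigr => i _; rewrite scalerA.
have DP u : D u -> P u.
  by move=> Du; exists (fun=> 0); rewrite big1 ?subr0 // => i _; rewrite scale0r.
have gP' i : P (g (lift i0 i)).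
  exists (fun j => (j == i)%:R); rewrite (bigD1 i) //= eqxx scale1r big1 ?addr0 ?subrr.
    exact: (smod0 sD).
  by move=> j /negPf ->; rewrite scale0r.
have sm := mulset_submod m X.
have [p [v' [Pp mv' eg]]] : exists p v', [/\ P p, mulset m X v' & g i0 = v' + p].
  pose p0 := \sum_i c i *: g i - v.
  exists (b *: (p0 - \sum_i c (lift i0 i) *: g (lift i0 i))), (b *: v); split.
  - apply: (smodZ _ sP); apply: (smodB sP); first exact: DP.
    by apply: (smod_sum _ sP) => i _; exact: (smodZ _ sP).
  - exact: (smodZ _ sm).
  rewrite -scalerDr /p0 (bigD1_ord i0) //= addrA (addrC v) subrK addrK scalerA.
  by rewrite mulrC bc scale1r.
have XP : X `<=` P.
  apply: (nakayama mI m_unit1) => // u /gP[a Da].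
  exists (a i0 *: v'), (u - a i0 *: v'); split; [exact: (smodZ _ sm)| |by rewrite addrC subrK].
  have -> : u - a i0 *: v' = (u - \sum_i a i *: g i) + a i0 *: p +
      \sum_i a (lift i0 i) *: g (lift i0 i).
    rewrite (bigD1_ord i0) //= eg scalerDr opprD addrA.
    by rewrite [X in _ = X + _]addrAC opprD addrA subrK subrK.
  apply: (smodD sP); last by apply: (smod_sum _ sP) => i _; exact: (smodZ _ sP).
  by apply: (smodD sP); [exact: DP|exact: (smodZ _ sP)].
have /minn : G n by apply/asboolP; exists (fun i => g (lift i0 i)) => // u /XP.
by rewrite ltnn.
Qed.

Variables (M : int -> lmodType R) (d : forall n m, {linear M n -> M m}).
Hypothesis dd : forall n m p u, d m p (d n m u) = 0.
Hypothesis nR : noetherian R.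
Hypothesis nM : forall l, noetherian_mod (M l).

(** Differentials and images of basis elements are functions on [nat], with sizes supplied by the
    ranks: the ranks are fixed one degree at a time, and typed matrices would have to be transported
    at each change. *)
Definition rmx (D : nat -> nat -> R) r0 r1 : 'M[R]_(r0, r1) := \matrix_(a, s) D a s.
Definition rlin l r (p : nat -> M l) (v : 'rV[R]_r) : M l := \sum_a v 0 a *: p a.

(** The cycles in degree [l] of the cone of the comparison map from the free complex, built so far
    in degrees above [l], to [M]. [Bset] gives the boundaries of this cone, which come from [M]
    alone. *)
Definition Xset l r1 r2 (D1 : nat -> nat -> R) (p1 : nat -> M (l + 1)) : set (M l * 'rV[R]_r1) :=
  [set u | u.2 *m rmx D1 r1 r2 = 0 /\ rlin p1 u.2 = d l (l + 1) u.1].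

Definition Bset l r1 : set (M l * 'rV[R]_r1) :=
  [set u | u.2 = 0 /\ exists l' (w : M l'), l = l' + 1 /\ u.1 = d l' l w].

Definition rgen l r1 (D0 : nat -> nat -> R) (p0 : nat -> M l) (a : nat) : (M l * 'rV[R]_r1)%type :=
  (p0 a, \row_s D0 a s).

(** The new basis generates the homology of that cone in degree [l]; the last clause is minimality,
    phrased through coefficients in [m]. *)
Definition res_at l r0 r1 r2 (D0 D1 : nat -> nat -> R) (p0 : nat -> M l) (p1 : nat -> M (l + 1)) :=
  [/\ forall a : 'I_r0, Xset r2 D1 p1 (rgen r1 D0 p0 a),
      forall u, Xset r2 D1 p1 u -> exists c : 'I_r0 -> R, Bset (u - \sum_a c a *: rgen r1 D0 p0 a) &
      forall c : 'I_r0 -> R, (exists v, mulset m (@Xset l r1 r2 D1 p1) v /\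
        Bset (\sum_a c a *: rgen r1 D0 p0 a - v)) -> forall a, m (c a)].

Lemma rlin_linear l r (p : nat -> M l) : linear (@rlin l r p).
Proof.
move=> a u v; rewrite /rlin scaler_sumr -big_split; apply: eq_bigr => i _.
by rewrite !mxE scalerDl scalerA.
Qed.

Lemma Xset_submod l r1 r2 D1 (p1 : nat -> M (l + 1)) : is_submod (@Xset l r1 r2 D1 p1).
Proof.
split.
- split; first by rewrite /= mul0mx.
  by rewrite /= raddf0 /rlin big1 // => i _; rewrite mxE scale0r.
- move=> u v [u1 u2] [v1 v2]; split; first by rewrite /= mulmxDl u1 v1 addr0.
  have := rlin_linear p1 1 u.2 v.2; rewrite !scale1r /= => ->.
  by rewrite raddfD /= u2 v2.
- move=> a u [u1 u2]; split; first by rewrite /= -scalemxAl u1 scaler0.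
  have := rlin_linear p1 a u.2 0; rewrite !addr0 /= => ->.
  by rewrite linearZ /= u2 /rlin big1 ?addr0 // => i _; rewrite mxE scale0r.
Qed.

Lemma Bset_submod l r1 : is_submod (@Bset l r1).
Proof.
split.
- by split=> //; exists (l - 1), 0; split; [rewrite subrK|rewrite !raddf0].
- move=> u v [u1 [l' [w [e ew]]]] [v1 [l'' [w' [e' ew']]]].
  split; first by rewrite /= u1 v1 addr0.
  have e2 : l'' = l' by apply: (addIr 1); rewrite -e' e.
  by subst l''; exists l', (w + w'); split=> //; rewrite [RHS]raddfD /= -ew -ew'.
- move=> a u [u1 [l' [w [e ew]]]]; split; first by rewrite /= u1 scaler0.
  by exists l', (a *: w); split=> //; rewrite [RHS]linearZ /= -ew.
Qed.

Lemma resolve_step l r1 r2 D1 (p1 : nat -> M (l + 1)) : exists r0 D0 (p0 : nat -> M l),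
  res_at r0 r1 r2 D0 D1 p0 p1.
Proof.
have [||u [u0 [l' [w [e ew]]]]|r0 [g [gX gG gM]]] :=
  @minimal_generators (M l * 'rV[R]_r1)%type (@Xset l r1 r2 D1 p1) (@Bset l r1).
- by apply: (noetherian_prod nR (@nM l)); exact: Xset_submod.
- exact: Bset_submod.
- split; first by rewrite u0 mul0mx.
  by rewrite u0 ew dd /rlin big1 // => i _; rewrite mxE scale0r.
exists r0, (fun a s => if insub a is Some i then if insub s is Some j then (g i).2 0 j else 0 else 0),
  (fun a => if insub a is Some i then (g i).1 else 0).
have gE (a : 'I_r0) : rgen r1 (fun a s => if insub a is Some i then if insub s is Some j
    then (g i).2 0 j else 0 else 0) (fun a => if insub a is Some i then (g i).1 else 0) a = g a.
  rewrite /rgen valK; case: (g a) => c v /=; congr pair; apply/rowP => s.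
  by rewrite mxE !valK.
have gsum (c : 'I_r0 -> R) : \sum_a c a *: rgen r1 (fun a s => if insub a is Some i then
    if insub s is Some j then (g i).2 0 j else 0 else 0)
    (fun a => if insub a is Some i then (g i).1 else 0) a = \sum_a c a *: g a.
  by apply: eq_bigr => a _; rewrite gE.
split.
- by move=> a; rewrite gE.
- by move=> u /gG[c Hc]; exists c; rewrite gsum.
- by move=> c; rewrite gsum; exact: gM.
Qed.

Definition resolved n (rk : int -> nat) (D : int -> nat -> nat -> R) (p : forall l, nat -> M l) :=
  forall l, (n <= l)%R -> res_at (rk l) (rk (l + 1)) (rk (l + 1 + 1)) (D l) (D (l + 1)) (p l) (p (l + 1)).

Variable b0 : int.
Hypothesis top0 : forall l, (b0 <= l)%R -> forall u : M l, u = 0.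

(** Descending induction from the degree [b0] above which [M] vanishes. The property [P] is
    established at the moment a rank is chosen: at that point all ranks in degrees at most [n] are
    still zero, so the free complex is bounded, as the construction of an apex will require. *)
Lemma resolution_exists (P : int -> nat -> Prop) :
  (forall n rk D p r0 D0 (p0 : nat -> M n), resolved (n + 1) rk D p ->
     (forall l, (b0 <= l)%R || (l <= n)%R -> rk l = 0%N) ->
     res_at r0 (rk (n + 1)) (rk (n + 1 + 1)) D0 (D (n + 1)) p0 (p (n + 1)) -> P n r0) ->
  forall i : nat, exists rk D p, [/\ resolved (b0 - i%:Z) rk D p,
    forall l, (b0 <= l)%R || (l < b0 - i%:Z)%R -> rk l = 0%N &
    forall l, (b0 - i%:Z <= l < b0)%R -> P l (rk l)].
Proof.
move=> HP; elim=> [|i [rk [D [p [res rk0 Prk]]]]].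
  exists (fun=> 0%N), (fun _ _ _ => 0), (fun _ _ => 0); rewrite subr0; split=> // l.
    move=> bl; split=> [[]//|u _|c _ []//].
    exists (fun=> 0); rewrite big_ord0 subr0; split; first exact: thinmx0.
    by exists (l - 1), 0; split; [rewrite subrK|rewrite !raddf0 (top0 bl u.1)].
  by case: (leP b0 l) => //= /lt_le_trans/(_) H; rewrite andbF.
pose n := b0 - i.+1%:Z.
have n1 : n + 1 = b0 - i%:Z by rewrite /n -addn1 PoszD; ring.
have [r0 [D0 [p0 rn]]] := @resolve_step n (rk (n + 1)) (rk (n + 1 + 1)) (D (n + 1)) (p (n + 1)).
have ltn l : (l < n + 1)%R = (l <= n)%R by rewrite ltzD1.
pose rk' l := if l == n then r0 else rk l.
pose D' l := if l == n then D0 else D l.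
pose p' := dfwith p p0.
have rkE l : (n < l)%R -> rk' l = rk l by move=> nl; rewrite /rk' gt_eqF.
have DE l : (n < l)%R -> D' l = D l by move=> nl; rewrite /D' gt_eqF.
have pE l : (n < l)%R -> p' l = p l by move=> nl; rewrite /p' dfwith_out // lt_eqF.
have nn : (n < n + 1)%R by rewrite ltrDl.
have nn2 : (n < n + 1 + 1)%R by rewrite (lt_trans nn) // ltrDl.
exists rk', D', p'; split.
- move=> l; rewrite -/n le_eqVlt => /orP[/eqP <-|nl].
    rewrite (rkE _ nn) (rkE _ nn2) (DE _ nn) (pE _ nn) /rk' /D' eqxx.
    by rewrite /p' dfwith_in.
  have nl1 : (n < l + 1)%R by rewrite (lt_trans nl) // ltrDl.
  have nl2 : (n < l + 1 + 1)%R by rewrite (lt_trans nl1) // ltrDl.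
  rewrite (rkE _ nl) (rkE _ nl1) (rkE _ nl2) (DE _ nl) (DE _ nl1) (pE _ nl) (pE _ nl1).
  by apply: res; rewrite -n1 lezD1.
- move=> l; rewrite -/n => H; rewrite /rk'; case: eqP => [ln|_]; last first.
    by apply: rk0; rewrite -n1 ltn; case/orP: H => [->//|/ltW ->]; rewrite orbT.
  exfalso; move: H; rewrite ln ltxx orbF /n => H.
  by move: H; rewrite lerBrDr gerDl.
- move=> l; rewrite -/n le_eqVlt => /andP[/orP[/eqP <- _|nl lb]]; last first.
    by rewrite rkE //; apply: Prk; rewrite -n1 lezD1 nl.
  rewrite /rk' eqxx; apply: (HP n rk D p r0 D0 p0) => //; first by rewrite n1.
  by move=> l' H; apply: rk0; rewrite -n1 ltn.
Qed.

HB.instance Definition _ l r (p : nat -> M l) :=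
  GRing.isLinear.Build R 'rV[R]_r (M l) *:%R (@rlin l r p) (@rlin_linear l r p).

Lemma rgen_sum l r0 r1 D0 (p0 : nat -> M l) (c : 'I_r0 -> R) :
  \sum_a c a *: rgen r1 D0 p0 a = (rlin p0 (\row_a c a), (\row_a c a) *m rmx D0 r0 r1).
Proof.
have fsum (s : seq 'I_r0) (f : 'I_r0 -> M l) (f' : 'I_r0 -> 'rV[R]_r1) :
    \sum_(i <- s) ((f i, f' i) : M l * 'rV[R]_r1) = (\sum_(i <- s) f i, \sum_(i <- s) f' i).
  by elim: s => [|i s IH]; rewrite ?big_nil ?big_cons ?IH.
rewrite (eq_bigr (fun a => (c a *: p0 a, c a *: \row_s D0 a s))) // fsum; congr pair.
  by apply: eq_bigr => a _; rewrite mxE.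
apply/rowP => s; rewrite summxE !mxE; apply: eq_bigr => a _; by rewrite !mxE.
Qed.

Lemma res_comb l r0 r1 r2 D0 D1 p0 (p1 : nat -> M (l + 1)) : res_at r0 r1 r2 D0 D1 p0 p1 ->
  [/\ forall c : 'rV_r0, c *m rmx D0 r0 r1 *m rmx D1 r1 r2 = 0,
      forall c : 'rV_r0, rlin p1 (c *m rmx D0 r0 r1) = d l (l + 1) (rlin p0 c),
      forall u, Xset r2 D1 p1 u -> exists c : 'rV_r0, u.2 = c *m rmx D0 r0 r1 /\
        exists l' w, l = l' + 1 /\ u.1 = rlin p0 c + d l' l w &
      forall c : 'rV_r0, (exists v l' w, [/\ mulset m (@Xset l r1 r2 D1 p1) v, l = l' + 1,
        c *m rmx D0 r0 r1 = v.2 & rlin p0 c = v.1 + d l' l w]) -> forall a, m (c 0 a)].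
Proof.
move=> [H1 H2 H3].
have rowE (c : 'rV[R]_r0) : \row_a c 0 a = c by apply/rowP => a; rewrite mxE.
have X1 (c : 'rV_r0) : Xset r2 D1 p1 (rlin p0 c, c *m rmx D0 r0 r1).
  rewrite -{1 2}(rowE c) -(rgen_sum r1 D0 p0 (c 0)).
  have sX := @Xset_submod l r1 r2 D1 p1.
  by apply: (smod_sum _ sX) => a _; apply: (smodZ _ sX); exact: H1.
split=> [c|c|u|c [v [l' [w [mv e e2 e1]]]] a].
- by case: (X1 c).
- by case: (X1 c).
- move=> /H2[c]; rewrite rgen_sum => -[/= e2 [l' [w [e e1]]]].
  exists (\row_a c a); split; first by apply/eqP; rewrite -subr_eq0; apply/eqP.
  by exists l', w; split=> //; rewrite -e1 addrC subrK.
- apply: (H3 (c 0)); exists v; split=> //; rewrite rgen_sum rowE; split=> /=.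
    by rewrite e2 subrr.
  by exists l', w; rewrite e1 addrAC subrr add0r.
Qed.

(** * A stalk subcomplex carrying a functional that no homotopy kills *)

Section LocalApex.
Variables (q : nat) (y : 'I_q -> R).
Hypothesis ym : gpow y 1 `<=` m.
Variables (n : int) (rk : int -> nat) (D : int -> nat -> nat -> R) (p : forall l, nat -> M l).
Variables (r0 : nat) (D0 : nat -> nat -> R) (p0 : nat -> M n).
Hypothesis res : resolved (n + 1) rk D p.
Hypothesis resn : res_at r0 (rk (n + 1)) (rk (n + 1 + 1)) D0 (D (n + 1)) p0 (p (n + 1)).
Hypothesis rk0 : forall l, (b0 <= l)%R -> rk l = 0%N.
Variables (N : int -> lmodType R) (dN : forall n m, {linear N n -> N m}).
Hypothesis dNN : forall n m p u, dN m p (dN n m u) = 0.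
Hypothesis nN : forall l, noetherian_mod (N l).
Variable p1 : forall l, {linear N l -> M l}.
Variable p2 : forall l, {linear N l -> 'rV[R]_(rk l + rk (l + 1))}.
Variable mk : forall l, M l -> 'rV[R]_(rk l + rk (l + 1)) -> N l.
Hypothesis mk1 : forall l u v, p1 l (mk u v) = u.
Hypothesis mk2 : forall l u v, p2 l (@mk l u v) = v.
Hypothesis pinj : forall l u v, p1 l u = p1 l v -> p2 l u = p2 l v -> u = v.
Hypothesis p1d : forall l l' u, p1 l' (dN l l' u) = d l l' (p1 l u).
Hypothesis p2d : forall l u, p2 (l + 1) (dN l (l + 1) u) = row_mx (rsubmx (p2 l u)) 0.

Local Notation DD l := (rmx (D l) (rk l) (rk (l + 1))).

(** [N] is [M] plus the contractible complex with terms [F^l + F^(l+1)], where [F] is the free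
    complex. The second summand makes the comparison map from [F] injective without changing
    homology. *)
Definition emb l (g : 'rV[R]_(rk l)) : N l := mk (rlin (p l) g) (row_mx g (g *m DD l)).

Lemma emb_linear l : linear (@emb l).
Proof.
move=> a u v; apply: pinj; rewrite linearP !(mk1, mk2) ?linearP //.
by rewrite scale_row_mx add_row_mx mulmxDl scalemxAl.
Qed.
HB.instance Definition _ l := GRing.isLinear.Build R 'rV[R]_(rk l) (N l) *:%R (@emb l) (@emb_linear l).

(** Forgetting the component in [F^l] compares [N] with the cone whose cycles are [Xset]. *)
Definition tau l (u : N l) : (M l * 'rV[R]_(rk (l + 1)))%type := (p1 l u, rsubmx (p2 l u)).
Lemma tau_linear l : linear (@tau l).
Proof.
move=> a u v; exact: (congr2 pair (linearP (p1 l) a u v) (etrans (congr1 rsubmx (linearP (p2 l) a u v))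
  (linearP rsubmx a (p2 l u) (p2 l v)))).
Qed.
HB.instance Definition _ l := GRing.isLinear.Build R (N l) (M l * 'rV[R]_(rk (l + 1)))%type *:%R
  (@tau l) (@tau_linear l).

Lemma cone_boundary l l' (u : N l) w : l = l' + 1 -> dN l (l + 1) u = 0 -> p1 l u = d l' l w ->
  exists e : N l', u = dN l' l e /\ p1 l' e = w.
Proof.
move=> e; subst l => du uw; exists (mk w (row_mx 0 (lsubmx (p2 _ u)))).
rewrite mk1; split=> //; apply: pinj; first by rewrite p1d mk1.
rewrite p2d mk2 row_mxKr -[LHS]hsubmxK; congr row_mx.
have := congr1 (fun v => lsubmx (p2 _ v)) du.
by rewrite p2d !raddf0 /= row_mxKl.
Qed.

Lemma emb_d l g : (n + 1 <= l)%R -> dN l (l + 1) (@emb l g) = emb (g *m DD l).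
Proof.
move=> nl; have [H1 H2 _ _] := res_comb (res nl).
apply: pinj; first by rewrite p1d !mk1 H2.
by rewrite p2d !mk2 row_mxKr H1.
Qed.

Lemma tau_X l (u : N l) g : dN l (l + 1) u = emb g ->
  tau u = (p1 l u, g) /\ Xset (rk (l + 1 + 1)) (D (l + 1)) (p (l + 1)) (tau u).
Proof.
move=> e; have := congr1 (@p2 _) e; rewrite p2d mk2 => /eq_row_mx[eg gD].
have := congr1 (@p1 _) e; rewrite p1d mk1 => e1.
by rewrite /tau eg; split=> //; split=> /=.
Qed.

(** A subcomplex of [N] with the same homology which is the embedded free complex above degree [n].
    In degree [n] it is as large as possible; there [tau] sends it to [Xset], whose minimal
    generators will define a functional. *)
Definition XX l : set (N l) := if (l < n)%R then setT else
  if l == n then [set u | exists g, dN l (l + 1) u = emb g] else [set u | exists g, u = emb g].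

Lemma XX_submod l : is_submod (@XX l).
Proof.
rewrite /XX; case: ifP => _; first by split.
case: ifP => _; split.
- by exists 0; rewrite !raddf0.
- by move=> u v [g eu] [h ev]; exists (g + h); rewrite !raddfD /= eu ev.
- by move=> a u [g eu]; exists (a *: g); rewrite !linearZ /= eu.
- by exists 0; rewrite !raddf0.
- by move=> u v [g eu] [h ev]; exists (g + h); rewrite !raddfD /= eu ev.
- by move=> a u [g eu]; exists (a *: g); rewrite !linearZ /= eu.
Qed.

Lemma XX_cycle l (u : N l) : dN l (l + 1) u = 0 ->
  exists x l' w, [/\ XX x, l = l' + 1 & u = x + dN l' l w].
Proof.
move=> du; have [ln|nl|ln] := ltgtP l n.
- by exists u, (l - 1), 0; rewrite raddf0 addr0 subrK /XX ln.
- have nl1 : (n + 1 <= l)%R by rewrite lezD1.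
  have [_ _ H _] := res_comb (res nl1).
  have tu : dN l (l + 1) u = emb 0 by rewrite du raddf0.
  have [etu /H[c]] := tau_X tu; rewrite etu /= => -[c0 [l' [w [e e1]]]].
  exists (emb c), l'.
  have [||e' [ee _]] := @cone_boundary l l' (u - emb c) w e.
  + by rewrite raddfB /= du emb_d // -c0 raddf0 subrr.
  + by rewrite raddfB /= mk1 e1 addrC addKr.
  exists e'; split=> //; last by rewrite -ee addrC subrK.
  rewrite /XX ltNge (ltW nl) /= gt_eqF //; by exists c.
- have [f1 f2] : ((l < n)%R = false) /\ (l == n) by rewrite ln ltxx eqxx.
  exists u, (l - 1), 0; rewrite raddf0 addr0 subrK /XX f1 f2; split=> //.
  by exists 0; rewrite raddf0.
Qed.

Lemma XX_boundary l l' (e : N l') : l = l' + 1 -> XX (dN l' l e) ->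
  exists x, XX x /\ dN l' l e = dN l' l x.
Proof.
move=> ll; subst l => Xe; have [ln|nl|ln] := ltgtP l' n.
- by exists e; rewrite /XX ln.
- move: Xe; rewrite {1}/XX ltNge (ltW (lt_trans nl _)) ?ltrDl //= gt_eqF ?(lt_trans nl) ?ltrDl // => -[g eg].
  have nl1 : (n + 1 <= l')%R by rewrite lezD1.
  have [_ _ H _] := res_comb (res nl1).
  have [etu /H[c]] := tau_X eg; rewrite etu /= => -[gc _].
  exists (emb c); split; first by rewrite /XX ltNge (ltW nl) /= gt_eqF //; exists c.
  by rewrite eg emb_d // -gc.
- exists e; split=> //.
  have [f1 f2] : ((l' < n)%R = false) /\ (l' == n) by rewrite ln ltxx eqxx.
  have [f3 f4] : ((l' + 1 < n)%R = false) /\ (l' + 1 == n = false).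
    by rewrite ln ltNge ltW ?ltrDl // gt_eqF ?ltrDl.
  by move: Xe; rewrite /XX f1 f2 f3 f4 => -[g eg]; exists g.
Qed.

Lemma XX_d l l' (x : N l) : l' = l + 1 -> XX x -> XX (dN l l' x).
Proof.
move=> ll; subst l' => Xx; have [ln|nl|ln] := ltgtP l n.
- have : (l + 1 <= n)%R by rewrite lezD1.
  rewrite le_eqVlt => /orP[/eqP ln1|ln1]; last by rewrite /XX ln1.
  have [f1 f2] : ((l + 1 < n)%R = false) /\ (l + 1 == n) by rewrite ln1 ltxx eqxx.
  by rewrite /XX f1 f2; exists 0; rewrite dNN raddf0.
- move: Xx; rewrite {1}/XX ltNge (ltW nl) /= gt_eqF // => -[g ->].
  rewrite emb_d ?lezD1 // /XX ltNge (ltW (lt_trans nl _)) ?ltrDl //= gt_eqF ?(lt_trans nl) ?ltrDl //.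
  by exists (g *m DD l).
- have [f1 f2] : ((l < n)%R = false) /\ (l == n) by rewrite ln ltxx eqxx.
  have [f3 f4] : ((l + 1 < n)%R = false) /\ (l + 1 == n = false).
    by rewrite ln ltNge ltW ?ltrDl // gt_eqF ?ltrDl.
  by move: Xx; rewrite /XX f1 f2 f3 f4 => -[g ->]; exists g.
Qed.

Definition ZZ l : set (N l) := [set u | exists x l' w, [/\ XX x, l = l' + 1 & u = x + dN l' l w]].

Lemma ZZ_submod l : is_submod (@ZZ l).
Proof.
have sX := XX_submod l; split.
- by exists 0, (l - 1), 0; rewrite raddf0 addr0 subrK; split=> //; exact: (smod0 sX).
- move=> u v [x [l1 [w [Xx e1 ->]]]] [x' [l2 [w' [Xx' e2 ->]]]].
  have e : l2 = l1 by apply: (addIr 1); rewrite -e1 -e2.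
  subst l2; exists (x + x'), l1, (w + w'); split=> //; first exact: (smodD sX).
  by rewrite raddfD addrACA.
- move=> a u [x [l1 [w [Xx e1 ->]]]]; exists (a *: x), l1, (a *: w); split=> //; first exact: (smodZ _ sX).
  by rewrite linearZ scalerDr.
Qed.

(** The exponents are chosen upwards from degree [n], each by Artin-Rees relative to the preceding
    one. *)
Lemma exponents_exist : exists t : int -> nat,
  (forall u : N n, mulset (gpow y (t n)) setT u -> XX u -> mulset (gpow y 1) (@XX n) u) /\
  forall l (u : N (l + 1)), (n <= l)%R -> mulset (gpow y (t (l + 1))) setT u -> ZZ u ->
    mulset (gpow y (t l)) (@ZZ (l + 1)) u.
Proof.
have /choice[f fP] l : exists g : nat -> nat, forall s (u : N l),
    mulset (gpow y (g s)) setT u -> ZZ u -> mulset (gpow y s) (@ZZ l) u.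
  have H s := artin_rees y (nN (l := l)) s (ZZ_submod l).
  by have [g gP] := choice H; exists g.
have [t0 t0P] := artin_rees y (nN (l := n)) 1 (XX_submod n).
pose T := fix T j := if j is j'.+1 then f (n + j%:Z) (T j') else t0.
exists (fun l => T `|l - n|%N); split; first by rewrite subrr.
move=> l u nl.
have nl0 : (0 <= l - n)%R by rewrite subr_ge0.
have -> : `|(l + 1 - n)%R|%N = `|(l - n)%R|%N.+1 by lia.
have e : n + `|(l - n)%R|%N.+1%:Z = l + 1 by lia.
by rewrite /= e; exact: fP.
Qed.

Variable t : int -> nat.
Hypothesis tn : forall u : N n, mulset (gpow y (t n)) setT u -> XX u -> mulset (gpow y 1) (@XX n) u.
Hypothesis tS : forall l (u : N (l + 1)), (n <= l)%R -> mulset (gpow y (t (l + 1))) setT u -> ZZ u ->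
    mulset (gpow y (t l)) (@ZZ (l + 1)) u.

Local Notation JN l := (mulset (gpow y (t l)) (@setT (N l))).

(** [XX] need not contain a power of the maximal ideal times [N], which coherence of the
    corresponding subsheaf demands. It is thickened by [(y)^(t l) N], and by the boundaries of such
    elements so as to remain a subcomplex. *)
Definition WW l : set (N l) := [set u | exists x c l' (a : N l'),
  [/\ XX x, JN l c, l = l' + 1, JN l' a & u = x + dN l' l a + c]].

Lemma WW_submod l : is_submod (@WW l).
Proof.
have sX := XX_submod l; have sJ l' := mulset_submod (gpow y (t l')) (@setT (N l')); split.
- exists 0, 0, (l - 1), 0; rewrite raddf0 !addr0 subrK.
  by split=> //; [exact: (smod0 sX)|exact: (smod0 (sJ _))|exact: (smod0 (sJ _))].
- move=> u v [x [c [l1 [w [Xx Jc e1 Jw ->]]]]] [x' [c' [l2 [w' [Xx' Jc' e2 Jw' ->]]]]].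
  have e : l2 = l1 by apply: (addIr 1); rewrite -e1 -e2.
  subst l2; exists (x + x'), (c + c'), l1, (w + w').
  split=> //; [exact: (smodD sX)|exact: (smodD (sJ _))|exact: (smodD (sJ _))|].
  by rewrite raddfD addrACA (addrACA x).
- move=> a u [x [c [l1 [w [Xx Jc e1 Jw ->]]]]]; exists (a *: x), (a *: c), l1, (a *: w).
  split=> //; [exact: (smodZ _ sX)|exact: (smodZ _ (sJ _))|exact: (smodZ _ (sJ _))|].
  by rewrite linearZ !scalerDr.
Qed.

Lemma WW_X l (u : N l) : XX u -> WW u.
Proof.
move=> Xu; exists u, 0, (l - 1), 0; rewrite raddf0 !addr0 subrK.
by split=> //; exact: (smod0 (mulset_submod _ _)).
Qed.

Lemma WW_J l (u : N l) : JN l u -> WW u.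
Proof.
move=> Ju; exists 0, u, (l - 1), 0; rewrite raddf0 addr0 add0r subrK.
by split=> //; [exact: (smod0 (XX_submod _))|exact: (smod0 (mulset_submod _ _))].
Qed.

Lemma WW_d l l' (u : N l) : l' = l + 1 -> WW u -> WW (dN l l' u).
Proof.
move=> e [x [c [l1 [a [Xx Jc e1 Ja ->]]]]].
exists (dN l l' x), 0, l, c; split=> //; first exact: XX_d.
  exact: (smod0 (mulset_submod _ _)).
by rewrite !raddfD /= dNN !addr0.
Qed.

(** The thickening creates no homology. The term [c] of a boundary lies in [ZZ], so by the choice of
    [t] it is, up to [XX], the boundary of an element of [(y)^(t l') N]; what remains is a boundary
    in [XX], handled by [XX_boundary]. *)
Lemma WW_boundary l l' (e : N l') : l = l' + 1 -> WW (dN l' l e) ->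
  exists w, WW w /\ dN l' l e = dN l' l w.
Proof.
move=> ll [x [c [l1 [a [Xx Jc e1 Ja ee]]]]].
have e2 : l1 = l' by apply: (addIr 1); rewrite -e1 -ll.
subst l1; case: (ltP l' n) => ln.
  by exists e; split=> //; apply: WW_X; rewrite /XX ln.
have Zc : ZZ c.
  exists (- x), l', (e - a); split=> //; first exact: (smodN (XX_submod _)).
  by rewrite raddfB /= ee addrAC addrK addKr.
have [x' [a' [Xx' Ja' ec]]] : exists x' a', [/\ XX x', JN l' a' & c = x' + dN l' l a'].
  subst l; have := tS ln Jc Zc.
  apply: (@mulset_min _ _ _ _ [set c | exists x' a', [/\ XX x', JN l' a' & c = x' + dN l' (l' + 1) a']]).
    split.
    - exists 0, 0; rewrite raddf0 addr0; split=> //; first exact: (smod0 (XX_submod _)).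
      exact: (smod0 (mulset_submod _ _)).
    - move=> u v [x1 [a1 [X1 J1 ->]]] [x2 [a2 [X2 J2 ->]]]; exists (x1 + x2), (a1 + a2).
      split; [exact: (smodD (XX_submod _))|exact: (smodD (mulset_submod _ _))|].
      by rewrite raddfD addrACA.
    - move=> b u [x1 [a1 [X1 J1 ->]]]; exists (b *: x1), (b *: a1).
      split; [exact: (smodZ _ (XX_submod _))|exact: (smodZ _ (mulset_submod _ _))|].
      by rewrite linearZ scalerDr.
  move=> b v Jb [x1 [l2 [w [X1 el2 ->]]]].
  have el : l2 = l' by apply: (addIr 1).
  subst l2; exists (b *: x1), (b *: w); split; [exact: (smodZ _ (XX_submod _))|exact: mulset_in|].
  by rewrite linearZ scalerDr.
have Xs : XX (dN l' l (e - a - a')).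
  rewrite !raddfB /= ee ec.
  have -> : x + dN l' l a + (x' + dN l' l a') - dN l' l a - dN l' l a' = x + x'.
    by rewrite -[LHS]addrA -opprD addrACA addrK.
  exact: (smodD (XX_submod _)).
have [x2 [X2 ex2]] := XX_boundary ll Xs.
exists (x2 + a' + a); split; last by rewrite !raddfD /= -ex2 !raddfB /= subrK subrK.
apply: (smodD (WW_submod _)); last exact: WW_J.
by apply: (smodD (WW_submod _)); [exact: WW_X|exact: WW_J].
Qed.

Lemma WW_inj l l' (u : N l) w : l = l' + 1 -> WW u -> dN l (l + 1) u = 0 -> p1 l u = d l' l w ->
  exists w', WW w' /\ u = dN l' l w'.
Proof.
move=> e Wu du uw; have [e' [ee _]] := cone_boundary e du uw.
by move: Wu; rewrite ee => /(WW_boundary e)[w' [? ->]]; exists w'.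
Qed.

Lemma WW_surj l (z : M l) : d l (l + 1) z = 0 ->
  exists u l' w, [/\ WW u, dN l (l + 1) u = 0, l = l' + 1 & z = p1 l u + d l' l w].
Proof.
move=> dz; have [|x [l' [w [Xx e ex]]]] := @XX_cycle l (mk z 0).
  apply: pinj; first by rewrite p1d mk1 dz raddf0.
  by rewrite p2d mk2 raddf0 /= row_mx0 raddf0.
exists x, l', (p1 l' w); split=> //; first exact: WW_X.
  have : dN l (l + 1) (mk z 0 - dN l' l w) = 0.
    apply: pinj; rewrite raddfB /= dNN subr0; first by rewrite p1d mk1 dz raddf0.
    by rewrite p2d mk2 raddf0 /= row_mx0 raddf0.
  by rewrite ex addrK.
by have := congr1 (p1 l) ex; rewrite mk1 raddfD /= p1d.
Qed.

Variables (k : comPzRingType) (ev : {rmorphism R -> k}) (i0 : 'I_r0).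
Hypothesis ev_m : forall a, m a -> ev a = 0.

Lemma XX_n (x : N n) : XX x <-> exists g, dN n (n + 1) x = emb g.
Proof. by rewrite /XX ltxx eqxx. Qed.

(** The graph of the functional: the coefficient of the [i0]-th minimal generator, read in the
    residue field. It is a relation at first because neither the decomposition of [u] nor the
    coefficient vector [e] is unique. *)
Definition theta (u : N n) (kap : k) := exists x c (e : 'rV[R]_r0) l' (w : M l'),
  [/\ XX x, JN n c, u = x + c, (tau x).2 = e *m rmx D0 r0 (rk (n + 1)) &
   [/\ n = l' + 1, (tau x).1 = rlin p0 e + d l' n w & kap = ev (e 0 i0)]].

Lemma theta_total u : WW u -> exists kap, theta u kap.
Proof.
move=> [x [c [l1 [a [Xx Jc e1 Ja ->]]]]].
have Xx' : XX (x + dN l1 n a).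
  apply: (smodD (XX_submod _)) => //; apply/XX_n; exists 0; by rewrite dNN raddf0.
have /XX_n[g eg] := Xx'.
have [_ _ H _] := res_comb resn.
have [_ /H[e [e2 [l' [w [nl e3]]]]]] := tau_X eg.
by exists (ev (e 0 i0)), (x + dN l1 n a), c, e, l', w; split.
Qed.

Lemma theta_lin a u v kap kap' : theta u kap -> theta v kap' -> theta (a *: u + v) (ev a * kap + kap').
Proof.
move=> [x [c [e [l1 [w [Xx Jc -> e2 [nl e1 ->]]]]]]] [x' [c' [e' [l2 [w' [Xx' Jc' -> e2' [nl' e1' ->]]]]]]].
have ll : l2 = l1 by apply: (addIr 1); rewrite -nl -nl'.
subst l2; exists (a *: x + x'), (a *: c + c'), (a *: e + e'), l1, (a *: w + w'); split.
- by apply: (smodD (XX_submod _)) => //; apply: (smodZ _ (XX_submod _)).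
- by apply: (smodD (mulset_submod _ _)) => //; apply: (smodZ _ (mulset_submod _ _)).
- by rewrite scalerDr addrACA.
- have -> : (tau (a *: x + x')).2 = a *: (tau x).2 + (tau x').2 by rewrite /= !linearP.
  by rewrite e2 e2' mulmxDl scalemxAl.
split=> //; last by rewrite !mxE rmorphD rmorphM.
have -> : (tau (a *: x + x')).1 = a *: (tau x).1 + (tau x').1 by rewrite /= !linearP.
by rewrite e1 e1' !linearP /= scalerDr addrACA.
Qed.

(** If [x + c = 0], then [x] is in [XX] and in the thickening, so [tn] puts it into [m XX];
    minimality of the generators then forces the coefficients into [m]. *)
Lemma theta0 kap : theta 0 kap -> kap = 0.
Proof.
move=> [x [c [e [l1 [w [Xx Jc ex e2 [nl e1 ->]]]]]]].
have Jx : JN n x.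
  have -> : x = - c by apply/eqP; rewrite -addr_eq0 -ex.
  exact: (smodN (mulset_submod _ _)).
have := tn Jx Xx => mx.
have mtx : mulset m (@Xset n (rk (n + 1)) (rk (n + 1 + 1)) (D (n + 1)) (p (n + 1))) (tau x).
  have := mulset_map (f := @tau n) (Q := @Xset n (rk (n + 1)) (rk (n + 1 + 1)) (D (n + 1)) (p (n + 1))) _ mx.
  case/(_ _)/Wrap => [v /XX_n[g eg]|]; first by have [] := tau_X eg.
  apply: mulset_min; first exact: mulset_submod.
  by move=> a v /ym ma Xv; exact: mulset_in.
have [_ _ _ H] := res_comb resn.
apply: ev_m; apply: H; exists (tau x), l1, (- w); split=> //.
by rewrite e1 raddfN /= addrK.
Qed.

Lemma chi_exists : exists chi : N n -> k,
  [/\ forall a u v, WW u -> WW v -> chi (a *: u + v) = ev a * chi u + chi v,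
      forall l' w, n = l' + 1 -> chi (dN l' n w) = 0 &
      forall u, XX u -> tau u = rgen (rk (n + 1)) D0 p0 i0 -> chi u = 1].
Proof.
have /choice[chi chiP] (u : N n) : exists kap, WW u -> theta u kap.
  have [Wu|nWu] := pselect (WW u); last by exists 0.
  by have [kap H] := theta_total Wu; exists kap.
have chiE u kap : WW u -> theta u kap -> chi u = kap.
  move=> Wu tu; apply/eqP; rewrite eq_sym -subr_eq0; apply/eqP/theta0.
  have := theta_lin (-1) (chiP u Wu) tu.
  by rewrite scaleN1r addNr rmorphN rmorph1 mulN1r addrC.
have J0 : JN n 0 by exact: (smod0 (mulset_submod _ _)).
exists chi; split=> [a u v Wu Wv|l' w nl|u Xu tu].
- apply: chiE; last by apply: theta_lin; exact: chiP.
  by apply: (smodD (WW_submod _)) => //; exact: (smodZ _ (WW_submod _)).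
- have Xd : XX (dN l' n w) by apply/XX_n; exists 0; rewrite dNN raddf0.
  apply: chiE; first exact: WW_X.
  exists (dN l' n w), 0, 0, l', (p1 l' w); split=> //; first by rewrite addr0.
    have [-> _] := @tau_X n (dN l' n w) 0 (etrans (dNN _ _ _) (esym (raddf0 _))).
    by rewrite mul0mx.
  by split; rewrite ?mxE ?rmorph0 // raddf0 add0r /= p1d.
apply: chiE; first exact: WW_X.
exists u, 0, (delta_mx 0 i0), (n - 1), 0; split=> //; first by rewrite addr0.
  by rewrite tu /=; apply/rowP => s; rewrite -rowE !mxE.
split; first by rewrite subrK.
  rewrite raddf0 addr0 tu /rlin (bigD1 i0) //= !mxE !eqxx scale1r big1 ?addr0 // => a ai.
  by rewrite mxE (negPf ai) andbF scale0r.
by rewrite mxE !eqxx rmorph1.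
Qed.

Variable chi : N n -> k.
Hypothesis chi_lin : forall a u v, WW u -> WW v -> chi (a *: u + v) = ev a * chi u + chi v.
Hypothesis chi_d : forall l' w, n = l' + 1 -> chi (dN l' n w) = 0.
Hypothesis chi_1 : forall u, XX u -> tau u = rgen (rk (n + 1)) D0 p0 i0 -> chi u = 1.
Variables (V : int -> lmodType R) (dV : forall n m, {linear V n -> V m}).
Variable a : forall l, {linear V l -> N l}.
Hypothesis dVV : forall n m p u, dV m p (dV n m u) = 0.
Hypothesis aW : forall l v, WW (a l v).
Hypothesis ad : forall l l' v, a l' (dV l l' v) = dN l l' (a l v).
Hypothesis a_inj : forall l v, dV (l + 1) (l + 1 + 1) v = 0 ->
  (exists w, p1 (l + 1) (a (l + 1) v) = d l (l + 1) w) -> exists w, v = dV l (l + 1) w.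
Hypothesis a_surj : forall l z, d l (l + 1) z = 0 -> exists v l' w,
  [/\ l = l' + 1, dV l (l + 1) v = 0 & z = p1 l (a l v) + d l' l w].
Variable h : V (n + 1) -> k.
Hypothesis h_lin : forall b u v, h (b *: u + v) = ev b * h u + h v.
Hypothesis h_chi : forall v, chi (a n v) = h (dV n (n + 1) v).

Lemma apex_cycle l (u : N l) : WW u -> dN l (l + 1) u = 0 -> exists v l' w,
  [/\ l = l' + 1, dV l (l + 1) v = 0, WW w & u = a l v + dN l' l w].
Proof.
move=> Wu du; have [|v [l' [w [e dv ev1]]]] := @a_surj l (p1 l u); first by rewrite -p1d du raddf0.
have [|||w' [Ww' ew]] := @WW_inj l l' (u - a l v) w e.
- exact: (smodB (WW_submod _)).
- by rewrite raddfB /= du -ad dv raddf0 subrr.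
- by rewrite raddfB /= ev1 addrC addKr.
by exists v, l', w'; split=> //; rewrite -ew addrC subrK.
Qed.

Definition comb l r (f : 'I_r -> N l) (g : 'rV[R]_r) := \sum_i g 0 i *: f i.
Definition combV l r (f : 'I_r -> V l) (g : 'rV[R]_r) := \sum_i g 0 i *: f i.

(* One step of lifting along the quasi-isomorphism: [x] stands for a basis element of the free
   resolution, [g] for its image under the differential. *)
Lemma lift_step l (lam : 'I_(rk (l + 1)) -> V (l + 1)) (s : 'I_(rk (l + 1)) -> N l) (x : N l) g :
  (forall i, WW (s i)) -> WW x -> dN l (l + 1) x = emb g ->
  dV (l + 1) (l + 1 + 1) (combV lam g) = 0 ->
  a (l + 1) (combV lam g) - emb g = dN l (l + 1) (comb s g) ->
  exists v l' w, [/\ dV l (l + 1) v = combV lam g, l = l' + 1, WW w,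
    WW (a l v - x - comb s g) & a l v - x - comb s g = dN l' l w].
Proof.
move=> Ws Wx dx dlam e.
have [|t0 et] := a_inj dlam.
  exists (p1 l (x + comb s g)); rewrite -p1d raddfD /= dx -e; congr (p1 _ _).
  by rewrite [RHS]addrC subrK.
have Wc : WW (comb s g).
  by apply: (smod_sum _ (WW_submod _)) => i _; exact: (smodZ _ (WW_submod _)).
have Wu : WW (a l t0 - x - comb s g) by do 2 apply: (smodB (WW_submod _)) => //.
have [|v [l' [w [ll dv Ww ew]]]] := apex_cycle Wu.
  by rewrite !raddfB /= -ad -et dx -e subrr.
exists (t0 - v), l', w; split=> //; first by rewrite raddfB /= dv subr0.
  by do 2 apply: (smodB (WW_submod _)) => //.
have -> : a l (t0 - v) - x - comb s g = (a l t0 - x - comb s g) - a l v.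
  by rewrite raddfB /= [RHS]addrAC; congr (_ - _); rewrite [RHS]addrAC.
by rewrite ew addrC addKr.
Qed.

(** The embedded free complex lifts to [V] in degree [l + 1] up to the boundaries prescribed by [s].
    The identities are required on cycles only, which is enough to pass to the next lower degree. *)
Definition lifted l := exists (lam : 'I_(rk (l + 1)) -> V (l + 1)) (s : 'I_(rk (l + 1)) -> N l),
  (forall i, WW (s i)) /\ forall g : 'rV_(rk (l + 1)), g *m DD (l + 1) = 0 ->
    dV (l + 1) (l + 1 + 1) (combV lam g) = 0 /\
    a (l + 1) (combV lam g) - emb g = dN l (l + 1) (comb s g).

Lemma lifted_step l : (n <= l)%R -> lifted (l + 1) -> lifted l.
Proof.
move=> nl [lam [s [Ws H]]].
have nl1 : (n + 1 <= l + 1)%R by rewrite lerD2r.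
have [DD0 _ _ _] := res_comb (res nl1).
have row0 (i : 'I_(rk (l + 1))) : (delta_mx 0 i : 'rV_(rk (l + 1))) *m DD (l + 1) *m DD (l + 1 + 1) = 0 by exact: DD0.
have Wemb (g : 'rV_(rk (l + 1))) : WW (emb g).
  by apply: WW_X; rewrite /XX ltNge (ltW (_ : (n < l + 1)%R)) ?gt_eqF ?ltzD1 //=; exists g.
have step (i : 'I_(rk (l + 1))) : exists vw : V (l + 1) * N l,
    [/\ dV (l + 1) (l + 1 + 1) vw.1 = combV lam (delta_mx 0 i *m DD (l + 1)), WW vw.2 &
    a (l + 1) vw.1 - emb (delta_mx 0 i) - comb s (delta_mx 0 i *m DD (l + 1)) = dN l (l + 1) vw.2].
  have [d1 d2] := H _ (row0 i).
  have [||v [l' [w [e1 ll Ww _ ew]]]] := lift_step (x := emb (delta_mx 0 i)) Ws _ _ d1 d2.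
  - exact: Wemb.
  - exact: emb_d.
  have e : l' = l by apply: (addIr 1).
  by subst l'; exists (v, w).
have /choice[f fP] := step.
exists (fun i => (f i).1), (fun i => (f i).2); split=> [i|g g0]; first by have [] := fP i.
have sumD (T : lmodType R) (F : 'rV[R]_(rk (l + 1 + 1)) -> T) : linear F ->
    \sum_i g 0 i *: F (delta_mx 0 i *m DD (l + 1)) = 0.
  move=> Flin; pose F' : {linear 'rV[R]_(rk (l + 1 + 1)) -> T} :=
    HB.pack F (GRing.isLinear.Build _ _ _ _ F Flin).
  have -> : \sum_i g 0 i *: F (delta_mx 0 i *m DD (l + 1)) = F' (g *m DD (l + 1)).
    rewrite {2}(row_sum_delta g) mulmx_suml linear_sum; apply: eq_bigr => i _.
    by rewrite -scalemxAl linearZ.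
  by rewrite g0 raddf0.
have clin : linear (combV lam).
  by move=> b u v; rewrite /combV scaler_sumr -big_split; apply: eq_bigr => i _; rewrite !mxE scalerDl scalerA.
have clin' : linear (comb s).
  by move=> b u v; rewrite /comb scaler_sumr -big_split; apply: eq_bigr => i _; rewrite !mxE scalerDl scalerA.
split.
  rewrite /combV linear_sum -[RHS](sumD _ _ clin); apply: eq_bigr => i _.
  by rewrite linearZ; have [->] := fP i.
rewrite /combV /comb !linear_sum {2}(row_sum_delta g) linear_sum -sumrB.
rewrite -[LHS]subr0 -[X in _ - X = _](sumD _ _ clin') -sumrB; apply: eq_bigr => i _.
have [_ _ ei] := fP i.
transitivity (g 0 i *: (a (l + 1) (f i).1 - emb (delta_mx 0 i) - comb s (delta_mx 0 i *m DD (l + 1)))).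
  by rewrite !scalerBr; congr (_ - _ - _); rewrite linearZ.
by rewrite ei linearZ.
Qed.

Lemma lifted_all : lifted n.
Proof.
have H j : forall l, (n <= l)%R -> (b0 - j%:Z <= l)%R -> lifted l.
  elim: j => [|j IH] l nl bl.
    have r1 : rk (l + 1) = 0%N by apply: rk0; lia.
    exists (fun=> 0), (fun=> 0); split=> [i|g _]; first exact: (smod0 (WW_submod _)).
    have -> : g = 0 by apply/rowP => i; exfalso; case: i => i; rewrite r1.
    have c0 (T : lmodType R) (r : nat) (f : 'I_r -> T) : \sum_i (0 : 'rV[R]_r) 0 i *: f i = 0.
      by apply: big1 => i _; rewrite mxE scale0r.
    by rewrite /combV /comb !c0 !raddf0 ?subr0 ?addr0.
  by apply: lifted_step => //; apply: IH; lia.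
by apply: (H `|(b0 - n)%R|%N) => //; lia.
Qed.

(** The generator [i0] lifts to some [v] in [V], up to correction terms, and by minimality the
    differential of [v] is a combination of lifts with coefficients in [m]. The homotopy then gives
    [chi (a v) = 0], while [chi] is 1 on the generator and vanishes on the corrections. *)
Lemma no_lift : (0 : k) = 1.
Proof.
have [lam [s [Ws H]]] := lifted_all.
pose g : 'rV_(rk (n + 1)) := \row_j D0 i0 j.
have [X1 _ _ _] := res_comb resn.
have gE : g = delta_mx 0 i0 *m rmx D0 r0 (rk (n + 1)) by rewrite -rowE; apply/rowP => j; rewrite !mxE.
have g0 : g *m DD (n + 1) = 0 by rewrite gE X1.
have [rX _ _] := resn; have [/= _ e1] := rX i0.
pose xi := mk (p0 i0) (row_mx 0 g).
have dxi : dN n (n + 1) xi = emb g.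
  apply: pinj; first by rewrite p1d !mk1 -e1.
  by rewrite p2d !mk2 row_mxKr g0.
have Xxi : XX xi by apply/XX_n; exists g.
have gm j : m (g 0 j).
  have [_ _ _ Hm] := res_comb (res (lexx _)).
  apply: Hm; exists 0, n, (p0 i0); split=> //; first exact: (smod0 (mulset_submod _ _)).
  by rewrite add0r -e1.
have [d1 d2] := H _ g0.
have [v [l' [w [ev1 ll Ww Wu eu]]]] := lift_step Ws (WW_X Xxi) dxi d1 d2.
have chi0 : chi 0 = 0.
  have W0 := smod0 (WW_submod n).
  by have := chi_lin (-1) W0 W0; rewrite scaler0 addr0 rmorphN rmorph1 mulN1r addNr.
have chiB u u' : WW u -> WW u' -> chi (u - u') = chi u - chi u'.
  by move=> Wu' Wu''; rewrite addrC -scaleN1r chi_lin // rmorphN rmorph1 mulN1r addrC.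
have h0 : h 0 = 0.
  have := h_lin (-1) 0 0; rewrite scaler0 addr0 rmorphN rmorph1 mulN1r addNr; by [].
have evg j : ev (g 0 j) = 0 by exact: ev_m.
have hl : h (combV lam g) = 0.
  rewrite /combV; apply: (big_ind (fun u => h u = 0)) => //.
    by move=> u u' hu hu'; rewrite -[u]scale1r h_lin hu hu' mulr0 addr0.
  by move=> j _; rewrite -[_ *: _]addr0 h_lin evg mul0r h0 addr0.
have cs : WW (comb s g) /\ chi (comb s g) = 0.
  rewrite /comb; apply: (big_ind (fun u => WW u /\ chi u = 0)).
  - by split=> //; exact: (smod0 (WW_submod _)).
  - move=> u u' [Wu1 hu] [Wu2 hu']; split; first exact: (smodD (WW_submod _)).
    by rewrite -[u]scale1r chi_lin // hu hu' mulr0 addr0.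
  - move=> j _; split; first exact: (smodZ _ (WW_submod _)).
    by rewrite -[_ *: _]addr0 chi_lin ?evg ?mul0r ?chi0 ?addr0 //; exact: (smod0 (WW_submod _)).
have := congr1 chi eu; rewrite chi_d // !chiB ?cs.2 ?subr0 //; last first.
- exact: cs.1.
- by apply: (smodB (WW_submod _)) => //; exact: WW_X.
- exact: WW_X.
rewrite h_chi ev1 hl (chi_1 Xxi) ?sub0r; last by rewrite /tau mk1 mk2 row_mxKr.
by move/(congr1 -%R); rewrite opprK oppr0.
Qed.

End LocalApex.

End MinimalGenerators.

(** * Schemes of finite type over a field *)

Lemma is_unitM (R : comPzRingType) (a b : R) : is_unit (a * b) <-> is_unit a /\ is_unit b.
Proof.
split=> [[c e]|[[c e] [c' e']]].
  by split; [exists (b * c); rewrite mulrA|exists (a * c); rewrite mulrA (mulrC b)].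
by exists (c * c'); rewrite mulrACA e e' mulr1.
Qed.

Lemma is_unitX (R : comPzRingType) (a : R) n : is_unit a -> is_unit (a ^+ n).
Proof. by move=> [b e]; exists (b ^+ n); rewrite -exprMn e expr1n. Qed.

Lemma is_unit_rmorph (R S : comPzRingType) (f : {rmorphism R -> S}) a : is_unit a -> is_unit (f a).
Proof. by move=> [b e]; exists (f b); rewrite -rmorphM e rmorph1. Qed.

Lemma is_unit_eq0 (R : comPzRingType) (a b : R) : is_unit a -> a * b = 0 -> b = 0.
Proof. by move=> [c e] ab; rewrite -[b]mul1r -e mulrAC ab mul0r. Qed.

Lemma opens_eq (X : topologicalType) (U V : opens X) : U `<=` V -> V `<=` U -> U = V.
Proof.
case: U V => U oU [V oV] /= UV VU; have e : U = V by apply/seteqP.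
by subst V; congr Opens; exact: Prop_irrelevance.
Qed.

Section GermMorphism.
Variables (X : topologicalType) (O : ring_sheaf X) (x : X) (U : opens X) (Ux : oset U x).

Lemma germ_zmod : zmod_morphism (@germ X O x U Ux).
Proof.
move=> s t; apply: (addIr (germ Ux t)); by rewrite -germD !subrK.
Qed.
HB.instance Definition _ := GRing.isZmodMorphism.Build (O U) (stalk O x) (@germ X O x U Ux) germ_zmod.

Lemma germ_monoid : monoid_morphism (@germ X O x U Ux).
Proof. by split; [exact: germ1|exact: germM]. Qed.
HB.instance Definition _ := GRing.isMonoidMorphism.Build (O U) (stalk O x) (@germ X O x U Ux) germ_monoid.

Lemma basicP (f : O U) : oset (basic_open f) x <-> is_unit (germ Ux f).
Proof. by split=> [[Ux']|?]; [rewrite (Prop_irrelevance Ux' Ux)|exists Ux]. Qed.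

End GermMorphism.

Section AffineGeometry.
Variables (X : topologicalType) (O : ring_sheaf X).
Implicit Types U V W : opens X.

Lemma affine_loc U W (hW : W `<=` U) (g : O U) : affine_open O U ->
  W `<=` basic_open g -> basic_open g `<=` W -> is_localization_away (rres O hW) g.
Proof.
move=> [_ _ _ loc] h h'; have e := opens_eq h h'; subst W.
by rewrite (Prop_irrelevance hW (@basic_open_sub _ _ _ g)); exact: loc.
Qed.

(** Primes of the localization are the primes of [O U] that omit [f]. A function [h] on [D(f)]
    becomes some [a] after multiplication by a power of [f], so [D(h)] is the basic open of [a f] in
    [U]. *)
Lemma basic_open_affine U (f : O U) : affine_open O U -> affine_open O (basic_open f).
Proof.
move=> Ua; have [U1 U2 U3 U4] := Ua.
set D := basic_open f; have DU : D `<=` U by exact: basic_open_sub.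
pose rho : {rmorphism O U -> O D} := rres O DU.
have [uf floc fker] : is_localization_away rho f by exact: affine_loc.
have gE x (Dx : oset D x) a : germ Dx (rho a) = germ (DU _ Dx) a by exact: germ_res.
have num x (Dx : oset D x) b n a : rho f ^+ n * b = rho a ->
    (is_unit (germ Dx b) <-> is_unit (germ (DU _ Dx) a)).
  move=> e; rewrite -gE -e rmorphM is_unitM; split=> [ub|[]//]; split=> //.
  by apply: is_unit_rmorph; exact: is_unitX.
split.
- move=> x y Dx Dy e; apply: (U1 x y (DU _ Dx) (DU _ Dy)); apply/seteqP; split=> a /=.
    rewrite /point_ideal /= -(gE x Dx) -(gE y Dy) => H.
    by have : point_ideal Dx (rho a) by []; rewrite e.
  rewrite /point_ideal /= -(gE x Dx) -(gE y Dy) => H.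
  by have : point_ideal Dy (rho a) by []; rewrite -e.
- move=> P [[P0 PD PM] P1 PP].
  have [|x [Ux ex]] := U2 [set a | P (rho a)].
    split; first split.
    + by rewrite /= rmorph0.
    + by move=> a b; rewrite /= rmorphD; exact: PD.
    + by move=> a b; rewrite /= rmorphM; exact: PM.
    + by rewrite /= rmorph1.
    + by move=> a b; rewrite /= rmorphM; exact: PP.
  have Dx : oset D x.
    apply/(basicP Ux); apply: contrapT => nf.
    have : [set a | P (rho a)] f by rewrite ex.
    move=> /= Pf; have [c e] := uf; apply: P1; rewrite -e mulrC; exact: PM.
  have PX n b : P (rho f ^+ n * b) -> P b.
    have [c e] := is_unitX n uf => Pb; rewrite -[b]mul1r -e (mulrC _ c) -mulrA; exact: PM.
  exists x, Dx; apply/seteqP; split=> b; have [a [n e]] := floc b => H.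
    move=> /(num x Dx _ _ _ e); rewrite (Prop_irrelevance (DU _ Dx) Ux).
    have : [set a | P (rho a)] a by rewrite /= -e; exact: PM.
    by rewrite ex.
  apply: (PX n); rewrite e; have : point_ideal Ux a.
    by move=> ua; apply: H; apply/(num x Dx _ _ _ e); rewrite (Prop_irrelevance (DU _ Dx) Ux).
  by rewrite -ex.
- move=> V x VD Vx; have [g [gx gV]] := U3 V x (subset_trans VD DU) Vx.
  exists (rho g); split.
    by apply/(basicP (VD _ Vx)); rewrite gE; apply/basicP.
  by move=> z [Dz]; rewrite gE => gz; apply: gV; exists (DU _ Dz).
- move=> h; have [a [n e]] := floc h.
  set W := basic_open h; have WD : W `<=` D by exact: basic_open_sub.
  have WU := subset_trans WD DU.
  pose r : {rmorphism O D -> O W} := rres O WD.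
  have rE b : r (rho b) = rres O WU b by exact: rres_comp.
  have [uaf afloc afker] : is_localization_away (rres O WU) (a * f).
    apply: affine_loc => // z.
      move=> [Dz hz]; exists (DU _ Dz); rewrite rmorphM is_unitM; split; last exact/basicP.
      exact/(num z Dz _ _ _ e).
    move=> [Uz]; rewrite rmorphM is_unitM => -[ua ufz].
    have Dz : oset D z by apply/(basicP Uz).
    by exists Dz; apply/(num z Dz _ _ _ e); rewrite (Prop_irrelevance (DU _ Dz) Uz).
  have [c ec] := uf.
  have hE : h = c ^+ n * rho a by rewrite -e mulrA -exprMn (mulrC c) ec expr1n mul1r.
  rewrite (Prop_irrelevance (@basic_open_sub _ _ _ h) WD); change (is_localization_away r h); split.
  + move: uaf; rewrite rmorphM is_unitM => -[ua _].
    by rewrite hE rmorphM rE is_unitM; split=> //; apply: is_unit_rmorph; apply: is_unitX; exists (rho f); rewrite mulrC.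
  + move=> b; have [a' [N eN]] := afloc b.
    exists (c ^+ (n * N) * c ^+ N * rho a'), N.
    have erc : (r (rho f) * r c) ^+ N = 1 by rewrite -rmorphM ec rmorph1 expr1n.
    rewrite hE !(rmorphM r) !(rmorphXn r) (rE a') -eN -rE (rmorphM rho) (rmorphM r).
    rewrite -[LHS]mulr1 -erc !exprMn -exprM.
    by move: (r c ^+ (n * N)) (r c ^+ N) (r (rho a) ^+ N) (r (rho f) ^+ N) => u1 u2 u3 u4; ring.
  + move=> b rb; have [a' [n' e']] := floc b.
    have [|N eN] := afker a'.
      by rewrite -rE -e' rmorphM rb mulr0.
    exists N; rewrite hE exprMn.
    have : rho ((a * f) ^+ N * a') = 0 by rewrite eN rmorph0.
    rewrite !rmorphM rmorphXn rmorphM -e' exprMn => z0.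
    have u1 : is_unit (rho f ^+ N * rho f ^+ n') by rewrite is_unitM; split; exact: is_unitX.
    have -> : c ^+ n ^+ N * rho a ^+ N * b = c ^+ n ^+ N * (rho a ^+ N * b) by rewrite mulrA.
    rewrite (is_unit_eq0 u1 (b := rho a ^+ N * b)) ?mulr0 //.
    rewrite -[RHS]z0; ring.
Qed.

End AffineGeometry.

Section SchemesOverField.
Variables (k : closedFieldType) (Y : scheme).
Local Notation O := (structure_sheaf Y).
Variable phi : {rmorphism k -> O (oT Y)}.
Implicit Types U V W : opens Y.

Definition kres V : {rmorphism k -> O V} := rres O (@sub_oT _ V) \o phi.

Lemma kres_res U V (h : V `<=` U) c : rres O h (kres U c) = kres V c.
Proof. exact: rres_comp. Qed.

Definition kstalk y : {rmorphism k -> stalk O y} := @germ _ O y (oT Y) I \o phi.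

Lemma germ_kres V y (Vy : oset V y) c : germ Vy (kres V c) = kstalk y c.
Proof. exact: germ_res. Qed.

Definition affine_ft V := affine_open O V /\ finitely_generated_over (kres V).

Lemma affine_ft_basic U (f : O U) : affine_ft U -> affine_ft (basic_open f).
Proof.
move=> [Ua [n [g gen]]]; split; first exact: basic_open_affine.
have [_ _ _ /(_ f)[[c ec] floc _]] := Ua.
set D := basic_open f in floc c ec *; set rho := rres O _ in ec floc.
exists n.+1, (fun i => if unlift ord0 i is Some j then rho (g j) else c) => S Sk Sg SD SM b.
have S_c : S c by have := Sg ord0; rewrite unlift_none.
have S1 : S 1 by rewrite -(rmorph1 (kres D)).
have Sr : forall a, S (rho a).
  apply: gen => [e|i|a a' Sa Sa'|a a' Sa Sa'].
  - by rewrite kres_res.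
  - by have := Sg (lift ord0 i); rewrite liftK.
  - by rewrite rmorphD; exact: SD.
  - by rewrite rmorphM; exact: SM.
have [a [N e]] := floc b.
have -> : b = c ^+ N * rho a by rewrite -e mulrA -exprMn (mulrC c) ec expr1n mul1r.
apply: (SM) => //; elim: N {e} => [|N IH]; first by rewrite expr0.
by rewrite exprS; exact: SM.
Qed.

Hypothesis Yft : finite_type phi.

Lemma affine_ft_exists y : exists V, affine_ft V /\ oset V y.
Proof. by have [n [U [Ug /(_ y)[i Uy]]]] := Yft; exists (U i); split=> //; exact: (Ug i). Qed.

Lemma affine_ft_small y U : oset U y -> exists V, [/\ affine_ft V, oset V y & V `<=` U].
Proof.
move=> Uy; have [V [gV Vy]] := affine_ft_exists y; have [[_ _ V3 _] _] := gV.
have [f [fy fU]] := V3 (oI V U) y (@oIl _ _ _) (conj Vy Uy).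
exists (basic_open f); split=> //; first exact: affine_ft_basic.
exact: subset_trans (@oIr _ V U).
Qed.

Lemma stalk_num V y (Vy : oset V y) : affine_open O V -> forall u : stalk O y,
  exists w a, is_unit (germ Vy w) /\ germ Vy w * u = germ Vy a.
Proof.
move=> [_ _ V3 V4] u; have [U [Uy [s ->]]] := germ_surj u.
have [f [fy fU]] := V3 (oI V U) y (@oIl _ _ _) (conj Vy Uy).
have [uf floc _] := V4 f.
have fU' := subset_trans fU (@oIr _ V U).
have [a [n e]] := floc (rres O fU' s).
exists (f ^+ n), a; split; first by rewrite rmorphXn; apply: is_unitX; apply/basicP.
have := congr1 (germ fy) e; rewrite rmorphM rmorphXn /= (germ_res Uy) !(germ_res Vy).
by rewrite rmorphXn.
Qed.

Lemma stalk_ker V y (Vy : oset V y) (a : O V) : affine_open O V -> germ Vy a = 0 ->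
  exists w, is_unit (germ Vy w) /\ w * a = 0.
Proof.
move=> [_ _ V3 V4]; rewrite -(germ0 O Vy) => /germP[W [h [h' [Wy e]]]].
have [f [fy fW]] := V3 W y h Wy; have [uf _ fker] := V4 f.
have [|n en] := fker a.
  by rewrite -(rres_comp h fW) e !rmorph0.
by exists (f ^+ n); split=> //; rewrite rmorphXn; apply: is_unitX; apply/basicP.
Qed.

Lemma stalk_nz y : 1 <> 0 :> stalk O y.
Proof. by move=> e; have [+ _ _] := @scheme_local Y y; apply; exists 0; rewrite mul0r. Qed.

Lemma point_ideal_prime V y (Vy : oset V y) : is_prime (@point_ideal _ O V y Vy).
Proof.
have [m0 mD mM] := @scheme_local Y y; split; first split.
- by rewrite /point_ideal /= germ0.
- by move=> a b; rewrite /point_ideal /= germD; exact: mD.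
- by move=> a b; rewrite /point_ideal /= germM; exact: mM.
- by move=> H; apply: H; rewrite germ1; exists 1; rewrite mulr1.
- move=> a b; rewrite /point_ideal /= germM is_unitM => H; apply: contrapT => /not_orP[Ha Hb].
  by apply: H; split; apply: contrapT.
Qed.

Lemma affine_ft_nz V y : oset V y -> 1 <> 0 :> O V.
Proof. by move=> Vy e; apply: (@stalk_nz y); rewrite -(germ1 O Vy) e germ0. Qed.

Lemma fg_noetherian_pz (A : comPzRingType) (iota : {rmorphism k -> A}) :
  finitely_generated_over iota -> noetherian A.
Proof.
have [e|nz] := pselect (1 = 0 :> A).
  move=> _ I II; exists 0%N, (fun=> 0); apply/seteqP; split=> a Ia.
    by exists (fun=> 0); rewrite big_ord0 -[a]mul1r e mul0r.
  by rewrite -[a]mul1r e mul0r; exact: ideal0 II.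
have [A' eA] := comNzRing_exists nz; subst A => -[s [g gen]].
exact: (@fg_noetherian k A' iota s g gen).
Qed.

Lemma weak_ns (A : comPzRingType) (iota : {rmorphism k -> A}) (I : set A) :
  finitely_generated_over iota -> is_ideal I -> ~ I 1 ->
  exists ev : {rmorphism A -> k}, (forall c, ev (iota c) = c) /\ forall a, I a -> ev a = 0.
Proof.
move=> fg II I1; have nz : 1 <> 0 :> A by move=> e; apply: I1; rewrite e; exact: ideal0 II.
have [A' eA] := comNzRing_exists nz; subst A; have [s [g gen]] := fg.
exact: (@weak_nullstellensatz k A' iota s g gen).
Qed.

Lemma strong_ns (A : comPzRingType) (iota : {rmorphism k -> A}) (I : set A) a :
  finitely_generated_over iota -> is_ideal I ->
  (forall ev : {rmorphism A -> k}, (forall c, ev (iota c) = c) ->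
    (forall b, I b -> ev b = 0) -> ev a = 0) -> exists N, I (a ^+ N).
Proof.
move=> fg II H; have [e|nz] := pselect (1 = 0 :> A).
  by exists 0%N; rewrite expr0 e; exact: ideal0 II.
have [A' eA] := comNzRing_exists nz; subst A.
exact: (@strong_nullstellensatz k A' iota I a fg II H).
Qed.

Lemma affine_ft_noetherian V : affine_ft V -> noetherian (O V).
Proof. by move=> [_ /fg_noetherian_pz]. Qed.

Lemma stalk_noetherian y : noetherian (stalk O y).
Proof.
have [V [gV Vy]] := affine_ft_exists y.
apply: (@localization_noetherian _ _ (@germ _ O y V Vy)) (affine_ft_noetherian gV) _ => u.
by have [w [a [uw e]]] := stalk_num Vy gV.1 u; exists w, a.
Qed.

Lemma nilpotent_basic V (a : O V) : affine_ft V -> (forall y, ~ oset (basic_open a) y) ->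
  exists N, a ^+ N = 0.
Proof.
move=> [[_ _ _ /(_ a)[_ _ aker]] _] H; have [|N e] := aker 1; last by exists N; rewrite -[LHS]mulr1.
by apply: (@rsep _ O (basic_open a) False (fun i => False_rect _ i) (fun i => False_rect _ i)) => [y /H|[]].
Qed.

Hypothesis Yirr : irreducible_scheme Y.

Lemma irreducible_meet U V : (exists x, oset U x) -> (exists x, oset V x) ->
  exists x, oset U x /\ oset V x.
Proof.
move=> [x Ux] [y Vy]; apply: contrapT => H; have [_ irr] := Yirr.
have [|||H1|H1] := irr (~` oset U) (~` oset V).
- by apply: open_closedC; exact: oset_open.
- by apply: open_closedC; exact: oset_open.
- by move=> z _; apply: contrapT => /not_orP[/contrapT Uz /contrapT Vz]; apply: H; exists z.
- by have := H1 x I; apply.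
- by have := H1 y I; apply.
Qed.

(** If neither factor is nilpotent, their basic opens are nonempty and meet by irreducibility; at a
    common point the product is invertible in a nonzero stalk. *)
Lemma nilradical_prime V (a b : O V) n : affine_ft V -> (a * b) ^+ n = 0 ->
  (exists N, a ^+ N = 0) \/ (exists N, b ^+ N = 0).
Proof.
move=> gV ab; apply: contrapT => /not_orP[Ha Hb].
have ex (c : O V) : ~ (exists N, c ^+ N = 0) -> exists x, oset (basic_open c) x.
  by move=> Hc; apply: contrapT => H; apply: Hc; apply: nilpotent_basic => // y cy; apply: H; exists y.
have [x [[Vx ua] [Vx' ub]]] := irreducible_meet (ex a Ha) (ex b Hb).
rewrite (Prop_irrelevance Vx' Vx) in ub.
have : is_unit (germ Vx ((a * b) ^+ n)).
  by rewrite rmorphXn rmorphM; apply: is_unitX; rewrite is_unitM.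
by rewrite ab rmorph0 => -[c]; rewrite mul0r => e; apply: (@stalk_nz x).
Qed.

Lemma stalk_not_nilpotent V y (Vy : oset V y) (c : O V) : affine_ft V ->
  (forall N, c ^+ N <> 0) -> forall M, germ Vy c ^+ M <> 0.
Proof.
move=> gV nc M; rewrite -rmorphXn => /(stalk_ker gV.1)[w [uw e]].
have [|[N eN]|[N eN]] := @nilradical_prime V w (c ^+ M) 1 gV; first by rewrite expr1.
  have := is_unitX N uw; rewrite -rmorphXn eN rmorph0 => -[b]; rewrite mul0r => e1.
  exact: (@stalk_nz y).
by apply: (nc (M * N)%N); rewrite exprM.
Qed.

Definition residue_k y := forall u : stalk O y, exists c, nonunits (u - kstalk y c).

Lemma residue_of_ev V y (Vy : oset V y) (ev : {rmorphism O V -> k}) : affine_open O V ->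
  (forall c, ev (kres V c) = c) -> (forall a, point_ideal Vy a <-> ev a = 0) -> residue_k y.
Proof.
move=> Va evK evP u; have [w [a [uw e]]] := stalk_num Vy Va u.
have w0 : ev w != 0 by apply/eqP => /evP.
have [c ec] : exists c, c = ev a / ev w by exists (ev a / ev w).
exists c => -[b eb].
have : is_unit (germ Vy (a - w * kres V c)).
  rewrite rmorphB rmorphM /= germ_kres -e -mulrBr is_unitM; split=> //; by exists b.
apply/evP; rewrite rmorphB rmorphM evK ec mulrC divfK ?subrr //.
Qed.

Lemma residue_max V y (Vy : oset V y) (I : set (O V)) : residue_k y -> is_ideal I -> ~ I 1 ->
  point_ideal Vy `<=` I -> I = point_ideal Vy.
Proof.
move=> res II I1 sub; apply/seteqP; split=> // b Ib ub; apply: I1.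
have [c nc] := res (germ Vy b).
have Ic : I (kres V c).
  have -> : kres V c = b - (b - kres V c) by ring.
  apply: (idealB II) => //; apply: sub; rewrite /point_ideal /= rmorphB /= germ_kres; exact: nc.
have [c0|c0] := eqVneq c 0; first by move: nc; rewrite c0 rmorph0 subr0.
have -> : 1 = kres V c^-1 * kres V c by rewrite -rmorphM mulVf ?rmorph1.
exact: (ideal_mull _ II).
Qed.

(** If every neighbourhood of [x] contains [y], the ideal of [x] contains that of [y], which is
    already maximal; points of an affine open being determined by their ideals, [x = y]. *)
Lemma residue_closed y : residue_k y -> closed [set y].
Proof.
move=> res; rewrite -[X in closed X]setCK; apply: open_closedC.
have -> : ~` [set y] = \bigcup_(W in [set W : opens Y | ~ oset W y]) oset W.
  apply/seteqP; split=> [x xy|x [W /= Wy Wx] xy]; last by apply: Wy; rewrite -xy.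
  apply: contrapT => H; have near W : oset W x -> oset W y.
    by move=> Wx; apply: contrapT => Wy; apply: H; exists W.
  have [V [[Va _] Vx]] := affine_ft_exists x; have Vy := near V Vx; have [V1 _ _ _] := Va.
  apply: xy; apply: (V1 x y Vx Vy); apply: residue_max => //.
  - by have [] := point_ideal_prime Vx.
  - by have [] := point_ideal_prime Vx.
  move=> b nb ub; apply: nb; apply/basicP; apply: near; exact/basicP.
by apply: bigcup_open => W _; exact: oset_open.
Qed.

Lemma point_of_ev V (ev : {rmorphism O V -> k}) : affine_ft V -> (forall c, ev (kres V c) = c) ->
  exists y (Vy : oset V y), (forall a, point_ideal Vy a <-> ev a = 0) /\ closed [set y].
Proof.
move=> gV evK; have [[_ V2 _ _] _] := gV.
have [|y [Vy e]] := V2 [set a | ev a = 0].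
  split; first split.
  - exact: rmorph0.
  - by move=> a b /= ea eb; rewrite rmorphD /= ea eb addr0.
  - by move=> a b /= eb; rewrite rmorphM /= eb mulr0.
  - by rewrite /= rmorph1; exact/eqP/oner_neq0.
  - by move=> a b /=; rewrite rmorphM => /eqP; rewrite mulf_eq0 => /orP[/eqP|/eqP]; [left|right].
have H a : point_ideal Vy a <-> ev a = 0 by rewrite -e.
by exists y, Vy; split=> //; apply: residue_closed; exact: residue_of_ev gV.1 evK H.
Qed.

(** The weak Nullstellensatz gives a point [z] at which all functions vanishing at [y] vanish. If
    [z] were not [y], a basic open around [z] avoiding the closed point [y] would supply a function
    vanishing at [y] but not at [z]. *)
Lemma closed_ev V y (Vy : oset V y) : affine_ft V -> closed [set y] ->
  exists ev : {rmorphism O V -> k}, (forall c, ev (kres V c) = c) /\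
    forall a, point_ideal Vy a <-> ev a = 0.
Proof.
move=> gV cy; have [pI p1 _] := point_ideal_prime Vy.
have [ev [evK evI]] := weak_ns gV.2 pI p1.
have [z [Vz [Hz _]]] := point_of_ev gV evK.
suff zy : z = y by subst z; exists ev; rewrite (Prop_irrelevance Vy Vz).
apply: contrapT => zy; have [_ _ V3 _] := gV.1.
have [f [fz fo]] := V3 (oI V (open_off cy)) z (@oIl _ _ _) (conj Vz zy).
have : point_ideal Vy f.
  by move=> uf; have [_ H] := fo y (proj2 (basicP Vy f) uf); case: H.
by move=> /evI /Hz; apply; apply/basicP.
Qed.

Lemma closed_residue y : closed [set y] -> residue_k y.
Proof.
move=> cy; have [V [gV Vy]] := affine_ft_exists y.
have [ev [evK evP]] := closed_ev Vy gV cy; exact: residue_of_ev gV.1 evK evP.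
Qed.

Lemma stalk_ev y : closed [set y] -> exists ev : {rmorphism stalk O y -> k},
  (forall c, ev (kstalk y c) = c) /\ forall u, ev u != 0 <-> is_unit u.
Proof.
by move=> cy; apply: residue_field_morphism; [exact: scheme_local|exact: closed_residue].
Qed.

(** The ideal of [y] in the affine ring is maximal, so its generators cannot all vanish at another
    point; its extension to the stalk is the maximal ideal. *)
Lemma closed_point_generators V y (Vy : oset V y) : affine_ft V -> closed [set y] ->
  exists q (f : 'I_q -> O V), [/\ forall i, point_ideal Vy (f i),
    forall u : stalk O y, nonunits u -> exists c, u = \sum_i c i * germ Vy (f i) &
    forall x (Vx : oset V x), x <> y -> exists i, is_unit (germ Vx (f i))].
Proof.
move=> gV cy; have [pI p1 _] := point_ideal_prime Vy.
have [q [f pf]] := affine_ft_noetherian gV pI.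
have fp i : point_ideal Vy (f i) by rewrite pf; exact: generated_by_gen.
exists q, f; split=> // [u nu|x Vx xy].
  have [w [a [[b eb] e]]] := stalk_num Vy gV.1 u.
  have : point_ideal Vy a.
    rewrite /point_ideal /= -e is_unitM => -[_]; exact: nu.
  rewrite pf => -[c ea]; exists (fun i => b * germ Vy (c i)).
  have -> : u = b * (germ Vy w * u) by rewrite mulrA (mulrC b) eb mul1r.
  rewrite e ea rmorph_sum mulr_sumr; apply: eq_bigr => i _.
  by rewrite rmorphM mulrA.
apply: contrapT => H; apply: xy; have [V1 _ _ _] := gV.1; apply: (V1 x y Vx Vy).
have [qI q1 _] := point_ideal_prime Vx.
apply: residue_max => //; first exact: closed_residue.
rewrite pf => a [c ->]; apply: (ideal_sum _ qI) => i _; apply: (ideal_mull _ qI).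
by move=> ui; apply: H; exists i.
Qed.

(** Near a point [x] of the smallest closed set, the chain becomes a chain of primes of an affine
    ring [O V'], and [chain_independent] applies to elements [t_i] separating them. By
    irreducibility [V'] meets [V], and on a basic open of [g] in the intersection the [t_i] are
    fractions from [O V]; [s0] is the power of [g] that serves as common denominator. *)
Lemma chain_box V d (Z : 'I_d.+1 -> set Y) : affine_ft V -> (exists y, oset V y) -> closed_chain Z ->
  exists s0 (s : 'I_d -> O V), forall D (c : {ffun 'I_d -> 'I_D} -> k),
  \sum_al kres V (c al) * (s0 ^+ (d * D - \sum_i al i) * \prod_i s i ^+ al i) = 0 ->
  forall al, c al = 0.
Proof.
move=> gV exV [Zirr Zlt].
have [x Zx0] : exists x, Z ord0 x by have [_ [[x ?] _]] := Zirr ord0; exists x.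
have Zx i : Z i x.
  have [->//|i0] := eqVneq i ord0.
  have lt0 : ((ord0 : 'I_d.+1) < i)%N by rewrite lt0n.
  exact: (Zlt ord0 i lt0).1.
have [V' [gV' V'x]] := affine_ft_exists x.
pose Pz (S : set Y) : set (O V') := [set a | forall z (Vz : oset V' z), S z -> point_ideal Vz a].
have Pz_prime i : is_prime (Pz (Z i)).
  split; first split.
  - by move=> z Vz _; have [[]] := point_ideal_prime Vz.
  - by move=> a b Ha Hb z Vz Sz; have [[_ + _] _ _] := point_ideal_prime Vz; apply; [exact: Ha|exact: Hb].
  - by move=> a b Hb z Vz Sz; have [[_ _ +] _ _] := point_ideal_prime Vz; apply; exact: Hb.
  - by move=> /(_ x V'x (Zx i)); have [] := point_ideal_prime V'x.
  move=> a b Hab; have [_ irr] := (Zirr i).2.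
  have cl (f : O V') : closed (~` oset (basic_open f)) by apply: open_closedC; exact: oset_open.
  have [|H|H] := irr _ _ (cl a) (cl b).
  - move=> z Zz; apply: contrapT => /not_orP[/contrapT[Vz ua] /contrapT[Vz' ub]].
    rewrite (Prop_irrelevance Vz' Vz) in ub.
    by have := Hab z Vz Zz; apply; rewrite rmorphM is_unitM.
  - by left=> z Vz Sz uz; apply: (H z Sz); apply/(basicP Vz).
  - by right=> z Vz Sz uz; apply: (H z Sz); apply/(basicP Vz).
have Pz_sub (i j : 'I_d.+1) : (i < j)%N -> Pz (Z j) `<=` Pz (Z i).
  by move=> ij a Ha z Vz Sz; apply: Ha; exact: (Zlt i j ij).1.
have Pz_lt (i j : 'I_d.+1) : (i < j)%N -> exists g, Pz (Z i) g /\ ~ Pz (Z j) g.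
  move=> ij; have [sub nsub] := Zlt i j ij; have [cli _] := Zirr i; have [_ [_ irr]] := Zirr j.
  have [z [Zjz [V'z Ziz]]] : exists z, Z j z /\ oset V' z /\ ~ Z i z.
    apply: contrapT => H.
    have [|||H1|H1] := irr (Z i) (~` oset V').
    - exact: cli.
    - by apply: open_closedC; exact: oset_open.
    - move=> z Zz; apply: contrapT => /not_orP[nz /contrapT Vz]; apply: H; by exists z.
    - exact: nsub.
    - by have := H1 x (Zx j); apply.
  have [[_ _ V3 _] _] := gV'.
  have op : open (oset V' `&` ~` Z i) by apply: openI; [exact: oset_open|exact: closed_openC].
  have [g [gz gs]] := V3 (Opens op) z (@subIsetl _ _ _) (conj V'z Ziz).
  exists g; split=> [z' Vz' Sz' uz'|H]; last by apply: (H z V'z Zjz); apply/basicP.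
  by have [] := gs z' (proj2 (basicP Vz' g) uz').
(* Ideals grow as closed sets shrink, hence the reversal of indices. *)
pose P (i : 'I_d.+1) := Pz (Z (rev_ord i)).
have lt_rev (i : 'I_d) : (rev_ord (lift ord0 i) < rev_ord (widen_ord (leqnSn d) i))%N.
  by rewrite /= /bump /=; have := ltn_ord i; lia.
have /choice[t tP] i := Pz_lt _ _ (lt_rev i).
have ind := @chain_independent k _ (kres V') d P t (fun i => Pz_prime _)
  (fun i => Pz_sub _ _ (lt_rev i)) tP.
have [z [Vz V'z]] := irreducible_meet exV (ex_intro _ x V'x).
have [[_ _ V3 V4] _] := gV.
have [g [gz gs]] := V3 (oI V V') z (@oIl _ _ _) (conj Vz V'z).
have [ug gloc _] := V4 g.
set D0 := basic_open g in gz gs ug gloc; set rho := rres O _ in ug gloc.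
pose rho' : {rmorphism O V' -> O D0} := rres O (subset_trans gs (@oIr _ _ _)).
have /choice[an anP] i : exists an : O V * nat, rho g ^+ an.2 * rho' (t i) = rho an.1.
  by have [a [n e]] := gloc (rho' (t i)); exists (a, n).
pose N := (\sum_i (an i).2)%N.
exists (g ^+ N), (fun i => g ^+ (N - (an i).2) * (an i).1) => D c H.
pose T := \sum_al kres V' (c al) * \prod_i t i ^+ al i.
have rT : rho' T = 0.
  apply: (@is_unit_eq0 _ (rho g ^+ N ^+ (d * D))); first by do 2 apply: is_unitX.
  rewrite -[RHS](rmorph0 rho) -H !rmorph_sum mulr_sumr; apply: eq_bigr => al _.
  rewrite !(rmorphM rho) !(rmorphM rho') !rmorph_prod (rmorphXn rho) (rmorphXn rho) /rho /rho' !kres_res -/rho -/rho'.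
  rewrite mulrCA; congr (_ * _).
  have sE i : rho (g ^+ (N - (an i).2) * (an i).1) = rho g ^+ N * rho' (t i).
    rewrite rmorphM rmorphXn -anP mulrA -exprD subnK //.
    by rewrite /N (bigD1 i) //= leq_addr.
  rewrite [in RHS](eq_bigr (fun i => rho g ^+ N ^+ al i * rho' (t i) ^+ al i)) => [|i _]; last first.
    by rewrite rmorphXn sE exprMn.
  rewrite big_split /= prodrXr mulrA -exprD subnK; last first.
    rewrite -[d in (_ <= d * _)%N]card_ord -sum_nat_const; apply: leq_sum => i _; exact: ltnW.
  by congr (_ * _); apply: eq_bigr => i _; rewrite rmorphXn.
(* If [T] were invertible at some point, its basic open would meet that of [g], where [T]
   vanishes. *)
apply: ind; move=> z' V'z' _ uT.
have [z2 [[V'z2 uT2] Dz2]] := @irreducible_meet (basic_open T) D0 (ex_intro _ z' (proj2 (basicP V'z' T) uT)) (ex_intro _ z gz).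
move: uT2; rewrite -(germ_res V'z2 Dz2 (subset_trans gs (@oIr _ _ _))).
rewrite -[rres O _ T]/(rho' T) rT germ0 => -[b]; rewrite mul0r => e; exact: (@stalk_nz z2).
Qed.

(** The closure of the point [q], written through neighbourhoods. *)
Definition closure_point (q : Y) : set Y := [set x | forall W, oset W x -> oset W q].

Lemma closure_point_closed q : closed (closure_point q).
Proof.
rewrite -[X in closed X]setCK; apply: open_closedC.
have -> : ~` closure_point q = \bigcup_(W in [set W : opens Y | ~ oset W q]) oset W.
  apply/seteqP; split=> [x nx|x [W /= Wq Wx] cx]; last by apply: Wq; exact: cx.
  apply: contrapT => H; apply: nx => W Wx; apply: contrapT => Wq; apply: H; by exists W.
by apply: bigcup_open => W _; exact: oset_open.
Qed.

Lemma closure_point_min q (A : set Y) : closed A -> A q -> closure_point q `<=` A.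
Proof.
move=> clA Aq x cx; apply: contrapT => nA.
by have := cx (Opens (closed_openC clA)) nA; apply.
Qed.

Lemma closure_point_irreducible q : irreducible_set (closure_point q).
Proof.
have qq : closure_point q q by [].
split; first by exists q.
by move=> A B clA clB /(_ q qq)[Aq|Bq]; [left|right]; exact: closure_point_min.
Qed.

(** Primes of the stalk are points of an affine neighbourhood, and the closures of these points form
    a chain of irreducible closed sets in the opposite order. *)
Lemma stalk_dim_le y d m (P : 'I_m.+1 -> set (stalk O y)) : space_dim_eq Y d ->
  prime_chain P -> (m <= d)%N.
Proof.
move=> [_ dimY] [Pp Plt]; have [V [gV Vy]] := affine_ft_exists y; have [[_ V2 V3 _] _] := gV.
have /choice[q qP] i : exists x, exists Vx : oset V x, [set a | P i (germ Vy a)] = point_ideal Vx.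
  have [[P0 PD PM] P1 PP] := Pp i; apply: V2; split; first split.
  - by rewrite /= germ0.
  - by move=> a b; rewrite /= germD; exact: PD.
  - by move=> a b; rewrite /= germM; exact: PM.
  - by rewrite /= germ1.
  - by move=> a b; rewrite /= germM; exact: PP.
have cl (i j : 'I_m.+1) : (i < j)%N -> closure_point (q i) (q j).
  move=> ij W Wq; have [Vi ei] := qP i; have [Vj ej] := qP j.
  have [g [gj gs]] := V3 (oI V W) (q j) (@oIl _ _ _) (conj Vj Wq).
  have [] // := gs (q i) _; apply/(basicP Vi); apply: contrapT => nu.
  have : point_ideal Vi g by [].
  rewrite -ei => /(Plt i j ij).1 => H.
  have : point_ideal Vj g by rewrite -ej.
  by apply; apply/basicP.
have ncl (i j : 'I_m.+1) : (i < j)%N -> ~ closure_point (q j) (q i).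
  move=> ij H; have [Vi ei] := qP i; have [Vj ej] := qP j.
  have [_ nsub] := Plt i j ij; apply: nsub => u Pu.
  have [w [a [uw e]]] := stalk_num Vy gV.1 u.
  have [[P0 PD PM] P1 PP] := Pp i; have [[_ _ PMj] _ _] := Pp j.
  have Pa : point_ideal Vj a by rewrite -ej /= -e; exact: PMj.
  have : [set a | P i (germ Vy a)] a.
    rewrite ei => ua; apply: Pa; apply/basicP; apply: H; exact/basicP.
  rewrite /= -e => /PP[Pw|//]; have [b eb] := uw.
  by case: P1; rewrite -eb mulrC; exact: PM.
apply: (dimY m (fun i => closure_point (q (rev_ord i)))); split.
  by move=> i; split; [exact: closure_point_closed|exact: closure_point_irreducible].
move=> i j ij; have ji : (rev_ord j < rev_ord i)%N by rewrite /=; have := ltn_ord j; lia.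
split.
  by apply: closure_point_min; [exact: closure_point_closed|exact: cl].
by move=> H; apply: (ncl _ _ ji); apply: H.
Qed.

End SchemesOverField.

(** * Coherent sheaves and support of homology *)

Lemma noetherian_rV (R : comPzRingType) n : noetherian R -> noetherian_mod 'rV[R]_n.
Proof.
move=> nR N sN; apply: (@noetherian_span R _ _ (fun i => delta_mx 0 i)) => // u _.
by exists (u 0); rewrite -row_sum_delta.
Qed.

Section FiniteFamilies.
Variables (A B : comPzRingType) (rho : {rmorphism A -> B}) (g : A).
Hypothesis gloc : is_localization_away rho g.

Lemma common_num n (b : 'I_n -> B) : exists N (a : 'I_n -> A), forall i, rho g ^+ N * b i = rho (a i).
Proof.
have [_ loc _] := gloc.
have /choice[an anP] i : exists an : A * nat, rho g ^+ an.2 * b i = rho an.1.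
  by have [a [m e]] := loc (b i); exists (a, m).
exists (\sum_i (an i).2)%N, (fun i => g ^+ (\sum_i (an i).2 - (an i).2) * (an i).1) => i.
rewrite rmorphM rmorphXn -anP mulrA -exprD subnK //.
by rewrite (bigD1 i) //= leq_addr.
Qed.

Lemma common_ker n (a : 'I_n -> A) : (forall i, rho (a i) = 0) -> exists N, forall i, g ^+ N * a i = 0.
Proof.
have [_ _ ker] := gloc => H.
have /choice[m mP] i := ker _ (H i).
exists (\sum_i m i)%N => i.
by rewrite (bigD1 i) //= exprD mulrAC mP mul0r.
Qed.

End FiniteFamilies.

Lemma germ_family (X : topologicalType) (O : ring_sheaf X) x n (p : 'I_n -> stalk O x) (U0 : opens X) :
  oset U0 x -> exists (U : opens X) (Ux : oset U x) (s : 'I_n -> O U),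
  U `<=` U0 /\ forall i, p i = germ Ux (s i).
Proof.
move=> U0x.
have [||U [Ux UU0 H]] := @common_open X x n (fun i U => exists (U' : opens X) (h : U `<=` U')
  (U'x : oset U' x) s, p i = germ U'x s) U0 U0x.
- by move=> i U V h [U' [h' [U'x [s e]]]]; exists U', (subset_trans h h'), U'x, s.
- move=> i; have [U [Ux [s e]]] := germ_surj (p i); exists U; split=> //.
  by exists U, (@subset_refl _ _), Ux, s.
have /choice[s sP] i : exists s, p i = germ Ux s.
  by have [U' [h [U'x [s ->]]]] := H i; exists (rres O h s); rewrite germ_res.
by exists U, Ux, s.
Qed.

Section CyclesGenerators.
Variables (X : topologicalType) (O : ring_sheaf X) (E : complex O).
Implicit Types U V W : opens X.

Definition locally_generated (F : mod_sheaf O) (B : subsheaf F) := forall x,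
  exists U n (g : 'I_n -> F U), [/\ oset U x, forall i, B U (g i) &
    forall V (h : V `<=` U) (t : F V) x', B V t -> oset V x' ->
    exists W (hWV : W `<=` V) (hWU : W `<=` U) (c : 'I_n -> O W),
    oset W x' /\ mres F hWV t = \sum_i c i *: mres F hWU (g i)].

Lemma locally_generated_fin (F : mod_sheaf O) (B : subsheaf F) x U (T : finType) (g : T -> F U) :
  oset U x -> (forall i, B U (g i)) ->
  (forall V (h : V `<=` U) (t : F V) x', B V t -> oset V x' ->
    exists W (hWV : W `<=` V) (hWU : W `<=` U) (c : T -> O W),
    oset W x' /\ mres F hWV t = \sum_i c i *: mres F hWU (g i)) ->
  exists U n (g : 'I_n -> F U), [/\ oset U x, forall i, B U (g i) &
    forall V (h : V `<=` U) (t : F V) x', B V t -> oset V x' ->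
    exists W (hWV : W `<=` V) (hWU : W `<=` U) (c : 'I_n -> O W),
    oset W x' /\ mres F hWV t = \sum_i c i *: mres F hWU (g i)].
Proof.
move=> Ux Bg gG; exists U, #|T|, (fun i => g (enum_val i)); split=> // V h t x' Bt Vx'.
have [W [h1 [h2 [c [Wx e]]]]] := gG V h t x' Bt Vx'.
exists W, h1, h2, (fun i => c (enum_val i)); split=> //; rewrite e.
by rewrite (reindex_onto enum_val enum_rank) => [|i _]; [apply: eq_bigl => i; rewrite enum_valK eqxx|exact: enum_rankK].
Qed.

(** Relations among the differentials of generators of [E m] are finitely generated by coherence of
    [E (m + 1)]; they are the coefficient families of generating cycles. *)
Lemma cycles_generated m : coherent (E m) -> coherent (E (m + 1)) -> locally_generated (cycles E m).
Proof.
move=> [gen _] [_ rel] x; have [U [n [g [Ux gG]]]] := gen x.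
have [V [h [p [r [Vx rP rG]]]]] := rel U n (fun i => diff E m (m + 1) U (g i)) x Ux.
exists V, p, (fun j => \sum_i r j i *: mres (E m) h (g i)); split=> // [j|W hWV t x' Zt Wx'].
  rewrite /= linear_sum -[RHS](rP j); apply: eq_bigr => i _.
  by rewrite linearZ /= mor_res.
have hWU := subset_trans hWV h.
have [W1 [h1 [h1U [c [W1x ec]]]]] := gG W hWU t x' Wx'.
have h1V := subset_trans h1 hWV.
have [|W2 [h2 [h2V [c' [W2x ec']]]]] := rG W1 h1V h1U c _ x' W1x.
  rewrite /is_relation -[RHS](raddf0 (mres (E (m + 1)) h1)) -[X in mres (E (m + 1)) h1 X]Zt.
  rewrite -mor_res ec linear_sum; apply: eq_bigr => i _; by rewrite linearZ /= mor_res.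
have h2U := subset_trans h2 h1U.
exists W2, (subset_trans h2 h1), h2V, c'; split=> //.
rewrite -(mres_comp h1 h2) ec raddf_sum.
transitivity (\sum_i \sum_j (c' j * rres O h2V (r j i)) *: mres (E m) h2U (g i)).
  by apply: eq_bigr => i _; rewrite mresZ ec' scaler_suml (mres_comp _ _ h2U).
rewrite exchange_big; apply: eq_bigr => j _; rewrite raddf_sum scaler_sumr.
by apply: eq_bigr => i _; rewrite mresZ scalerA (mres_comp _ _ h2U).
Qed.

End CyclesGenerators.

Section CoherentSheaves.
Variables (k : closedFieldType) (Y : scheme).
Local Notation O := (structure_sheaf Y).
Variable phi : {rmorphism k -> O (oT Y)}.
Implicit Types U V W : opens Y.
Hypothesis Yft : finite_type phi.

(** Over an affine open of finite type the relations form a submodule of a finite free module over a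
    noetherian ring. A relation on a basic open of [g] becomes one over the whole affine open after
    multiplication by a power of [g], which is invertible on the basic open. *)
Lemma free_coherent b : coherent (free_sheaf O b).
Proof.
split; first exact: free_finite_type.
move=> U n s x Ux; have [V [gV Vx h]] := affine_ft_small Yft Ux.
have [[_ _ V3 _] _] := gV.
pose comb (a : 'rV[O V]_n) : free_sheaf O b V := \sum_i a 0 i *: mres (free_sheaf O b) h (s i).
pose N : set 'rV[O V]_n := [set a | comb a = 0].
have combl c u v : comb (c *: u + v) = c *: comb u + comb v.
  by rewrite /comb scaler_sumr -big_split; apply: eq_bigr => i _; rewrite !mxE scalerDl scalerA.
have comb0 : comb 0 = 0 by rewrite /comb big1 // => i _; rewrite mxE scale0r.
have sN : is_submod N.
  split=> //=.
  - by move=> u v; rewrite /N /= => Nu Nv; rewrite -[u]scale1r combl Nu Nv scaler0 addr0.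
  - by move=> a u; rewrite /N /= => Nu; rewrite -[_ *: u]addr0 combl Nu comb0 scaler0 addr0.
have [m [r Nr]] := noetherian_rV (affine_ft_noetherian gV) sN.
exists V, h, m, (fun j i => r j 0 i); split=> // [j|W hWV hWU a rel y Wy].
  have : N (r j) by rewrite Nr; exact: span_of_gen.
  by [].
have [g [gy gW]] := V3 W y hWV Wy.
have DV := subset_trans gW hWV; have DU := subset_trans DV h.
pose rho : {rmorphism O V -> O (basic_open g)} := rres O DV.
have gloc : is_localization_away rho g by apply: affine_loc => //; exact: gV.1.
have [M [a' a'P]] := common_num gloc (fun i => rres O gW (a i)).
have z0 : mres (free_sheaf O b) DV (comb (\row_i a' i)) = 0.
  rewrite raddf_sum; transitivity (rho g ^+ M *: mres (free_sheaf O b) gW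
      (\sum_i a i *: mres (free_sheaf O b) hWU (s i))); last by rewrite rel raddf0 scaler0.
  rewrite raddf_sum scaler_sumr; apply: eq_bigr => i _.
  rewrite !mresZ mxE -[rres O DV _]/(rho _) -a'P -scalerA; congr (_ *: (_ *: _)).
  by rewrite !(mres_comp _ _ DU).
have [|M' M'P] := common_ker gloc (a := fun j => comb (\row_i a' i) 0 j).
  by move=> j; have := congr1 (fun v : 'rV_b => v 0 j) z0; rewrite !mxE.
have : N (g ^+ M' *: \row_i a' i).
  rewrite /N /= -[_ *: _]addr0 combl comb0 addr0; apply/rowP => j.
  by rewrite !mxE; exact: M'P.
rewrite Nr => -[c ec]; have [[e ee] _ _] := gloc.
exists (basic_open g), gW, DV, (fun j => e ^+ (M' + M) * rho (c j)); split=> // i.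
have eM : e ^+ (M' + M) * rho g ^+ (M' + M) = 1 by rewrite -exprMn mulrC ee expr1n.
have -> : rres O gW (a i) = e ^+ (M' + M) * rho (g ^+ M' * a' i).
  by rewrite rmorphM rmorphXn -a'P (mulrA (_ ^+ M')) -exprD mulrA eM mul1r.
have -> : g ^+ M' * a' i = \sum_j c j * r j 0 i.
  have := congr1 (fun v : 'rV_n => v 0 i) ec; rewrite !mxE summxE => ->.
  by apply: eq_bigr => j _; rewrite mxE.
by rewrite rmorph_sum mulr_sumr; apply: eq_bigr => j _; rewrite rmorphM mulrA.
Qed.

Lemma coherent_noetherian (F : mod_sheaf O) x : coherent F -> noetherian_mod (mstalk F x).
Proof.
move=> [gen _] N sN; have [U [n [g [Ux gG]]]] := gen x.
apply: (@noetherian_span _ _ n (fun i => mgerm Ux (g i))) => //.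
  exact: (stalk_noetherian Yft).
move=> u _; have [V [Vx [t [VU ->]]]] := mgerm_small u Ux.
have [W [hWV [hWU [c [Wx e]]]]] := gG V VU t x Vx.
exists (fun i => germ Wx (c i)); rewrite -(mgerm_res Vx Wx hWV) e mgerm_sum.
by apply: eq_bigr => i _; rewrite mgermZ mgerm_res.
Qed.

(** The generators are lifts of generators of [N], which suffice at [y], and the sections
    [f_i^t g_l], which suffice at nearby points since some [f_i] is invertible there. The inclusion
    of [(f)^t F_y] in [N] puts the latter into the subsheaf. *)
Lemma point_subsheaf_coherent (F : mod_sheaf O) y V (Vy : oset V y) q (f : 'I_q -> O V)
    (N : set (mstalk F y)) (sN : is_submod N) t : closed [set y] ->
  (forall i, point_ideal Vy (f i)) ->
  (forall x (Vx : oset V x), x <> y -> exists i, is_unit (germ Vx (f i))) ->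
  coherent F -> mulset (gpow (fun i => germ Vy (f i)) t) setT `<=` N ->
  coherent (sub_sheaf (point_subsheaf sN)).
Proof.
move=> cy fy foff cF tN; apply: sub_coherent => // x; have [gen _] := cF.
have [xy|xy] := pselect (x = y); last first.
  have [U [n [g [Ux gG]]]] := gen x.
  have hU : oI U (open_off cy) `<=` U by exact: oIl.
  exists (oI U (open_off cy)), n, (fun i => mres F hU (g i)); split=> //.
    by move=> i Uy; case: Uy => _ [].
  move=> W hW t0 x' _ Wx'.
  have [W' [h1 [h2 [c [W'x e]]]]] := gG W (subset_trans hW hU) t0 x' Wx'.
  exists W', h1, (subset_trans h1 hW), c; split=> //; rewrite e; apply: eq_bigr => i _.
  by rewrite (mres_comp _ _ h2).
subst x; have [m [w Nw]] := coherent_noetherian cF sN.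
have [U [n [g [Uy gG]]]] := gen y.
have [U' [U'y [s [U'UV sE]]]] := @mgerm_family _ _ F y m w (oI U V) (conj Uy Vy).
have hU := subset_trans U'UV (@oIl _ _ _); have hV := subset_trans U'UV (@oIr _ _ _).
pose big (i : ('I_m + 'I_q * 'I_n)%type) : F U' := match i with
  | inl j => s j
  | inr j => rres O hV (f j.1) ^+ t *: mres F hU (g j.2) end.
apply: (@locally_generated_fin _ _ F (point_subsheaf sN) _ U' _ big) => //.
  case=> [j|[i l]] Uy' /=.
    by rewrite (Prop_irrelevance Uy' U'y) -sE Nw; exact: span_of_gen.
  rewrite mgermZ; apply: tN; apply: mulset_in => //.
  rewrite rmorphXn /= (germ_res Vy); exact: (gpowX (fun i => germ Vy (f i)) i t).
move=> W hW t0 x' Nt Wx'; have [xy|xy] := pselect (x' = y).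
  subst x'; have := Nt Wx'; rewrite Nw => -[c ec].
  have [W1 [W1y [c1 [W1W c1E]]]] := germ_family c Wx'.
  have W1U := subset_trans W1W hW.
  have /mgermP[W2 [h1 [h2 [W2y e2]]]] :
      mgerm Wx' t0 = mgerm W1y (\sum_j c1 j *: mres F W1U (s j)).
    rewrite ec mgerm_sum; apply: eq_bigr => j _.
    by rewrite mgermZ mgerm_res sE c1E.
  have W2U := subset_trans h2 W1U.
  exists W2, h1, W2U, (fun i => if i is inl j then rres O h2 (c1 j) else 0); split=> //.
  rewrite e2 raddf_sum big_sumType /= [X in _ = _ + X]big1 ?addr0 => [|i _]; last by rewrite scale0r.
  by apply: eq_bigr => j _; rewrite mresZ (mres_comp _ _ W2U).
have [W1 [h1 [h2 [c [W1x ec]]]]] := gG W (subset_trans hW hU) t0 x' Wx'.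
have W1U := subset_trans h1 hW.
have [a [b eb]] := foff x' (hV _ (W1U _ W1x)) xy.
have [W2 [W2x [b2 [W2W1 b2E]]]] := germ_family (fun _ : 'I_1 => b) W1x.
have W2V := subset_trans W2W1 (subset_trans W1U hV).
have /germP[W3 [h3 [h3' [W3x e3]]]] : germ W2x (rres O W2V (f a) * b2 ord0) = germ W2x 1.
  by rewrite germM -b2E (germ_res (hV _ (W1U _ W1x))) eb germ1.
have W31 := subset_trans h3 W2W1; have W3U := subset_trans W31 W1U.
have W3V := subset_trans W3U hV; have W3UU := subset_trans W3U hU.
exists W3, (subset_trans W31 h1), W3U,
  (fun i => if i is inr j then (j.1 == a)%:R * (rres O h3 (b2 ord0) ^+ t * rres O W31 (c j.2)) else 0).
split=> //; rewrite -(mres_comp h1 W31) ec raddf_sum big_sumType /= [X in _ = X + _]big1 ?add0r; last first.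
  by move=> j _; rewrite scale0r.
rewrite -(pair_bigA _ (fun i l => ((i == a)%:R * (rres O h3 (b2 ord0) ^+ t * rres O W31 (c l))) *:
  mres F W3U (rres O hV (f i) ^+ t *: mres F hU (g l)))) /=.
rewrite (bigD1 a) //= [X in _ = _ + X]big1 ?addr0 => [|i /negPf ia]; last first.
  by rewrite big1 // => l _; rewrite ia mul0r scale0r.
apply: eq_bigr => l _; rewrite eqxx mul1r !mresZ rmorphXn (rres_comp _ _ W3V) (mres_comp _ _ W3UU).
rewrite (mres_comp _ _ W3UU) scalerA mulrAC -exprMn.
have -> : rres O h3 (b2 ord0) * rres O W3V (f a) = 1.
  move: e3; rewrite rmorphM rmorph1 (rres_comp _ _ W3V) mulrC; exact.
by rewrite expr1n mul1r.
Qed.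

(** * Support and annihilators of homology *)

Section Support.
Variable E : complex O.
Hypothesis cE : forall n, coherent (E n).

Definition homology_zero x m := forall z : mstalk (E m) x, sdiff E x m (m + 1) z = 0 ->
  exists w, z = sdiff E x (m - 1) m w.

(** The [z_i] generate the cycles near [x], and [I i] is the annihilator of the class of [z_i]: the
    first coefficients of relations between [z_i], at index 0, and the boundaries of generators of
    [E (m - 1)]. Coherence makes these relations generated by relations over one open set, which
    relates the ideals to all nearby stalks. *)
Lemma support_data x m : exists V (Vx : oset V x) a (z : 'I_a -> E m V) (I : 'I_a -> set (O V)),
  [/\ affine_ft phi V, forall i, is_ideal (I i) /\ cycles E m V (z i),
   forall v (Vv : oset V v) u, sdiff E v m (m + 1) u = 0 ->
     exists c : 'I_a -> stalk O v, u = \sum_i c i *: mgerm Vv (z i),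
   forall i b v (Vv : oset V v), I i b -> exists w, germ Vv b *: mgerm Vv (z i) = sdiff E v (m - 1) m w &
   forall i v (Vv : oset V v) w, mgerm Vv (z i) = sdiff E v (m - 1) m w -> ~ (I i `<=` point_ideal Vv)].
Proof.
have [U1 [a [z [U1x Zz zG]]]] := cycles_generated (cE m) (cE (m + 1)) x.
have [[gen _] [_ rel]] := (cE (m - 1), cE m).
have [U2 [q [u [U2x uG]]]] := gen x.
pose U := oI U1 U2; have Ux : oset U x by [].
have hU1 : U `<=` U1 by exact: oIl. have hU2 : U `<=` U2 by exact: oIr.
pose fam i (j : 'I_q.+1) : E m U := if unlift ord0 j is Some l
  then diff E (m - 1) m U (mres (E (m - 1)) hU2 (u l)) else mres (E m) hU1 (z i).
have fam0 i : fam i ord0 = mres (E m) hU1 (z i) by rewrite /fam unlift_none.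
have famS i l : fam i (lift ord0 l) = diff E (m - 1) m U (mres (E (m - 1)) hU2 (u l)).
  by rewrite /fam liftK.
pose P (i : 'I_a) V := exists (h : V `<=` U) p (r : 'I_p -> 'I_q.+1 -> O V),
  (forall l, is_relation h (fam i) (r l)) /\
  forall W (hWV : W `<=` V) (hWU : W `<=` U) (b : 'I_q.+1 -> O W), is_relation hWU (fam i) b ->
    forall y, oset W y -> exists W' (h1 : W' `<=` W) (h2 : W' `<=` V) (c : 'I_p -> O W'),
    oset W' y /\ forall j, rres O h1 (b j) = \sum_l c l * rres O h2 (r l j).
have [||V0 [V0x V0U PV0]] := @common_open Y x a P U Ux.
- move=> i V V' hV [h [p [r [rP rG]]]].
  have hU := subset_trans hV h.
  exists hU, p, (fun l j => rres O hV (r l j)); split=> [l|W hWV hWU b Hb y Wy].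
    rewrite /is_relation -[RHS](raddf0 (mres (E m) hV)) -[X in mres (E m) hV X](rP l).
    by rewrite raddf_sum; apply: eq_bigr => j _; rewrite mresZ (mres_comp _ _ hU).
  have [W' [h1 [h2 [c [W'y e]]]]] := rG W (subset_trans hWV hV) hWU b Hb y Wy.
  exists W', h1, (subset_trans h1 hWV), c; split=> // j; rewrite e; apply: eq_bigr => l _.
  by rewrite (rres_comp _ _ h2).
- move=> i; have [V [h [p [r [Vx rP rG]]]]] := rel U q.+1 (fam i) x Ux.
  by exists V; split=> //; exists h, p, r.
have [V [gV Vx VV0]] := affine_ft_small Yft V0x.
have VU := subset_trans VV0 V0U; have VU1 := subset_trans VU hU1; have VU2 := subset_trans VU hU2.
pose I i : set (O V) := [set b | exists r, is_relation VU (fam i) r /\ r ord0 = b].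
exists V, Vx, a, (fun i => mres (E m) VU1 (z i)), I; split=> //.
- move=> i; split; last exact: (ssec_res VU1 (Zz i)).
  split.
  + by exists (fun=> 0); split=> //; apply: big1 => j _; rewrite scale0r.
  + move=> b b' [r [Hr <-]] [r' [Hr' <-]]; exists (fun j => r j + r' j); split=> //.
    rewrite /is_relation -[RHS]addr0 -[X in _ = X + _]Hr -[X in _ = _ + X]Hr' -big_split.
    by apply: eq_bigr => j _; rewrite scalerDl.
  + move=> b b' [r [Hr <-]]; exists (fun j => b * r j); split=> //.
    rewrite /is_relation -[RHS](scaler0 _ b) -[X in _ = _ *: X]Hr scaler_sumr.
    by apply: eq_bigr => j _; rewrite scalerA.
- move=> v Vv u0 /cycle_germ[W [Wv [t [Zt ->]]]].
  have WU1v : oset (oI W U1) v by split=> //; exact: VU1.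
  have [W1 [h1 [h2 [c [W1v e]]]]] := zG (oI W U1) (@oIr _ _ _) (mres _ (@oIl _ _ _) t) v
    (ssec_res (@oIl _ W U1) Zt) WU1v.
  exists (fun i => germ W1v (c i)).
  rewrite -(mgerm_res Wv WU1v (@oIl _ _ _)) -(mgerm_res WU1v W1v h1) e mgerm_sum.
  by apply: eq_bigr => i _; rewrite mgermZ (mgerm_res (VU1 _ Vv)) (mgerm_res (VU1 _ Vv)).
- move=> i b v Vv [r [Hr <-]].
  exists (- \sum_l germ Vv (r (lift ord0 l)) *: mgerm (VU2 _ Vv) (u l)).
  have := congr1 (mgerm Vv) Hr; rewrite big_ord_recl mgermD mgermZ mgerm0 fam0 (mres_comp _ _ VU1) => /eqP.
  rewrite addr_eq0 => /eqP ->; rewrite [RHS]raddfN; congr (- _); rewrite [RHS]linear_sum mgerm_sum.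
  apply: eq_bigr => l _; rewrite [RHS]linearZ /= mgermZ; congr (_ *: _).
  by rewrite famS (mgerm_res (VU _ Vv)) /sdiff -(mgerm_res (VU2 _ Vv) (VU _ Vv) hU2) smapE.
- move=> i v Vv w; have [W [Wv [t [WV ->]]]] := mgerm_small w Vv.
  rewrite /sdiff smapE => /mgermP[W1 [h1 [h2 [W1v e1]]]] sub.
  have W1U2 := subset_trans h1 VU2; have W1U := subset_trans h1 VU.
  have [W2 [h3 [h4 [c [W2v e2]]]]] := uG W1 W1U2 (mres _ h2 t) v W1v.
  have W2U := subset_trans h3 W1U; have W2V := subset_trans h3 h1; have W2V0 := subset_trans W2V VV0.
  have [hh [p [r [rP rG]]]] := PV0 i.
  (* If [z_i] is a boundary at [v], there is a local relation with first coefficient 1; it is a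
     combination of the generating relations, whose first coefficients would all vanish at [v]. *)
  have [|W' [h5 [h6 [c' [W'v ec']]]]] := rG W2 W2V0 W2U
    (fun j => if unlift ord0 j is Some l then - c l else 1) _ v W2v.
    rewrite /is_relation big_ord_recl unlift_none scale1r fam0 (mres_comp _ _ (subset_trans W2U hU1)).
    apply/eqP; rewrite addr_eq0; apply/eqP.
    transitivity (mres (E m) h3 (mres (E m) h1 (mres (E m) VU1 (z i)))).
      by rewrite (mres_comp _ _ (subset_trans h1 VU1)) (mres_comp _ _ (subset_trans W2U hU1)).
    rewrite e1 -mor_res -mor_res e2 linear_sum -sumrN; apply: eq_bigr => l _.
    rewrite liftK scaleNr opprK linearZ /= famS -mor_res; congr (_ *: _).
    by rewrite (mres_comp _ _ h4).
  have := ec' ord0; rewrite unlift_none rmorph1 => /(congr1 (germ W'v)).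
  rewrite germ1 rmorph_sum => e; have [n0 nD nM] := @scheme_local Y v.
  suff : nonunits (1 : stalk O v) by apply; exists 1; rewrite mulr1.
  rewrite e; apply: (ideal_sum _ (And3 n0 nD nM)) => l _; rewrite rmorphM; apply: nM.
  rewrite /= (germ_res (VV0 _ Vv)) -(germ_res (VV0 _ Vv) Vv VV0); apply: sub.
  exists (fun j => rres O VV0 (r l j)); split=> //.
  rewrite /is_relation -[RHS](raddf0 (mres (E m) VV0)) -[X in mres (E m) VV0 X](rP l).
  by rewrite raddf_sum; apply: eq_bigr => j _; rewrite mresZ (mres_comp _ _ VU).
Qed.

Lemma support_points x m : exists V (Vx : oset V x) a (z : 'I_a -> E m V) (I : 'I_a -> set (O V)),
  [/\ affine_ft phi V, forall i, is_ideal (I i),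
   forall u, sdiff E x m (m + 1) u = 0 -> exists c : 'I_a -> stalk O x, u = \sum_i c i *: mgerm Vx (z i),
   forall i b, I i b -> exists w, germ Vx b *: mgerm Vx (z i) = sdiff E x (m - 1) m w &
   forall i (ev : {rmorphism O V -> k}), (forall c, ev (kres phi V c) = c) -> (forall b, I i b -> ev b = 0) ->
     exists y (Vy : oset V y), [/\ forall a, point_ideal Vy a <-> ev a = 0, closed [set y] &
       ~ homology_zero y m]].
Proof.
have [V [Vx [a [z [I [gV IZ Igen I1 I2]]]]]] := support_data x m.
exists V, Vx, a, z, I; split=> //.
- by move=> i; have [] := IZ i.
- exact: Igen.
- by move=> i b; exact: I1.
move=> i ev evK evI; have [y [Vy [evP cy]]] := point_of_ev Yft gV evK.
exists y, Vy; split=> // H.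
have [|w ew] := H (mgerm Vy (z i)).
  by rewrite /sdiff smapE (IZ i).2 mgerm0.
by apply: (I2 i y Vy w ew) => b /evI /evP.
Qed.

(** If an annihilator ideal were proper, the Nullstellensatz would give it a zero, and this closed
    point would carry homology. *)
Lemma homology_support x m : (forall y, closed [set y] -> homology_zero y m) -> homology_zero x m.
Proof.
move=> H; have [V [Vx [a [z [I [gV II Igen I1 I2]]]]]] := support_points x m.
have bz i : exists w, mgerm Vx (z i) = sdiff E x (m - 1) m w.
  have I_1 : I i 1.
    apply: contrapT => nI1; have [ev [evK evI]] := weak_ns gV.2 (II i) nI1.
    by have [y [Vy [_ cy]]] := I2 i ev evK evI; apply; exact: H.
  have [w ew] := I1 i 1 I_1; exists w; by rewrite -ew germ1 scale1r.
move=> u /Igen[c ->]; have /choice[w wP] := bz.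
exists (\sum_i c i *: w i); rewrite linear_sum; apply: eq_bigr => i _.
by rewrite linearZ /= -wP.
Qed.

(** The annihilator ideals can vanish only at [y0], so by the strong Nullstellensatz each contains a
    power of any function vanishing at [y0]; the sum of the exponents serves all generators. *)
Lemma homology_power y0 m u : closed [set y0] ->
  (forall y, closed [set y] -> y <> y0 -> homology_zero y m) -> nonunits u ->
  exists N, forall z, sdiff E y0 m (m + 1) z = 0 -> exists w, u ^+ N *: z = sdiff E y0 (m - 1) m w.
Proof.
move=> cy0 H nu; have [V [Vx [a [z [I [gV II Igen I1 I2]]]]]] := support_points y0 m.
have [v [b [uv e]]] := stalk_num Vx gV.1 u.
have pb : point_ideal Vx b by rewrite /point_ideal /= -e is_unitM => -[_]; exact: nu.
have /choice[N NP] i : exists N, I i (b ^+ N).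
  apply: (strong_ns gV.2 (II i)) => ev evK evI.
  have [y [Vy [evP cy nH]]] := I2 i ev evK evI.
  have yy : y = y0 by apply: contrapT => yy; apply: nH; exact: H.
  by subst y; apply/evP; rewrite (Prop_irrelevance Vy Vx).
exists (\sum_i N i)%N => z0 /Igen[c ->].
have [v' ev'] := uv.
have uE : u = v' * germ Vx b by rewrite -e mulrA (mulrC v') ev' mul1r.
have bz i : exists w, u ^+ (\sum_i N i) *: (c i *: mgerm Vx (z i)) = sdiff E y0 (m - 1) m w.
  have [w ew] := I1 i _ (NP i).
  exists ((c i * v' ^+ (\sum_i N i) * germ Vx b ^+ (\sum_i N i - N i)) *: w).
  rewrite [RHS]linearZ /= -ew !scalerA; congr (_ *: _).
  have sE : (\sum_i N i)%N = ((\sum_i N i - N i) + N i)%N by rewrite subnK // (bigD1 i) //= leq_addr.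
  rewrite uE exprMn {2}sE exprD rmorphXn; ring.
have /choice[w wP] := bz; exists (\sum_i w i); rewrite scaler_sumr linear_sum.
by apply: eq_bigr => i _; rewrite wP.
Qed.

End Support.

End CoherentSheaves.

(** * Derived morphisms to skyscraper sheaves *)

(** The stalk construction with its internals hidden: [W] is the thickened subcomplex, and the last
    clause says that [chi] does not become nullhomotopic after pullback along a
    quasi-isomorphism. *)
Lemma local_apex (R : comPzRingType) (m : set R) (M : int -> lmodType R)
  (d : forall n m0 : int, {linear M n -> M m0}) (b0 : int) q (y : 'I_q -> R) (n : int)
  (rk : int -> nat) (D : int -> nat -> nat -> R) (p : forall l : int, nat -> M l)
  (r0 : nat) (D0 : nat -> nat -> R) (p0 : nat -> M n) (N : int -> lmodType R)
  (dN : forall n0 m0 : int, {linear N n0 -> N m0}) (p1 : forall l : int, {linear N l -> M l})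
  (p2 : forall l : int, {linear N l -> 'rV[R]_(rk l + rk (l + 1))})
  (mk : forall l : int, M l -> 'rV[R]_(rk l + rk (l + 1)) -> N l)
  (k : comPzRingType) (ev : {rmorphism R -> k}) (i0 : 'I_r0) :
  gpow y 1 `<=` m -> resolved m d (n + 1) rk D p ->
  res_at m d r0 (rk (n + 1)) (rk (n + 1 + 1)) D0 (D (n + 1)) p0 (p (n + 1)) ->
  (forall l : int, (b0 <= l)%R -> rk l = 0%N) ->
  (forall n0 m0 p1 u, dN m0 p1 (dN n0 m0 u) = 0) -> (forall l, noetherian_mod (N l)) ->
  (forall l u v, p1 l (mk l u v) = u) -> (forall l u v, p2 l (mk l u v) = v) ->
  (forall l u v, p1 l u = p1 l v -> p2 l u = p2 l v -> u = v) ->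
  (forall l l' u, p1 l' (dN l l' u) = d l l' (p1 l u)) ->
  (forall l u, p2 (l + 1) (dN l (l + 1) u) = row_mx (rsubmx (p2 l u)) 0) ->
  (forall a, m a -> ev a = 0) ->
  exists (W : forall l, set (N l)) (t : int -> nat) (chi : N n -> k),
  [/\ (forall l, is_submod (W l)) /\ (forall l, mulset (gpow y (t l)) setT `<=` W l),
      forall l l' u, l' = l + 1 -> W l u -> W l' (dN l l' u),
      (forall l l' u w, l = l' + 1 -> W l u -> dN l (l + 1) u = 0 -> p1 l u = d l' l w ->
         exists w', W l' w' /\ u = dN l' l w') /\
      (forall l z, d l (l + 1) z = 0 -> exists u l' w,
         [/\ W l u, dN l (l + 1) u = 0, l = l' + 1 & z = p1 l u + d l' l w]),
      (forall a u v, W n u -> W n v -> chi (a *: u + v) = ev a * chi u + chi v) /\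
      (forall l' w, n = l' + 1 -> chi (dN l' n w) = 0) &
      forall (V : int -> lmodType R) (dV : forall n m, {linear V n -> V m})
        (a : forall l, {linear V l -> N l}),
      (forall l v, W l (a l v)) -> (forall l l' v, a l' (dV l l' v) = dN l l' (a l v)) ->
      (forall l v, dV (l + 1) (l + 1 + 1) v = 0 ->
        (exists w, p1 (l + 1) (a (l + 1) v) = d l (l + 1) w) -> exists w, v = dV l (l + 1) w) ->
      (forall l z, d l (l + 1) z = 0 -> exists v l' w,
        [/\ l = l' + 1, dV l (l + 1) v = 0 & z = p1 l (a l v) + d l' l w]) ->
      forall h : V (n + 1) -> k, (forall b u v, h (b *: u + v) = ev b * h u + h v) ->
      (forall v, chi (a n v) = h (dV n (n + 1) v)) -> 0 = 1 :> k].
Proof.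
move=> ym res resn rk0 dNN nN mk1 mk2 pinj p1d p2d ev_m.
have [t [tn tS]] := exponents_exist y n D p dN nN mk1 mk2 pinj.
have [chi [chi_lin chi_d chi_1]] :=
  chi_exists ym resn dNN mk1 mk2 pinj p1d p2d tn i0 ev_m.
exists (fun l => @WW R M q y n rk D p N dN mk t l), t, chi; split.
- split=> l; first exact: WW_submod mk1 mk2 pinj t l.
  by move=> u; exact: (WW_J n D p dN mk1 mk2 pinj).
- by move=> l l' u e Wu; exact: (@WW_d R m M d q y n rk D p res N dN dNN p1 p2 mk mk1 mk2 pinj p1d p2d t l l' u e Wu).
- split; first by move=> l l' u w; exact: (WW_inj res mk1 mk2 pinj p1d p2d tS).
  by move=> l z; exact: (WW_surj y res dNN mk1 mk2 pinj p1d p2d t).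
- by split.
move=> V dV a aW ad ainj asurj h hlin hchi.
exact: (no_lift res resn rk0 mk1 mk2 pinj p1d p2d tS ev_m chi_lin chi_d chi_1 aW ad ainj asurj hlin hchi).
Qed.

Lemma semilinear_of_relation (R k : comPzRingType) (ev : {rmorphism R -> k}) (M : lmodType R)
    (Rel : M -> k -> Prop) :
  (forall u, exists c, Rel u c) ->
  (forall a u v c c', Rel u c -> Rel v c' -> Rel (a *: u + v) (ev a * c + c')) ->
  (forall c, Rel 0 c -> c = 0) ->
  exists f : M -> k, (forall u c, Rel u c -> f u = c) /\
    forall a u v, f (a *: u + v) = ev a * f u + f v.
Proof.
move=> tot lin zero; have /choice[f fP] := tot.
have fE u c : Rel u c -> f u = c.
  move=> Rc; apply/eqP; rewrite eq_sym -subr_eq0; apply/eqP/zero.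
  have := lin (-1) _ _ _ _ (fP u) Rc.
  by rewrite scaleN1r addNr rmorphN rmorph1 mulN1r addrC.
by exists f; split=> // a u v; apply: fE; exact: lin.
Qed.

Section StalkFunctoriality.
Variables (X : topologicalType) (O : ring_sheaf X) (x : X).

Lemma smap_comp (F G H : mod_sheaf O) (g : mor G H) (f : mor F G) p :
  smap x (mor_comp g f) p = smap x g (smap x f p).
Proof. by have [U [Ux [s ->]]] := mgerm_surj p; rewrite !smapE. Qed.

Lemma smap_zero (F G : mod_sheaf O) p : smap x (mor_zero F G) p = 0.
Proof. by have [U [Ux [s ->]]] := mgerm_surj p; rewrite !smapE mgerm0. Qed.

Lemma smap_chain (E F : complex O) (f : chain_map E F) n m p :
  smap x (f m) (sdiff E x n m p) = sdiff F x n m (smap x (f n) p).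
Proof. by have [U [Ux [s ->]]] := mgerm_surj p; rewrite /sdiff !smapE cmap_diff. Qed.

Lemma sdiff_shape (E : complex O) n m p : m <> n + 1 -> sdiff E x n m p = 0.
Proof.
by move=> nm; have [U [Ux [s ->]]] := mgerm_surj p; rewrite /sdiff smapE diff_shape // mgerm0.
Qed.

End StalkFunctoriality.

Section FreeCone.
Variables (X : topologicalType) (O : ring_sheaf X).

Section FreeMorphism.
Variables (b b' : nat) (N : 'M[int]_(b, b')).
Definition free_mor_fun (U : opens X) (v : 'rV[O U]_b) : 'rV[O U]_b' := v *m map_mx intr N.
Lemma free_mor_linear (U : opens X) : linear (@free_mor_fun U).
Proof. by move=> a u v; rewrite /free_mor_fun mulmxDl scalemxAl. Qed.
HB.instance Definition _ (U : opens X) := GRing.isLinear.Build (O U) 'rV[O U]_b 'rV[O U]_b' *:%R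
  (@free_mor_fun U) (@free_mor_linear U).
Program Definition free_mor : mor (free_sheaf O b) (free_sheaf O b') :=
  @Mor _ _ (free_sheaf O b) (free_sheaf O b') (fun U => @free_mor_fun U : {linear _ -> _}) _.
Next Obligation.
move=> U V h s; rewrite /= /free_res /free_mor_fun map_mxM; congr (_ *m _).
by apply/matrixP => i j; rewrite !mxE rmorph_int.
Qed.
End FreeMorphism.

Variables (E : complex O) (rk : int -> nat).

(** The differential [(g, g') -> (g', 0)] of the contractible complex, as an integer matrix so that
    it acts over every ring of sections at once. *)
Definition cone_mx l m : 'M[int]_(rk l + rk (l + 1), rk m + rk (m + 1)) :=
  (m == l + 1)%:R *: col_mx 0 (row_mx (pid_mx (rk (l + 1))) 0).

Lemma cone_mx0 l m : m <> l + 1 -> cone_mx l m = 0.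
Proof. by move=> /eqP/negPf ml; rewrite /cone_mx ml scale0r. Qed.

Lemma cone_mxM l m p : cone_mx l m *m cone_mx m p = 0.
Proof.
rewrite /cone_mx -scalemxAl -scalemxAr mul_col_mx mul0mx mul_row_col mulmx0 mul0mx addr0 col_mx0.
by rewrite !scaler0.
Qed.

Definition cone_diff l m : mor (prod_sheaf (E l) (free_sheaf O (rk l + rk (l + 1))))
    (prod_sheaf (E m) (free_sheaf O (rk m + rk (m + 1)))) :=
  pairing (mor_comp (diff E l m) (prod_fst _ _)) (mor_comp (free_mor (cone_mx l m)) (prod_snd _ _)).

Program Definition free_cone : complex O := @Complex X O
  (fun l => prod_sheaf (E l) (free_sheaf O (rk l + rk (l + 1)))) cone_diff _ _.
Next Obligation.
move=> l m ml U s; rewrite /= /pairing_fun /= diff_shape // /free_mor_fun cone_mx0 //.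
by rewrite map_mx0 mulmx0.
Qed.
Next Obligation.
move=> l m p U s; rewrite /= /pairing_fun /= diff_diff /free_mor_fun -mulmxA -map_mxM cone_mxM.
by rewrite map_mx0 mulmx0.
Qed.

Program Definition cone_fst : chain_map free_cone E :=
  @ChainMap X O free_cone E (fun l => prod_fst _ _) _.
Next Obligation. by []. Qed.

Lemma cone_bounded a b : bounded E ->
  (forall l, (l < a)%R || (b < l)%R -> rk l = 0%N /\ rk (l + 1) = 0%N) -> bounded free_cone.
Proof.
move=> [a' [b' H]] rk0; exists (Num.min a a'), (Num.max b b') => l Hl U [s v].
have [r1 r2] : rk l = 0%N /\ rk (l + 1) = 0%N by apply: rk0; lia.
have -> : s = 0 by apply: (H l _ U s); lia.
suff -> : v = 0 by [].
apply/rowP => -[j jl]; exfalso; move: jl; by rewrite r1 r2.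
Qed.

Variable x : X.

Definition cone1 l : {linear mstalk (free_cone l) x -> mstalk (E l) x} := smap x (prod_fst _ _).
Definition cone2 l : {linear mstalk (free_cone l) x -> 'rV[stalk O x]_(rk l + rk (l + 1))} :=
  @germ_row _ _ _ x \o smap x (prod_snd _ _).

Lemma cone_inj l u v : cone1 l u = cone1 l v -> cone2 l u = cone2 l v -> u = v.
Proof. by move=> e1 /germ_row_inj e2; exact: prod_stalk_inj e1 e2. Qed.

Lemma cone_mk : exists mk : forall l, mstalk (E l) x -> 'rV[stalk O x]_(rk l + rk (l + 1)) -> mstalk (free_cone l) x,
  (forall l u v, cone1 l (mk l u v) = u) /\ (forall l u v, cone2 l (mk l u v) = v).
Proof.
have H l u v : exists w, cone1 l w = u /\ cone2 l w = v.
  have [v' <-] := germ_row_surj v.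
  by have [w [e1 e2]] := prod_stalk_surj u v'; exists w; split=> //; rewrite /cone2 /= e2.
exists (fun l u v => sval (cid (H l u v))).
by split=> l u v; have [] := svalP (cid (H l u v)).
Qed.

Lemma cone1_d l l' u : cone1 l' (sdiff free_cone x l l' u) = sdiff E x l l' (cone1 l u).
Proof. exact: (smap_chain cone_fst). Qed.

Lemma cone2E l (U : opens X) (Ux : oset U x) (s : free_cone l U) : cone2 l (mgerm Ux s) = map_mx (germ Ux) s.2.
Proof.
transitivity (germ_row (smap x (prod_snd (E l) (free_sheaf O (rk l + rk (l + 1)))) (mgerm Ux s))) => //.
by rewrite smapE germ_rowE.
Qed.

Lemma cone2_d l u : cone2 (l + 1) (sdiff free_cone x l (l + 1) u) = row_mx (rsubmx (cone2 l u)) 0.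
Proof.
have [U [Ux [s ->]]] := mgerm_surj u; rewrite /sdiff smapE !cone2E /=.
rewrite /free_mor_fun /cone_mx eqxx scale1r.
rewrite -[X in map_mx _ (X *m _)]hsubmxK map_col_mx map_mx0 mul_row_col mulmx0 add0r.
rewrite map_row_mx map_pid_mx map_mx0 mul_mx_row mulmx0 pid_mx_1 mulmx1 map_row_mx map_mx0.
by rewrite map_rsubmx.
Qed.

Lemma cone_cycle l z : sdiff E x l (l + 1) z = 0 -> exists u, sdiff free_cone x l (l + 1) u = 0 /\ cone1 l u = z.
Proof.
have [mk [mk1 mk2]] := cone_mk => dz; exists (mk l z 0); split=> //.
apply: cone_inj; first by rewrite cone1_d mk1 dz raddf0.
by rewrite cone2_d mk2 !raddf0 row_mx0.
Qed.

End FreeCone.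

Section PointSheafValues.
Variables (k : closedFieldType) (Y : scheme).
Local Notation O := (structure_sheaf Y).
Variable phi : {rmorphism k -> O (oT Y)}.
Implicit Types U V W : opens Y.
Variables (y : Y) (ev : {rmorphism stalk O y -> k}).
Hypothesis evK : forall c, ev (kstalk phi y c) = c.
Hypothesis ev_unit : forall u, ev u != 0 <-> is_unit u.
Local Notation sky := (skyscraper y).

Lemma class_res U V (h : V `<=` U) (z : O U) (T : sky U) : is_class (F := regular_sheaf O) z T ->
  is_class (F := regular_sheaf O) (rres O h z) (mres sky h T).
Proof.
move=> zT; apply: qresE => //; exact: (@lifts_res _ _ (regular_sheaf O) _ _ _ T _ _ h z zT).
Qed.

Lemma class_lin U a (z z' : O U) (T T' : sky U) : is_class (F := regular_sheaf O) z T ->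
  is_class (F := regular_sheaf O) z' T' -> is_class (F := regular_sheaf O) (a * z + z') (a *: T + T').
Proof.
move=> zT zT'; have hU : U `<=` U by [].
have := qaddE (qscaleE a hU zT) zT'; rewrite rres_id; exact.
Qed.

Definition val_rel (p : mstalk sky y) (c : k) := exists U (Uy : oset U y) (T : sky U) z,
  [/\ p = mgerm Uy T, is_class (F := regular_sheaf O) z T & c = ev (germ Uy z)].

(** The value map identifies the stalk with the residue field [k]; by the last clause a section is
    zero as soon as its value at [y] is, so morphisms to the skyscraper are built and compared
    through values. *)
Lemma sky_val : exists val : mstalk sky y -> k,
  [/\ forall a p q, val (a *: p + q) = ev a * val p + val q,
      forall U (Uy : oset U y) (T : sky U) z, is_class (F := regular_sheaf O) z T -> val (mgerm Uy T) = ev (germ Uy z) &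
      forall U (T : sky U), (forall Uy : oset U y, val (mgerm Uy T) = 0) -> T = 0].
Proof.
have evn u : nonunits u -> ev u = 0 by move=> nu; apply/eqP/negPn/negP => /ev_unit.
have [p|a p q c c' [U [Uy [T [z [-> zT ->]]]]] [U' [Uy' [T' [z' [-> zT' ->]]]]]|c [U [Uy [T [z [e zT ->]]]]]|val [valE vallin]] :=
  @semilinear_of_relation _ _ ev _ val_rel.
- have [U [Uy [T ->]]] := mgerm_surj p.
  have [V [h [z [Vy zT]]]] := locally_is_class T Uy.
  exists (ev (germ Vy z)), V, Vy, (mres sky h T), z; split=> //; by rewrite mgerm_res.
- have [W [Wy [a' ->]]] := germ_surj a.
  pose W' := oI W (oI U U'); have W'y : oset W' y by [].
  have hU : W' `<=` U by move=> ? [_ []]. have hU' : W' `<=` U' by move=> ? [_ []].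
  have hW : W' `<=` W by move=> ? [].
  exists W', W'y, (rres O hW a' *: mres sky hU T + mres sky hU' T'), (rres O hW a' * rres O hU z + rres O hU' z').
  split; last by rewrite germD germM !germ_res rmorphD rmorphM.
    by rewrite mgermD mgermZ !mgerm_res germ_res.
  by apply: class_lin; exact: class_res.
- have [V [h [Vy e0]]] := mgerm_eq0 (esym e).
  have /(is_class_eq0 (class_res h zT)) H := e0.
  by apply: evn; have := H Vy; rewrite /point_ideal /= (germ_res Uy).
have vE U (Uy : oset U y) (T : sky U) z : is_class (F := regular_sheaf O) z T -> val (mgerm Uy T) = ev (germ Uy z).
  by move=> zT; apply: valE; exists U, Uy, T, z.
exists val; split=> // U T H; apply: mgerm_eq => x Ux; rewrite mgerm0.
have [V [h [z [Vx zT]]]] := locally_is_class T Ux.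
rewrite -(mgerm_res Ux Vx h).
have -> : mres sky h T = 0; last by rewrite mgerm0.
apply/(is_class_eq0 zT) => Vy; rewrite /point_ideal /= => /ev_unit; apply/negP; rewrite negbK.
by rewrite -(vE V Vy _ z zT) (mgerm_res (h _ Vy)) H.
Qed.

Variables (val : mstalk sky y -> k).
Hypothesis val_lin : forall a p q, val (a *: p + q) = ev a * val p + val q.
Hypothesis valE : forall U (Uy : oset U y) (T : sky U) z, is_class (F := regular_sheaf O) z T -> val (mgerm Uy T) = ev (germ Uy z).
Hypothesis val_eq0 : forall U (T : sky U), (forall Uy : oset U y, val (mgerm Uy T) = 0) -> T = 0.

Lemma val0 : val 0 = 0.
Proof. by have := val_lin (-1) 0 0; rewrite scaler0 addr0 rmorphN rmorph1 mulN1r addNr. Qed.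

Lemma val_eq U (T T' : sky U) : (forall Uy : oset U y, val (mgerm Uy T) = val (mgerm Uy T')) -> T = T'.
Proof.
move=> H; apply/eqP; rewrite -subr_eq0; apply/eqP/val_eq0 => Uy.
by rewrite mgermB -scaleN1r addrC val_lin H rmorphN rmorph1 mulN1r addNr.
Qed.

Lemma sky_section U (c : k) : exists T : sky U, forall Uy : oset U y, val (mgerm Uy T) = c.
Proof.
have [T [zT _]] := is_class_exists (Z := whole_subsheaf (regular_sheaf O))
  (point_ideal_sheaf (@scheme_local Y y)) (z := kres phi U c) I.
by exists T => Uy; rewrite (valE Uy zT) germ_kres evK.
Qed.

(** Off [y] the target has only zero sections, so the functional on the stalk at [y] already
    prescribes the morphism. *)
Lemma point_functional (F : mod_sheaf O) (N : set (mstalk F y)) (sN : is_submod N) (chi : mstalk F y -> k) :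
  (forall a u v, N u -> N v -> chi (a *: u + v) = ev a * chi u + chi v) ->
  exists f : mor (sub_sheaf (point_subsheaf sN)) sky,
    forall p, val (smap y f p) = chi (smap y (sub_inc (point_subsheaf sN)) p).
Proof.
move=> chi_lin.
have H U (s : sub_sheaf (point_subsheaf sN) U) : exists T : sky U,
    forall Uy : oset U y, val (mgerm Uy T) = chi (mgerm Uy (ssv s)).
  have [Uy|nU] := pselect (oset U y); last by exists 0.
  have [T TP] := sky_section U (chi (mgerm Uy (ssv s))); exists T => Uy'.
  by rewrite TP (Prop_irrelevance Uy' Uy).
pose f U s := sval (cid (H U s)).
have fP U s (Uy : oset U y) : val (mgerm Uy (f U s)) = chi (mgerm Uy (ssv s)) by exact: (svalP (cid (H U s))).
have flin U : linear (f U).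
  move=> a s t; apply: val_eq => Uy; rewrite fP.
  transitivity (ev (germ Uy a) * val (mgerm Uy (f U s)) + val (mgerm Uy (f U t))); last first.
    by rewrite mgermD mgermZ val_lin.
  rewrite !fP -chi_lin; [by rewrite -mgermZ -mgermD|exact: (ssvP s)|exact: (ssvP t)].
pose fl U : {linear sub_sheaf (point_subsheaf sN) U -> sky U} :=
  HB.pack (f U) (GRing.isLinear.Build _ _ _ _ (f U) (flin U)).
have fres U V (h : V `<=` U) s : fl V (mres (sub_sheaf (point_subsheaf sN)) h s) = mres sky h (fl U s).
  apply: val_eq => Vy; rewrite (mgerm_res (h _ Vy)) /= !fP; congr chi.
  by rewrite ssv_res (mgerm_res (h _ Vy)).
exists (Mor fres) => p; have [U [Uy [s ->]]] := mgerm_surj p.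
by rewrite !smapE /= fP.
Qed.

End PointSheafValues.

(** * A nonzero rank gives a nonzero morphism to a shifted skyscraper *)

Section HomVanishing.
Variables (k : closedFieldType) (Y : scheme).
Local Notation O := (structure_sheaf Y).
Variable phi : {rmorphism k -> O (oT Y)}.
Hypothesis Yft : finite_type phi.
Variable E : complex O.
Hypothesis Eb : bounded E.
Hypothesis cE : forall n, coherent (E n).
Variable y : Y.
Hypothesis cy : closed [set y].
Local Notation sky := (skyscraper y).
Implicit Types U V W : opens Y.

Lemma cone_stalk_noetherian rk x l : noetherian_mod (mstalk (free_cone E rk l) x).
Proof. exact: (coherent_noetherian Yft (prod_coherent (cE l) (free_coherent Yft _))). Qed.

Section Apex.
Variables (rk : int -> nat) (W : forall l, set (mstalk (free_cone E rk l) y)).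
Hypothesis sW : forall l, is_submod (@W l).
Hypothesis Wd : forall l l' u, l' = l + 1 -> @W l u -> @W l' (sdiff (free_cone E rk) y l l' u).
Hypothesis Winj : forall l l' u w, l = l' + 1 -> @W l u -> sdiff (free_cone E rk) y l (l + 1) u = 0 ->
  cone1 E rk y l u = sdiff E y l' l w -> exists w', @W l' w' /\ u = sdiff (free_cone E rk) y l' l w'.
Hypothesis Wsurj : forall l z, sdiff E y l (l + 1) z = 0 -> exists u l' w,
  [/\ @W l u, sdiff (free_cone E rk) y l (l + 1) u = 0, l = l' + 1 & z = cone1 E rk y l u + sdiff E y l' l w].

Definition apex_sub l := point_subsheaf (sW l).

Lemma apex_sub_d l m U s : apex_sub l U s -> apex_sub m U (diff (free_cone E rk) l m U s).
Proof.
move=> Bs; have [ml|ml] := eqVneq m (l + 1); last first.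
  by rewrite diff_shape; [exact: ssec0|exact/eqP].
move=> Uy; rewrite -(smapE (diff (free_cone E rk) l m)); apply: Wd => //; exact: Bs.
Qed.

Definition apex_complex := subcomplex apex_sub_d.
Definition apex_denom := chain_comp (cone_fst E rk) (subcomplex_inc apex_sub_d).

Lemma apex_denomE x l p : smap x (apex_denom l) p = cone1 E rk x l (smap x (sub_inc (apex_sub l)) p).
Proof. exact: smap_comp. Qed.

(** At [y] this is [Winj] and [Wsurj]. At any other point the subsheaf has the full stalk, and the
    free summand is contractible. *)
Lemma apex_quasi_iso : quasi_iso apex_denom.
Proof.
apply: stalk_quasi_iso => x n; split.
  move=> z dz [w ew]; rewrite apex_denomE in ew.
  set u := smap x (sub_inc (apex_sub n)) z in ew.
  have du : sdiff (free_cone E rk) x n (n + 1) u = 0.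
    by rewrite -(sdiff_inc (Bd := apex_sub_d)) dz raddf0.
  suff [w' ew'] : exists w', u = sdiff (free_cone E rk) x (n - 1) n (smap x (sub_inc (apex_sub (n - 1))) w').
    by exists w'; apply: (@sub_stalk_inj _ _ _ (apex_sub n)); rewrite (sdiff_inc (Bd := apex_sub_d)).
  have nn : n = n - 1 + 1 by rewrite subrK.
  have [xy|xy] := pselect (x = y).
    subst x; have [|w' [Ww' ->]] := Winj nn _ du ew; first exact: point_stalk.
    by have [w'' <-] := point_stalk_lift (sW (n - 1)) Ww'; exists w''.
  have [mk [mk1 mk2]] := cone_mk E rk x.
  have [e [-> _]] := cone_boundary mk1 mk2 (@cone_inj _ _ E rk x) (cone1_d (E := E) (rk := rk) (x := x))
    (cone2_d (E := E) (rk := rk) (x := x)) nn du ew.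
  by have [w' <-] := off_stalk_lift (sW (n - 1)) cy e xy; exists w'.
move=> z dz.
suff [u [w [du ez]]] : exists u w, sdiff (free_cone E rk) x n (n + 1) (smap x (sub_inc (apex_sub n)) u) = 0 /\
    z = cone1 E rk x n (smap x (sub_inc (apex_sub n)) u) + sdiff E x (n - 1) n w.
  exists u, w; split; last by rewrite apex_denomE.
  by apply: (@sub_stalk_inj _ _ _ (apex_sub (n + 1))); rewrite (sdiff_inc (Bd := apex_sub_d)) du raddf0.
have [xy|xy] := pselect (x = y).
  subst x; have [u [l' [w [Wu du nl ez]]]] := Wsurj dz.
  have e : l' = n - 1 by rewrite nl addrK.
  subst l'; have [u' eu] := point_stalk_lift (sW n) Wu.
  by exists u', w; rewrite /apex_sub eu.
have [u [du eu]] := cone_cycle rk dz.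
have [u' eu'] := off_stalk_lift (sW n) cy u xy.
by exists u', 0; rewrite /apex_sub eu' eu raddf0 addr0.
Qed.

Variables (ev : {rmorphism stalk O y -> k}) (val : mstalk sky y -> k).
Hypothesis val_lin : forall a p q, val (a *: p + q) = ev a * val p + val q.
Hypothesis val_eq0 : forall U (T : sky U), (forall Uy : oset U y, val (mgerm Uy T) = 0) -> T = 0.
Variable f : forall l, mor (apex_complex l) sky.
Hypothesis f_d : forall l m p, val (smap y (f m) (sdiff apex_complex y l m p)) = 0.

(** Defined by cases on the target degree [e], so that the term of [in_degree_0] in that degree
    reduces. *)
Definition apex_numer_at l (e : int) : mor (apex_complex l) (in_degree_0 sky e) :=
  match e as e return mor (apex_complex l) (in_degree_0 sky e) with
  | Posz 0 => f l | _ => mor_zero _ _ end.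

Lemma apex_numer_d l m e U s : apex_numer_at m e U (diff apex_complex l m U s) = 0.
Proof.
case: e => [[|?]|?] //=; apply: val_eq0 => Uy.
by rewrite -(smapE (f m)) -(smapE (diff apex_complex l m)); exact: f_d.
Qed.

Program Definition apex_numer (i : int) : chain_map apex_complex (shift (in_degree_0 sky) i) :=
  @ChainMap _ _ apex_complex (shift (in_degree_0 sky) i) (fun l => apex_numer_at l (l + i)) _.
Next Obligation.
by move=> i l m U s; rewrite [RHS]/= scaler0; exact: apex_numer_d.
Qed.

Definition val_at (e : int) : mstalk (in_degree_0 sky e) y -> k :=
  match e as e return mstalk (in_degree_0 sky e) y -> k with Posz 0 => val | _ => fun=> 0 end.

Lemma val_at_lin e a p q : @val_at e (a *: p + q) = ev a * val_at p + val_at q.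
Proof. by case: e p q => [[|?]|?] p q /=; rewrite ?val_lin ?mulr0 ?addr0. Qed.

Lemma val_at_numer l e p : e = 0 -> val_at (smap y (apex_numer_at l e) p) = val (smap y (f l) p).
Proof. by move=> ->. Qed.

End Apex.

(** For [r0 > 0] the first minimal generator defines a functional and hence a fraction to the
    skyscraper in degree [n]. If the fraction were zero, its numerator would become nullhomotopic
    after a quasi-isomorphism, which [local_apex] excludes. *)
Lemma hom_vanishing_rank n rk D p r0 D0 p0 b0 :
  D_hom_zero E (shift (in_degree_0 sky) (- n)) ->
  resolved (@nonunits (stalk O y)) (sdiff E y) (n + 1) rk D p ->
  (forall l, (b0 <= l)%R || (l <= n)%R -> rk l = 0%N) ->
  res_at (@nonunits (stalk O y)) (sdiff E y) r0 (rk (n + 1)) (rk (n + 1 + 1)) D0 (D (n + 1)) p0 (p (n + 1)) ->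
  r0 = 0%N.
Proof.
move=> hom0 res rk0 resn; apply/eqP; rewrite -leqn0 leqNgt; apply/negP => r0_gt.
have loc := @scheme_local Y y.
have [V [gV Vy]] := affine_ft_exists Yft y.
have [q [g [gy _ goff]]] := closed_point_generators Yft Vy gV cy.
have [ev [evK ev_unit]] := stalk_ev Yft cy.
have evn u : nonunits u -> ev u = 0 by move=> nu; apply/eqP/negPn/negP => /ev_unit.
have [mk [mk1 mk2]] := cone_mk E rk y.
have g1 : gpow (fun i => germ Vy (g i)) 1 `<=` (@nonunits (stalk O y)).
  move=> u [a _ ->]; apply: (ideal_sum _ loc) => i _; apply: (ideal_mulr _ loc); exact: gy.
have rk0' l : (b0 <= l)%R -> rk l = 0%N by move=> bl; apply: rk0; rewrite bl.
have [W [t [chi [[sW tW] Wd [Winj Wsurj] [chi_lin chi_d] fin]]]] :=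
  local_apex (Ordinal r0_gt) g1 res resn rk0' (@sdiff_diff _ _ (free_cone E rk) y)
    (fun l => @cone_stalk_noetherian rk y l) mk1 mk2 (@cone_inj _ _ E rk y)
    (cone1_d (E := E) (rk := rk) (x := y)) (cone2_d (E := E) (rk := rk) (x := y)) evn.
pose Wc := apex_complex sW Wd.
have [val [val_lin valE val_eq0]] := sky_val ev_unit.
(* [chi] lives in degree [n]; it is extended by zero to a family over all degrees. *)
pose chiF := dfwith (fun m (_ : mstalk (free_cone E rk m) y) => 0 : k) chi.
have chiFn : chiF n = chi by exact: dfwith_in.
have chiFm m : m != n -> chiF m = (fun=> 0) by move=> mn; rewrite /chiF dfwith_out // eq_sym.
have chiF_lin l a u v : W l u -> W l v -> chiF l (a *: u + v) = ev a * chiF l u + chiF l v.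
  have [ln|ln] := eqVneq l n; first by subst l; rewrite chiFn; exact: chi_lin.
  by rewrite chiFm // mulr0 addr0.
have H l := point_functional evK val_lin valE val_eq0 (sW l) (chiF_lin l).
pose f l := sval (cid (H l)).
have fP l p1 : val (smap y (f l) p1) = chiF l (smap y (sub_inc (point_subsheaf (sW l))) p1) by exact: (svalP (cid (H l))).
have f_d l m p1 : val (smap y (f m) (sdiff Wc y l m p1)) = 0.
  rewrite fP (sdiff_inc (Bd := @apex_sub_d _ _ sW Wd)).
  have [mn|mn] := eqVneq m n; last by rewrite chiFm.
  have [ml|ml] := eqVneq m (l + 1).
    by subst m; rewrite chiFn; exact: chi_d.
  rewrite sdiff_shape; last exact/eqP.
  have := chiF_lin m (-1) 0 0 (smod0 (sW m)) (smod0 (sW m)).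
  by rewrite scaler0 addr0 rmorphN rmorph1 mulN1r addNr.
pose r := Fraction (apex_denom sW Wd) (apex_numer val_eq0 f_d (- n)).
have rD : D_morphism r.
  split; last exact: apex_quasi_iso.
  split=> [|l].
    apply: subcomplex_bounded; apply: (@cone_bounded _ _ E rk (n - 1) b0) => //.
    by move=> l Hl; split; apply: rk0; lia.
  apply: (point_subsheaf_coherent Yft (sW l) (t := t l) cy gy goff) => //.
  exact: (prod_coherent (cE l) (free_coherent Yft _)).
have [V' [a [b [V'O aq _ [h hP]]]]] := hom0 r rD.
have qs := quasi_iso_stalk y aq.
pose al l : {linear mstalk (V' l) y -> mstalk (free_cone E rk l) y} :=
  smap y (sub_inc (apex_sub sW l)) \o smap y (a l).
have alE l p1 : cone1 E rk y l (al l p1) = smap y (chain_comp (apex_denom sW Wd) a l) p1.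
  rewrite [RHS]smap_comp; symmetry; exact: apex_denomE.
have [hh hhE] : exists hh : mor (V' (n + 1)) (in_degree_0 sky (n - n)), hh = h (n + 1) n.
  by exists (h (n + 1) n).
have e01 : (0 : k) <> 1 by move=> /eqP; rewrite eq_sym oner_eq0.
apply: e01; apply: (fin (fun l => mstalk (V' l) y) (sdiff V' y) al _ _ _ _
  (fun v => val_at val (smap y hh v))).
- move=> l v; exact: point_stalk.
- move=> l l' v.
  transitivity (smap y (sub_inc (apex_sub sW l')) (smap y (a l') (sdiff V' y l l' v))) => //.
  by rewrite (smap_chain a); exact: (sdiff_inc (Bd := @apex_sub_d _ _ sW Wd)).
- move=> l v dv [w ew]; have [q1 _] := qs (l + 1); rewrite addrK in q1.
  by apply: q1 => //; exists w; rewrite -alE.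
- move=> l z dz; have [_ q2] := qs l; have [z' [w [dz' ez]]] := q2 z dz.
  by exists z', (l - 1), w; rewrite subrK alE.
- by move=> c u v; rewrite linearP (val_at_lin val_lin).
move=> v; have [U [Uy [s ->]]] := mgerm_surj v.
transitivity (val_at val (smap y (apex_numer_at f n (n - n)) (smap y (a n) (mgerm Uy s)))).
  by rewrite val_at_numer ?subrr // fP chiFn.
(* The target complex has zero differential, so of the homotopy only the term that passes through
   the differential of [V'] remains. *)
have e : apex_numer_at f n (n - n) U (a n U s) =
    hh U (diff V' n (n + 1) U s).
  by rewrite hhE; have := hP n U s; rewrite /= scaler0 add0r subr0.
have -> : sdiff V' y n (n + 1) (mgerm Uy s) = mgerm Uy (diff V' n (n + 1) U s) by rewrite /sdiff smapE.
by rewrite (smapE (a n)) (smapE (apex_numer_at f n (n - n))) e (smapE hh).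
Qed.

End HomVanishing.

(** * Regularity of the local ring *)

Section RegularityCriterion.
Variables (k : closedFieldType) (A : comNzRingType) (iota : {rmorphism k -> A}).
Variables (R : comPzRingType) (phi : {rmorphism A -> R}) (ev : {rmorphism R -> k}).
Hypothesis evK : forall c, ev (phi (iota c)) = c.
Hypothesis loc : forall u, exists w a, ev (phi w) != 0 /\ phi w * u = phi a.
Hypothesis ev_unit : forall u, ev u != 0 -> is_unit u.
Hypothesis ker : forall a, phi a = 0 -> exists w, ev (phi w) != 0 /\ w * a = 0.
Hypothesis fgA : finitely_generated_over iota.
Hypothesis nR : noetherian R.
Hypothesis not_nilpotent : forall c : A, (forall N, c ^+ N <> 0) -> forall M, phi c ^+ M <> 0.
Variable d : nat.
Hypothesis box : exists s0 (s : 'I_d -> A), forall D (c : {ffun 'I_d -> 'I_D} -> k),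
  \sum_al iota (c al) * (s0 ^+ (d * D - \sum_i al i) * \prod_i s i ^+ al i) = 0 ->
  forall al, c al = 0.

Local Notation kap := (phi \o iota).
Definition evker : set R := [set u | ev u = 0].

Lemma evker_ideal : is_ideal evker.
Proof.
split=> [|a b ea eb|a b eb]; first exact: rmorph0.
  by rewrite /evker /= rmorphD ea eb addr0.
by rewrite /evker /= rmorphM eb mulr0.
Qed.

Lemma evker_unit a : evker a -> is_unit (1 - a).
Proof. by move=> ea; apply: ev_unit; rewrite rmorphB rmorph1 ea subr0 oner_neq0. Qed.

(** The kernel of [phi] is finitely generated, and a product of elements annihilating its generators
    is still invertible at the point. *)
Lemma common_annihilator : exists f0, ev (phi f0) != 0 /\ forall a, phi a = 0 -> f0 * a = 0.
Proof.
have [s [g gen]] := fgA.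
have nA : noetherian A := fg_noetherian gen.
have [|n [a aP]] := nA [set a | phi a = 0].
  split=> [|a b ea eb|a b eb]; first exact: rmorph0.
    by rewrite /= rmorphD ea eb addr0.
  by rewrite /= rmorphM eb mulr0.
have /choice[w wP] i : exists w, ev (phi w) != 0 /\ w * a i = 0.
  apply: ker; have : [set a | phi a = 0] (a i) by rewrite aP; exact: generated_by_gen.
  by [].
exists (\prod_i w i); split.
  rewrite !rmorph_prod; apply/prodf_neq0 => i _; by have [] := wP i.
move=> b eb; have : [set a | phi a = 0] b by [].
rewrite aP => -[c ->]; rewrite mulr_sumr; apply: big1 => i _.
rewrite (bigD1 i) //=; set P := \prod_(_ | _) _.
have -> : w i * P * (c i * a i) = P * c i * (w i * a i) by ring.
by rewrite (wP i).2 mulr0.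
Qed.

(** What Noether normalization leaves in the local ring; it matters that [gam] comes before the
    exponent [e]. *)
Definition normalized r (x : 'I_r -> R) (gam : R) := [/\ (d <= r)%N, forall i, ev (x i) = 0,
  forall M, gam ^+ M <> 0 &
  forall e (j : 'I_r) (u : R) (v : 'I_r -> R),
    x j ^+ e * u = \sum_(l < r | (l < j)%N) x l ^+ e * v l ->
    exists w : 'I_r -> R, gam * u = \sum_(l < r | (l < j)%N) x l ^+ e * w l].

Variables (beta : nat -> nat) (Dl : forall i, 'M[R]_(beta i.+1, beta i)).
Hypothesis short : forall i, (d < i)%N -> beta i = 0%N.
Hypothesis dd : forall i, Dl i.+1 *m Dl i = 0.
Hypothesis Dl_min : forall i a b, ev (Dl i a b) = 0.
Hypothesis power : forall u, ev u = 0 -> exists N,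
  (forall v : 'rV_(beta 0), exists w, u ^+ N *: v = w *m Dl 0) /\
  forall i (v : 'rV_(beta i.+1)), v *m Dl i = 0 -> exists w, u ^+ N *: v = w *m Dl i.+1.
Variables (u0 : 'rV[R]_(beta 0)) (eps : 'cV[R]_(beta 0)).
Hypothesis u0_unimodular : u0 *m eps = 1%:M.
Hypothesis u0_torsion : forall a, ev a = 0 -> exists z, z *m Dl 0 = a *: u0.

Lemma nullhomotopic_family r (x : 'I_r -> R) : (forall i, ev (x i) = 0) -> exists N
  (H : 'I_r -> forall i, 'M[R]_(beta i, beta i.+1)), [/\ (0 < N)%N,
  forall j, H j 0%N *m Dl 0%N = (x j ^+ N)%:M &
  forall j i, H j i.+1 *m Dl i.+1 + Dl i *m H j i = (x j ^+ N)%:M].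
Proof.
move=> ex; have /choice[N NP] j := power (ex j).
pose N' := (\sum_j N j).+1.
have leN j : (N j <= N')%N by rewrite /N' leqW // (bigD1 j) //= leq_addr.
have H j : exists H : forall i, 'M[R]_(beta i, beta i.+1),
    H 0 *m Dl 0 = ((x j ^+ N') ^+ d.+1)%:M /\
    forall i, H i.+1 *m Dl i.+1 + Dl i *m H i = ((x j ^+ N') ^+ d.+1)%:M.
  have [N0 NS] := NP j; apply: nullhomotopic_power => // [v|i v dv].
    have [w e] := N0 v; exists (x j ^+ (N' - N j) *: w).
    by rewrite -scalemxAl -e scalerA -exprD subnK.
  have [w e] := NS i v dv; exists (x j ^+ (N' - N j) *: w).
  by rewrite -scalemxAl -e scalerA -exprD subnK.
exists (N' * d.+1)%N, (fun j => sval (cid (H j))); split=> // j.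
  by have [-> _] := svalP (cid (H j)); rewrite exprM.
by move=> i; have [_ ->] := svalP (cid (H j)); rewrite exprM.
Qed.

Lemma minimal_parameters : exists n (y : 'I_n -> R), [/\ forall i, ev (y i) = 0,
  forall u, ev u = 0 -> generated_by y u &
  forall c : 'I_n -> R, mulset evker (evker : set R^o) (\sum_i c i * y i) -> forall i, ev (c i) = 0].
Proof.
have mu a : ~ evker a -> is_unit a by move=> na; apply: ev_unit; apply/eqP.
have [||u ->|n [y [yX yG yM]]] := @minimal_generators R evker evker_ideal evker_unit mu R^o evker [set u | u = 0].
- by apply: (noetherian_regular nR); have [] := evker_ideal.
- split=> // [u v -> ->|a u ->]; [exact: addr0|exact: scaler0].
- exact: rmorph0.
exists n, y; split=> // [u /yG[c /= e]|c Hc i].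
  by exists c; apply/eqP; rewrite -subr_eq0; apply/eqP.
by apply: (yM c); exists (\sum_i c i * y i); split=> //=; rewrite subrr.
Qed.

(** If the [z_i] were dependent modulo the maximal ideal, a combination of the [y_i] with constant
    coefficients, not all zero, would lie in the square of that ideal, because [Dl 0] has entries in
    it; this contradicts the minimality of [y]. The matrix [rho] is a right inverse over [k] of the
    reduction of the [z_i]. *)
Lemma independent_lifts n (y : 'I_n -> R) : (forall i, ev (y i) = 0) ->
  (forall c : 'I_n -> R, mulset evker (evker : set R^o) (\sum_i c i * y i) -> forall i, ev (c i) = 0) ->
  exists (z : 'I_n -> 'rV[R]_(beta 1)) (rho : 'M[R]_(beta 1, n)),
  (forall i, z i *m Dl 0 = y i *: u0) /\ forall i j, ev ((z i *m rho) 0 j - (i == j)%:R) = 0.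
Proof.
move=> ey ymin; have /choice[z zP] i := u0_torsion (ey i).
pose Z : 'M[k]_(n, beta 1) := \matrix_(i, j) ev (z i 0 j).
have Zfree : row_free Z.
  apply/row_freeP; apply: contrapT => nZ.
  have [v [v0 vZ]] : exists v : 'rV[k]_n, v != 0 /\ v *m Z = 0.
    have : kermx Z != 0 by apply/negP => /eqP/eqP; rewrite kermx_eq0 => /row_freeP[B eB]; apply: nZ; exists B.
    move=> /rowV0Pn[v vk v0]; exists v; split=> //; exact/sub_kermxP.
  have c0 : forall i, ev (phi (iota (v 0 i))) = 0.
    apply: ymin.
    have -> : \sum_i phi (iota (v 0 i)) * y i = ((\sum_i phi (iota (v 0 i)) *: z i) *m Dl 0 *m eps) 0 0.
      rewrite mulmx_suml (eq_bigr (fun i => (phi (iota (v 0 i)) * y i) *: u0)); last first.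
        by move=> i _; rewrite -scalemxAl zP scalerA.
      by rewrite -scaler_suml -scalemxAl u0_unimodular !mxE mulr1.
    set s := \sum_i _; have es j : ev (s 0 j) = 0.
      rewrite /s summxE rmorph_sum.
      have e := congr1 (fun w : 'rV_(beta 1) => w 0 j) vZ; rewrite !mxE in e; rewrite -[RHS]e.
      by apply: eq_bigr => i _; rewrite !mxE rmorphM evK.
    rewrite -mulmxA mxE; apply: (smod_sum _ (mulset_submod _ _)) => j _.
    apply: (@mulset_in _ R^o) => //; rewrite /evker /= mxE rmorph_sum; apply: big1 => i _.
    by rewrite rmorphM Dl_min mul0r.
  by case/eqP: v0; apply/rowP => i; rewrite mxE -[LHS]evK c0.
have /row_freeP[B ZB] := Zfree.
exists z, (map_mx (phi \o iota) B); split=> // i j.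
rewrite rmorphB rmorph_nat !mxE rmorph_sum.
have := congr1 (fun W : 'M_n => W i j) ZB; rewrite !mxE => <-.
apply/eqP; rewrite subr_eq0; apply/eqP; apply: eq_bigr => l _.
by rewrite !mxE rmorphM /= evK.
Qed.

Lemma krull_separated n (y : 'I_n -> R) g : (forall i, ev (y i) = 0) -> g <> 0 -> exists s, ~ gpow y s g.
Proof.
move=> ey g0; apply: contrapT => H; apply: g0; apply: (@krull_intersection _ n y) => // [a [c ->]|s].
  apply: evker_unit; rewrite /evker /= rmorph_sum; apply: big1 => i _.
  by rewrite rmorphM ey mulr0.
by apply: contrapT => ng; apply: H; exists s.
Qed.

Lemma normalization_and_bound : (exists r x gam, @normalized r x gam) /\
  forall n (y : 'I_n -> R), (forall i, ev (y i) = 0) -> (forall u, ev u = 0 -> generated_by y u) ->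
  (forall c : 'I_n -> R, mulset evker (evker : set R^o) (\sum_i c i * y i) -> forall i, ev (c i) = 0) ->
  (n <= d)%N.
Proof.
have [s [g gen]] := fgA.
have [f0 [f0u f0k]] := common_annihilator.
have [r [x [x_indep x0 x_int]]] := centered_normalization (ev := ev \o phi) g evK.
have [T [b gen_b]] := finite_over_polynomials x_int gen.
have [G [c [c0 freeG crel]]] := generic_freeness iota x b.
have [s0 [s' box']] := box.
have dr : (d <= r)%N := transcendence_bound box' gen x_int.
have gam0 M : phi (mmap iota x c) ^+ M <> 0.
  apply: not_nilpotent => N; rewrite -rmorphXn => /x_indep /eqP; apply/negP.
  by rewrite expf_eq0 negb_and c0 orbT.
have evV u : ev u != 0 -> exists v, u * v = 1 by move=> /ev_unit.
split.
  exists r, (fun i => phi (x i)), (phi (mmap iota x c)); split=> // e j u v H.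
  have /choice[frel frelP] := crel.
  exact: (almost_regular_local loc evV f0u f0k gen_b freeG frelP H).
move=> n y ey ygen ymin.
have [N [H [_ H0 HS]]] := nullhomotopic_family (x := fun i => phi (x i)) x0.
have [z [rho [zP rhoP]]] := independent_lifts ey ymin.
apply: (embedding_dimension_bound evK loc evV f0u f0k x0 gen_b freeG crel ygen _ short dr dd
  _ H0 HS u0_unimodular zP).
- by move=> M; apply: krull_separated => //; exact: gam0.
- by move=> i a b'; apply: ygen; exact: Dl_min.
- by move=> i j; apply: ygen; exact: rhoP.
Qed.

Lemma regularity_criterion :
  [/\ exists P : 'I_d.+1 -> set R, prime_chain P,
      exists g : 'I_d -> R, evker = generated_by g &
      forall i (z : 'rV_(beta i.+1)), z *m Dl i = 0 -> exists w, z = w *m Dl i.+1].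
Proof.
have [n [y [ey ygen ymin]]] := minimal_parameters.
have [[r [x [gam [dr x0 gam0 ar]]]] /(_ n y ey ygen ymin) nd] := normalization_and_bound.
pose x' (j : nat) := if insub j is Some i then x i else 0 : R.
have x'E (i : 'I_r) : x' i = x i by rewrite /x' valK.
have AR e : almost_regular_on (fun j => x' j ^+ e) gam r R^o.
  move=> j u jr [v ev1].
  have sumE (F : nat -> R) : \sum_(l < j) x' l ^+ e * F l = \sum_(l < r | (l < j)%N) x l ^+ e * F l.
    rewrite (big_ord_widen r (fun l => x' l ^+ e * F l) (ltnW jr)).
    by apply: eq_bigr => l _; rewrite x'E.
  have [|w ew] := ar e (Ordinal jr) u (fun l => v l).
    by rewrite -x'E /=; have := ev1; rewrite -(sumE v).
  exists (fun l => if insub l is Some i then w i else 0).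
  rewrite [LHS]ew -[RHS]/(\sum_(l < j) x' l ^+ e * (fun l => if insub l is Some i then w i else 0) l).
  by rewrite sumE; apply: eq_bigr => l _; rewrite valK.
have nP (ws : seq R) : (size ws < d)%N -> (forall w, w \in ws -> ev w = 0) -> ~ primary y (ideal_seq ws).
  move=> sw; apply: (no_small_parameters ev_unit nR ey ygen (AR) _ gam0).
    by move=> j; rewrite /x'; case: insub => [i|]; rewrite ?x0 ?rmorph0.
  exact: leq_trans sw dr.
pose us := [seq y i | i <- enum 'I_n].
have us_m u : u \in us -> ev u = 0 by move=> /mapP[i _ ->].
have us_gen a : ev a = 0 -> ideal_seq us a.
  move=> /ygen[c ->]; apply: (ideal_sum _ (ideal_seq_ideal us)) => i _.
  apply: (ideal_mull _ (ideal_seq_ideal us)); apply: ideal_seq_mem.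
  by apply/mapP; exists i; rewrite ?mem_enum.
have sus : size us = n by rewrite size_map size_enum_ord.
have nd' : n = d.
  apply/eqP; rewrite eqn_leq nd /= leqNgt; apply/negP => lt_nd.
  apply: (nP us) => //; first by rewrite sus.
  exists 1%N => u [a _ ->]; apply: us_gen; rewrite rmorph_sum; apply: big1 => i _.
  by rewrite rmorphM ey mul0r.
have nP' (ws : seq R) : (size ws < size us)%N -> (forall w, w \in ws -> ev w = 0) -> ~ primary y (ideal_seq ws).
  by move=> sw; apply: nP; rewrite -nd' -sus.
have usd : size us = d by rewrite sus.
split.
- by have := parameters_chain (phi \o iota) ev_unit nR ey us_m us_gen nP'; rewrite usd.
- suff : exists g : 'I_n -> R, evker = generated_by g by rewrite nd'.
  exists y; apply/seteqP; split=> u; first exact: ygen.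
  by move=> [c ->]; rewrite /evker /= rmorph_sum; apply: big1 => i _; rewrite rmorphM ey mulr0.
move=> i z dz.
(* The generators of the maximal ideal now take the place of the coordinates [x], so that the
   acyclicity lemma applies with multiplier 1. *)
have [N [H [N0 H0 HS]]] := nullhomotopic_family (x := fun i : 'I_(size us) => us`_i)
  (fun i => us_m _ (mem_nth 0 (ltn_ord i))).
pose H' (j : nat) : forall i, 'M[R]_(beta i, beta i.+1) :=
  if insub j is Some i then H i else fun=> 0.
have H'E (j : 'I_(size us)) : H' j = H j by rewrite /H' valK.
have [||||w ew] := @free_complex_almost_exact R (fun j => us`_j ^+ N) 1 (size us) beta Dl H' _ _ dd _ d short _ i z dz.
- by move=> j jr; rewrite -[j]/(nat_of_ord (Ordinal jr)) H'E H0.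
- by move=> j jr i'; rewrite -[j]/(nat_of_ord (Ordinal jr)) H'E HS.
- exact: (parameters_regular (phi \o iota) ev_unit nR ey us_m us_gen nP' N0).
- by rewrite usd.
by exists w; rewrite -ew expr1n scale1r.
Qed.

End RegularityCriterion.

(** * Truncation and the main theorem *)

Section ClassMorphism.
Variables (X : topologicalType) (O : ring_sheaf X) (F : mod_sheaf O) (Z B : subsheaf F).
Implicit Types U V W : opens X.

Lemma class_linear U a (z z' : F U) (T T' : quotient_sheaf Z B U) :
  is_class z T -> is_class z' T' -> is_class (a *: z + z') (a *: T + T').
Proof.
move=> zT zT'; have hU : U `<=` U by [].
have := qaddE (qscaleE a hU zT) zT'; rewrite rres_id; exact.
Qed.

Lemma class_unique U (z : F U) (T T' : quotient_sheaf Z B U) : is_class z T -> is_class z T' -> T = T'.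
Proof.
move=> zT zT'; have [T0 [_ uniq]] := is_class_exists B (lifts_in zT).
by rewrite -(uniq T) // -(uniq T').
Qed.

Lemma class_restrict U V (h : V `<=` U) (z : F U) (T : quotient_sheaf Z B U) : is_class z T ->
  is_class (mres F h z) (mres (quotient_sheaf Z B) h T).
Proof. by move=> zT; apply: qresE => //; exact: lifts_res. Qed.

Definition class_fun U (s : sub_sheaf Z U) : quotient_sheaf Z B U :=
  sval (cid (is_class_exists B (ssvP s))).

Lemma class_funP U (s : sub_sheaf Z U) : is_class (ssv s) (class_fun s).
Proof. by have [] := svalP (cid (is_class_exists B (ssvP s))). Qed.

Lemma class_fun_linear U : linear (@class_fun U).
Proof.
move=> a s t; apply: (@class_unique U (ssv (a *: s + t))); first exact: class_funP.
by apply: class_linear; exact: class_funP.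
Qed.
HB.instance Definition _ U := GRing.isLinear.Build (O U) (sub_sheaf Z U) (quotient_sheaf Z B U) *:%R
  (@class_fun U) (@class_fun_linear U).

Program Definition class_mor : mor (sub_sheaf Z) (quotient_sheaf Z B) :=
  @Mor _ _ _ _ (fun U => @class_fun U : {linear _ -> _}) _.
Next Obligation.
move=> U V h s; apply: (@class_unique V (mres F h (ssv s))); first exact: class_funP.
by apply: class_restrict; exact: class_funP.
Qed.

Lemma class_mor_eq0 U (s : sub_sheaf Z U) : class_mor U s = 0 <-> B U (ssv s).
Proof. exact: (is_class_eq0 (class_funP s)). Qed.

Lemma class_mor_surj x (p : mstalk (quotient_sheaf Z B) x) : exists q, smap x class_mor q = p.
Proof.
have [U [Ux [T ->]]] := mgerm_surj p; have [V [h [z [Vx zT]]]] := locally_is_class T Ux.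
exists (@mgerm _ _ (sub_sheaf Z) x V Vx (SubSec (lifts_in zT))).
rewrite smapE -(mgerm_res Ux Vx h); congr (mgerm Vx _).
exact: (@class_unique V z _ _ (class_funP (SubSec (lifts_in zT))) zT).
Qed.

End ClassMorphism.

Section Truncation.
Variables (X : topologicalType) (O : ring_sheaf X).
Implicit Types U V W : opens X.

Program Definition zero_subsheaf (F : mod_sheaf O) : subsheaf F :=
  @Subsheaf X O F (fun U => [set s | s = 0]) _ _ _ _ _.
Next Obligation. by []. Qed.
Next Obligation. by move=> F U s t /= -> ->; rewrite addr0. Qed.
Next Obligation. by move=> F U a s /= ->; rewrite scaler0. Qed.
Next Obligation. by move=> F U V h s /= ->; rewrite raddf0. Qed.
Next Obligation.
move=> F U s H; apply: mgerm_eq => x Ux; have [V [h [Vx e]]] := H x Ux.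
by rewrite -(mgerm_res Ux Vx h) e !mgerm0.
Qed.

Variable E : complex O.

(** The good truncation in degrees at most 0, by cases on the constructors of [int] so that the
    types of terms reduce. *)
Definition trunc_sub (n : int) : subsheaf (E n) := match n with
  | Posz 0 => cycles E (Posz 0)
  | Posz n'.+1 => zero_subsheaf (E (Posz n'.+1))
  | Negz n' => whole_subsheaf (E (Negz n')) end.

Lemma trunc_sub_d n m U s : trunc_sub n U s -> trunc_sub m U (diff E n m U s).
Proof.
case: m => [[|m]|m] //=; first by move=> _; exact: diff_diff.
have [nm|nm] := eqVneq n (Posz m); last first.
  by move=> _; rewrite diff_shape //= => e; case/eqP: nm; lia.
subst n; case: m s => [|m] s /= => [e|->]; last by rewrite raddf0.
exact: e.
Qed.

Definition trunc := subcomplex trunc_sub_d.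
Definition trunc_inc : chain_map trunc E := subcomplex_inc trunc_sub_d.
Definition H0 := homology E 0.

Definition trunc_class_at (n : int) : mor (trunc n) (in_degree_0 H0 n) :=
  match n as n return mor (trunc n) (in_degree_0 H0 n) with
  | Posz 0 => class_mor (cycles E (Posz 0)) (boundaries E (Posz 0))
  | Posz n'.+1 => mor_zero _ _ | Negz n' => mor_zero _ _ end.

Program Definition trunc_class : chain_map trunc (in_degree_0 H0) :=
  @ChainMap _ _ trunc (in_degree_0 H0) trunc_class_at _.
Next Obligation.
move=> n m U s; case: m => [[|m]|m] //=.
apply/class_mor_eq0 => /=; have [nm|nm] := eqVneq n (0 - 1).
  subst n => x Ux; exists U, (@subset_refl _ _), (ssv s); split=> //; exact: mres_id.
rewrite diff_shape; first exact: (ssec0 (boundaries E (Posz 0)) U).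
by move=> e; case/eqP: nm; lia.
Qed.

Hypothesis cE : forall n, coherent (E n).
Hypothesis Eb : bounded E.

Lemma trunc_object : D_object trunc.
Proof.
split; first exact: subcomplex_bounded.
case=> [[|n]|n]; apply: sub_coherent => //.
- exact: (cycles_generated (cE (Posz 0)) (cE (Posz 0 + 1))).
- move=> x; exists (oT X), 0%N, (fun=> 0); split=> // V h t x' /= -> Vx'.
  by exists V, (@subset_refl _ _), h, (fun=> 0); rewrite big_ord0 raddf0.
- move=> x; have [gen _] := cE (Negz n); have [U [m [g [Ux gG]]]] := gen x.
  by exists U, m, g; split=> // V h t x' _; exact: gG.
Qed.

Lemma trunc_sub_neg n U s : (n < 0)%R -> trunc_sub n U s.
Proof. by case: n s => [[|n]|n]. Qed.

Lemma trunc_lift_neg n x u : (n < 0)%R -> exists p, smap x (sub_inc (trunc_sub n)) p = u.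
Proof.
by move=> n0; have [U [Ux [s ->]]] := mgerm_surj u; apply: sub_stalk_im; exact: trunc_sub_neg.
Qed.

Lemma trunc_pos0 n x (p : mstalk (trunc n) x) : (0 < n)%R -> p = 0.
Proof.
case: n p => [[|n]|n] // p _; have [U [Ux [[s /= s0] ->]]] := mgerm_surj p.
rewrite -(mgerm0 (trunc (Posz n.+1)) Ux); congr (mgerm Ux _); exact: subsec_eq.
Qed.

Lemma trunc_cycle0 x (u : mstalk (E 0) x) : sdiff E x 0 (0 + 1) u = 0 ->
  exists p, smap x (sub_inc (trunc_sub 0)) p = u.
Proof. by move=> /cycle_germ[U [Ux [s [Zs ->]]]]; exact: sub_stalk_im. Qed.

Hypothesis H_zero : forall x n, n <> 0 -> forall z : mstalk (E n) x, sdiff E x n (n + 1) z = 0 ->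
  exists w, z = sdiff E x (n - 1) n w.

Lemma trunc_boundary n x (z : mstalk (trunc n) x) w : (n <= 0)%R ->
  smap x (sub_inc (trunc_sub n)) z = sdiff E x (n - 1) n w -> exists w', z = sdiff trunc x (n - 1) n w'.
Proof.
move=> n0; have [|w' <-] := @trunc_lift_neg (n - 1) x w; first by lia.
rewrite -(sdiff_inc (Bd := trunc_sub_d)) => /sub_stalk_inj ->; by exists w'.
Qed.

Lemma trunc_cycle n x (z : mstalk (trunc n) x) : sdiff trunc x n (n + 1) z = 0 ->
  sdiff E x n (n + 1) (smap x (sub_inc (trunc_sub n)) z) = 0.
Proof. by move=> dz; rewrite -(sdiff_inc (Bd := trunc_sub_d)) dz raddf0. Qed.

Lemma trunc_inc_qis : quasi_iso trunc_inc.
Proof.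
apply: stalk_quasi_iso => x n; split.
  move=> z dz [w ew]; have [n0|n0] := leP n 0; first exact: trunc_boundary ew.
  by exists 0; rewrite raddf0; exact: trunc_pos0.
move=> z dz; have [n0|n0|n0] := ltgtP n 0.
- have [p ep] := trunc_lift_neg z n0; exists p, 0; rewrite raddf0 addr0; split=> //.
  apply: (@sub_stalk_inj _ _ _ (trunc_sub (n + 1))).
  by rewrite (sdiff_inc (Bd := trunc_sub_d)) ep dz raddf0.
- have [|w ew] := H_zero _ dz; first by move=> e; rewrite e in n0.
  by exists 0, w; rewrite !raddf0 add0r.
- subst n; have [p ep] := trunc_cycle0 dz; exists p, 0; rewrite raddf0 addr0; split=> //.
  apply: (@sub_stalk_inj _ _ _ (trunc_sub (0 + 1))).
  by rewrite (sdiff_inc (Bd := trunc_sub_d)) ep dz raddf0.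
Qed.

Lemma zero_stalk x (p : mstalk (zero_sheaf O) x) : p = 0.
Proof.
by have [U [Ux [s ->]]] := mgerm_surj p; rewrite (zero_sheafP s) mgerm0.
Qed.

Lemma trunc_class_qis : quasi_iso trunc_class.
Proof.
apply: stalk_quasi_iso => x n; split.
  move=> z dz [w]; rewrite /sdiff smap_zero => ew.
  have [n0|n0|n0] := ltgtP n 0.
  - have [|w' ew'] := H_zero _ (trunc_cycle dz); first by move=> e; rewrite e in n0.
    by apply: (trunc_boundary (ltW n0)) ew'.
  - by exists 0; rewrite raddf0; exact: trunc_pos0.
  - subst n; have [U [Ux [s es]]] := mgerm_surj z.
    move: ew; rewrite es (smapE (class_mor _ _)) => /mgerm_eq0[V [h [Vx]]].
    rewrite -mor_res => /class_mor_eq0 /(boundary_germ Vx)[w' ew'].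
    apply: (@trunc_boundary 0 x _ w') => //; rewrite smapE -ew' ssv_res mgerm_res //.
case: n => [[|n]|n] z dz.
- have [q eqz] := class_mor_surj z; exists q, 0; split; first exact: (@trunc_pos0 1).
  by rewrite [sdiff _ _ _ _ 0]raddf0 addr0 -eqz.
- by exists 0, 0; split; [rewrite raddf0|rewrite !raddf0 addr0; exact: zero_stalk].
- by exists 0, 0; split; [rewrite raddf0|rewrite !raddf0 addr0; exact: zero_stalk].
Qed.

Lemma homotopic_eq (K L : complex O) (f g : chain_map K L) :
  (forall n U s, f n U s = g n U s) -> homotopic f g.
Proof.
move=> H; exists (fun n m => mor_zero _ _) => n U s.
by rewrite H subrr /= raddf0 addr0.
Qed.

Lemma quasi_iso_id (K : complex O) : quasi_iso (chain_id K).
Proof.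
move=> n; exists (mor_id _); split; first by [].
by exists (mor_id _).
Qed.

(** The roof through [trunc] and its reversal are inverse to each other; both composites are
    computed with [trunc] as common apex. *)
Lemma truncation_iso : D_isomorphic E (in_degree_0 H0).
Proof.
have qE := trunc_inc_qis; have qH := trunc_class_qis; have tO := trunc_object.
exists (Fraction trunc_inc trunc_class), (Fraction trunc_class trunc_inc); split=> //.
- exists trunc, (chain_id trunc), (chain_id trunc); split=> //; first exact: quasi_iso_id.
    exact: homotopic_eq.
  exists trunc, (chain_id trunc), trunc_inc; split=> //; exact: homotopic_eq.
- exists trunc, (chain_id trunc), (chain_id trunc); split=> //; first exact: quasi_iso_id.
    exact: homotopic_eq.
  exists trunc, (chain_id trunc), trunc_class; split=> //; exact: homotopic_eq.
Qed.

End Truncation.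

Lemma class_stalk_eq0 (X : topologicalType) (O : ring_sheaf X) (E : complex O) n x
    (q : mstalk (sub_sheaf (cycles E n)) x) :
  smap x (class_mor (cycles E n) (boundaries E n)) q = 0 <->
  exists w, smap x (sub_inc (cycles E n)) q = sdiff E x (n - 1) n w.
Proof.
have [U [Ux [s ->]]] := mgerm_surj q; rewrite !smapE; split.
  move=> /mgerm_eq0[V [h [Vx]]]; rewrite -mor_res => /class_mor_eq0 /(boundary_germ Vx)[w ew].
  by exists w; rewrite -ew ssv_res (mgerm_res Ux).
move=> [w /germ_boundary[V [h [Vx Bs]]]].
rewrite -(mgerm_res Ux Vx h) -mor_res.
have -> : class_mor (cycles E n) (boundaries E n) V (mres _ h s) = 0 by apply/class_mor_eq0.
exact: mgerm0.
Qed.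

(** Consecutive degrees are linked by equations rather than by the form of the terms, so that they
    can be instantiated with negated naturals without transport. *)
Lemma resolved_steps (R : comPzRingType) (m : set R) (M : int -> lmodType R)
    (d : forall n m, {linear M n -> M m}) (n : int) rk D (p : forall l, nat -> M l) :
  resolved m d n rk D p -> forall l l1 l2 : int, (n <= l)%R -> l1 = l + 1 -> l2 = l1 + 1 ->
  [/\ forall c : 'rV[R]_(rk l), c *m rmx (D l) (rk l) (rk l1) *m rmx (D l1) (rk l1) (rk l2) = 0,
      forall c : 'rV[R]_(rk l), rlin (p l1) (c *m rmx (D l) (rk l) (rk l1)) = d l l1 (rlin (p l) c),
      forall (u : M l) (v : 'rV[R]_(rk l1)), v *m rmx (D l1) (rk l1) (rk l2) = 0 ->
        rlin (p l1) v = d l l1 u -> exists c, v = c *m rmx (D l) (rk l) (rk l1) /\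
        exists l' w, l = l' + 1 /\ u = rlin (p l) c + d l' l w &
      forall (a : 'I_(rk l)) (b : 'I_(rk l1)), m (D l a b)].
Proof.
move=> res l l1 l2 nl e1 e2; subst l2 l1.
have [H1 H2 H3 _] := res_comb (res l nl).
have nl1 : (n <= l + 1)%R by rewrite (le_trans nl) // lerDl.
have [_ _ _ H4] := res_comb (res _ nl1).
split=> // [u v v0 vu|a b]; first by exact: (H3 (u, v)).
(* The row of a basis element has the boundary [d (p a)] as its image, so minimality one degree
   higher puts its entries into [m]. *)
have -> : D l a b = ((delta_mx 0 a : 'rV_(rk l)) *m rmx (D l) (rk l) (rk (l + 1))) 0 b by rewrite -rowE !mxE.
apply: H4; exists 0, l, (rlin (p l) (delta_mx 0 a : 'rV_(rk l))); split=> //.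
- exact: (smod0 (mulset_submod _ _)).
- by rewrite H2 add0r.
Qed.

Lemma regularity_criterion_pz (k : closedFieldType) (A : comPzRingType) (iota : {rmorphism k -> A})
    (R : comPzRingType) (phi : {rmorphism A -> R}) (ev : {rmorphism R -> k}) d beta
    (Dl : forall i, 'M[R]_(beta i.+1, beta i)) (u0 : 'rV[R]_(beta 0)) (eps : 'cV[R]_(beta 0)) :
  1 <> 0 :> A ->
  (forall c, ev (phi (iota c)) = c) ->
  (forall u, exists w a, ev (phi w) != 0 /\ phi w * u = phi a) ->
  (forall u, ev u != 0 -> is_unit u) ->
  (forall a, phi a = 0 -> exists w, ev (phi w) != 0 /\ w * a = 0) ->
  finitely_generated_over iota -> noetherian R ->
  (forall c : A, (forall N, c ^+ N <> 0) -> forall M, phi c ^+ M <> 0) ->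
  (exists s0 (s : 'I_d -> A), forall D (c : {ffun 'I_d -> 'I_D} -> k),
    \sum_al iota (c al) * (s0 ^+ (d * D - \sum_i al i) * \prod_i s i ^+ al i) = 0 ->
    forall al, c al = 0) ->
  (forall i, (d < i)%N -> beta i = 0%N) -> (forall i, Dl i.+1 *m Dl i = 0) ->
  (forall i a b, ev (Dl i a b) = 0) ->
  (forall u, ev u = 0 -> exists N, (forall v : 'rV_(beta 0), exists w, u ^+ N *: v = w *m Dl 0) /\
    forall i (v : 'rV_(beta i.+1)), v *m Dl i = 0 -> exists w, u ^+ N *: v = w *m Dl i.+1) ->
  u0 *m eps = 1%:M -> (forall a, ev a = 0 -> exists z, z *m Dl 0 = a *: u0) ->
  [/\ exists P : 'I_d.+1 -> set R, prime_chain P,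
      exists g : 'I_d -> R, [set u | ev u = 0] = generated_by g &
      forall i (z : 'rV_(beta i.+1)), z *m Dl i = 0 -> exists w, z = w *m Dl i.+1].
Proof.
move=> nz; have [A' eA] := comNzRing_exists nz; subst A => evK loc eu ker fg nR nn bx sh dd mi po un to.
exact: (regularity_criterion evK loc eu ker fg nR nn bx sh dd mi po un to).
Qed.

Section MainTheorem.
Variables (k : closedFieldType) (Y : scheme).
Local Notation O := (structure_sheaf Y).
Variables (phi : {rmorphism k -> O (oT Y)}) (d : nat) (E : complex O) (y0 : Y).
Hypothesis Yft : finite_type phi.
Hypothesis Yirr : irreducible_scheme Y.
Hypothesis Ydim : space_dim_eq Y d.
Hypothesis Eobj : D_object E.
Hypothesis cy0 : closed [set y0].
Hypothesis summand : direct_summand (skyscraper y0) (homology E 0).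
Hypothesis Hom_vanishing : forall (y : Y) (i : int), closed [set y] ->
  ~ (y = y0 /\ 0 <= i <= d%:Z) -> D_hom_zero E (shift (in_degree_0 (skyscraper y)) i).

(** The vanishing of ranks is proved while the complex is built: the rank chosen in degree [l] is
    tested against morphisms to the skyscraper shifted by [- l]. *)
Lemma resolution_at y (lo : int) : closed [set y] -> exists rk D p n,
  [/\ resolved (@nonunits (stalk O y)) (sdiff E y) n rk D p, (n <= lo)%R &
      forall l : int, ~ (y = y0 /\ 0 <= - l <= d%:Z) -> rk l = 0%N].
Proof.
move=> cy; have [Eb cE] := Eobj; have [a [b Hab]] := Eb.
have loc := @scheme_local Y y.
have u1 (u : stalk O y) : nonunits u -> is_unit (1 - u).
  move=> nu; apply: contrapT => n1; have : nonunits (1 : stalk O y).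
    have -> : 1 = (1 - u) + u by rewrite subrK.
    exact: (idealD loc).
  by apply; exists 1; rewrite mulr1.
have u2 (u : stalk O y) : ~ nonunits u -> is_unit u by move=> /contrapT.
(* Above the top degree of [E], and not below [lo], so that the number of descending steps [b0 - lo]
   is a natural number. *)
pose b0 := Num.max (b + 1) lo.
have top0 l : (b0 <= l)%R -> forall u : mstalk (E l) y, u = 0.
  move=> bl u; have [U [Uy [s ->]]] := mgerm_surj u.
  by rewrite (Hab l _ U s) ?mgerm0 //; lia.
have [n rk D p r0 D0 p0 res rk0 resn nv|rk [D [p [res rk0 rkP]]]] :=
  @resolution_exists (stalk O y) (@nonunits (stalk O y)) loc u1 u2 (fun l => mstalk (E l) y) (sdiff E y)
    (@sdiff_diff _ _ E y) (@stalk_noetherian k Y phi Yft y) (fun l => coherent_noetherian Yft (cE l)) b0 top0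
    (fun n r => ~ (y = y0 /\ 0 <= - n <= d%:Z) -> r = 0%N) _ `|(b0 - lo)%R|%N.
  exact: (hom_vanishing_rank Yft Eb cE cy (Hom_vanishing cy nv) res rk0 resn).
exists rk, D, p, (b0 - `|(b0 - lo)%R|%N%:Z); split=> //; first by lia.
move=> l nv; have [bl|lb] := leP b0 l; first by apply: rk0; rewrite bl.
have [H|H] := ltP l (b0 - `|(b0 - lo)%R|%N%:Z); first by apply: rk0; rewrite H orbT.
by apply: rkP => //; rewrite H.
Qed.

(** A cycle, paired with 0 in the next free module, is a combination of the basis in degree [n] up
    to a boundary, and that basis is empty. *)
Lemma homology_zero_off y n : closed [set y] -> ~ (y = y0 /\ 0 <= - n <= d%:Z) -> homology_zero E y n.
Proof.
move=> cy nv z dz; have [rk [D [p [n0 [res n0n rk0]]]]] := resolution_at n cy.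
have [_ _ R3 _] := resolved_steps res n0n erefl erefl.
have [||c [_ [l' [w [nl ez]]]]] := R3 z 0.
- by rewrite mul0mx.
- by rewrite raddf0 dz.
have e : l' = n - 1 by rewrite nl addrK.
subst l'; exists w; rewrite ez /rlin big1 ?add0r // => a _; exfalso.
by case: a => a; rewrite rk0.
Qed.

(** The cycle [e] represents the generator of the summand, which the maximal ideal annihilates. The
    retraction [p] onto the skyscraper gives a functional with value 1 on it that kills boundaries
    and combinations with coefficients in the maximal ideal. *)
Lemma summand_cycle (ev : {rmorphism stalk O y0 -> k}) :
  (forall c, ev (kstalk phi y0 c) = c) -> (forall u, ev u != 0 <-> is_unit u) ->
  exists (e : mstalk (E 0) y0), [/\ sdiff E y0 0 (0 + 1) e = 0,
    forall a, ev a = 0 -> exists w, a *: e = sdiff E y0 (0 - 1) 0 w &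
    forall r (c : 'I_r -> stalk O y0) (q : 'I_r -> mstalk (E 0) y0) w,
      (forall i, sdiff E y0 0 (0 + 1) (q i) = 0) -> e = \sum_i c i *: q i + sdiff E y0 (0 - 1) 0 w ->
      exists i, ev (c i) != 0].
Proof.
move=> evK ev_unit; have [val [val_lin valE val_eq0]] := sky_val ev_unit.
have [_ [i [p [_ [_ [pi _ _ _ _]]]]]] := summand.
have [T TP] := sky_section evK valE (oT Y) 1.
pose g1 : mstalk (skyscraper y0) y0 := @mgerm _ _ (skyscraper y0) y0 (oT Y) I T.
have val_inj q : val q = 0 -> q = 0.
  have [U [Uy [t ->]]] := mgerm_surj q => vt; rewrite (val_eq0 U t) ?mgerm0 // => Uy'.
  by rewrite (Prop_irrelevance Uy' Uy).
have v0 := val0 val_lin.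
pose cl := class_mor (cycles E 0) (boundaries E 0).
have [e' ee] := class_mor_surj (smap y0 i g1 : mstalk (quotient_sheaf (cycles E 0) (boundaries E 0)) y0).
have lift_cycle (u : mstalk (E 0) y0) : sdiff E y0 0 (0 + 1) u = 0 ->
    exists q, smap y0 (sub_inc (cycles E 0)) q = u.
  by move=> /cycle_germ[U [Ux [s [Zs ->]]]]; exact: sub_stalk_im.
have cyc q : sdiff E y0 0 (0 + 1) (smap y0 (sub_inc (cycles E 0)) q) = 0.
  have [U [Ux [s [Zs ->]]]] := sub_stalk_ex q; by rewrite /sdiff smapE Zs mgerm0.
exists (smap y0 (sub_inc (cycles E 0)) e'); split=> //.
  move=> a ea.
  have /class_stalk_eq0[w ew] : smap y0 cl (a *: e') = 0.
    rewrite linearZ /= [smap _ _ _]ee -linearZ /= (val_inj (a *: g1)) ?raddf0 //.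
    by rewrite -[a *: g1]addr0 val_lin ea mul0r v0 addr0.
  by exists w; rewrite -ew linearZ.
move=> r c q w qc ex; apply: contrapT => nc.
have c0 j : ev (c j) = 0 by apply/eqP/negPn/negP => cj; apply: nc; exists j.
have /choice[q' q'P] j := lift_cycle _ (qc j).
have [|qw qwP] := lift_cycle (sdiff E y0 (0 - 1) 0 w); first exact: sdiff_diff.
have e'E : e' = \sum_j c j *: q' j + qw.
  apply: (@sub_stalk_inj _ _ _ (cycles E 0)); rewrite ex raddfD /= qwP; congr (_ + _).
  by rewrite linear_sum; apply: eq_bigr => j _; rewrite linearZ /= q'P.
pose om q := val (smap y0 p (smap y0 cl q)).
have om_lin a u v : om (a *: u + v) = ev a * om u + om v by rewrite /om !linearP val_lin.
have omw : om qw = 0.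
  by rewrite /om (_ : smap y0 cl qw = 0) ?raddf0 //; apply/class_stalk_eq0; exists w.
have om0 : om 0 = 0 by rewrite /om !raddf0.
have ome : om e' = 1.
  rewrite /om [smap y0 cl e']ee -smap_comp.
  have -> : smap y0 (mor_comp p i) g1 = g1 by rewrite smapE /= pi.
  exact: TP.
have : om e' = 0.
  rewrite e'E -[X in om (X + _)]scale1r om_lin omw addr0 rmorph1 mul1r.
  apply: (big_ind (fun u => om u = 0)) => // [u v ou ov|j _].
    by rewrite -[u]scale1r om_lin ou ov mulr0 addr0.
  by rewrite -[_ *: _]addr0 om_lin c0 mul0r om0 addr0.
by rewrite ome => /eqP; rewrite oner_eq0.
Qed.

Lemma regular_and_exact : regular_local_ring (stalk O y0) /\
  forall n, n <> 0 -> homology_zero E y0 n.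
Proof.
have [Eb cE] := Eobj.
have [ev [evK ev_unit]] := stalk_ev Yft cy0.
have evn u : nonunits u -> ev u = 0 by move=> nu; apply/eqP/negPn/negP => /ev_unit.
have evn' u : ev u = 0 -> nonunits u by move=> eu /ev_unit; rewrite eu eqxx.
(* Low enough to include the degrees just below [- d], which occur in the identities around the last
   possibly nonzero term. *)
have [rk [D [p [n0 [res n0l rk0]]]]] := resolution_at (- d.+3%:Z) cy0.
have rkz (l : int) : (l < - d%:Z)%R || (0 < l)%R -> rk l = 0%N by move=> H; apply: rk0 => -[_]; lia.
have rv0 (l : int) (v : 'rV[stalk O y0]_(rk l)) : rk l = 0%N -> v = 0.
  by move=> e; apply/rowP => j; exfalso; case: j => j; rewrite e.
(* From here on cohomological degree [- i] is homological degree [i]. *)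
pose beta i := rk (- i%:Z).
pose Dl i : 'M[stalk O y0]_(beta i.+1, beta i) := rmx (D (- i.+1%:Z)) (rk (- i.+1%:Z)) (rk (- i%:Z)).
have H1 i : (i <= d.+1)%N -> (n0 <= - i.+1%:Z)%R by lia.
have H2 i : - i%:Z = - i.+1%:Z + 1 by lia.
have S i (l2 : int) (id : (i <= d.+1)%N) (e : l2 = - i%:Z + 1) := resolved_steps res (H1 i id) (H2 i) e.
have short i : (d < i)%N -> beta i = 0%N by move=> di; apply: rkz; lia.
have ord_le i (a : 'I_(beta i)) : (i <= d)%N.
  by rewrite leqNgt; apply/negP => /short e; case: a => a; rewrite e.
have dd i : Dl i.+1 *m Dl i = 0.
  apply/row_matrixP => a; have id := ord_le _ a.
  have [R1 _ _ _] := S i.+1 (- i%:Z) (leqW (ltnW id)) (H2 i).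
  by rewrite !rowE mulmxA R1 mulmx0.
have Dl_min i a b : ev (Dl i a b) = 0.
  have id := ord_le _ a; have [_ _ _ R4] := S i _ (leqW (ltnW id)) erefl.
  by rewrite mxE; apply: evn; exact: R4.
have power u : ev u = 0 -> exists N, (forall v : 'rV_(beta 0), exists w, u ^+ N *: v = w *m Dl 0) /\
    forall i (v : 'rV_(beta i.+1)), v *m Dl i = 0 -> exists w, u ^+ N *: v = w *m Dl i.+1.
  move=> eu.
  have H i : exists N, forall z, sdiff E y0 (- i%:Z) (- i%:Z + 1) z = 0 ->
      exists w, u ^+ N *: z = sdiff E y0 (- i.+1%:Z) (- i%:Z) w.
    have := @homology_power k Y phi Yft E cE y0 (- i%:Z) u cy0 _ (evn' u eu).
    have -> : - i%:Z - 1 = - i.+1%:Z by lia.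
    by apply=> y cy yy; apply: homology_zero_off => // -[].
  have /choice[N NP] := H.
  pose NN := (\sum_(i < d.+1) N i)%N.
  have key i (v : 'rV_(beta i)) : v *m rmx (D (- i%:Z)) (rk (- i%:Z)) (rk (- i%:Z + 1)) = 0 ->
      exists w : 'rV_(beta i.+1), u ^+ NN *: v = w *m Dl i.
    move=> v0; have [di|id] := ltnP d i.
      by exists 0; rewrite (rv0 _ v (short _ di)) scaler0 mul0mx.
    have NE : NN = ((NN - N i) + N i)%N.
      by rewrite subnK // /NN (bigD1 (Ordinal (id : (i < d.+1)%N))) //= leq_addr.
    have n0i : (n0 <= - i%:Z)%R by lia.
    have [_ R2 _ _] := resolved_steps res n0i erefl erefl.
    have [|w ew] := NP i (@rlin _ (fun l => mstalk (E l) y0) _ _ (p (- i%:Z)) v); first by rewrite -R2 v0 raddf0.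
    have [_ _ R3 _] := S i _ (leqW id) erefl.
    have [||c [ec _]] := R3 (u ^+ (NN - N i) *: w) (u ^+ NN *: v).
    - by rewrite -scalemxAl v0 scaler0.
    - by rewrite !linearZ /= -ew scalerA -exprD -NE.
    by exists c.
  exists NN; split=> [v|i v v0].
    by apply: (key 0%N); apply: rv0; apply: rkz; lia.
  by apply: key; rewrite -(H2 i).
have [e [de tor uni]] := summand_cycle evK ev_unit.
have n00 : (n0 <= 0)%R by lia.
have [_ R2 R3 _] := resolved_steps res n00 erefl erefl.
have [||c [_ [l' [w [nl ec]]]]] := R3 e 0; [by rewrite mul0mx|by rewrite raddf0 de|].
have el : l' = 0 - 1 by rewrite nl addrK.
subst l'.
have rlin_delta (a : 'I_(rk 0)) : @rlin _ (fun l => mstalk (E l) y0) _ _ (p 0) (delta_mx 0 a : 'rV_(rk 0)) = p 0 a.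
  rewrite /rlin (bigD1 a) //= !mxE !eqxx scale1r big1 ?addr0 // => b ba.
  by rewrite mxE (negPf ba) andbF scale0r.
(* The coordinates of [e] in the minimal basis include a unit, and the corresponding coordinate
   functional splits the vector [c]. *)
have [|i0 ci0] := uni (rk 0) (c 0) (fun a => p 0 a) w _ ec.
  have rk1 : rk (0 + 1) = 0%N by apply: rkz; lia.
  by move=> a; rewrite -rlin_delta -R2; set v := _ *m _; rewrite (rv0 _ v rk1) raddf0.
have [b eb] : is_unit (c 0 i0) by apply/ev_unit.
have un : (c : 'rV_(beta 0)) *m (b *: delta_mx i0 0 : 'cV_(beta 0)) = 1%:M.
  rewrite -scalemxAr -(colE i0 c); apply/matrixP => i j; rewrite !mxE !ord1 eqxx mulr1n.
  by rewrite mulrC eb.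
have torsion a : ev a = 0 -> exists z, z *m Dl 0 = a *: (c : 'rV_(beta 0)).
  move=> ea; have [w' ew'] := tor a ea.
  have [_ _ R3' _] := S 0%N _ isT erefl.
  have [||z [ez _]] := R3' (w' - a *: w) (a *: c).
  - by apply: rv0; apply: rkz; lia.
  - rewrite linearZ raddfB /= linearZ /=.
    transitivity (a *: e - a *: sdiff E y0 (0 - 1) 0 w); last by rewrite ew'.
    by rewrite ec scalerDr addrK.
  by exists z; rewrite -ez.
have [V [gV Vy]] := affine_ft_exists Yft y0.
have [[Z Zc] _] := Ydim.
have [chain [g gE] EX] := @regularity_criterion_pz k (O V) (kres phi V) (stalk O y0)
  (@germ _ O y0 V Vy) ev d beta Dl c (b *: delta_mx i0 0) (affine_ft_nz Vy)
  (fun c => etrans (congr1 ev (germ_kres phi Vy c)) (evK c))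
  (fun u => let: ex_intro w (ex_intro a (conj uw e)) := stalk_num Vy gV.1 u in
     ex_intro _ w (ex_intro _ a (conj (proj2 (ev_unit _) uw) e)))
  (fun u => proj1 (ev_unit u))
  (fun a a0 => let: ex_intro w (conj uw e) := stalk_ker gV.1 a0 in
     ex_intro _ w (conj (proj2 (ev_unit _) uw) e))
  gV.2 (@stalk_noetherian k Y phi Yft y0) (fun c => @stalk_not_nilpotent k Y phi Yirr V y0 Vy c gV)
  (chain_box Yft Yirr gV (ex_intro _ y0 Vy) Zc) short dd Dl_min power un torsion.
have nuE : @nonunits (stalk O y0) = [set u | ev u = 0].
  by apply/seteqP; split=> u; [exact: evn|exact: evn'].
split.
  split; [exact: (@stalk_noetherian k Y phi Yft y0)|exact: scheme_local|].
  exists d; split; last by exists g; rewrite nuE.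
  by split=> // m P; exact: (stalk_dim_le Yft Ydim).
(* Outside the permitted degrees the ranks vanish; inside them, exactness of the matrix complex is
   carried back to the stalk of [E] through the comparison map. *)
move=> n nn; have [nd|nd] := boolP (0 <= - n <= d%:Z); last first.
  by apply: homology_zero_off => // -[_]; apply/negP.
have [i ni] : exists i : nat, n = - i.+1%:Z by exists `|n|%N.-1; lia.
subst n => z; have id : (i < d)%N by lia.
rewrite -(H2 i) => dz; have [_ _ R3i _] := S i _ (leqW (ltnW id)) erefl.
have [||c' [c0 [l' [w' [nl' ez]]]]] := R3i z 0; [by rewrite mul0mx|by rewrite raddf0 dz|].
have [c2 ec2] := EX i c' (esym c0).
have [_ R2i _ _] := S i.+1 _ (ltnW id : (i.+1 <= d.+1)%N) erefl.
have e2 : - i.+1%:Z - 1 = - i.+2%:Z by lia.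
have el : l' = - i.+2%:Z by lia.
rewrite e2; subst l'; exists (@rlin _ (fun l => mstalk (E l) y0) _ _ (p (- i.+2%:Z)) c2 + w').
by rewrite raddfD /= -R2i ez ec2.
Qed.

End MainTheorem.

Theorem corollary1p2 (k : closedFieldType) (Y : scheme)
    (phi : {rmorphism k -> structure_sheaf Y (oT Y)}) (d : nat)
    (E : complex (structure_sheaf Y)) (y0 : Y)
    (Y_finite_type : finite_type phi)
    (Y_irreducible : irreducible_scheme Y)
    (Y_dim : space_dim_eq Y d)
    (E_object : D_object E)
    (y0_closed : closed [set y0])
    (ky0_summand : direct_summand (skyscraper y0) (homology E 0))
    (Hom_vanishing : forall (y : Y) (i : int), closed [set y] ->
      ~ (y = y0 /\ 0 <= i <= d%:Z) ->
      D_hom_zero E (shift (in_degree_0 (skyscraper y)) i)) :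
  regular_local_ring (stalk (structure_sheaf Y) y0) /\
  D_isomorphic E (in_degree_0 (homology E 0)).
Proof.
have [reg exact0] := regular_and_exact Y_finite_type Y_irreducible Y_dim E_object y0_closed
  ky0_summand Hom_vanishing.
split=> //; have [Eb cE] := E_object; apply: truncation_iso => // x n n0.
apply: (homology_support Y_finite_type cE) => y cy.
have [yy|yy] := pselect (y = y0); first by subst y; exact: exact0.
by apply: (homology_zero_off Y_finite_type E_object Hom_vanishing) => // -[].
Qed.
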